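(* Let $k\geq 2$ be an integer and let $f$ be a positive multiplicative function such that $f(p)\to 1$ as $p\to\infty$ over primes. Let $K:=k(k+1)((k-1)!)^2$. (a) If $\sum_{p:\, f(p)>1}(f(p)-1)=\infty$, then the set of tuples $\{(f(p+1),\ldots,f(p+k)) : p\text{ prime}\}$ is dense in $[f(K),\infty)\times[f(1),\infty)\times[f(2),\infty)\times\cdots\times[f(k-1),\infty)$. (b) If $\sum_{p:\, f(p)<1}(1-f(p))=\infty$, then the set of tuples $\{(f(p+1),\ldots,f(p+k)) : p\text{ prime}\}$ is dense in $[0,f(K)]\times[0,f(1)]\times[0,f(2)]\times\cdots\times[0,f(k-1)]$.
   Context: A multiplicative function satisfies $f(1)=1$ and $f(mn)=f(m)f(n)$ whenever $\gcd(m,n)=1$; positive means $f(n)>0$ for all $n$. Sums indexed by $p$ run over primes. In the product of intervals, the first factor corresponds to the coordinate $f(p+1)$ and the $i$-th factor ($2\le i\le k$) is $[f(i-1),\infty)$ resp. $[0,f(i-1)]$. *)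

(* Defs.v *)
From Stdlib Require Import Reals.
From mathcomp Require Import all_boot.

Open Scope R_scope.

Definition positive_fun (f : nat -> R) : Prop := forall n : nat, (0 < n)%N -> 0 < f n.

Definition multiplicative (f : nat -> R) : Prop :=
  f 1%N = 1 /\
  forall m n : nat, (0 < m)%N -> (0 < n)%N -> coprime m n -> f (m * n)%N = f m * f n.

Definition tends_to_one_on_primes (f : nat -> R) : Prop :=
  forall eps : R, 0 < eps -> exists N : nat,
    forall p : nat, prime p -> (N <= p)%N -> Rabs (f p - 1) < eps.

Definition excess_term (f : nat -> R) (n : nat) : R :=
  if prime n then (if Rlt_dec 1 (f n) then f n - 1 else 0) else 0.
Definition deficit_term (f : nat -> R) (n : nat) : R :=
  if prime n then (if Rlt_dec (f n) 1 then 1 - f n else 0) else 0.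

(* a series of nonnegative terms diverges to +infinity: partial sums unbounded *)
Definition diverges (a : nat -> R) : Prop :=
  forall M : R, exists N : nat, M < sum_f_R0 a N.

Definition Kconst (k : nat) : nat := (k * (k + 1) * (k.-1)`! ^ 2)%N.

Definition endpoint (f : nat -> R) (k i : nat) : R :=
  if i == 1%N then f (Kconst k) else f (i.-1).

(* every point x of the product set S (coordinates x 1, ..., x k) lies in the
   closure of {(f(p+1),...,f(p+k)) : p prime}  (sup-norm on R^k) *)
Definition dense_in (f : nat -> R) (k : nat) (S : (nat -> R) -> Prop) : Prop :=
  forall x : nat -> R, S x ->
  forall eps : R, 0 < eps -> exists p : nat, prime p /\
    forall i : nat, (1 <= i <= k)%N -> Rabs (f (p + i)%N - x i) < eps.

(* Main.v *)
(** Choose p in a residue class to a modulus W built from K = k(k+1)((k-1)!)^2 and from integers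
    t_1, ..., t_k composed of large primes: with p = K - 1 (mod K^2) and p = t_i - i (mod t_i^2)
    one gets p + i = e_i t_i m_i with pairwise coprime factors, e_1 = K and e_i = i - 1.  The
    divergence hypothesis lets f(t_i) approach any admissible ratio (products of f(p) move by
    factors tending to 1), so it remains to make f(m_i) close to 1.  For this m_i has to be
    squarefree, free of small primes, and with a bounded number of prime factors, while p is
    prime: a theorem of Renyi type for k shifts of a prime.

    The weights (ln n)^j n^(-1-e) / j! with e = 1/Y, Y = 2^j, localise ln n near jY.  Logarithmic
    derivatives of order j turn a lower bound for |L(1+e, chi)| into a saving Y^(-a) for every
    fixed a in sums of Lambda(n) chi(n).  Such lower bounds hold for all characters of modulus at
    most a fixed power of Y along a sequence of scales: a character with a small value repels all
    others (positivity of a product of four Euler products), so otherwise one fixed real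
    character would vanish at 1.  Moduli beyond that power are handled on average by Vaughan's
    identity and Cauchy's inequality.  These estimates feed a Selberg sieve with a penalty term,
    in the style of Richert's weights, which bounds the number of prime factors of the m_i. *)

Require Import Defs.
From Stdlib Require Import Reals.
From mathcomp Require Import all_boot all_order all_algebra all_fingroup.
From mathcomp Require Import cyclic algC cyclotomic separable classfun character.
From mathcomp Require Import boolp reals Rstruct sequences exp complex.
From mathcomp Require Import zify ring lra.

Set Implicit Arguments.
Unset Strict Implicit.
Unset Printing Implicit Defensive.
Import Order.TTheory GRing.Theory Num.Theory.
Local Open Scope ring_scope.

(** * Arithmetic functions and elementary sums *)

(** The only information on [f] at large primes is that [f p] tends to 1, with no rate. So [f (m_i)]
    can be forced near 1 only if the number of prime factors of [m_i] is bounded before one knows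
    how large these factors must be. Hence the order of quantifiers in [almost_prime_shifts]: the
    bound [C] depends on [k] alone, while the modulus [W], the class [b] and the threshold [B0] come
    later and act only through the choice of a large scale.

    The constant [K] serves two purposes. Every prime up to [k + 1] divides it, so the sieve meets
    only primes [q > k + 1], for which the [k] shifts exclude [k] distinct nonzero classes. And
    [(k-1)!] occurs twice in it, so for [i >= 2] the quotient [K / (i-1)] keeps all primes of [K],
    and [(p+i) / (i-1)] is 1 modulo each of them.

    One prime [p] per tolerance is wanted, so one good scale beyond any given bound is enough. This
    takes the place of zero-free regions and of Siegel's theorem: nothing is claimed at an arbitrary
    scale, and the constants never depend on an exceptional character. *)

Section Convolution.
Variable V : zmodType.
Implicit Types F : nat -> nat -> V.

Lemma sum_divisors_pairs (M n : nat) F : (0 < n < M)%N ->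
  \sum_(d <- divisors n) F d (n %/ d)%N =
  \sum_(1 <= d < M) \sum_(1 <= e < M | (d * e == n)%N) F d e.
Proof.
move=> /andP[n0 nM].
have -> : \sum_(1 <= d < M) \sum_(1 <= e < M | (d * e == n)%N) F d e =
  \sum_(1 <= d < M | (d %| n)%N) F d (n %/ d)%N.
  rewrite [RHS]big_mkcond /=; apply: eq_big_nat => d /andP[d0 dM].
  case: ifPn => [dn|dn]; last first.
    rewrite big1 // => e /eqP de; exfalso; move/negP: dn; apply.
    by rewrite -de dvdn_mulr.
  rewrite (eq_bigl (fun e => e == n %/ d)%N) => [|e].
    rewrite big_nat1_eq divn_gt0 // dvdn_leq //=.
    by rewrite (leq_ltn_trans _ nM) // leq_div.
  apply/eqP/eqP => [<-|->]; first by rewrite mulKn.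
  by rewrite mulnC divnK.
rewrite -[RHS]big_filter; apply: perm_big; apply: uniq_perm.
- exact: divisors_uniq.
- by rewrite filter_uniq // iota_uniq.
- move=> d; rewrite mem_filter -dvdn_divisors // mem_index_iota.
  case dn: (d %| n)%N => //=; rewrite (dvdn_gt0 n0 dn) /=.
  by rewrite (leq_ltn_trans _ nM) // dvdn_leq.
Qed.

Lemma sum_convolution (M : nat) F :
  \sum_(1 <= n < M) \sum_(d <- divisors n) F d (n %/ d)%N =
  \sum_(1 <= d < M) \sum_(1 <= e < M | (d * e < M)%N) F d e.
Proof.
under eq_big_nat => n Hn do rewrite (@sum_divisors_pairs M) //.
rewrite exchange_big /=; apply: eq_big_nat => d /andP[d0 dM].
rewrite (exchange_big_dep xpredT) //= [RHS]big_mkcond /=.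
apply: eq_big_nat => e /andP[e0 eM]; case: ifPn => deM.
  rewrite (eq_bigl (fun n => n == d * e)%N) => [|n]; last exact: eq_sym.
  by rewrite big_nat1_eq deM muln_gt0 d0 e0.
rewrite big_nat_cond big1 // => n /andP[/andP[_ nM] /eqP den].
by move: deM; rewrite den nM.
Qed.

(** The divisors added on passing from [n / p] to [n] are those carrying the full power of [p]. This
    peeling drives the inductions for [sum_Lam], [sum_mu] and [dsum_pfactor]. *)
Lemma sum_divisors_step (n p : nat) (G : nat -> V) : (0 < n)%N -> prime p -> (p %| n)%N ->
  \sum_(d <- divisors n) G d = \sum_(d <- divisors (n %/ p)) G d +
   \sum_(d <- divisors n | ~~ (d %| n %/ p)%N) G d.
Proof.
move=> n0 pp pn; rewrite (bigID (fun d => (d %| n %/ p)%N)) /=; congr (_ + _).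
have m0 : (0 < n %/ p)%N by rewrite divn_gt0 ?prime_gt0 // dvdn_leq.
rewrite -big_filter; apply: perm_big; apply: uniq_perm.
- by rewrite filter_uniq // divisors_uniq.
- exact: divisors_uniq.
- move=> d; rewrite mem_filter -!dvdn_divisors //.
  case dm: (d %| n %/ p)%N => //=; apply: (dvdn_trans dm).
  by apply/dvdnP; exists p; rewrite mulnC divnK.
Qed.

End Convolution.

Section VonMangoldt.
Variable R : realType.

Definition Lam (n : nat) : R := if primes n is [:: p] then ln p%:R else 0.

Lemma Lam_pfactor (p a : nat) : prime p -> (0 < a)%N -> Lam (p ^ a) = ln p%:R.
Proof. by move=> pp a0; rewrite /Lam primesX // primes_prime. Qed.

Lemma Lam_prime (p : nat) : prime p -> Lam p = ln p%:R.
Proof. by move=> pp; rewrite /Lam primes_prime. Qed.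

Lemma Lam_neq0 (n : nat) : Lam n != 0 ->
  exists p a, [/\ prime p, (0 < a)%N & n = (p ^ a)%N].
Proof.
rewrite /Lam; case E: (primes n) => [|p [|q s]]; rewrite ?eqxx // => _.
have : p \in primes n by rewrite E inE.
rewrite mem_primes => /and3P[pp n0 pn]; exists p, (logn p n); split => //.
  by rewrite logn_gt0 mem_primes pp n0.
by rewrite [LHS]prod_prime_decomp // prime_decompE E /= big_cons big_nil muln1.
Qed.

Lemma lnr_ge0 (n : nat) : 0 <= ln n%:R :> R.
Proof.
case: n => [|n]; last by rewrite ln_ge0 // ler1n.
by rewrite ln0.
Qed.

Lemma Lam_ge0 (n : nat) : 0 <= Lam n.
Proof.
by rewrite /Lam; case: (primes n) => [|p [|q s]] //; exact: lnr_ge0.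
Qed.

Lemma Lam1 : Lam 1 = 0.
Proof. by []. Qed.

Lemma lnrM (m n : nat) : (0 < m)%N -> (0 < n)%N ->
  ln (m * n)%:R = ln m%:R + ln n%:R :> R.
Proof. by move=> m0 n0; rewrite natrM lnM // posrE ltr0n. Qed.

Lemma ler_lnr (m n : nat) : (0 < m)%N -> (m <= n)%N -> ln m%:R <= ln n%:R :> R.
Proof.
move=> m0 mn; rewrite ler_ln ?posrE ?ltr0n ?ler_nat //; exact: leq_trans mn.
Qed.

Lemma sum_Lam (n : nat) : (0 < n)%N -> \sum_(d <- divisors n) Lam d = ln n%:R.
Proof.
elim/ltn_ind: n => n IH n0.
have [->|n1] := eqVneq n 1%N; first by rewrite big_seq1 Lam1 ln1.
have pp : prime (pdiv n) by rewrite pdiv_prime // ltn_neqAle eq_sym n1.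
set p := pdiv n in pp *; have pn : (p %| n)%N by apply: pdiv_dvd.
set m := (n %/ p)%N; have nE : n = (p * m)%N by rewrite mulnC divnK.
have m0 : (0 < m)%N by rewrite divn_gt0 ?prime_gt0 // dvdn_leq.
have mn : (m < n)%N by rewrite ltn_Pdiv // prime_gt1.
rewrite (sum_divisors_step _ n0 pp pn) -/m IH // {2}nE lnrM ?(prime_gt0 pp) //.
rewrite addrC; congr (_ + _).
have lE : logn p n = (logn p m).+1.
  by rewrite nE lognM ?(prime_gt0 pp) // (logn_prime _ pp) // eqxx.
have ndvd d : (d %| n)%N -> ~~ (d %| m)%N -> logn p d = logn p n.
  move=> dn; apply: contraNeq => ld.
  have d0 := dvdn_gt0 n0 dn.
  have ldn : (logn p d <= logn p n)%N by apply: dvdn_leq_log.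
  have ldm : (logn p d <= logn p m)%N by lia.
  apply/dvdn_partP => // q qd.
  rewrite p_part; case: (eqVneq q p) => [->|qp].
    by rewrite pfactor_dvdn.
  rewrite pfactor_dvdn //; last by move: qd; rewrite mem_primes => /and3P[].
  have -> : logn q m = logn q n.
    rewrite nE lognM ?(prime_gt0 pp) // (logn_prime _ pp) // (negbTE qp) // .
  exact: dvdn_leq_log.
(* Among divisors with the full [p]-part, the only prime power is that [p]-part itself. *)
rewrite -big_filter (bigD1_seq (p ^ logn p n)%N) /= ?filter_uniq ?divisors_uniq //.
  rewrite Lam_pfactor ?lE // big_seq_cond big1 ?addr0 // => d /andP[].
  rewrite mem_filter -dvdn_divisors // => /andP[dm dn] dne.
  apply/eqP; apply: contraNT dne => /Lam_neq0 [q [a [qp a0 dE]]].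
  have ldE := ndvd _ dn dm; move: ldE; rewrite dE lognX (logn_prime _ qp).
  by rewrite lE; case: eqP => [<-|_]; rewrite ?muln1 ?muln0 // => ->.
rewrite mem_filter -dvdn_divisors // pfactor_dvdnn andbT.
by rewrite pfactor_dvdn // lE ltnn.
Qed.

Lemma Lam_le (n : nat) : (0 < n)%N -> Lam n <= ln n%:R.
Proof.
move=> n0; rewrite -sum_Lam // (bigD1_seq n) /= ?divisors_uniq //.
  by rewrite lerDl sumr_ge0 // => d _; exact: Lam_ge0.
by rewrite -dvdn_divisors.
Qed.

Definition mu (n : nat) : R :=
  if all (fun p => logn p n == 1)%N (primes n) then (-1) ^+ size (primes n) else 0.

Lemma mu_norm (n : nat) : `|mu n| <= 1.
Proof. by rewrite /mu; case: ifP => _; rewrite ?normr0 // normrX normrN1 expr1n. Qed.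

Lemma mu1 : mu 1 = 1. Proof. by rewrite /mu /= expr0. Qed.

Lemma mu_square (p n : nat) : (1 < logn p n)%N -> mu n = 0.
Proof.
move=> lp; rewrite /mu; case: ifP => // /allP H.
have pn : p \in primes n by rewrite -logn_gt0; exact: ltn_trans lp.
by move: lp; rewrite (eqP (H _ pn)).
Qed.

Lemma muMp (p n : nat) : prime p -> (0 < n)%N -> ~~ (p %| n)%N -> mu (p * n) = - mu n.
Proof.
move=> pp n0 pn.
have pE : perm_eq (primes (p * n)) (p :: primes n).
  apply: uniq_perm; rewrite ?primes_uniq //=.
    by rewrite primes_uniq andbT mem_primes (negbTE pn) !andbF.
  by move=> q; rewrite inE primesM ?(prime_gt0 pp) // primes_prime // inE.
have all_p : all (fun q => logn q (p * n) == 1)%N (primes (p * n)) =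
   all (fun q => logn q n == 1)%N (primes n).
  rewrite (perm_all _ pE) /= lognM ?(prime_gt0 pp) // (logn_prime _ pp) // eqxx.
  rewrite (eqP (_ : logn p n == 0)%N) /=; last first.
    by rewrite -leqn0 leqNgt logn_gt0 mem_primes (negbTE pn) !andbF.
  apply: eq_in_all => q qn; rewrite lognM ?(prime_gt0 pp) // (logn_prime _ pp) //.
  have /negbTE -> : q != p by apply: contraNneq pn => <-; move: qn; rewrite mem_primes => /and3P[].
  by [].
rewrite /mu all_p (perm_size pE) /=; case: ifP; rewrite ?oppr0 // => _.
by rewrite exprS mulN1r.
Qed.

Lemma sum_mu (n : nat) : (0 < n)%N -> \sum_(d <- divisors n) mu d = (n == 1%N)%:R.
Proof.
elim/ltn_ind: n => n IH n0.
have [->|n1] := eqVneq n 1%N; first by rewrite big_seq1 mu1.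
have pp : prime (pdiv n) by rewrite pdiv_prime // ltn_neqAle eq_sym n1.
set p := pdiv n in pp *; have pn : (p %| n)%N by apply: pdiv_dvd.
set m := (n %/ p)%N; have nE : n = (p * m)%N by rewrite mulnC divnK.
have m0 : (0 < m)%N by rewrite divn_gt0 ?prime_gt0 // dvdn_leq.
have mn : (m < n)%N by rewrite ltn_Pdiv // prime_gt1.
rewrite (sum_divisors_step _ n0 pp pn) -/m.
(* If [p] still divides [n / p], the new divisors are divisible by [p ^ 2] and [mu] vanishes on
   them. Otherwise they are the [p * d] with [d] dividing [n / p], and cancel the old ones. *)
have [pm|pm] := boolP (p %| m)%N.
  have m1 : m != 1%N by apply: contraTneq pm => ->; rewrite dvdn1 gtn_eqF ?prime_gt1.
  rewrite IH // (negbTE m1) add0r big_seq_cond big1 // => d /andP[].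
  rewrite -dvdn_divisors // => dn dm; apply: (@mu_square p).
  have d0 := dvdn_gt0 n0 dn.
  rewrite ltnNge; apply: contra dm => ldp.
  apply/dvdn_partP => // q qd; rewrite p_part pfactor_dvdn //; last first.
    by move: qd; rewrite mem_primes => /and3P[].
  case: (eqVneq q p) => [->|qp].
    by apply: (leq_trans ldp); rewrite logn_gt0 mem_primes pp m0.
  have -> : logn q m = logn q n.
    by rewrite nE lognM ?(prime_gt0 pp) // (logn_prime _ pp) // (negbTE qp).
  exact: dvdn_leq_log.
rewrite -[X in _ + X]big_filter [X in _ + X](perm_big [seq (p * d)%N | d <- divisors m]) /=; last first.
  apply: uniq_perm; first by rewrite filter_uniq // divisors_uniq.
    rewrite map_inj_uniq ?divisors_uniq // => x y /eqP.
    by rewrite eqn_pmul2l ?prime_gt0 // => /eqP.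
  move=> d; rewrite mem_filter -dvdn_divisors //; apply/andP/mapP.
    move=> [dm dn]; have [pd|pd] := boolP (p %| d)%N; last first.
      case/negP: dm; move: dn; rewrite nE Gauss_dvdr //.
      by rewrite coprime_sym prime_coprime.
    exists (d %/ p)%N; last by rewrite mulnC divnK.
    by rewrite -dvdn_divisors // -(@dvdn_pmul2l p) ?prime_gt0 // -nE mulnC divnK.
  move=> [e]; rewrite -dvdn_divisors // => em ->; split.
    apply: contra pm => H; apply: dvdn_trans H; exact: dvdn_mulr.
  by rewrite nE dvdn_pmul2l ?prime_gt0.
rewrite big_map [X in _ + X]big_seq [X in _ + X](eq_bigr (fun d => - mu d)); last first.
  move=> d; rewrite -dvdn_divisors // => dm; rewrite muMp ?(dvdn_gt0 m0 dm) //.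
  by apply: contra pm => H; apply: dvdn_trans dm.
by rewrite sumrN -big_seq subrr.
Qed.

End VonMangoldt.

Section PowerSums.
Variable R : realType.
Implicit Types (e s t v c : R) (m n N M i : nat).

(* [n ^ (- s)]; at [n = 0] the junk value [ln 0 = 0] makes it [1]. *)
Definition nexp s n : R := expR (- (s * ln n%:R)).

Lemma nexp_gt0 s n : 0 < nexp s n. Proof. exact: expR_gt0. Qed.
Lemma nexp_ge0 s n : 0 <= nexp s n. Proof. exact: expR_ge0. Qed.

Lemma nexpM s m n : (0 < m)%N -> (0 < n)%N -> nexp s (m * n) = nexp s m * nexp s n.
Proof. by move=> m0 n0; rewrite /nexp lnrM // mulrDr opprD expRD. Qed.

Lemma nexpD s t n : nexp (s + t) n = nexp s n * nexp t n.
Proof. by rewrite /nexp mulrDl opprD expRD. Qed.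

Lemma nexp1 n : (0 < n)%N -> nexp 1 n = n%:R^-1.
Proof. by move=> n0; rewrite /nexp mul1r expRN lnK // posrE ltr0n. Qed.

Lemma nexp_1 s : nexp s 1 = 1.
Proof. by rewrite /nexp ln1 mulr0 oppr0 expR0. Qed.

Lemma nexp_le s m n : 0 <= s -> (0 < m <= n)%N -> nexp s n <= nexp s m.
Proof.
move=> s0 /andP[m0 mn]; rewrite /nexp ler_expR lerN2.
by apply: ler_wpM2l => //; exact: ler_lnr.
Qed.

Lemma nexp_le1 s n : 0 <= s -> nexp s n <= 1.
Proof.
by move=> s0; rewrite /nexp -[X in _ <= X]expR0 ler_expR oppr_le0 mulr_ge0 // lnr_ge0.
Qed.

Lemma nexp_ler s t n : s <= t -> nexp t n <= nexp s n.
Proof.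
by move=> st; rewrite /nexp ler_expR lerN2 ler_wpM2r // lnr_ge0.
Qed.

(** One term of the exponential series at [v / c]. With [v = ln n] and [c = 1 / e] it trades a power
    of the logarithm for [n ^ e]. *)
Lemma pow_fact_le v c i : 0 <= v -> 0 < c -> v ^+ i / i`!%:R <= c ^+ i * expR (v / c).
Proof.
move=> v0 c0; case: i => [|i].
  by rewrite !expr0 mul1r fact0 invr1 mul1r -expR0 ler_expR divr_ge0 // ltW.
have vc : 0 <= v / c by rewrite divr_ge0 // ltW.
have := expR_ge1Dxn i vc; rewrite expr_div_n => H.
have H2 : v ^+ i.+1 / c ^+ i.+1 / (i.+1)`!%:R <= expR (v / c) by lra.
rewrite -ler_pdivrMl ?exprn_gt0 //; apply: le_trans H2.
by rewrite [X in X <= _]mulrA [c ^- _ * _]mulrC.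
Qed.

Lemma ln_le_nexp e n : 0 < e -> (0 < n)%N -> ln n%:R <= e^-1 * nexp (- e) n.
Proof.
move=> e0 n0; have := @pow_fact_le (ln n%:R) e^-1 1 (lnr_ge0 _ _).
rewrite !expr1 (_ : 1`! = 1)%N // divr1 invrK invr_gt0 => /(_ e0).
by rewrite /nexp mulNr opprK [e * _]mulrC.
Qed.

Lemma ln_step n : (1 < n)%N -> n%:R^-1 <= ln n%:R - ln n.-1%:R :> R.
Proof.
case: n => [|[|n]] // _; rewrite succnK.
have n2 : 0 < n.+2%:R :> R by rewrite ltr0n.
have n1 : 0 < n.+1%:R :> R by rewrite ltr0n.
rewrite -[X in _ <= X]opprK opprB -ln_div ?posrE //.
have -> : n.+1%:R / n.+2%:R = 1 + - n.+2%:R^-1 :> R.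
  by apply: (mulIf (lt0r_neq0 n2)); rewrite mulfVK ?lt0r_neq0 // mulrDl mulNr mulVf ?lt0r_neq0 // mul1r -[n.+2]addn1 natrD addrK.
rewrite lerNr; apply: le_ln1Dx; rewrite ltrN2 invf_lt1 // ltr1n //.
Qed.

Lemma ln_stepS n : (0 < n)%N -> ln n.+1%:R - ln n%:R <= n%:R^-1 :> R.
Proof.
move=> n0; have p0 : 0 < n%:R :> R by rewrite ltr0n.
rewrite -ln_div ?posrE ?ltr0n //.
have -> : n.+1%:R / n%:R = 1 + n%:R^-1 :> R.
  by rewrite -addn1 natrD mulrDl divff ?lt0r_neq0 // mul1r.
by apply: le_ln1Dx; apply: lt_trans (_ : 0 < _); rewrite ?ltrN10 // invr_gt0.
Qed.

Lemma harmonic_ge N : (0 < N)%N -> ln N%:R <= \sum_(1 <= n < N) n%:R^-1 :> R.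
Proof.
elim: N => // [[|N] IH] _; first by rewrite ln1 big_geq.
rewrite big_nat_recr //=; apply: le_trans (lerD (IH isT) (lexx _)).
by rewrite -lerBlDl; exact: ln_stepS.
Qed.

Lemma harmonic_le N : (0 < N)%N -> \sum_(1 <= n < N.+1) n%:R^-1 <= 1 + ln N%:R :> R.
Proof.
elim: N => // [[|N] IH] _; first by rewrite big_nat1 ln1 invr1 addr0.
rewrite big_nat_recr //=; apply: le_trans (lerD (IH isT) (lexx _)) _.
by rewrite -addrA lerD2l -lerBrDl; exact: (@ln_step N.+2).
Qed.

(** The inequality [1 + x <= expR x] replaces the comparison with an integral; the right-hand side
    telescopes. *)
Lemma nexp_step e n : 0 < e -> (1 < n)%N ->
  nexp (1 + e) n <= e^-1 * (nexp e n.-1 - nexp e n).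
Proof.
move=> e0 n1; have n0 : (0 < n)%N by exact: ltn_trans n1.
have -> : nexp e n.-1 = nexp e n * expR (e * (ln n%:R - ln n.-1%:R)).
  by rewrite /nexp -expRD; congr expR; ring.
rewrite nexpD nexp1 // -[X in _ - X]mulr1 -mulrBr.
rewrite [X in X <= _]mulrC mulrCA; apply: ler_wpM2l; first exact: nexp_ge0.
rewrite -ler_pdivrMl ?invr_gt0 // invrK.
have H1 := @ln_step n n1; have H2 := expR_ge1Dx (e * (ln n%:R - ln n.-1%:R)).
have : e * n%:R^-1 <= e * (ln n%:R - ln n.-1%:R) by rewrite ler_pM2l.
lra.
Qed.

Lemma sum_nexp_tail e N M : 0 < e -> (0 < N)%N ->
  \sum_(N.+1 <= n < M) nexp (1 + e) n <= e^-1 * nexp e N.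
Proof.
move=> e0 N0; have [MN|NM] := leqP M N.+1.
  by rewrite big_geq // mulr_ge0 ?nexp_ge0 // invr_ge0 ltW.
apply: (@le_trans _ _ (e^-1 * (nexp e N - nexp e M.-1))); last first.
  by rewrite ler_wpM2l ?invr_ge0 ?(ltW e0) // gerBl nexp_ge0.
elim: M NM => // M IH; rewrite ltnS leq_eqVlt => /orP[/eqP <-|NM].
  by rewrite big_nat1; exact: nexp_step.
rewrite big_nat_recr //; last exact: ltnW.
have := IH NM; have := @nexp_step e M e0 (leq_ltn_trans N0 (ltnW NM)).
rewrite succnK; move: (nexp e N) (nexp e M.-1) (nexp e M) => a b c.
by move=> H1 H2; apply: (le_trans (lerD H2 H1)); rewrite -mulrDr ler_wpM2l ?invr_ge0 ?(ltW e0) //; lra.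
Qed.

Lemma sum_nexp_le e M : 0 < e -> \sum_(1 <= n < M) nexp (1 + e) n <= 1 + e^-1.
Proof.
move=> e0; have p : 0 <= 1 + e^-1 by rewrite addr_ge0 // invr_ge0 ltW.
case: M => [|[|M]]; [by rewrite big_geq|by rewrite big_geq|].
rewrite big_ltn // nexp_1 lerD2l; apply: le_trans (sum_nexp_tail M.+2 e0 (ltn0Sn 0)) _.
by rewrite nexp_1 mulr1.
Qed.

Lemma sum_ln_nexp_le e M : 0 < e ->
  \sum_(1 <= n < M) ln n%:R * nexp (1 + e) n <= 2 / e * (1 + 2 / e).
Proof.
move=> e0; have e20 : 0 < e / 2 by rewrite divr_gt0.
apply: (@le_trans _ _ (\sum_(1 <= n < M) 2 / e * nexp (1 + e / 2) n)).
  rewrite !big_nat; apply: ler_sum => n /andP[n0 _].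
  have -> : nexp (1 + e) n = nexp (e / 2) n * nexp (1 + e / 2) n.
    by rewrite -nexpD (_ : e / 2 + (1 + e / 2) = 1 + e) //; lra.
  rewrite mulrA; apply: ler_wpM2r; first exact: nexp_ge0.
  have H := ln_le_nexp e20 n0.
  apply: le_trans (ler_wpM2r (nexp_ge0 _ _) H) _.
  by rewrite -mulrA -nexpD addNr /nexp mul0r oppr0 expR0 mulr1 invf_div.
rewrite -mulr_sumr; apply: ler_wpM2l; first by rewrite divr_ge0 // ltW.
by have := sum_nexp_le M e20; rewrite invf_div.
Qed.

Lemma truncn_itvP (x : R) : 0 <= x -> (Num.truncn x)%:R <= x /\ x < (Num.truncn x).+1%:R.
Proof. by move=> x0; have /andP[] := truncn_itv x0. Qed.

Lemma ler_sum_nat_cond (m n : nat) (P : pred nat) (F : nat -> R) :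
  (forall i, (m <= i < n)%N -> 0 <= F i) ->
  \sum_(m <= i < n | P i) F i <= \sum_(m <= i < n) F i.
Proof.
move=> F0; rewrite [X in _ <= X](bigID P) /= lerDl big_nat_cond.
by apply: sumr_ge0 => i /andP[Hi _]; exact: F0.
Qed.

Lemma ler_sum_nat_widen (m n n' : nat) (F : nat -> R) : (n <= n')%N ->
  (forall i, (m <= i < n')%N -> 0 <= F i) ->
  \sum_(m <= i < n) F i <= \sum_(m <= i < n') F i.
Proof.
move=> nn F0; have [mn|nm] := leqP m n; last first.
  rewrite big_geq ?(ltnW nm) // big_nat; apply: sumr_ge0 => i; exact: F0.
rewrite [X in _ <= X](@big_cat_nat _ _ _ n) //= lerDl big_nat.
apply: sumr_ge0 => i /andP[ni Hi]; apply: F0; by rewrite Hi (leq_trans mn).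
Qed.

Lemma lnr_le (x : R) n : (0 < n)%N -> n%:R <= expR x -> ln n%:R <= x.
Proof. by move=> n0 H; rewrite -ler_expR lnK // posrE ltr0n. Qed.

Lemma lnr_lt (x : R) n : (0 < n)%N -> expR x < n%:R -> x < ln n%:R.
Proof. by move=> n0 H; rewrite -ltr_expR lnK // posrE ltr0n. Qed.

(** As long as [ln n <= 1 / e], the factor [n ^ (- e)] is at least [expR (-1)], and the harmonic sum
    over that range is at least [1 / e]. *)
Lemma sum_nexp_ge e N : 0 < e -> expR e^-1 < N%:R ->
  expR (-1) / e <= \sum_(1 <= n < N) nexp (1 + e) n.
Proof.
move=> e0; set T := Num.truncn (expR e^-1) => HN.
have [T1 T2] := truncn_itvP (expR_ge0 e^-1).
have TN : (T < N)%N by rewrite -(ltr_nat R); exact: le_lt_trans HN.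
apply: le_trans (ler_sum_nat_widen TN _); last by move=> *; exact: nexp_ge0.
apply: (@le_trans _ _ (\sum_(1 <= n < T.+1) expR (-1) * n%:R^-1)).
  rewrite -mulr_sumr ler_wpM2l ?expR_ge0 //; apply: le_trans (harmonic_ge _) => //.
  by apply/ltW/lnr_lt.
rewrite !big_nat; apply: ler_sum => n /andP[n0 nT].
rewrite nexpD nexp1 // mulrC ler_wpM2l ?invr_ge0 // /nexp ler_expR lerN2.
have : ln n%:R <= e^-1 by apply: lnr_le => //; apply: le_trans T1; rewrite ler_nat.
by move/(ler_wpM2l (ltW e0)); rewrite mulfV // gt_eqF.
Qed.

(** Only [ln n] between [1 / (2 e)] and [1 / e] is kept, where each factor has its full size;
    [e <= 1 / 4] absorbs the additive 1 of [harmonic_le]. *)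
Lemma sum_ln_nexp_ge e N : 0 < e -> e <= 4^-1 -> expR e^-1 < N%:R ->
  expR (-1) / 8 / e ^+ 2 <= \sum_(1 <= n < N) ln n%:R * nexp (1 + e) n.
Proof.
move=> e0 e4; set T := Num.truncn (expR e^-1) => HN.
have [T1 T2] := truncn_itvP (expR_ge0 e^-1).
set S := Num.truncn (expR (e^-1 / 2)).
have [S1 S2] := truncn_itvP (expR_ge0 (e^-1 / 2)).
have TN : (T < N)%N by rewrite -(ltr_nat R); exact: le_lt_trans HN.
have ei : 4 <= e^-1 by rewrite -[4]invrK lef_pV2 ?posrE // invr_gt0.
have ST : (S <= T)%N.
  by apply: le_truncn; rewrite ler_expR; lra.
have S0 : (0 < S)%N.
  by rewrite truncn_gt0 -[X in X <= _]expR0 ler_expR; lra.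
have F0 i : 0 <= ln i%:R * nexp (1 + e) i by rewrite mulr_ge0 ?nexp_ge0 ?lnr_ge0.
apply: le_trans (ler_sum_nat_widen TN _) => //.
rewrite (@big_cat_nat _ _ _ S.+1) //=.
apply: (@le_trans _ _ (\sum_(S.+1 <= n < T.+1) (e^-1 / 2 * expR (-1)) * n%:R^-1)); last first.
  rewrite -[X in X <= _]add0r; apply: lerD; first by apply: sumr_ge0 => i _; exact: F0.
  rewrite !big_nat; apply: ler_sum => n /andP[Sn nT].
  have n0 : (0 < n)%N by exact: leq_trans Sn.
  rewrite nexpD nexp1 // -mulrA; apply: ler_pM => //.
  - by rewrite divr_ge0 // invr_ge0 ltW.
  - by rewrite mulr_ge0 ?expR_ge0 // invr_ge0.
  - apply/ltW/lnr_lt => //; apply: (lt_le_trans S2); by rewrite ler_nat.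
  rewrite mulrC ler_wpM2l ?invr_ge0 // /nexp ler_expR lerN2.
  have : ln n%:R <= e^-1 by apply: lnr_le => //; apply: le_trans T1; rewrite ler_nat.
  by move/(ler_wpM2l (ltW e0)); rewrite mulfV // gt_eqF.
rewrite -mulr_sumr.
have H1 : e^-1 <= \sum_(1 <= n < T.+1) n%:R^-1 :> R.
  by apply: le_trans (harmonic_ge _) => //; apply/ltW/lnr_lt.
have H2 := harmonic_le S0.
have H3 : ln S%:R <= e^-1 / 2 by apply: lnr_le.
move: H1; rewrite (@big_cat_nat _ _ _ S.+1) //= => H1.
set Z := \sum_(S.+1 <= _ < _) _ in H1 *.
have HZ : e^-1 / 4 <= Z by lra.
have -> : expR (-1) / 8 / e ^+ 2 = (e^-1 / 2 * expR (-1)) * (e^-1 / 4) :> R.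
  by field; rewrite gt_eqF.
by apply: ler_wpM2l => //; rewrite mulr_ge0 ?expR_ge0 // divr_ge0 // invr_ge0 ltW.
Qed.

Lemma sum_Lam_nexp_conv s M :
  \sum_(1 <= n < M) ln n%:R * nexp s n =
  \sum_(1 <= d < M) \sum_(1 <= f < M | (d * f < M)%N) (Lam R d * nexp s d) * nexp s f.
Proof.
rewrite -(sum_convolution M (fun d f => (Lam R d * nexp s d) * nexp s f)).
apply: eq_big_nat => n /andP[n0 _]; rewrite -sum_Lam // mulr_suml.
rewrite [LHS]big_seq [RHS]big_seq; apply: eq_bigr => d; rewrite -dvdn_divisors // => dn.
rewrite -mulrA -nexpM ?(dvdn_gt0 n0 dn) //; last by rewrite divn_gt0 ?(dvdn_gt0 n0 dn) // dvdn_leq.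
by rewrite mulnC divnK.
Qed.

(** The identity [sum_Lam] read as an inequality: the box [d, f < N] lies inside [d * f < N * N], so
    the sum over [Lam] times the truncated zeta sum is at most the sum of [ln n] over [n < N * N].
    The range is first enlarged beyond [expR (1 / e)] so that [sum_nexp_ge] applies. *)
Lemma sum_Lam_le e M : 0 < e -> e <= 1 ->
  \sum_(1 <= n < M) Lam R n * nexp (1 + e) n <= 6 * expR 1 / e.
Proof.
move=> e0 e1.
pose N := maxn M (Num.truncn (expR e^-1)).+1.
have [T1 T2] := truncn_itvP (expR_ge0 e^-1).
have HN : expR e^-1 < N%:R by apply: lt_le_trans T2 _; rewrite ler_nat leq_maxr.
have L0 i : 0 <= Lam R i * nexp (1 + e) i by rewrite mulr_ge0 ?Lam_ge0 ?nexp_ge0.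
apply: le_trans (ler_sum_nat_widen (leq_maxl M (Num.truncn (expR e^-1)).+1) _) _ => //.
rewrite -/N; set A := \sum_(_ <= _ < _) _.
have A0 : 0 <= A by apply: sumr_ge0 => i _; exact: L0.
have H : A * (expR (-1) / e) <= 2 / e * (1 + 2 / e).
  apply: le_trans (sum_ln_nexp_le (N * N) e0).
  apply: le_trans (ler_wpM2l A0 (sum_nexp_ge e0 HN)) _.
  rewrite sum_Lam_nexp_conv mulr_suml.
  have NN : (N <= N * N)%N by rewrite leq_pmulr // /N leq_max orbT.
  apply: le_trans (ler_sum_nat_widen NN _); last first.
    by move=> i _; apply: sumr_ge0 => j _; rewrite mulr_ge0 ?nexp_ge0 ?L0.
  rewrite !big_nat; apply: ler_sum => d /andP[d0 dN]; rewrite mulr_sumr.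
  rewrite [X in _ <= X]big_mkcond /=.
  apply: le_trans (ler_sum_nat_widen NN _); last first.
    by move=> i _; case: ifP => // _; rewrite mulr_ge0 ?nexp_ge0 ?L0.
  rewrite !big_nat; apply: ler_sum => f /andP[f0 fN].
  by rewrite ltn_mul.
have ep : 0 < e^-1 by rewrite invr_gt0.
have e1' : 1 <= e^-1 by rewrite -invr1 lef_pV2 ?posrE.
move: H; rewrite mulrA ler_pdivrMr // expRN ler_pdivrMr ?expR_gt0 // => /le_trans; apply.
have -> : 2 / e * (1 + 2 / e) * e * expR 1 = (2 + 4 * e^-1) * expR 1 :> R.
  by field; rewrite gt_eqF.
have -> : 6 * expR 1 / e = (6 * e^-1) * expR 1 :> R by rewrite mulrAC.
by apply: ler_wpM2r; rewrite ?expR_ge0 //; lra.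
Qed.

(** The reverse inclusion: pairs with [d * f < N] lie in the box [d, f < N]. *)
Lemma sum_Lam_ge e N : 0 < e -> e <= 4^-1 -> expR e^-1 < N%:R ->
  expR (-1) / 16 / e <= \sum_(1 <= n < N) Lam R n * nexp (1 + e) n.
Proof.
move=> e0 e4 HN; set A := \sum_(_ <= _ < _) _.
have L0 i : 0 <= Lam R i * nexp (1 + e) i by rewrite mulr_ge0 ?Lam_ge0 ?nexp_ge0.
have A0 : 0 <= A by apply: sumr_ge0 => i _; exact: L0.
have H : expR (-1) / 8 / e ^+ 2 <= A * (1 + e^-1).
  apply: le_trans (sum_ln_nexp_ge e0 e4 HN) _; rewrite sum_Lam_nexp_conv.
  apply: le_trans (ler_wpM2l A0 (sum_nexp_le N e0)); rewrite mulr_suml.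
  rewrite big_nat [X in _ <= X]big_nat; apply: ler_sum => d /andP[d0 dN]; rewrite mulr_sumr.
  by apply: ler_sum_nat_cond => i _; rewrite mulr_ge0 ?nexp_ge0 ?L0.
have ep : 0 < e^-1 by rewrite invr_gt0.
have e1' : 1 <= e^-1 by rewrite -invr1 lef_pV2 ?posrE //; lra.
have H2 : expR (-1) / 8 / e ^+ 2 <= A * (2 * e^-1).
  by apply: (le_trans H); rewrite ler_wpM2l //; lra.
have -> : expR (-1) / 16 / e = (expR (-1) / 8 / e ^+ 2) / (2 * e^-1) :> R.
  by field; rewrite gt_eqF.
by rewrite ler_pdivrMr // mulr_gt0.
Qed.

Lemma expRN_le (x : R) : 0 < x -> expR (- x) <= x^-1.
Proof.
move=> x0; rewrite expRN lef_pV2 ?posrE ?expR_gt0 //.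
by have := expR_ge1Dx x; lra.
Qed.

(** A positive proportion of the mass of [Lam] sits where [ln n] is comparable with [1 / e]. Both
    tails are removed from [sum_Lam_ge] by Rankin's trick: small [n] are compared with the exponent
    [1 + e / th], large ones with [1 + e / 2]. *)
Lemma Lam_window : exists th c : R, [/\ 0 < th, th < 1, 0 < c &
  forall e N, 0 < e -> e <= th -> expR e^-1 < N%:R ->
  c / e <= \sum_(1 <= n < N | (th / e < ln n%:R) && (ln n%:R <= (th * e)^-1))
     Lam R n * n%:R^-1].
Proof.
pose E : R := expR 1; have E1 : 1 <= E by rewrite /E -[X in X <= _]expR0 ler_expR.
have E0 : 0 < E by exact: expR_gt0.
set c0 : R := expR (-1) / 16; have c00 : 0 < c0 by rewrite divr_gt0 ?expR_gt0.
have c01 : c0 <= 1 by rewrite /c0; have : expR (-1) <= 1 :> R; [rewrite expR_le1; lra|lra].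
(* Chosen so that the two tails, together at most [30 * E ^+ 2 * th / e], take no more than half of
   the lower bound [c0 / e]. *)
set th : R := c0 / (60 * E ^+ 2).
have EE : 0 < E ^+ 2 by rewrite exprn_gt0.
have E2 : 1 <= E ^+ 2 by rewrite exprn_ege1.
have th0 : 0 < th by rewrite divr_gt0 // mulr_gt0.
have th4 : th <= 4^-1.
  by rewrite /th ler_pdivrMr ?mulr_gt0 //; lra.
exists th, (c0 / 2); split => //; [lra|by rewrite divr_gt0|].
move=> e N e0 eth HN.
have e4 : e <= 4^-1 by lra.
have L0 s i : 0 <= Lam R i * nexp s i by rewrite mulr_ge0 ?Lam_ge0 ?nexp_ge0.
have ep : 0 < e^-1 by rewrite invr_gt0.
have := sum_Lam_ge e0 e4 HN; rewrite -/c0.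
pose P n := (th / e < ln n%:R) && (ln n%:R <= (th * e)^-1).
rewrite (bigID P) /= => H.
have HW : \sum_(1 <= n < N | P n) Lam R n * nexp (1 + e) n <=
   \sum_(1 <= n < N | P n) Lam R n * n%:R^-1.
  rewrite big_nat_cond [X in _ <= X]big_nat_cond; apply: ler_sum => n /andP[/andP[n0 _] _].
  apply: ler_wpM2l; first exact: Lam_ge0.
  by rewrite nexpD nexp1 // ler_piMr ?invr_ge0 // nexp_le1 // ltW.
have eth1 : e / th <= 1 by rewrite ler_pdivrMr // mul1r.
have eth0 : 0 < e / th by rewrite divr_gt0.
have HR : \sum_(1 <= n < N | ~~ P n) Lam R n * nexp (1 + e) n <=
   E * (6 * E / (e / th)) + 2 * th * (6 * E / (e / 2)).
  apply: le_trans (lerD (ler_wpM2l (ltW E0) (sum_Lam_le N eth0 eth1))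
    (ler_wpM2l (_ : 0 <= 2 * th) (sum_Lam_le N (_ : 0 < e / 2) _))); [|lra..].
  rewrite !mulr_sumr -big_split /= big_mkcond /= !big_nat; apply: ler_sum => n /andP[n0 _].
  have p1 : 0 <= E * (Lam R n * nexp (1 + e / th) n) by rewrite mulr_ge0 // ltW.
  have p2 : 0 <= 2 * th * (Lam R n * nexp (1 + e / 2) n) by rewrite mulr_ge0 //; lra.
  case: ifPn => [|_]; last by rewrite addr_ge0.
  rewrite /P negb_and -leNgt -ltNge => /orP[H1|H1].
    apply: (@le_trans _ _ (E * (Lam R n * nexp (1 + e / th) n))); last by rewrite lerDl.
    rewrite mulrCA; apply: ler_wpM2l; first exact: Lam_ge0.
    rewrite !nexpD mulrCA; apply: ler_wpM2l; first exact: nexp_ge0.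
    rewrite /E /nexp -expRD ler_expR.
    have : e / th * ln n%:R <= e / th * (th / e) by rewrite ler_wpM2l // ltW.
    have -> : e / th * (th / e) = 1 by field; rewrite !gt_eqF.
    have : 0 <= e * ln n%:R by rewrite mulr_ge0 ?lnr_ge0 // ltW.
    lra.
  apply: (@le_trans _ _ (2 * th * (Lam R n * nexp (1 + e / 2) n))); last by rewrite lerDr.
  rewrite mulrCA; apply: ler_wpM2l; first exact: Lam_ge0.
  have -> : nexp (1 + e) n = nexp (e / 2) n * nexp (1 + e / 2) n.
    by rewrite -nexpD (_ : e / 2 + (1 + e / 2) = 1 + e) //; lra.
  apply: ler_wpM2r; first exact: nexp_ge0.
  have t2 : 0 < (2 * th)^-1 by rewrite invr_gt0; lra.
  have := expRN_le t2; rewrite invrK; apply: le_trans.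
  rewrite /nexp ler_expR lerN2.
  have : e / 2 * (th * e)^-1 <= e / 2 * ln n%:R by rewrite ler_wpM2l //; lra.
  by apply: le_trans; rewrite le_eqVlt; apply/orP; left; apply/eqP; field; rewrite !gt_eqF.
have : E * (6 * E / (e / th)) + 2 * th * (6 * E / (e / 2)) <= c0 / 2 / e.
  have -> : E * (6 * E / (e / th)) + 2 * th * (6 * E / (e / 2)) = (6 * E ^+ 2 + 24 * E) * th / e.
    by field; rewrite !gt_eqF.
  rewrite ler_wpM2r ?(ltW ep) //.
  have EEE : E <= E ^+ 2 by rewrite expr2 ler_peMl // ltW.
  have : (6 * E ^+ 2 + 24 * E) * th <= (30 * E ^+ 2) * th by rewrite ler_wpM2r ?(ltW th0) //; lra.
  move/le_trans; apply; rewrite /th le_eqVlt; apply/orP; left; apply/eqP.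
  by field; rewrite !gt_eqF.
move: H HW HR.
move: (\sum_(1 <= n < N | P n) _) (\sum_(1 <= n < N | ~~ P n) _) (E * _ + _).
move=> a b d; move: (\sum_(1 <= n < N | _) _) => a'; lra.
Qed.

End PowerSums.

(** * Periodic functions, their means, and Abel summation *)

Definition periodic (T : Type) (m : nat) (h : nat -> T) := forall n, h (n + m)%N = h n.

Lemma periodicMl (T : Type) m k (h : nat -> T) : periodic m h -> periodic (k * m) h.
Proof.
move=> ph n; elim: k => [|k IH]; first by rewrite mul0n addn0.
by rewrite mulSn [(m + _)%N]addnC addnA ph.
Qed.

Lemma periodic_mod (T : Type) m (h : nat -> T) n : periodic m h -> h (n %% m)%N = h n.
Proof.
move=> ph; rewrite [in RHS](divn_eq n m) addnC.
by rewrite (periodicMl (n %/ m) ph).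
Qed.

Section PeriodicSums.
Variable V : comNzRingType.
Implicit Types (f g : nat -> V) (a b c m n : nat).

Definition psum m f : V := \sum_(n < m) f n.

(** The map [t -> c + a t] permutes the residues modulo [b]. *)
Lemma psum_affine a b c g : (0 < b)%N -> coprime a b -> periodic b g ->
  psum b (fun t => g (c + a * t)%N) = psum b g.
Proof.
move=> b0 ab pg; rewrite /psum.
pose h (t : 'I_b) : 'I_b := Ordinal (ltn_pmod (c + a * t) b0).
have hi : injective h.
  move=> x y /(congr1 val) /= /eqP; rewrite eqn_modDl => H.
  apply/val_inj; wlog xy : x y H / (x <= y)%N.
    move=> W; case/orP: (leq_total x y) => [xy|yx]; first exact: W.
    by apply/esym/W => //; rewrite eq_sym.
  move: H; rewrite eq_sym eqn_mod_dvd ?leq_mul2l ?xy ?orbT // -mulnBr.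
  rewrite Gauss_dvdr // 1?coprime_sym // => /dvdn_leq.
  have := ltn_ord y; case: (ltnP x y) => [xy' yb|yx _ _].
    rewrite subn_gt0 => /(_ xy') H.
    by exfalso; move: yb; rewrite ltnNge (leq_trans H) // leq_subr.
  by apply/eqP; rewrite eqn_leq xy.
rewrite [RHS](reindex_inj hi); apply: eq_bigr => t _ /=.
by rewrite periodic_mod.
Qed.

Lemma psum_split a b f : (0 < a)%N -> psum (a * b) f = \sum_(i < a) \sum_(t < b) f (i + a * t)%N.
Proof.
move=> a0; rewrite /psum; elim: b => [|b IH].
  by rewrite muln0 big_ord0 big1 // => i _; rewrite big_ord0.
rewrite mulnS addnC big_split_ord /= IH.
rewrite -big_split /=; apply: eq_bigr => i _.
by rewrite big_ord_recr /= addnC.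
Qed.

(** The Chinese remainder theorem for mean values: along [n = i + a t] the factor [f] is constant
    while [g] runs through a whole period. *)
Lemma psum_mul a b f g : (0 < a)%N -> (0 < b)%N -> coprime a b -> periodic a f -> periodic b g ->
  psum (a * b) (fun n => f n * g n) = psum a f * psum b g.
Proof.
move=> a0 b0 ab pf pg; rewrite psum_split // mulr_suml; apply: eq_bigr => i _.
rewrite -(psum_affine i b0 ab pg) mulr_sumr; apply: eq_bigr => t _.
by rewrite [(a * t)%N]mulnC (periodicMl t pf).
Qed.

Lemma psum_dil a b f : (0 < a)%N -> periodic a f -> psum (a * b) f = psum a f *+ b.
Proof.
move=> a0 pf; rewrite psum_split // -sumrMnl; apply: eq_bigr => i _.
rewrite (eq_bigr (fun _ => f i)) ?sumr_const ?card_ord // => t _.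
by rewrite [(a * t)%N]mulnC (periodicMl t pf).
Qed.

Lemma periodic_prod (s : seq nat) (F : nat -> nat -> V) :
  (forall q, q \in s -> periodic q (F q)) ->
  periodic (\prod_(q <- s) q) (fun n => \prod_(q <- s) F q n).
Proof.
elim: s => [|p s IH] H n; first by rewrite !big_nil.
rewrite !big_cons mulnC; congr (_ * _).
  by rewrite (periodicMl _ (H p (mem_head _ _))).
by rewrite mulnC (periodicMl p (IH _)) // => q qs; apply: H; rewrite inE qs orbT.
Qed.

Lemma psum_prod (s : seq nat) (F : nat -> nat -> V) (W : nat) g :
  uniq s -> all prime s -> (0 < W)%N -> all (fun q => coprime q W) s ->
  (forall q, q \in s -> periodic q (F q)) -> periodic W g ->
  psum ((\prod_(q <- s) q) * W) (fun n => \prod_(q <- s) F q n * g n) =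
  \prod_(q <- s) psum q (F q) * psum W g.
Proof.
elim: s => [|p s IH] /=.
  by move=> *; rewrite !big_nil mul1n mul1r; apply: eq_bigr => n _; rewrite big_nil mul1r.
move=> /andP[ps us] /andP[pp sp] W0 /andP[pW sW] pF pg.
have pF' q : q \in s -> periodic q (F q) by move=> qs; apply: pF; rewrite inE qs orbT.
have r0 : (0 < \prod_(q <- s) q)%N.
  by rewrite big_seq; apply: prodn_cond_gt0 => q qs; apply/prime_gt0/(allP sp).
have -> : (\prod_(q <- p :: s) q * W = p * (\prod_(q <- s) q * W))%N.
  by rewrite big_cons mulnA.
rewrite (_ : psum _ _ = psum (p * (\prod_(q <- s) q * W)) (fun n => F p n * (\prod_(q <- s) F q n * g n))); last first.
  by apply: eq_bigr => n _; rewrite big_cons mulrA.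
rewrite psum_mul ?(prime_gt0 pp) ?muln_gt0 ?r0 //.
- by rewrite IH // big_cons mulrA.
- rewrite coprimeMr pW andbT; rewrite big_seq; apply: (big_ind (coprime p)).
  + exact: coprimen1.
  + by move=> x y; rewrite coprimeMr => -> ->.
  + move=> q qs; rewrite prime_coprime // dvdn_prime2 //; last by apply: (allP sp).
    by apply: contraNneq ps => ->.
- by apply: pF; rewrite mem_head.
- move=> n; congr (_ * _).
    by rewrite mulnC (periodicMl W (periodic_prod pF')).
  by rewrite (periodicMl _ pg).
Qed.

End PeriodicSums.

Section Abel.
Variable R : realType.
Implicit Types (a c h : nat -> R) (B H : R).

Lemma abel_sum a c B (V N : nat) : (V < N)%N ->
  (forall L, (V <= L <= N)%N -> `|\sum_(V <= l < L) c l| <= B) ->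
  0 <= a N.-1 ->
  (forall l, (V <= l)%N -> (l.+1 < N)%N -> a l.+1 <= a l) ->
  `|\sum_(V <= l < N) a l * c l| <= a V * B.
Proof.
move=> VN HB aN am.
(* The boundary term stays inside the norm, so that the error telescopes with the decrease of
   [a]. *)
have key M : (V < M <= N)%N -> `|\sum_(V <= l < M) a l * c l - a M.-1 * \sum_(V <= l < M) c l|
    <= (a V - a M.-1) * B.
  elim: M => // M IH; rewrite ltnS => /andP[]; rewrite leq_eqVlt => /orP[/eqP <- _|VM MN].
    by rewrite !big_nat1 succnK !subrr normr0 mul0r.
  have VM' := ltnW VM.
  have := IH _; rewrite VM (ltnW MN) => /(_ isT) {}IH.
  rewrite !big_nat_recr //= .
  set S := \sum_(V <= l < M) a l * c l in IH *; set C := \sum_(V <= l < M) c l in IH *.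
  have -> : S + a M * c M - a M * (C + c M) = (S - a M.-1 * C) + (a M.-1 - a M) * C by ring.
  apply: le_trans (ler_normD _ _) _.
  have d0 : 0 <= a M.-1 - a M.
    rewrite subr_ge0; have := am M.-1; rewrite prednK ?(leq_ltn_trans _ VM) //; apply => //.
    by rewrite -ltnS prednK // (leq_ltn_trans _ VM).
  have : `|(a M.-1 - a M) * C| <= (a M.-1 - a M) * B.
    by rewrite normrM ger0_norm // ler_wpM2l // HB // VM' ltnW.
  move: IH; set X := `|S - _|; set Y := `|_ * C|; move=> H1 H2.
  by have := lerD H1 H2; move/le_trans; apply; rewrite -mulrDl; lra.
have := key N; rewrite VN leqnn => /(_ isT) H.
have H2 : `|a N.-1 * \sum_(V <= l < N) c l| <= a N.-1 * B.
  by rewrite normrM ger0_norm // ler_wpM2l // HB // leqnn ltnW.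
rewrite -[X in `|X|](subrK (a N.-1 * \sum_(V <= l < N) c l)).
apply: le_trans (ler_normD _ _) _; apply: le_trans (lerD H H2) _.
by rewrite -mulrDl subrK.
Qed.

Lemma psum_shift h m V : periodic m h -> \sum_(V <= l < V + m) h l = psum m h.
Proof.
move=> ph; elim: V => [|V IH]; first by rewrite add0n big_mkord.
case: m ph IH => [|m] ph IH; first by rewrite addn0 big_geq // /psum big_ord0.
rewrite addSn big_nat_recr //=; last by rewrite addnS ltnS leq_addr.
by rewrite ph addrC -IH [RHS]big_ltn // addnS ltnS leq_addr.
Qed.

Lemma periodic_sum_bound h m H V L : (0 < m)%N -> periodic m h -> psum m h = 0 ->
  (forall n, `|h n| <= H) -> `|\sum_(V <= l < L) h l| <= m%:R * H.
Proof.
move=> m0 ph h0 hH; have H0 : 0 <= H by apply: le_trans (hH 0%N).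
elim/ltn_ind: L => L IH; have [LV|VL] := leqP (V + m) L; last first.
  have [LV|VL'] := leqP L V; first by rewrite big_geq // normr0 mulr_ge0.
  apply: le_trans (ler_norm_sum _ _ _) _.
  apply: le_trans (ler_sum _ (fun i _ => hH i)) _.
  rewrite big_const_nat iter_addr_0 -[X in X <= _]mulr_natl ler_wpM2r // ler_nat.
  by rewrite leq_subLR ltnW.
have Lm : (m <= L)%N by apply: leq_trans LV; rewrite leq_addl.
rewrite (@big_cat_nat _ _ _ (L - m)) ?leq_subr //=; last by rewrite leq_subRL // addnC.
rewrite -{3}(subnK Lm) psum_shift // h0 addr0 IH //.
by rewrite ltn_subrL m0 (leq_trans m0).
Qed.

(** Subtracting the mean of [h] leaves a periodic function of mean 0 bounded by [2 * H], whose
    partial sums are those of an incomplete period. *)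
Lemma periodic_abel a h m H V N : (0 < m)%N -> periodic m h -> (forall n, `|h n| <= H) ->
  (V < N)%N -> 0 <= a N.-1 ->
  (forall l, (V <= l)%N -> (l.+1 < N)%N -> a l.+1 <= a l) ->
  `|\sum_(V <= l < N) a l * h l - psum m h / m%:R * \sum_(V <= l < N) a l|
     <= a V * (m%:R * (2 * H)).
Proof.
move=> m0 ph hH VN aN am; set u := psum m h / m%:R.
have mR : 0 < m%:R :> R by rewrite ltr0n.
have uH : `|u| <= H.
  rewrite normrM normfV (@ger0_norm _ m%:R) ?ler0n // ler_pdivrMr // /psum.
  apply: le_trans (ler_norm_sum _ _ _) _.
  apply: le_trans (ler_sum _ (fun (i : 'I_m) _ => hH i)) _.
  by rewrite sumr_const card_ord mulr_natr.
have -> : \sum_(V <= l < N) a l * h l - u * \sum_(V <= l < N) a l =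
  \sum_(V <= l < N) a l * (h l - u).
  by rewrite mulr_sumr -sumrB; apply: eq_bigr => l _; ring.
apply: abel_sum => // L _; apply: periodic_sum_bound => //.
- by move=> n; rewrite ph.
- rewrite /psum sumrB -/(psum m h) sumr_const card_ord /u -[X in _ - X]mulr_natr divfK ?subrr // gt_eqF //.
- by move=> n; apply: le_trans (ler_normB _ _) _; have := hH n; lra.
Qed.

End Abel.

Local Open Scope complex_scope.

(** * A real-valued norm on the complex numbers *)

Section ComplexNorm.
Variable R : realType.
Implicit Types (z u : R[i]) (x : R).

(** The norm of [R[i]] takes its values in [R[i]]; passing to the real part lets all estimates live
    in the ordered field [R]. *)
Definition nc z : R := complex.Re `|z|.

Lemma ncE z : (nc z)%:C = `|z|.
Proof. by rewrite /nc RRe_real // normr_real. Qed.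

Lemma nc_ge0 z : 0 <= nc z.
Proof. by rewrite -ler0c ncE normr_ge0. Qed.

Lemma ncM z u : nc (z * u) = nc z * nc u.
Proof. by apply: complexI; rewrite rmorphM /= !ncE normrM. Qed.

Lemma ncD z u : nc (z + u) <= nc z + nc u.
Proof. by rewrite -lecR rmorphD /= !ncE ler_normD. Qed.

Lemma ncN z : nc (- z) = nc z.
Proof. by rewrite /nc normrN. Qed.

Lemma ncB z u : nc (z - u) <= nc z + nc u.
Proof. by rewrite -(ncN u) ncD. Qed.

Lemma nc0 : nc 0 = 0. Proof. by rewrite /nc normr0. Qed.
Lemma nc1 : nc 1 = 1. Proof. by rewrite /nc normr1. Qed.

Lemma ncJ z : nc z^* = nc z.
Proof. by rewrite /nc normcJ. Qed.

Lemma nc_sqr z : nc z ^+ 2 = complex.Re z ^+ 2 + complex.Im z ^+ 2.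
Proof. by apply: complexI; rewrite add_Re2_Im2 rmorphXn /= ncE. Qed.

Lemma nc_real x : nc x%:C = `|x|.
Proof.
apply/eqP; rewrite -(@eqrXn2 _ 2) ?nc_ge0 ?normr_ge0 //.
by rewrite nc_sqr /= expr0n addr0 real_normK // num_real.
Qed.

Lemma nc_Re z : `|complex.Re z| <= nc z.
Proof. by rewrite -lecR ncE normc_ge_Re. Qed.

Lemma nc_Im z : `|complex.Im z| <= nc z.
Proof.
rewrite -(@ler_pXn2r _ 2) ?nnegrE ?nc_ge0 ?normr_ge0 // nc_sqr real_normK ?num_real //.
by rewrite lerDr sqr_ge0.
Qed.

Lemma nc_le z : nc z <= `|complex.Re z| + `|complex.Im z|.
Proof.
rewrite -(@ler_pXn2r _ 2) ?nnegrE ?nc_ge0 ?addr_ge0 ?normr_ge0 //.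
rewrite nc_sqr sqrrD !real_normK ?num_real //.
have : 0 <= `|complex.Re z| * `|complex.Im z| by rewrite mulr_ge0.
rewrite -mulr_natr; move: (`|_| * _) => x; lra.
Qed.

Lemma nc_sum (I : Type) (r : seq I) (P : pred I) (F : I -> R[i]) :
  nc (\sum_(i <- r | P i) F i) <= \sum_(i <- r | P i) nc (F i).
Proof.
elim/big_rec2: _ => [|i y z _ H]; first by rewrite nc0.
by apply: le_trans (ncD _ _) _; rewrite lerD2l.
Qed.

Lemma ncX z n : nc (z ^+ n) = nc z ^+ n.
Proof. by elim: n => [|n IH]; rewrite ?expr0 ?nc1 // !exprS ncM IH. Qed.

Lemma nc_prod (I : Type) (r : seq I) (P : pred I) (F : I -> R[i]) :
  nc (\prod_(i <- r | P i) F i) = \prod_(i <- r | P i) nc (F i).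
Proof. by elim/big_rec2: _ => [|i y z _ <-]; rewrite ?nc1 ?ncM. Qed.

Lemma Re_sum (I : Type) (r : seq I) (P : pred I) (F : I -> R[i]) :
  complex.Re (\sum_(i <- r | P i) F i) = \sum_(i <- r | P i) complex.Re (F i).
Proof. by elim/big_rec2: _ => // i y z _ <-; case: (F i) => a b; case: z. Qed.

Lemma Im_sum (I : Type) (r : seq I) (P : pred I) (F : I -> R[i]) :
  complex.Im (\sum_(i <- r | P i) F i) = \sum_(i <- r | P i) complex.Im (F i).
Proof. by elim/big_rec2: _ => // i y z _ <-; case: (F i) => a b; case: z. Qed.

Lemma Re_mulr x z : complex.Re (x%:C * z) = x * complex.Re z.
Proof. by case: z => a b /=; rewrite mul0r subr0. Qed.

Lemma Im_mulr x z : complex.Im (x%:C * z) = x * complex.Im z.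
Proof. by case: z => a b /=; rewrite mul0r addr0. Qed.

Lemma ncMr x z : 0 <= x -> nc (x%:C * z) = x * nc z.
Proof. by move=> x0; rewrite ncM nc_real ger0_norm. Qed.

End ComplexNorm.

(** * Dirichlet characters and the recurrence for logarithmic derivatives *)

Section Characters.
Variable R : realType.
Implicit Types (chi : nat -> R[i]) (m n a b : nat).

(** What Dirichlet characters share with the constant 1; it suffices for the Euler products and for
    the recurrence. *)
Definition cmul chi :=
  [/\ chi 1%N = 1, (forall a b, chi (a * b)%N = chi a * chi b) & forall n, nc (chi n) <= 1].

(** Primitivity is not demanded, so that products of characters, taken to the product of the moduli,
    stay in the class. *)
Definition dchar m chi :=
  [/\ forall a b, chi (a * b)%N = chi a * chi b, periodic m chi,
      forall a, coprime a m -> nc (chi a) = 1 & forall a, ~~ coprime a m -> chi a = 0].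

Definition nonprincipal m chi := exists2 a, coprime a m & chi a <> 1.

Lemma dchar1 m chi : dchar m chi -> chi 1%N = 1.
Proof.
case=> M _ C _; have : nc (chi 1%N) = 1 by apply: C; exact: coprime1n.
move=> H; have c0 : chi 1%N != 0.
  by apply/negP => /eqP H0; move: H; rewrite H0 nc0 => /eqP; rewrite eq_sym oner_eq0.
by apply: (mulfI c0); rewrite -M mulr1.
Qed.

Lemma dchar_cmul m chi : dchar m chi -> cmul chi.
Proof.
move=> D; have c1 := dchar1 D; case: D => M _ C Z; split => // n.
by case: (boolP (coprime n m)) => [/C ->|/Z ->] //; rewrite nc0.
Qed.

Lemma dchar_psum m chi : (0 < m)%N -> dchar m chi -> nonprincipal m chi -> psum m chi = 0.
Proof.
move=> m0 D [a am ca]; have pc : periodic m chi by case: D.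
have := psum_affine 0 m0 am pc; rewrite /psum.
rewrite (eq_bigr (fun n : 'I_m => chi a * chi n)) => [|n _]; last by rewrite add0n; case: D => ->.
rewrite -mulr_sumr => /eqP; rewrite -subr_eq0 -{2}[\sum_(_ < _) _]mul1r -mulrBl mulf_eq0.
by rewrite subr_eq0 => /orP[/eqP|/eqP].
Qed.

Lemma dchar_mulJ m1 m2 chi1 chi2 : dchar m1 chi1 -> dchar m2 chi2 ->
  dchar (m1 * m2) (fun n => chi1 n * (chi2 n)^*).
Proof.
case=> M1 P1 C1 Z1 [M2 P2 C2 Z2]; split => [a b|n|a|a].
- by rewrite M1 M2 rmorphM /=; ring.
- by rewrite {1}mulnC (periodicMl m2 P1) (periodicMl m1 P2).
- by rewrite coprimeMr => /andP[a1 a2]; rewrite ncM ncJ C1 // C2 // mulr1.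
- rewrite coprimeMr negb_and => /orP[/Z1 ->|/Z2 ->]; first by rewrite mul0r.
  by rewrite rmorph0 mulr0.
Qed.

Lemma dcharJ m chi : dchar m chi -> dchar m (fun n => (chi n)^*).
Proof.
case=> M P C Z; split => [a b|n|a|a].
- by rewrite M rmorphM.
- by rewrite P.
- by rewrite ncJ; exact: C.
- by move/Z ->; rewrite rmorph0.
Qed.

End Characters.

Section DirichletSums.
Variable R : realType.
Implicit Types (chi : nat -> R[i]) (s e : R) (i j m n N M : nat).

(* As a Dirichlet series, weighting by [wt i] amounts to the [i]-th derivative divided by [i!], up to sign. *)
Definition wt i s n : R := ln n%:R ^+ i / i`!%:R * nexp s n.

Lemma wt_ge0 i s n : 0 <= wt i s n.
Proof. by rewrite mulr_ge0 ?nexp_ge0 // divr_ge0 ?exprn_ge0 ?lnr_ge0. Qed.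

Lemma Lam_wt_ge0 i s m n : 0 <= Lam R m * wt i s n.
Proof. by apply: mulr_ge0; rewrite ?Lam_ge0 ?wt_ge0. Qed.

Lemma wt0 s n : wt 0 s n = nexp s n.
Proof. by rewrite /wt expr0 fact0 invr1 mulr1 mul1r. Qed.

Lemma ln_wt i s n : ln n%:R * wt i s n = i.+1%:R * wt i.+1 s n.
Proof.
rewrite /wt exprS factS natrM.
have : i.+1%:R != 0 :> R by rewrite pnatr_eq0.
have : i`!%:R != 0 :> R by rewrite pnatr_eq0 -lt0n fact_gt0.
by move: (i`!%:R) (i.+1%:R) => x y x0 y0; field; rewrite x0 y0.
Qed.

(** The Leibniz rule for divided derivatives, here the binomial theorem for the powers of
    [ln m + ln n]. *)
Lemma wtM i s m n : (0 < m)%N -> (0 < n)%N ->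
  wt i s (m * n) = \sum_(a < i.+1) wt a s m * wt (i - a) s n.
Proof.
move=> m0 n0; rewrite /wt lnrM // nexpM // addrC exprDn mulr_suml mulr_suml.
apply: eq_bigr => a _.
have ai : (a <= i)%N by rewrite -ltnS.
have f0 b : b`!%:R != 0 :> R by rewrite pnatr_eq0 -lt0n fact_gt0.
have H : 'C(i, a)%:R / i`!%:R = (a`!%:R)^-1 / (i - a)`!%:R :> R.
  rewrite -(bin_fact ai) !natrM; field; rewrite !f0 /=.
  by rewrite pnatr_eq0 -lt0n bin_gt0.
rewrite -[X in X / _ * _]mulr_natr -[_ * _ / i`!%:R]mulrA H.
by move: (f0 a) (f0 (i - a)%N) => *; field; apply/andP; split.
Qed.

(** With [x = (v' - v) / v] this is [(1 + x) ^+ i <= expR (i * x)]: the function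
    [v ^+ i * expR (- (s * v))] decreases once [v >= i / s]. *)
Lemma pow_exp_decr i s v v' : 0 <= s -> i%:R <= s * v -> 0 <= v -> v <= v' ->
  v' ^+ i * expR (- (s * v')) <= v ^+ i * expR (- (s * v)).
Proof.
move=> s0; case: i => [|i] H v0 vv.
  by rewrite !expr0 !mul1r ler_expR lerN2 ler_wpM2l.
have v1 : 0 < v.
  rewrite lt_neqAle v0 andbT; apply/eqP => vE; move: H; rewrite -vE mulr0.
  by rewrite lern0.
have x1 : 0 <= (v' - v) / v by rewrite divr_ge0 // subr_ge0.
have -> : v' = v * (1 + (v' - v) / v) by field; rewrite gt_eqF.
rewrite exprMn -mulrA ler_wpM2l ?exprn_ge0 // -ler_pdivlMr ?expR_gt0 // -expRN -expRD.
apply: (@le_trans _ _ (expR ((v' - v) / v) ^+ i.+1)).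
  by rewrite ler_pXn2r ?nnegrE ?expR_ge0 ?addr_ge0 // expR_ge1Dx.
rewrite -expRM_natl ler_expR.
have -> : - (s * v) + - - (s * (v * (1 + (v' - v) / v))) = (s * v) * ((v' - v) / v).
  by field; rewrite gt_eqF.
by rewrite ler_wpM2r.
Qed.

Lemma wt_decr i s n n' : 0 <= s -> i%:R <= s * ln n%:R -> (0 < n)%N -> (n <= n')%N ->
  wt i s n' <= wt i s n.
Proof.
move=> s0 H n0 nn; rewrite /wt /nexp ![_ / _ * expR _]mulrAC ler_wpM2r ?invr_ge0 //.
by apply: pow_exp_decr; rewrite ?lnr_ge0 // ler_lnr.
Qed.

(* Truncations of the [i]-th Taylor coefficients (up to sign) of [L] and of [- L' / L] at [s]. *)
Definition Ls chi s i M : R[i] := \sum_(1 <= n < M) (wt i s n)%:C * chi n.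
Definition As chi s i M : R[i] := \sum_(1 <= n < M) (Lam R n * wt i s n)%:C * chi n.

(** Of the exponent [e], one quarter pays for the power of the logarithm, one quarter gives the
    small factor at [M], and one half is kept for convergence. *)
Lemma wt_tail i e n M : 0 < e -> (0 < M)%N -> (M <= n)%N ->
  wt i (1 + e) n <= (4 / e) ^+ i * nexp (e / 4) M * nexp (1 + e / 2) n.
Proof.
move=> e0 M0 Mn; have n0 := leq_trans M0 Mn.
have H := @pow_fact_le R (ln n%:R) (4 / e) i (lnr_ge0 _ _).
have {}H := H (divr_gt0 (ltr0n _ 4) e0).
apply: le_trans (ler_wpM2r (nexp_ge0 _ _) H) _.
rewrite -!mulrA ler_wpM2l ?exprn_ge0 ?divr_ge0 ?(ltW e0) //.
have -> : expR (ln n%:R / (4 / e)) = nexp (- (e / 4)) n.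
  by rewrite /nexp invf_div mulNr opprK mulrC.
rewrite -nexpD (_ : - (e / 4) + (1 + e) = e / 4 + (1 + e / 2)); last by lra.
rewrite nexpD ler_wpM2r ?nexp_ge0 //; apply: nexp_le; last by rewrite M0.
by rewrite divr_ge0 // ltW.
Qed.

Lemma small_nexp e (x : R) : 0 < e -> 0 < x -> exists M0, forall M, (M0 <= M)%N ->
  nexp e M <= x.
Proof.
move=> e0 x0; have [T1 T2] := truncn_itvP (expR_ge0 ((e * x)^-1)).
exists (Num.truncn (expR ((e * x)^-1))).+1 => M HM.
have M0 : (0 < M)%N by apply: leq_trans HM.
have H : (e * x)^-1 < ln M%:R.
  by apply: lnr_lt => //; apply: (lt_le_trans T2); rewrite ler_nat.
have x1 : 0 < x^-1 by rewrite invr_gt0.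
have := expRN_le x1; rewrite invrK; apply: le_trans.
rewrite /nexp ler_expR lerN2 -ler_pdivrMl //; apply: le_trans (ltW H).
by rewrite invfM.
Qed.

(** Truncation violates the identity only through the pairs [d, f < M] with [d * f >= M], whose
    total tends to 0 by [wt_tail] as [M] grows. The bound 1 is merely convenient. *)
Lemma As_rec chi e i : cmul chi -> 0 < e -> e <= 1 -> exists M0, forall M, (M0 <= M)%N ->
  nc (i.+1%:R * Ls chi (1 + e) i.+1 M -
      \sum_(a < i.+1) As chi (1 + e) a M * Ls chi (1 + e) (i - a) M) <= 1.
Proof.
move=> [_ cM c1] e0 e1.
set s := 1 + e.
have key M : i.+1%:R * Ls chi s i.+1 M -
      \sum_(a < i.+1) As chi s a M * Ls chi s (i - a) M =
   - \sum_(1 <= d < M) \sum_(1 <= f < M | ~~ (d * f < M)%N)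
      (Lam R d * wt i s (d * f)%N)%:C * chi (d * f)%N.
  have -> : i.+1%:R * Ls chi s i.+1 M =
    \sum_(1 <= d < M) \sum_(1 <= f < M | (d * f < M)%N)
      (Lam R d * wt i s (d * f)%N)%:C * chi (d * f)%N.
    rewrite -(sum_convolution M (fun d f => (Lam R d * wt i s (d * f)%N)%:C * chi (d * f)%N)).
    rewrite /Ls mulr_sumr; apply: eq_big_nat => n /andP[n0 _].
    rewrite mulrA -[i.+1%:R](rmorph_nat (real_complex R)) -rmorphM /= -ln_wt -sum_Lam //.
    rewrite mulr_suml rmorph_sum /= mulr_suml [LHS]big_seq [RHS]big_seq.
    apply: eq_bigr => d; rewrite -dvdn_divisors // => dn.
    by rewrite mulnC divnK.
  have -> : \sum_(a < i.+1) As chi s a M * Ls chi s (i - a) M =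
    \sum_(1 <= d < M) \sum_(1 <= f < M)
      (Lam R d * wt i s (d * f)%N)%:C * chi (d * f)%N.
    rewrite (eq_bigr (fun a : 'I_i.+1 => \sum_(1 <= d < M) \sum_(1 <= f < M)
      ((Lam R d * wt a s d)%:C * chi d) * ((wt (i - a) s f)%:C * chi f))); last first.
      by move=> a _; rewrite /As mulr_suml; apply: eq_bigr => d _; rewrite mulr_sumr.
    rewrite exchange_big /=; apply: eq_big_nat => d /andP[d0 _].
    rewrite exchange_big /=; apply: eq_big_nat => f /andP[f0 _].
    rewrite wtM // mulr_sumr rmorph_sum /= mulr_suml; apply: eq_bigr => a _.
    by rewrite cM !rmorphM /=; ring.
  rewrite -sumrB -sumrN; apply: eq_bigr => d _.
  rewrite [X in _ - X](bigID (fun f => (d * f < M)%N)) /= opprD addrA subrr add0r.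
  by [].
pose C : R := (6 * expR 1 / (e / 2)) * (1 + (e / 2)^-1) * (4 / e) ^+ i.
have e20 : 0 < e / 2 by rewrite divr_gt0.
have e21 : e / 2 <= 1 by lra.
have C0 : 0 < C.
  by rewrite !mulr_gt0 ?expR_gt0 ?invr_gt0 ?addr_gt0 ?exprn_gt0 ?divr_gt0 ?invr_gt0.
have Ci0 : 0 < C^-1 by rewrite invr_gt0.
have [M0 HM0] := small_nexp (divr_gt0 e0 (ltr0n _ 4)) Ci0.
  exists (maxn M0 1) => M HM; rewrite key ncN.
  have Mp : (0 < M)%N by apply: leq_trans HM; rewrite leq_maxr.
  have HM1 : nexp (e / 4) M <= C^-1 by apply: HM0; apply: leq_trans HM; rewrite leq_maxl.
  pose D : R := (4 / e) ^+ i * nexp (e / 4) M.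
  have D0 : 0 <= D by rewrite mulr_ge0 ?nexp_ge0 // exprn_ge0 // divr_ge0 // ltW.
  apply: (@le_trans _ _ (\sum_(1 <= d < M) \sum_(1 <= f < M)
     D * (Lam R d * nexp (1 + e / 2) d) * nexp (1 + e / 2) f)).
    apply: le_trans (nc_sum _ _ _) _; rewrite !big_nat; apply: ler_sum => d /andP[d0 dM].
    apply: le_trans (nc_sum _ _ _) _; rewrite big_mkcond /= !big_nat.
    apply: ler_sum => f /andP[f0 fM].
    have p0 : 0 <= D * (Lam R d * nexp (1 + e / 2) d) * nexp (1 + e / 2) f.
      apply: mulr_ge0; [apply: mulr_ge0 => //; apply: mulr_ge0|]; rewrite ?nexp_ge0 ?Lam_ge0 //.
    case: ifP => // dfM; rewrite ncMr ?Lam_wt_ge0 //.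
    apply: (@le_trans _ _ (Lam R d * wt i s (d * f))).
      by rewrite ler_piMr ?Lam_wt_ge0.
    have H : wt i s (d * f) <= D * nexp (1 + e / 2) (d * f).
      by apply: wt_tail => //; rewrite leqNgt dfM.
    apply: le_trans (ler_wpM2l (Lam_ge0 _ _) H) _.
    by rewrite nexpM // le_eqVlt; apply/orP; left; apply/eqP; ring.
  have -> : \sum_(1 <= d < M) \sum_(1 <= f < M)
     D * (Lam R d * nexp (1 + e / 2) d) * nexp (1 + e / 2) f =
     D * (\sum_(1 <= d < M) Lam R d * nexp (1 + e / 2) d) * \sum_(1 <= f < M) nexp (1 + e / 2) f.
    rewrite mulr_sumr mulr_suml; apply: eq_bigr => d _; by rewrite mulr_sumr.
  have S1 := sum_Lam_le M e20 e21; have S2 := sum_nexp_le M e20.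
  have S10 : 0 <= \sum_(1 <= d < M) Lam R d * nexp (1 + e / 2) d.
    by apply: sumr_ge0 => *; rewrite mulr_ge0 ?nexp_ge0 ?Lam_ge0.
  have S20 : 0 <= \sum_(1 <= d < M) nexp (1 + e / 2) d.
    by apply: sumr_ge0 => *; rewrite nexp_ge0.
  rewrite -mulrA; apply: le_trans (ler_wpM2l D0 (ler_pM S10 S20 S1 S2)) _.
  have -> : D * (6 * expR 1 / (e / 2) * (1 + (e / 2)^-1)) = nexp (e / 4) M * C.
    by rewrite /D /C; ring.
  by rewrite -ler_pdivlMr // mul1r.
Qed.

Lemma As_recs chi e j : cmul chi -> 0 < e -> e <= 1 -> exists M0, forall M, (M0 <= M)%N ->
  forall i, (i <= j)%N -> nc (i.+1%:R * Ls chi (1 + e) i.+1 M -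
      \sum_(a < i.+1) As chi (1 + e) a M * Ls chi (1 + e) (i - a) M) <= 1.
Proof.
move=> cc e0 e1; elim: j => [|j [M0 IH]].
  have [M0 H] := As_rec 0 cc e0 e1; exists M0 => M HM i; rewrite leqn0 => /eqP ->; exact: H.
have [M1 H] := As_rec j.+1 cc e0 e1; exists (maxn M0 M1) => M; rewrite geq_max => /andP[h0 h1] i.
rewrite leq_eqVlt => /orP[/eqP ->|]; first exact: H.
by rewrite ltnS; exact: IH.
Qed.

(* The Taylor coefficients [A i] of [- L' / L] satisfy [(i+1) L_(i+1) = sum A_a L_(i-a)], since [L' = (L' / L) L]. *)
Lemma recurrence_bound (L A : nat -> R[i]) (K l : R) j :
  1 <= K -> 0 < l -> l <= 1 ->
  (forall i, (i <= j.+1)%N -> nc (L i) <= K ^+ i.+1) -> l <= nc (L 0%N) ->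
  (forall i, (i <= j)%N -> nc (i.+1%:R * L i.+1 - \sum_(a < i.+1) A a * L (i - a)%N) <= 1) ->
  forall i, (i <= j)%N -> nc (A i) <= (8 * K ^+ 2 / l) ^+ i.+1.
Proof.
move=> K1 l0 l1 HL HL0 Hr; set B := 8 * K ^+ 2 / l.
have K0 : 0 < K by lra.
have KK : K <= K ^+ 2 by rewrite expr2 ler_peMl // ltW.
have B8 : 8 * K <= B.
  by rewrite /B ler_pdivlMr //; have : 8 * K * l <= 8 * K * 1 by [rewrite ler_wpM2l //; lra]; lra.
have B0 : 0 < B by lra.
elim/ltn_ind => i IH ij.
have geo b : \sum_(a < b) B ^+ a.+1 * K ^+ (b - a).-1 <= 2 * B ^+ b.
  elim: b => [|b IHb]; first by rewrite big_ord0 expr0; lra.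
  rewrite big_ord_recr /= subSnn expr0 mulr1.
  have -> : \sum_(a < b) B ^+ a.+1 * K ^+ (b.+1 - a).-1 =
     K * \sum_(a < b) B ^+ a.+1 * K ^+ (b - a).-1.
    rewrite mulr_sumr; apply: eq_bigr => a _; rewrite subSn ?(ltnW (ltn_ord a)) //=.
    by rewrite mulrCA -exprS prednK // subn_gt0.
  have H1 : K * \sum_(a < b) B ^+ a.+1 * K ^+ (b - a).-1 <= K * (2 * B ^+ b).
    by rewrite ler_wpM2l // ltW.
  have H2 : 2 * K * B ^+ b <= B * B ^+ b by rewrite ler_wpM2r ?exprn_ge0 ?(ltW B0) //; lra.
  rewrite exprS; lra.
have := Hr i ij; rewrite big_ord_recr /= subnn => H.
have HA : nc (A i) * l <= i.+1%:R * K ^+ i.+2 + \sum_(a < i) B ^+ a.+1 * K ^+ (i - a).+1 + 1.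
  apply: (@le_trans _ _ (nc (A i * L 0%N))).
    by rewrite ncM ler_wpM2l ?nc_ge0.
  set X := i.+1%:R * L i.+1; set Y := \sum_(a < i) A a * L (i - a)%N.
  have -> : A i * L 0%N = X - Y - (X - (Y + A i * L 0%N)) by ring.
  apply: le_trans (ncB _ _) _; apply: lerD; last exact: H.
  apply: le_trans (ncB _ _) _; apply: lerD.
    rewrite /X -[i.+1%:R](rmorph_nat (real_complex R)) ncMr ?ler0n // ler_wpM2l ?ler0n //.
    by apply: HL; rewrite ltnS.
  apply: le_trans (nc_sum _ _ _) _; apply: ler_sum => a _; rewrite ncM.
  apply: ler_pM; rewrite ?nc_ge0 //.
    by apply: IH => //; rewrite (leq_trans (ltnW (ltn_ord a))).
  by apply: HL; apply: leq_trans (leq_subr _ _) _; rewrite ltnW // ltnS.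
have S1 : \sum_(a < i) B ^+ a.+1 * K ^+ (i - a).+1 <= 2 * B ^+ i * K ^+ 2.
  apply: le_trans (ler_wpM2r (exprn_ge0 2 (ltW K0)) (geo i)); rewrite mulr_suml.
  apply: ler_sum => a _; rewrite -mulrA -exprD addn2 prednK // subn_gt0 //.
have S2 : i.+1%:R * K ^+ i.+2 <= B ^+ i * K ^+ 2.
  rewrite -[i.+2]addn2 exprD mulrA ler_wpM2r ?exprn_ge0 ?(ltW K0) //.
  apply: (@le_trans _ _ (2 ^+ i * K ^+ i)).
    by rewrite ler_wpM2r ?exprn_ge0 ?(ltW K0) // -natrX ler_nat ltn_expl.
  rewrite -exprMn; by apply: lerXn2r; rewrite ?nnegrE; lra.
have S3 : 1 <= B ^+ i * K ^+ 2.
  have b1 : 1 <= B ^+ i by rewrite exprn_ege1 //; lra.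
  have k1 : 1 <= K ^+ 2 by rewrite exprn_ege1.
  by rewrite -[1]mulr1 ler_pM.
have -> : B ^+ i.+1 = 8 * (B ^+ i * K ^+ 2) / l by rewrite exprS /B; ring.
rewrite ler_pdivlMr //; apply: (le_trans HA); lra.
Qed.

(** Logarithmic in the modulus: for [m] up to [2 ^ (A * i)] it is linear in [i], negligible against
    the factor [2 ^ i] gained in [small_char_bound]. *)
Definition Kc m : R := 6 * expR 1 * (1 + ln m%:R).

Lemma Kc_ge1 m : 1 <= Kc m.
Proof.
have E1 : 1 <= expR 1 :> R by rewrite -[X in X <= _]expR0 ler_expR.
have l1 : 1 <= 1 + ln m%:R :> R by rewrite lerDl lnr_ge0.
rewrite /Kc; apply: (@le_trans _ _ (6 * 1 * 1)); first lra.
by apply: ler_pM => //; lra.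
Qed.

Lemma abel_periodic_tail i s m (h : nat -> R) X M :
  (0 < m)%N -> periodic m h -> psum m h = 0 -> (forall n, `|h n| <= 1) ->
  (0 < X)%N -> i%:R <= s * ln X%:R -> 0 <= s ->
  `|\sum_(X <= n < M) wt i s n * h n| <= wt i s X * (m%:R * 2).
Proof.
move=> m0 ph h0 h1 X0 HX s0; have [MX|XM] := leqP M X.
  by rewrite big_geq // normr0 mulr_ge0 ?wt_ge0 // mulr_ge0.
have := @periodic_abel R (wt i s) h m 1 X M m0 ph h1 XM.
rewrite h0 mul0r mul0r subr0 mulr1; apply; first exact: wt_ge0.
move=> l Xl _; apply: wt_decr => //; last exact: leq_trans Xl.
by apply: (le_trans HX); rewrite ler_wpM2l // ler_lnr.
Qed.

(** The sum is cut at [X], just above [m * expR i]. Before [X] the trivial bound costs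
    [G * (1 + T)]. Beyond it the weight decreases, and Abel summation loses a factor [m] that the
    size of the weight at [X] repays. The bound is uniform in [e] and [M], as the recurrence near 1
    demands. *)
Lemma Ls_bound m chi e i M : (0 < m)%N -> dchar m chi -> nonprincipal m chi -> 0 < e ->
  nc (Ls chi (1 + e) i M) <= Kc m ^+ i.+1.
Proof.
move=> m0 D NP e0; have [_ _ c1] := dchar_cmul D.
set s := 1 + e; have s0 : 0 <= s by rewrite /s; lra.
set T : R := ln m%:R + i%:R; have T0 : 0 <= T by rewrite addr_ge0 ?lnr_ge0.
have [X1 X2] := truncn_itvP (expR_ge0 T); set X := (Num.truncn (expR T)).+1 in X2.
have X0 : (0 < X)%N by [].
have HX : T < ln X%:R by apply: lnr_lt.
set G : R := T ^+ i / i`!%:R.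
have G0 : 0 <= G by rewrite divr_ge0 ?exprn_ge0.
have mR : 0 < m%:R :> R by rewrite ltr0n.
have part1 M' : (M' <= X)%N -> nc (Ls chi s i M') <= G * (1 + T).
  move=> MX; apply: le_trans (nc_sum _ _ _) _.
  apply: (@le_trans _ _ (\sum_(1 <= n < M') G * n%:R^-1)).
    rewrite !big_nat; apply: ler_sum => n /andP[n0 nM]; rewrite ncMr ?wt_ge0 //.
    apply: le_trans (ler_wpM2l (wt_ge0 _ _ _) (c1 n)) _; rewrite mulr1 /wt.
    have lT : ln n%:R <= T.
      apply: lnr_le => //; apply: le_trans X1; rewrite ler_nat -ltnS.
      exact: leq_trans nM MX.
    apply: ler_pM; rewrite ?nexp_ge0 ?divr_ge0 ?exprn_ge0 ?lnr_ge0 //.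
      by rewrite ler_wpM2r ?invr_ge0 //; apply: lerXn2r; rewrite ?nnegrE ?lnr_ge0.
    rewrite /s nexpD nexp1 // ler_piMr ?invr_ge0 //; apply: nexp_le1; exact: ltW.
  rewrite -mulr_sumr ler_wpM2l //.
  have X3 : (0 < Num.truncn (expR T))%N.
    by rewrite truncn_gt0 -[X in X <= _]expR0 ler_expR.
  apply: le_trans (ler_sum_nat_widen MX _) _ => [n _|]; first by rewrite invr_ge0.
  have HH := @harmonic_le R _ X3; apply: (le_trans HH); rewrite lerD2l; exact: lnr_le.
have HG : G * (5 + T) <= Kc m ^+ i.+1.
  set c : R := 1 + ln m%:R; have c11 : 1 <= c by rewrite lerDl lnr_ge0.
  have c0 : 0 < c by lra.
  have H1 : G <= c ^+ i * expR (T / c) by apply: pow_fact_le.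
  have H2 : expR (T / c) <= expR 1 * expR 1 ^+ i.
    rewrite -expRM_natl mulr1 -expRD ler_expR ler_pdivrMr // /T /c.
    have : 0 <= i%:R * ln m%:R :> R by rewrite mulr_ge0 ?lnr_ge0.
    lra.
  have H3 : 5 + T <= 6 * c * 2 ^+ i.
    have p1 : i%:R + 1 <= 2 ^+ i :> R by rewrite natr1 -natrX ler_nat ltn_expl.
    have p0 : 1 <= 2 ^+ i :> R by rewrite exprn_ege1 // ler1n.
    rewrite /T; have -> : ln m%:R = c - 1 by rewrite /c; lra.
    move: p1 p0; move: (2 ^+ i) => p p1 p0.
    have : 0 <= (c - 1) * (p - 1) by rewrite mulr_ge0 // subr_ge0.
    have : 0 <= (c - 1) * p by rewrite mulr_ge0 // ?subr_ge0 //; lra.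
    by have := mulrDl c (-1) p; have := mulrBr (c - 1) p 1; rewrite !mulN1r !mulr1; lra.
  have -> : Kc m ^+ i.+1 = 6 * expR 1 * c * (6 * expR 1 * c) ^+ i by rewrite exprS.
  apply: (@le_trans _ _ ((c ^+ i * (expR 1 * expR 1 ^+ i)) * (6 * c * 2 ^+ i))).
    apply: ler_pM => //; first lra.
    by apply: (le_trans H1); rewrite ler_wpM2l // exprn_ge0 // ltW.
  have -> : c ^+ i * (expR 1 * expR 1 ^+ i) * (6 * c * 2 ^+ i) =
     6 * expR 1 * c * (2 * expR 1 * c) ^+ i.
    by rewrite !exprMn; ring.
  rewrite ler_wpM2l ?mulr_ge0 ?expR_ge0 ?(ltW c0) //.
  apply: lerXn2r; rewrite ?nnegrE ?mulr_ge0 ?expR_ge0 ?(ltW c0) //.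
  by rewrite -!mulrA ler_wpM2r ?mulr_ge0 ?expR_ge0 ?(ltW c0) // ler_nat.
have [MX|XM] := leqP M X.
  by apply: le_trans (part1 _ MX) _; apply: le_trans HG; rewrite ler_wpM2l //; lra.
rewrite /Ls (@big_cat_nat _ _ _ X) //=; last exact: ltnW.
apply: le_trans (ncD _ _) _; apply: le_trans HG.
have -> : G * (5 + T) = G * (1 + T) + (G * 2 + G * 2) by ring.
apply: lerD; first exact: part1.
have wX : wt i s X * (m%:R * 2) <= G * 2.
  rewrite mulrA ler_wpM2r //.
  have Tm : T <= ln X%:R by apply: ltW.
  have s1 : 1 <= s by rewrite /s; lra.
  have iT : i%:R <= s * T.
    have : 1 * T <= s * T by rewrite ler_wpM2r.
    by rewrite mul1r; apply: le_trans; rewrite /T lerDr lnr_ge0.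
  have := pow_exp_decr s0 iT T0 Tm; rewrite /wt /nexp => H.
  have : expR (- (s * T)) <= m%:R^-1.
    rewrite expRN lef_pV2 ?posrE ?expR_gt0 // -[m%:R in X in X <= _]lnK ?posrE // ler_expR.
    have : 1 * T <= s * T by rewrite ler_wpM2r.
    by rewrite mul1r; apply: le_trans; rewrite /T lerDl.
  move=> H2; rewrite -ler_pdivlMr // mulrAC /G [X in _ <= X]mulrAC ler_wpM2r ?invr_ge0 //.
  by apply: (le_trans H); rewrite ler_wpM2l ?exprn_ge0.
have iX : i%:R <= s * ln X%:R.
  have s1 : 1 <= s by rewrite /s; lra.
  have : 1 * ln X%:R <= s * ln X%:R by rewrite ler_wpM2r ?lnr_ge0.
  by rewrite mul1r; apply: le_trans; apply: le_trans (ltW HX); rewrite /T lerDr lnr_ge0.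
have p0 := dchar_psum m0 D NP; have pc : periodic m chi by case: D.
apply: le_trans (nc_le _) _; rewrite Re_sum Im_sum.
apply: lerD; apply: le_trans wX.
  under eq_bigr do rewrite Re_mulr.
  apply: abel_periodic_tail => //.
  - by move=> n; rewrite pc.
  - by rewrite /psum -Re_sum -/(psum m chi) p0.
  - by move=> n; apply: le_trans (nc_Re _) _.
under eq_bigr do rewrite Im_mulr.
apply: abel_periodic_tail => //.
- by move=> n; rewrite pc.
- by rewrite /psum -Im_sum -/(psum m chi) p0.
- by move=> n; apply: le_trans (nc_Im _) _.
Qed.

End DirichletSums.

Lemma sum_multiples (V : zmodType) (p M : nat) (P : pred nat) (F : nat -> V) : (0 < p)%N ->
  \sum_(1 <= n < M | P n && (p %| n)%N) F n =
  \sum_(1 <= n < M | (p * n < M)%N && P (p * n)%N) F (p * n)%N.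
Proof.
move=> p0.
transitivity (\sum_(1 <= n < M) \sum_(1 <= k < M | k == (p * n)%N) (if P k then F k else 0)); last first.
  rewrite [RHS]big_mkcond /=; apply: eq_big_nat => n /andP[n0 nM].
  by rewrite big_nat1_eq muln_gt0 p0 n0 /=; case: (p * n < M)%N.
rewrite (exchange_big_dep xpredT) //= [LHS]big_mkcond /=.
apply: eq_big_nat => k /andP[k0 kM].
case: (boolP (p %| k)%N) => pk; last first.
  rewrite andbF big1 // => n /eqP kE; by rewrite kE dvdn_mulr in pk.
rewrite andbT (eq_bigl (fun n => n == k %/ p)%N) => [|n].
  rewrite big_nat1_eq divn_gt0 // dvdn_leq //= (leq_ltn_trans _ kM) // leq_div //.
by apply/eqP/eqP => [->|->]; rewrite ?mulKn // mulnC divnK.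
Qed.

(** * Euler products and repulsion *)

Section EulerProducts.
Variable R : realType.
Implicit Types (chi : nat -> R[i]) (s e x : R) (i j m n p N M Q a b : nat).

Definition Efac chi s p : R[i] := 1 - (nexp s p)%:C * chi p.
(* The absolute value of the inverse of the Euler product over [a < p <= b]. *)
Definition nE chi s a b : R := \prod_(a.+1 <= p < b.+1 | prime p) nc (Efac chi s p).

Definition Rs chi s (ps : seq nat) M : R[i] :=
  \sum_(1 <= n < M | all (fun p => ~~ (p %| n)%N) ps) (nexp s n)%:C * chi n.

Lemma nc_nexp chi s n : cmul chi -> nc ((nexp s n)%:C * chi n) <= nexp s n.
Proof.
by case=> _ _ c1; rewrite ncMr ?nexp_ge0 // ler_piMr ?nexp_ge0.
Qed.

(** The discrepancy consists of the [n < M] with [p * n >= M], lost when the multiples of [p] are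
    truncated at [M]. *)
Lemma Rs_step chi e p ps M : cmul chi -> 0 < e -> prime p -> p \notin ps -> all prime ps ->
  (0 < M)%N ->
  nc (Rs chi (1 + e) ps M * Efac chi (1 + e) p - Rs chi (1 + e) (p :: ps) M) <=
    nexp (e / 2) M * (1 + (e / 2)^-1).
Proof.
move=> cc e0 pp pps aps M0; have [_ cM c1] := cc; set s := 1 + e.
have p0 := prime_gt0 pp.
set c := (nexp s p)%:C * chi p.
pose P n := all (fun p => ~~ (p %| n)%N) ps.
have Pp n : P (p * n)%N = P n.
  apply: eq_in_all => q qps; have pq := allP aps _ qps.
  rewrite Euclid_dvdM // dvdn_prime2 //.
  by case: (eqVneq q p) => [qp|//]; move: pps; rewrite -qp qps.
have E1 : Rs chi s ps M = Rs chi s (p :: ps) M +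
   c * \sum_(1 <= n < M | (p * n < M)%N && P n) (nexp s n)%:C * chi n.
  rewrite {1}/Rs (bigID (fun n => (p %| n)%N)) /= addrC; congr (_ + _).
    by apply: eq_bigl => k /=; rewrite andbC.
  rewrite (sum_multiples _ P (fun n => (nexp s n)%:C * chi n)) // mulr_sumr.
  rewrite big_nat_cond [RHS]big_nat_cond; apply: eq_big => n.
    by rewrite Pp.
  by move=> /andP[/andP[n0 _] _]; rewrite nexpM // cM rmorphM /c /=; ring.
set A := \sum_(1 <= n < M | (p * n < M)%N && P n) _ in E1.
set B := \sum_(1 <= n < M | P n && ~~ (p * n < M)%N) (nexp s n)%:C * chi n.
have E2 : Rs chi s ps M = A + B.
  rewrite {1}/Rs (bigID (fun n => (p * n < M)%N)) /=; congr (_ + _).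
  by apply: eq_bigl => n; rewrite andbC.
have -> : Rs chi s ps M * Efac chi s p - Rs chi s (p :: ps) M = - (c * B).
  have -> : Rs chi s (p :: ps) M = Rs chi s ps M - c * A by rewrite E1 addrK.
  by rewrite /Efac -/c {1}E2 E2; ring.
rewrite ncN mulr_sumr; apply: le_trans (nc_sum _ _ _) _.
have e20 : 0 < e / 2 by rewrite divr_gt0.
apply: le_trans (ler_wpM2l (nexp_ge0 _ _) (sum_nexp_le M e20)); rewrite mulr_sumr.
rewrite big_mkcond /= !big_nat; apply: ler_sum => n /andP[n0 nM].
case: ifP => [/andP[_]|_]; last by rewrite mulr_ge0 ?nexp_ge0.
rewrite -leqNgt => Mpn; rewrite ncM.
apply: le_trans (ler_pM (nc_ge0 _) (nc_ge0 _) (nc_nexp _ _ cc) (nc_nexp _ _ cc)) _.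
rewrite -nexpM // (_ : s = e / 2 + (1 + e / 2)); last by rewrite /s; lra.
rewrite nexpD; apply: ler_pM; rewrite ?nexp_ge0 //.
  by apply: nexp_le; rewrite ?M0 // ltW.
by apply: nexp_le; rewrite ?n0 ?leq_pmull //; lra.
Qed.

Lemma Efac_le2 chi e p : cmul chi -> 0 < e -> nc (Efac chi (1 + e) p) <= 2.
Proof.
move=> cc e0; apply: le_trans (ncB _ _) _; rewrite nc1.
by have := nc_nexp (1 + e) p cc; have := @nexp_le1 R (1 + e) p; lra.
Qed.

Lemma euler_rough chi e ps : cmul chi -> 0 < e -> uniq ps -> all prime ps ->
  forall x, 0 < x -> exists M0, forall M, (M0 <= M)%N ->
  nc (Ls chi (1 + e) 0 M * \prod_(p <- ps) Efac chi (1 + e) p - Rs chi (1 + e) ps M) <= x.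
Proof.
move=> cc e0; elim: ps => [|p ps IH] /=.
  move=> _ _ x x0; exists 0%N => M _; rewrite big_nil mulr1 /Rs /Ls.
  rewrite (eq_bigr (fun n => (nexp (1 + e) n)%:C * chi n)) => [|n _]; last by rewrite wt0.
  by rewrite subrr nc0 ltW.
move=> /andP[pps ups] /andP[pp aps] x x0.
have [M1 H1] := IH ups aps (x / 4) (divr_gt0 x0 (ltr0n _ 4)).
have e20 : 0 < e / 2 by rewrite divr_gt0.
have q0 : 0 < 1 + (e / 2)^-1 by rewrite addr_gt0 // invr_gt0.
have y0 : 0 < x / 2 / (1 + (e / 2)^-1) by rewrite !divr_gt0.
have [M2 H2] := small_nexp e20 y0.
exists (maxn 1 (maxn M1 M2)) => M; rewrite !geq_max => /andP[M0 /andP[h1 h2]].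
set L := Ls _ _ _ _; rewrite big_cons; set E := \prod_(_ <- _) _.
set F := Efac _ _ _.
have -> : L * (F * E) - Rs chi (1 + e) (p :: ps) M =
  F * (L * E - Rs chi (1 + e) ps M) + (Rs chi (1 + e) ps M * F - Rs chi (1 + e) (p :: ps) M).
  by ring.
apply: le_trans (ncD _ _) _.
have A1 : nc (F * (L * E - Rs chi (1 + e) ps M)) <= 2 * (x / 4).
  rewrite ncM; apply: ler_pM; rewrite ?nc_ge0 //; [exact: Efac_le2|exact: H1].
have A2 := Rs_step cc e0 pp pps aps M0.
have := H2 M h2; rewrite ler_pdivlMr // => A3.
move: A1 A2; rewrite -/F; move: (nc _) (nc _) => u v; lra.
Qed.

(** Once the primes up to [N] are removed, there remain 1 and integers beyond [N], whose sum is at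
    most [nexp e N / e <= 1 / 4]. So a finite Euler product measures the size of [L] up to a
    constant, and no infinite product is formed. *)
Lemma euler_L chi e N : cmul chi -> 0 < e -> (0 < N)%N -> nexp e N <= e / 4 ->
  exists M0, forall M, (M0 <= M)%N ->
   2^-1 <= nc (Ls chi (1 + e) 0 M) * nE chi (1 + e) 0 N <= 3 / 2.
Proof.
move=> cc e0 N0 HN.
have up : uniq [seq p <- index_iota 1 N.+1 | prime p] by rewrite filter_uniq // iota_uniq.
have ap : all prime [seq p <- index_iota 1 N.+1 | prime p] by rewrite filter_all.
have q4 : 0 < 4^-1 :> R by rewrite invr_gt0.
have [M1 H1] := euler_rough cc e0 up ap q4.
exists (maxn 2 M1) => M; rewrite geq_max => /andP[M2 h1].
have := H1 M h1; rewrite big_filter /=.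
set L := Ls _ _ _ _; set E := \prod_(_ <= _ < _ | _) _; set P := Rs _ _ _ _ => HH.
have nEE : nE chi (1 + e) 0 N = nc E by rewrite nc_prod.
have HP : nc (P - 1) <= 4^-1.
  rewrite /P /Rs big_mkcond /= big_ltn //.
  have -> : all (fun p => ~~ (p %| 1)%N) [seq p <- index_iota 1 N.+1 | prime p].
    apply/allP => p; rewrite mem_filter => /andP[pp _]; rewrite dvdn1.
    by apply: contraTneq pp => ->.
  have [c11 _ _] := cc; rewrite nexp_1 c11 mulr1 (_ : (1 : R)%:C = 1) // addrAC subrr add0r.
  apply: le_trans (nc_sum _ _ _) _.
  apply: (@le_trans _ _ (\sum_(2 <= n < M) if (N.+1 <= n)%N then nexp (1 + e) n else 0)).
    rewrite !big_nat; apply: ler_sum => n /andP[n2 nM].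
    have [nN|Nn] := leqP n N.
      case: ifP => [/allP H|_]; last by rewrite nc0.
      have n1 : n != 1%N by rewrite neq_ltn n2 orbT.
      have := H (pdiv n); rewrite pdiv_dvd mem_filter pdiv_prime // mem_index_iota pdiv_gt0 /=.
      by rewrite ltnS (leq_trans (pdiv_leq (ltnW n2))) // => /(_ isT).
    by case: ifP => _; [exact: nc_nexp|rewrite nc0 nexp_ge0].
  rewrite -big_mkcond /=.
  apply: (@le_trans _ _ (\sum_(N.+1 <= n < M) nexp (1 + e) n)).
    have [MN|NM] := leqP M N.+1.
      rewrite [X in _ <= X]big_geq // big_nat_cond big1 // => n /andP[/andP[_ nM] Nn].
      by exfalso; move: nM MN Nn; lia.
    rewrite (@big_cat_nat _ _ _ N.+1) //=; last exact: ltnW.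
    rewrite big_nat_cond big1 ?add0r => [|n /andP[/andP[_ nN] Nn]].
      by apply: ler_sum_nat_cond => n _; exact: nexp_ge0.
    by move: nN; rewrite ltnNge Nn.
  apply: le_trans (sum_nexp_tail M e0 N0) _.
  by rewrite ler_pdivrMl //; lra.
have HX : nc (L * E - 1) <= 2^-1.
  have -> : L * E - 1 = (L * E - P) + (P - 1) by ring.
  apply: le_trans (ncD _ _) _; lra.
rewrite nEE -ncM; apply/andP; split.
  have : nc 1 <= nc (L * E) + nc (L * E - 1).
    by have := ncB (L * E) (L * E - 1); rewrite subKr.
  rewrite nc1; lra.
have : nc (L * E) <= nc (L * E - 1) + nc 1.
  have -> : L * E = (L * E - 1) + 1 by ring.
  by apply: le_trans (ncD _ _) _; rewrite subrK.
rewrite nc1; lra.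
Qed.

Lemma nE_ge0 chi s a b : 0 <= nE chi s a b.
Proof. by apply: prodr_ge0 => p _; exact: nc_ge0. Qed.

Lemma nE_cat chi s a b N : (a <= b <= N)%N -> nE chi s a N = nE chi s a b * nE chi s b N.
Proof. by move=> /andP[ab bN]; rewrite /nE (@big_cat_nat _ _ _ b.+1). Qed.

Definition one_char : nat -> R[i] := fun=> 1.

Lemma cmul_one : cmul one_char.
Proof. by split => // [a b|n]; rewrite /one_char ?mulr1 ?nc1. Qed.

Lemma nexp_half s p : 1 <= s -> prime p -> nexp s p <= 2^-1.
Proof.
move=> s1 pp; apply: le_trans (nexp_ler p s1) _; rewrite nexp1 ?prime_gt0 //.
by rewrite lef_pV2 ?posrE ?ltr0n ?prime_gt0 // ler_nat prime_gt1.
Qed.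

Lemma Efac_ge chi s p : cmul chi -> 1 - nexp s p <= nc (Efac chi s p).
Proof.
move=> cc; have := nc_nexp s p cc; set c := _ * chi p => H.
have : nc 1 <= nc (1 - c) + nc c by rewrite -{1}(subrK c 1) ncD.
by rewrite nc1 /Efac -/c; lra.
Qed.

Lemma Efac_one s p : 0 <= s -> nc (Efac one_char s p) = 1 - nexp s p.
Proof.
move=> s0; rewrite /Efac /one_char mulr1 -[1 in LHS](rmorph1 (real_complex R)) -rmorphB /= nc_real.
by rewrite ger0_norm // subr_ge0 nexp_le1.
Qed.

(** The product is taken past [b], far enough for [euler_L], where [L] is at most [1 + 1 / e]. All
    factors lie in [[0, 1]], so a partial product is only larger. *)
Lemma nE_one_ge e a b : 0 < e -> (2 * (1 + e^-1))^-1 <= nE one_char (1 + e) a b.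
Proof.
move=> e0; have q0 : 0 < 1 + e^-1 by rewrite addr_gt0 // invr_gt0.
have [N0 HN0] := small_nexp e0 (divr_gt0 e0 (ltr0n R 4)).
pose N := maxn b (maxn 1 N0).
have Np : (0 < N)%N by rewrite /N !leq_max orbT.
have bN : (b <= N)%N by rewrite leq_maxl.
have HN : nexp e N <= e / 4 by apply: HN0; rewrite /N !leq_max leqnn !orbT.
have [M0 H] := euler_L cmul_one e0 Np HN.
have /andP[H1 _] := H M0 (leqnn _).
have HL : nc (Ls one_char (1 + e) 0 M0) <= 1 + e^-1.
  apply: le_trans (nc_sum _ _ _) _; apply: le_trans (sum_nexp_le M0 e0).
  by apply: ler_sum => n _; rewrite wt0; apply: nc_nexp; exact: cmul_one.
have f1 p : 0 <= nc (Efac one_char (1 + e) p) <= 1.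
  rewrite nc_ge0 Efac_one /=; last lra.
  by rewrite gerBl nexp_ge0.
have HN1 : (2 * (1 + e^-1))^-1 <= nE one_char (1 + e) 0 N.
  rewrite -[X in X <= _]mul1r ler_pdivrMr ?mulr_gt0 //.
  have := ler_wpM2r (nE_ge0 one_char (1 + e) 0 N) HL; lra.
have [ba|ab] := ltnP b a.
  rewrite /nE [X in _ <= X]big_geq; last exact: ltnW.
  by rewrite invf_le1 ?mulr_gt0 //; have : 0 < e^-1 by [rewrite invr_gt0]; lra.
have nE1 u v : nE one_char (1 + e) u v <= 1.
  by apply: prodr_ile1 => p _; exact: f1.
apply: (le_trans HN1); rewrite (@nE_cat _ _ 0 a N) ?(leq_trans ab) // (@nE_cat _ _ a b N) ?ab //.
apply: (@le_trans _ _ (1 * (nE one_char (1 + e) a b * 1))); last by rewrite mul1r mulr1.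
apply: ler_pM; rewrite ?nE_ge0 ?mulr_ge0 ?nE_ge0 //.
by apply: ler_pM; rewrite ?nE_ge0.
Qed.

Lemma expR_le_lin (y : R) : 0 <= y -> y <= 1 -> expR y <= 1 + expR 1 * y.
Proof.
move=> y0 y1; have H := expR_ge1Dx (- y).
have H2 : expR y * (1 - y) <= 1.
  apply: (@le_trans _ _ (expR y * expR (- y))); first by rewrite ler_wpM2l ?expR_ge0.
  by rewrite expRxMexpNx_1.
have H3 : expR y * y <= expR 1 * y by rewrite ler_wpM2r // ler_expR.
by move: H2; rewrite mulrBr mulr1; lra.
Qed.

Lemma expR_sum_nat (P : pred nat) (F : nat -> R) a b :
  expR (\sum_(a <= p < b | P p) F p) = \prod_(a <= p < b | P p) expR (F p).
Proof. by elim/big_rec2: _ => [|p y z _ <-]; rewrite ?expR0 ?expRD. Qed.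

Definition psm Q : R := \sum_(1 <= p < Q.+1 | prime p) p%:R^-1.

Lemma sum_prime_Lam (F : nat -> R) M : (forall n, 0 <= F n) ->
  \sum_(1 <= p < M | prime p) ln p%:R * F p <= \sum_(1 <= n < M) Lam R n * F n.
Proof.
move=> F0; rewrite big_mkcond /= !big_nat; apply: ler_sum => p _.
by case: ifP => [pp|_]; [rewrite Lam_prime|rewrite mulr_ge0 ?Lam_ge0].
Qed.

(** Mertens' upper bound with an unspecified constant. At [e = 1 / ln Q] the primes up to [Q]
    satisfy [1 / p <= (1 + expR 1 * e * ln p) * nexp (1 + e) p]; the first term exponentiates to an
    Euler product of the constant 1, the second is covered by [sum_Lam_le]. *)
Lemma prime_recip_sum : exists C1 : R, 0 < C1 /\
  forall Q, 1 <= ln Q%:R :> R -> expR (psm Q) <= C1 * (1 + ln Q%:R).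
Proof.
have E0 : 0 < expR 1 :> R by exact: expR_gt0.
exists (2 * expR (6 * expR 1 ^+ 2)); split; first by rewrite mulr_gt0 ?expR_gt0.
move=> Q lQ; set e : R := (ln Q%:R)^-1.
have l0 : 0 < ln Q%:R :> R by lra.
have e0 : 0 < e by rewrite invr_gt0.
have e1 : e <= 1 by rewrite invf_le1.
have Q0 : (0 < Q)%N by rewrite lt0n; apply: contraTneq l0 => ->; rewrite ln0 ?ltxx.
have bnd : psm Q <= \sum_(1 <= p < Q.+1 | prime p) nexp (1 + e) p + 6 * expR 1 ^+ 2.
  apply: (@le_trans _ _ (\sum_(1 <= p < Q.+1 | prime p) (nexp (1 + e) p +
     expR 1 * e * (ln p%:R * nexp (1 + e) p)))).
    rewrite /psm big_nat_cond [X in _ <= X]big_nat_cond; apply: ler_sum => p /andP[/andP[p0 pQ] pp].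
    have -> : p%:R^-1 = expR (e * ln p%:R) * nexp (1 + e) p.
      rewrite nexpD nexp1 // /nexp mulrCA -expRD subrr expR0 mulr1 //.
    have y0 : 0 <= e * ln p%:R by rewrite mulr_ge0 ?lnr_ge0 // ltW.
    have y1 : e * ln p%:R <= 1 by rewrite /e mulrC ler_pdivrMr // mul1r ler_lnr.
    have := ler_wpM2r (nexp_ge0 (1 + e) p) (expR_le_lin y0 y1).
    by rewrite mulrDl mul1r !mulrA.
  rewrite big_split /= lerD2l -mulr_sumr.
  have H := @sum_prime_Lam (nexp (1 + e)) Q.+1 (nexp_ge0 (1 + e)).
  have {}H := le_trans H (sum_Lam_le Q.+1 e0 e1).
  apply: le_trans (ler_wpM2l _ H) _; first by rewrite mulr_ge0 ?expR_ge0 // ltW.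
  by rewrite le_eqVlt; apply/orP; left; apply/eqP; field; rewrite gt_eqF.
have B2 : expR (\sum_(1 <= p < Q.+1 | prime p) nexp (1 + e) p) <= 2 * (1 + ln Q%:R).
  rewrite -[ln Q%:R]invrK -/e -[X in _ <= X]invrK -[X in X <= _]invrK.
  rewrite lef_pV2 ?posrE ?invr_gt0 ?expR_gt0 ?mulr_gt0 ?addr_gt0 ?invr_gt0 //.
  apply: (le_trans (nE_one_ge 0 Q e0)).
  rewrite -expRN -sumrN expR_sum_nat /nE big_nat_cond [X in _ <= X]big_nat_cond.
  apply: ler_prod => p _; rewrite nc_ge0 /= Efac_one; last lra.
  exact: expR_ge1Dx.
apply: (@le_trans _ _ (expR (\sum_(1 <= p < Q.+1 | prime p) nexp (1 + e) p + 6 * expR 1 ^+ 2))).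
  by rewrite ler_expR.
rewrite expRD [X in _ <= X]mulrAC.
by rewrite ler_wpM2r ?expR_ge0.
Qed.

(** Again [e = 1 / ln Q], at which [p ^ e <= expR 1] for all [p <= Q]. *)
Lemma mertens_upper Q : 1 <= ln Q%:R :> R ->
  \sum_(1 <= p < Q.+1 | prime p) ln p%:R / p%:R <= 6 * expR 1 ^+ 2 * ln Q%:R :> R.
Proof.
move=> lQ; set e : R := (ln Q%:R)^-1.
have l0 : 0 < ln Q%:R :> R by lra.
have e0 : 0 < e by rewrite invr_gt0.
have e1 : e <= 1 by rewrite invf_le1.
apply: (@le_trans _ _ (\sum_(1 <= p < Q.+1 | prime p) ln p%:R * (expR 1 * nexp (1 + e) p))).
  rewrite big_nat_cond [X in _ <= X]big_nat_cond; apply: ler_sum => p /andP[/andP[p0 pQ] pp].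
  rewrite ler_wpM2l ?lnr_ge0 // nexpD nexp1 // mulrCA ler_peMr ?invr_ge0 //.
  rewrite /nexp -expRD -[X in X <= _]expR0 ler_expR.
  have : e * ln p%:R <= 1 by rewrite /e mulrC ler_pdivrMr // mul1r ler_lnr.
  lra.
apply: le_trans (sum_prime_Lam _ _) _ => [n|]; first by rewrite mulr_ge0 ?expR_ge0 ?nexp_ge0.
under eq_bigr do rewrite mulrCA.
rewrite -mulr_sumr; apply: le_trans (ler_wpM2l (expR_ge0 _) (sum_Lam_le Q.+1 e0 e1)) _.
by rewrite /e invrK le_eqVlt; apply/orP; left; apply/eqP; ring.
Qed.

Lemma nE_le_psm chi s Q : cmul chi -> 1 <= s -> nE chi s 0 Q <= expR (psm Q).
Proof.
move=> cc s1; rewrite /psm expR_sum_nat /nE big_nat_cond [X in _ <= X]big_nat_cond.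
apply: ler_prod => p /andP[/andP[p0 _] _]; rewrite nc_ge0 /=.
apply: le_trans (ncB _ _) _; rewrite nc1; apply: le_trans (expR_ge1Dx _); rewrite lerD2l.
apply: le_trans (nc_nexp _ _ cc) _; apply: le_trans (nexp_ler p s1) _.
by rewrite nexp1.
Qed.

Lemma nE_ge_psm chi s Q : cmul chi -> 1 <= s -> expR (- (2 * psm Q)) <= nE chi s 0 Q.
Proof.
move=> cc s1; rewrite /psm mulr_sumr -sumrN expR_sum_nat /nE big_nat_cond [X in _ <= X]big_nat_cond.
apply: ler_prod => p /andP[/andP[p0 _] pp]; rewrite expR_ge0 /=.
apply: le_trans (Efac_ge s p cc).
have H1 : nexp s p <= p%:R^-1 by rewrite -nexp1 // nexp_ler.
have H2 : p%:R^-1 <= 2^-1 :> R by rewrite -nexp1 // nexp_half.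
have u0 : 0 < p%:R^-1 :> R by rewrite invr_gt0 ltr0n.
apply: (@le_trans _ _ (1 - p%:R^-1)); last lra.
move: H2 u0; move: (p%:R^-1 : R) => u H2 u0.
rewrite expRN -[X in X <= _]mul1r ler_pdivrMr ?expR_gt0 //.
have H3 := expR_ge1Dx (2 * u).
have : (1 - u) * (1 + 2 * u) <= (1 - u) * expR (2 * u) by rewrite ler_wpM2l //; lra.
apply: le_trans.
have : 0 <= u * (1 - 2 * u) by rewrite mulr_ge0; lra.
lra.
Qed.

(** Moving from [s'] to [s] changes a factor by at most [(s - s') * ln p * nexp s' p], and each
    factor is at least [1 / 2], whence the 2 in the exponent. If [s - 1] and [s' - 1] have bounded
    ratio, [sum_Lam_le] makes the total cost bounded. *)
Lemma nE_mono chi s s' a b : cmul chi -> 1 <= s' -> s' <= s ->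
  nE chi s a b <= nE chi s' a b *
   expR (2 * (s - s') * \sum_(1 <= n < b.+1) Lam R n * nexp s' n).
Proof.
move=> cc s1 ss.
apply: (@le_trans _ _ (nE chi s' a b * \prod_(a.+1 <= p < b.+1 | prime p)
   expR (2 * (s - s') * (ln p%:R * nexp s' p)))).
  rewrite /nE -big_split /= big_nat_cond [X in _ <= X]big_nat_cond.
  apply: ler_prod => p /andP[/andP[p0 _] pp]; rewrite nc_ge0 /=.
  have p1 : (0 < p)%N by apply: leq_trans p0.
  set x := nexp s p; set x' := nexp s' p.
  have xx : x <= x' by exact: nexp_ler.
  have x'2 : x' <= 2^-1 by exact: nexp_half.
  have dx : x' - x <= (s - s') * (ln p%:R * x').
    have -> : x = x' * expR (- ((s - s') * ln p%:R)).
      by rewrite /x /x' /nexp -expRD; congr expR; ring.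
    have := ler_wpM2l (nexp_ge0 s' p) (expR_ge1Dx (- ((s - s') * ln p%:R))).
    rewrite -/x'; lra.
  have Ec := Efac_ge s' p cc; rewrite -/x' in Ec.
  have H1 : nc (Efac chi s p) <= nc (Efac chi s' p) + (x' - x).
    have -> : Efac chi s p = Efac chi s' p + (x' - x)%:C * chi p.
      by rewrite /Efac -/x -/x' rmorphB /=; ring.
    apply: le_trans (ncD _ _) _; rewrite lerD2l ncMr ?subr_ge0 //.
    by rewrite ler_piMr ?subr_ge0 //; case: cc.
  have H2 : x' - x <= nc (Efac chi s' p) * (2 * (x' - x)).
    have : 2^-1 * (2 * (x' - x)) <= nc (Efac chi s' p) * (2 * (x' - x)).
      by rewrite ler_wpM2r ?mulr_ge0 ?subr_ge0 //; lra.
    lra.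
  apply: (@le_trans _ _ (nc (Efac chi s' p) * (1 + 2 * (x' - x)))); first by rewrite mulrDr mulr1; lra.
  rewrite ler_wpM2l ?nc_ge0 //; apply: le_trans (expR_ge1Dx _) _; rewrite ler_expR; lra.
rewrite ler_wpM2l ?nE_ge0 // -expR_sum_nat ler_expR -mulr_sumr ler_wpM2l ?mulr_ge0 ?subr_ge0 //.
have L0 i : 0 <= Lam R i * nexp s' i by rewrite mulr_ge0 ?Lam_ge0 ?nexp_ge0.
apply: (@le_trans _ _ (\sum_(a.+1 <= n < b.+1) Lam R n * nexp s' n)).
  rewrite big_mkcond /= !big_nat; apply: ler_sum => p _.
  by case: ifP => [pp|_]; [rewrite Lam_prime|exact: L0].
have [ba|ab] := leqP b a; first by rewrite big_geq // sumr_ge0.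
by rewrite [X in _ <= X](@big_cat_nat _ _ _ a.+1) //= ?lerDr ?sumr_ge0 // ltnW.
Qed.

Definition conjmul chi1 chi2 : nat -> R[i] := fun n => chi1 n * (chi2 n)^*.

Lemma nc_one_minus_sqr (x : R) (z : R[i]) : 0 <= x -> nc z <= 1 ->
  nc (1 - x%:C * z) ^+ 2 <= expR (- (2 * x * complex.Re z) + x ^+ 2).
Proof.
move=> x0 z1; apply: le_trans (expR_ge1Dx _).
have : nc z ^+ 2 <= 1 by rewrite exprn_ile1 ?nc_ge0.
rewrite !nc_sqr; case: z z1 => a b _ /=; rewrite mul0r subr0 mul0r addr0 => H.
have : x ^+ 2 * (a ^+ 2 + b ^+ 2) <= x ^+ 2 * 1 by rewrite ler_wpM2l ?sqr_ge0.
rewrite !expr2; lra.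
Qed.

(** At each prime the first-order term is [- p ^ (- s)] times [3 + 2 Re chi1 + 2 Re chi2 + 2 Re
    (chi1 conj chi2)], which is at least [|1 + chi1 + chi2| ^ 2]; this fixes the exponents 3, 2, 2,
    2. The second-order terms are absorbed by a sum of [p ^ (- 2)]. *)
Lemma repulsion chi1 chi2 s a b : 1 <= s -> (forall n, nc (chi1 n) <= 1) ->
  (forall n, nc (chi2 n) <= 1) ->
  nE one_char s a b ^+ 3 * (nE chi1 s a b ^+ 2 * nE chi2 s a b ^+ 2 *
    nE (conjmul chi1 chi2) s a b ^+ 2) <= expR 12.
Proof.
move=> s1 h1 h2; rewrite /nE -!prodrXl -!big_split /=.
apply: (@le_trans _ _ (\prod_(a.+1 <= p < b.+1 | prime p) expR (6 * nexp 2 p))); last first.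
  rewrite -expR_sum_nat ler_expR -mulr_sumr.
  apply: (@le_trans _ _ (6 * 2)); last lra.
  rewrite ler_wpM2l //; apply: (@le_trans _ _ (\sum_(1 <= p < b.+1) nexp 2 p)); last first.
    have := sum_nexp_le b.+1 (ltr01 : 0 < 1 :> R); rewrite invr1; apply.
  apply: (@le_trans _ _ (\sum_(a.+1 <= p < b.+1) nexp 2 p)).
    by apply: ler_sum_nat_cond => p _; exact: nexp_ge0.
  have [ba|ab] := leqP b a; first by rewrite big_geq // sumr_ge0 // => *; exact: nexp_ge0.
  rewrite [X in _ <= X](@big_cat_nat _ _ _ a.+1) //= ?lerDr ?sumr_ge0 //; last exact: ltnW.
  by move=> *; exact: nexp_ge0.
rewrite big_nat_cond [X in _ <= X]big_nat_cond.
apply: ler_prod => p /andP[/andP[p0 _] pp]; apply/andP; split.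
  by rewrite !mulr_ge0 ?exprn_ge0 ?nc_ge0.
set x := nexp s p; have x0 : 0 <= x by exact: nexp_ge0.
have p1 : (0 < p)%N by apply: leq_trans p0.
have xx : x ^+ 2 <= nexp 2 p.
  by rewrite expr2 -nexpD nexp_ler //; lra.
have x1 : x <= 1 by apply: nexp_le1; lra.
rewrite Efac_one; last lra.
have h12 : nc (conjmul chi1 chi2 p) <= 1.
  by rewrite /conjmul ncM ncJ mulr_ile1 ?nc_ge0.
have e1 := nc_one_minus_sqr x0 (h1 p); have e2 := nc_one_minus_sqr x0 (h2 p).
have e3 := nc_one_minus_sqr x0 h12.
have e0 : (1 - x) ^+ 3 <= expR (- (3 * x)).
  rewrite -mulrN expRM_natl; apply: lerXn2r; rewrite ?nnegrE ?subr_ge0 ?expR_ge0 //.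
  exact: expR_ge1Dx.
apply: (@le_trans _ _ (expR (- (3 * x)) * (expR (- (2 * x * complex.Re (chi1 p)) + x ^+ 2) *
  expR (- (2 * x * complex.Re (chi2 p)) + x ^+ 2) *
  expR (- (2 * x * complex.Re (conjmul chi1 chi2 p)) + x ^+ 2)))).
  apply: ler_pM; rewrite ?exprn_ge0 ?subr_ge0 ?mulr_ge0 ?exprn_ge0 ?nc_ge0 //.
  apply: ler_pM; rewrite ?exprn_ge0 ?mulr_ge0 ?exprn_ge0 ?nc_ge0 //.
  by apply: ler_pM; rewrite ?exprn_ge0 ?nc_ge0.
rewrite -!expRD ler_expR.
have := h1 p; have := h2 p; rewrite /conjmul.
case: (chi1 p) => u1 v1; case: (chi2 p) => u2 v2 /= n2 n1.
have m1 : u1 ^+ 2 + v1 ^+ 2 <= 1.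
  by have := exprn_ile1 2 (nc_ge0 _) n1; rewrite nc_sqr.
have m2 : u2 ^+ 2 + v2 ^+ 2 <= 1.
  by have := exprn_ile1 2 (nc_ge0 _) n2; rewrite nc_sqr.
have pos : 0 <= x * (3 + 2 * u1 + 2 * u2 + 2 * (u1 * u2 - v1 * - v2)).
  apply: mulr_ge0 => //.
  have := sqr_ge0 (1 + u1 + u2); have := sqr_ge0 (v1 + v2).
  by move: m1 m2; rewrite !expr2; lra.
have xN := nexp_ge0 (2 : R) p.
by clear -pos xx xN; clearbody x; move: (nexp 2 p) xx xN => N; lra.
Qed.

End EulerProducts.

(** * Positivity of the divisor sums of a real character *)

Section DivisorSumsOfSigns.
Variables (R : realType) (h : nat -> R).
Hypothesis hM : forall a b, h (a * b)%N = h a * h b.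
Hypothesis h1 : h 1%N = 1.
Hypothesis hv : forall n, [\/ h n = -1, h n = 0 | h n = 1].

Lemma hX p e : h (p ^ e)%N = h p ^+ e.
Proof. by elim: e => [|e IH]; rewrite ?expn0 ?h1 // expnS hM IH exprS. Qed.

Definition dsum n : R := \sum_(d <- divisors n) h d.

Lemma dsum_pfactor p e n : prime p -> (0 < n)%N -> ~~ (p %| n)%N ->
  dsum (p ^ e * n)%N = dsum n * \sum_(i < e.+1) h p ^+ i.
Proof.
move=> pp n0 pn; elim: e => [|e IH].
  by rewrite expn0 mul1n big_ord1 expr0 mulr1.
have q0 : (0 < p ^ e)%N by rewrite expn_gt0 prime_gt0.
have N0 : (0 < p ^ e.+1 * n)%N by rewrite muln_gt0 n0 andbT expn_gt0 prime_gt0.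
have NE : (p ^ e.+1 * n %/ p = p ^ e * n)%N by rewrite expnS -mulnA mulKn ?prime_gt0.
rewrite {1}/dsum (sum_divisors_step _ N0 pp) ?NE; last by rewrite expnS -mulnA dvdn_mulr.
rewrite -/(dsum (p ^ e * n)) IH [in RHS]big_ord_recr /= mulrDr; congr (_ + _).
rewrite -big_filter (perm_big [seq (p ^ e.+1 * d)%N | d <- divisors n]) /=; last first.
  apply: uniq_perm; first by rewrite filter_uniq // divisors_uniq.
    rewrite map_inj_uniq ?divisors_uniq // => x y /eqP.
    by rewrite eqn_pmul2l ?expn_gt0 ?prime_gt0 // => /eqP.
  move=> d; rewrite mem_filter -dvdn_divisors //; apply/andP/mapP.
    move=> [dn dN]; have d0 := dvdn_gt0 N0 dN.
    have [f [cpf dE]] : exists f, coprime p f /\ d = (f * p ^ logn p d)%N.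
      by have [f H1 H2] := pfactor_coprime pp d0; exists f.
    have fn : (f %| n)%N.
      have : (f %| p ^ e.+1 * n)%N by apply: dvdn_trans dN; rewrite dE dvdn_mulr.
      by rewrite Gauss_dvdr // coprimeXr // coprime_sym.
    have le1 : (logn p d <= e.+1)%N.
      have := dvdn_leq_log p N0 dN; rewrite lognM ?expn_gt0 ?(prime_gt0 pp) // pfactorK //.
      by rewrite (eqP (_ : logn p n == 0)%N) ?addn0 // -leqn0 leqNgt logn_gt0 mem_primes (negbTE pn) !andbF.
    have ld : logn p d = e.+1.
      apply/eqP; rewrite eqn_leq le1 ltnNge; apply: contra dn => le2.
      by rewrite dE mulnC; apply: dvdn_mul => //; apply: dvdn_exp2l.
    exists f; first by rewrite -dvdn_divisors.
    by rewrite {1}dE ld mulnC.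
  move=> [f]; rewrite -dvdn_divisors // => fn ->; split; last by rewrite dvdn_pmul2l ?expn_gt0 ?prime_gt0.
  rewrite expnSr -mulnA dvdn_pmul2l //; apply: contra pn => H.
  by apply: dvdn_trans H; rewrite dvdn_mulr.
rewrite big_map mulr_suml; apply: eq_bigr => d _.
by rewrite hM hX mulrC.
Qed.

Lemma geom_sign_ge0 p e : 0 <= \sum_(i < e.+1) h p ^+ i.
Proof.
case: (hv p) => ->.
- have : \sum_(i < e.+1) (-1 : R) ^+ i = (~~ odd e)%:R.
    elim: e => [|e IH]; first by rewrite big_ord1 expr0.
    by rewrite big_ord_recr IH /= -signr_odd /=; case: (odd e) => /=; rewrite ?expr0 ?expr1; lra.
  by move=> ->.
- by apply: sumr_ge0 => i _; rewrite exprn_ge0.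
- by apply: sumr_ge0 => i _; rewrite exprn_ge0.
Qed.

Lemma geom_sign_ge1 p e : ~~ odd e -> 1 <= \sum_(i < e.+1) h p ^+ i.
Proof.
move=> oe; case: (hv p) => ->.
- have : \sum_(i < e.+1) (-1 : R) ^+ i = (~~ odd e)%:R.
    elim: (e) => [|f IH]; first by rewrite big_ord1 expr0.
    by rewrite big_ord_recr IH /= -signr_odd /=; case: (odd f) => /=; rewrite ?expr0 ?expr1; lra.
  by move=> ->; rewrite oe.
- by rewrite big_ord_recl expr0 lerDl sumr_ge0 // => i _; rewrite exprn_ge0.
- by rewrite big_ord_recl expr0 lerDl sumr_ge0 // => i _; rewrite exprn_ge0.
Qed.

(** The local factor [1 + h p + ... + h p ^+ e] is never negative for [h p] in [{-1, 0, 1}], and it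
    is at least 1 when [e] is even. *)
Lemma dsum_ge0_sq_ge1 n : (0 < n)%N -> 0 <= dsum n /\ 1 <= dsum (n ^ 2)%N.
Proof.
elim/ltn_ind: n => n IH n0.
have [->|n1] := eqVneq n 1%N.
  by rewrite exp1n /dsum big_seq1 h1.
have pp : prime (pdiv n) by rewrite pdiv_prime // ltn_neqAle eq_sym n1.
set p := pdiv n in pp *.
have [f cpf nE] := pfactor_coprime pp n0.
have f0 : (0 < f)%N by move: n0; rewrite nE muln_gt0 => /andP[].
have e0 : (0 < logn p n)%N by rewrite logn_gt0 mem_primes pp n0 pdiv_dvd.
have fn : (f < n)%N.
  rewrite nE -[X in (X < _)%N]muln1 ltn_pmul2l // -(expn0 p) ltn_exp2l // prime_gt1 //.
have [H1 H2] := IH f fn f0.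
have pf : ~~ (p %| f)%N by rewrite -prime_coprime.
have pf2 : ~~ (p %| f ^ 2)%N by rewrite Euclid_dvdX // (negbTE pf).
split; first by rewrite nE mulnC dsum_pfactor // mulr_ge0 ?geom_sign_ge0.
rewrite nE expnMn mulnC -expnM dsum_pfactor ?expn_gt0 ?f0 //.
rewrite -[1]mulr1; apply: ler_pM => //; apply: geom_sign_ge1.
by rewrite muln2 odd_double.
Qed.

End DivisorSumsOfSigns.

(** * Nonvanishing at 1 for real characters *)

Section Nonvanishing.
Variables (R : realType) (h : nat -> R) (m : nat).
Hypothesis hM : forall a b, h (a * b)%N = h a * h b.
Hypothesis h1 : h 1%N = 1.
Hypothesis hv : forall n, [\/ h n = -1, h n = 0 | h n = 1].
Hypothesis m0 : (0 < m)%N.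
Hypothesis hp : periodic m h.
Hypothesis hs : psum m h = 0.
Implicit Types n d e N X Z : nat.

(** [v] is the inverse square root and [w] the square root. The argument is Mertens': two estimates
    are compared for the sum of [a n * v n], where [a] is the divisor sum of [h]. *)
Let v n : R := nexp 2^-1 n.
Let w n : R := nexp (- 2^-1) n.

Lemma h_le1 n : `|h n| <= 1.
Proof. by case: (hv n) => ->; rewrite ?normrN ?normr1 ?normr0. Qed.

Let v0 n : 0 < v n. Proof. exact: nexp_gt0. Qed.
Let w0 n : 0 < w n. Proof. exact: nexp_gt0. Qed.

Let vw n : v n * w n = 1.
Proof. by rewrite /v /w -nexpD subrr /nexp mul0r oppr0 expR0. Qed.

Let vv n : (0 < n)%N -> v n * v n = n%:R^-1.
Proof. by move=> n0; rewrite /v -nexpD (_ : 2^-1 + 2^-1 = 1 :> R) ?nexp1 //; lra. Qed.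

Let ww n : (0 < n)%N -> w n * w n = n%:R.
Proof.
move=> n0; apply: (mulfI (lt0r_neq0 (v0 n))); apply: (mulfI (lt0r_neq0 (v0 n))).
rewrite mulrA mulrACA vw mulr1 mulrA vv // mulVf // pnatr_eq0 -lt0n //.
Qed.

Let v_decr n n' : (0 < n)%N -> (n <= n')%N -> v n' <= v n.
Proof. by move=> n0 nn; apply: nexp_le; rewrite ?n0 // invr_ge0. Qed.

Let sum_hv (X Y : nat) : (0 < X)%N -> `|\sum_(X <= d < Y) v d * h d| <= v X * m%:R.
Proof.
move=> X0; have [YX|XY] := leqP Y X; first by rewrite big_geq // normr0 mulr_ge0 ?(ltW (v0 _)).
apply: (abel_sum XY) => [L _||l Xl _]; last 2 first.
- exact: ltW.
- by apply: v_decr => //; apply: leq_trans Xl.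
by have := periodic_sum_bound X L m0 hp hs h_le1; rewrite mulr1.
Qed.

(** An increasing sequence with limit [zeta (1 / 2)]; it measures the error of the approximation by
    the square root. *)
Let u N : R := \sum_(1 <= e < N) v e - 2 * w N.

Let u_step N : (0 < N)%N -> 0 <= u N.+1 - u N <= v N - v N.+1.
Proof.
move=> N0; rewrite /u big_nat_recr //=.
have -> : \sum_(1 <= i < N) v i + v N - 2 * w N.+1 - (\sum_(1 <= e < N) v e - 2 * w N) =
  v N - 2 * (w N.+1 - w N) by ring.
have a0 := w0 N; have b0 := w0 N.+1.
have E : (w N.+1 - w N) * (w N.+1 + w N) = 1.
  by rewrite -subr_sqr !expr2 !ww // -natrB // subSnn.
have ab : 0 < w N.+1 + w N by rewrite addr_gt0.
have E1 : w N.+1 - w N = (w N.+1 + w N)^-1 by apply: (mulIf (lt0r_neq0 ab)); rewrite E mulVf // gt_eqF.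
have d0 : 0 < w N.+1 - w N by rewrite E1 invr_gt0.
have vE n : v n = (w n)^-1 by apply: (mulIf (lt0r_neq0 (w0 n))); rewrite vw mulVf // gt_eqF.
have H1 : v N.+1 <= 2 * (w N.+1 - w N).
  rewrite E1 vE ler_pdivlMr // mulrC ler_pdivrMr //; lra.
have H2 : 2 * (w N.+1 - w N) <= v N.
  rewrite E1 vE ler_pdivrMr // mulrC ler_pdivlMr //; lra.
by rewrite subr_ge0 H2 lerD2l lerN2.
Qed.

Let u_diff N N' : (0 < N)%N -> (N <= N')%N -> 0 <= u N' - u N <= v N - v N'.
Proof.
move=> N0; elim: N' => [|N' IH]; first by rewrite leqn0 => /eqP H; rewrite H in N0.
rewrite leq_eqVlt => /orP[/eqP <-|]; first by rewrite !subrr lexx.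
rewrite ltnS => NN; have /andP[H1 H2] := IH NN.
have /andP[H3 H4] := u_step (leq_trans N0 NN); apply/andP; lra.
Qed.

Let u1 : u 1 = -2.
Proof. by rewrite /u big_geq // /w nexp_1; lra. Qed.

Let u_bound N : (0 < N)%N -> -2 <= u N <= -1.
Proof.
move=> N0; have /andP[H1 H2] := u_diff (ltn0Sn 0) N0; have := v0 N.
have v1 : v 1 = 1 by exact: nexp_1.
by move: H1 H2; rewrite u1 v1; move=> *; apply/andP; lra.
Qed.

Let P X : R := \sum_(1 <= d < X) h d * d%:R^-1.

Let a n := dsum h n.

(** Only the squares [n = s ^ 2] are kept: there [a n >= 1] and [v n = 1 / s]. *)
Let lower X : \sum_(1 <= s < X) s%:R^-1 <= \sum_(1 <= n < (X ^ 2)%N) a n * v n.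
Proof.
have a0 n : (0 < n)%N -> 0 <= a n * v n.
  move=> n0; have [H _] := dsum_ge0_sq_ge1 hM h1 hv n0.
  by rewrite mulr_ge0 // ltW.
elim: X => [|[|X] IH]; first by rewrite big_geq // big_geq.
  by rewrite big_geq // big_geq.
rewrite big_nat_recr //=.
have X2 : (X.+1 ^ 2 < X.+2 ^ 2)%N by rewrite ltn_exp2r.
have X1 : (1 <= X.+1 ^ 2)%N by rewrite expn_gt0.
rewrite [X in _ <= X](@big_cat_nat _ _ _ (X.+1 ^ 2)) //=; last exact: ltnW.
apply: lerD; first exact: IH.
rewrite big_ltn //; apply: ler_wpDr.
  by rewrite big_nat; apply: sumr_ge0 => i /andP[i0 _]; apply: a0; apply: leq_trans i0.
have [_ H] := dsum_ge0_sq_ge1 hM h1 hv (ltn0Sn X).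
have -> : v (X.+1 ^ 2) = X.+1%:R^-1 by rewrite expnS expn1 /v nexpM // vv.
by rewrite ler_peMl // invr_ge0.
Qed.

(** Dirichlet's hyperbola method with the cut at [X], the square root of [Z]. For [d < X] the inner
    sum is twice the square root of [Z / d] up to a bounded error, which produces [2 * X * P X]; for
    [d >= X] the sum over [d] is taken first and cancels by periodicity. *)
Let upper X : (0 < X)%N -> \sum_(1 <= n < (X ^ 2)%N) a n * v n <=
  2 * X%:R * `|P X| + 5 * m%:R + 3.
Proof.
move=> X0; set Z := (X ^ 2)%N.
have Z0 : (0 < Z)%N by rewrite expn_gt0 X0.
have ZE : Z%:R = X%:R * X%:R :> R by rewrite /Z expnS expn1 natrM.
have XR : 0 < X%:R :> R by rewrite ltr0n.
have XZ : (X <= Z)%N by rewrite /Z expnS expn1 leq_pmull.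
have -> : \sum_(1 <= n < Z) a n * v n =
   \sum_(1 <= d < Z) \sum_(1 <= e < Z | (d * e < Z)%N) (v d * h d) * v e.
  rewrite -(sum_convolution Z (fun d e => (v d * h d) * v e)).
  apply: eq_big_nat => n /andP[n0 _]; rewrite /a /dsum mulr_suml.
  rewrite [LHS]big_seq [RHS]big_seq; apply: eq_bigr => d; rewrite -dvdn_divisors // => dn.
  have d0 := dvdn_gt0 n0 dn; have nd0 : (0 < n %/ d)%N by rewrite divn_gt0 // dvdn_leq.
  by rewrite -{1}(divnK dn) /v nexpM // mulrC [nexp _ (n %/ d) * _]mulrC mulrAC.
(* for each d the admissible e form the interval [1, Nd d) *)
pose Nd d := (Z.-1 %/ d).+1.
have NdP d e : (0 < d)%N -> (d * e < Z)%N = (e < Nd d)%N.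
  by move=> d0; rewrite -{1}(prednK Z0) !ltnS leq_divRL // mulnC.
have NdZ d : (Nd d <= Z)%N.
  by rewrite /Nd -{2}(prednK Z0) ltnS leq_div.
have Nd_lo d : (0 < d)%N -> Z%:R <= d%:R * (Nd d)%:R :> R.
  move=> d0; rewrite -natrM ler_nat leqNgt NdP // ltnn //.
have Nd_hi d : (0 < d)%N -> d%:R * (Nd d)%:R <= Z%:R + d%:R :> R.
  move=> d0; rewrite -natrM -natrD ler_nat /Nd mulnS addnC leq_add2r mulnC.
  by apply: leq_trans (leq_trunc_div _ _) (leq_pred _).
have inner (x : R) d : (0 < d)%N -> \sum_(1 <= e < Z | (d * e < Z)%N) x * v e =
   x * \sum_(1 <= e < Nd d) v e.
  move=> d0; rewrite -mulr_sumr; congr (_ * _).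
  rewrite (@big_cat_nat _ _ _ (Nd d)) //= [X in _ + X]big_nat_cond.
  rewrite [X in _ + X]big1 ?addr0 => [|e /andP[/andP[He _]]]; last by rewrite NdP // ltnNge He.
  by rewrite big_nat_cond [RHS]big_nat_cond; apply: eq_bigl => e; rewrite NdP //; case: (e < Nd d)%N; rewrite ?andbF ?andbT.
rewrite (@big_cat_nat _ _ _ X) //=.
have T2 : \sum_(X <= d < Z) \sum_(1 <= e < Z | (d * e < Z)%N) (v d * h d) * v e <= 2 * m%:R.
  rewrite (exchange_big_dep_nat xpredT) //=.
  apply: (@le_trans _ _ (\sum_(1 <= e < X) v e * (v X * m%:R))).
    rewrite (@big_cat_nat _ _ _ X) //= [X in _ + X]big_nat [X in _ + X]big1 ?addr0; last first.
      move=> e /andP[Xe _]; rewrite big_nat_cond big1 // => d /andP[/andP[Xd _]].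
      by rewrite ltnNge /Z expnS expn1 leq_mul.
    rewrite !big_nat; apply: ler_sum => e /andP[e0 eX].
    rewrite -mulr_suml mulrC ler_wpM2l ?(ltW (v0 _)) //.
    apply: le_trans (ler_norm _) _.
    have -> : \sum_(X <= d < Z | (d * e < Z)%N) v d * h d = \sum_(X <= d < Nd e) v d * h d.
      have XN : (X <= Nd e)%N.
        by rewrite leqNgt; apply/negP => H; have := Nd_lo e e0; rewrite -natrM ler_nat leqNgt /Z expnS expn1 ltn_mul.
      rewrite (@big_cat_nat _ _ _ (Nd e)) //= [X in _ + X]big_nat_cond.
      rewrite [X in _ + X]big1 ?addr0 => [|d /andP[/andP[He _]]]; last by rewrite mulnC NdP // ltnNge He.
      by rewrite big_nat_cond [RHS]big_nat_cond; apply: eq_bigl => d; rewrite mulnC NdP //; case: (d < Nd e)%N; rewrite ?andbF ?andbT.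
    exact: sum_hv.
  rewrite -mulr_suml mulrA ler_wpM2r //.
  have /andP[_ ub] := u_bound X0; rewrite /u in ub.
  have : (\sum_(1 <= e < X) v e) * v X <= 2 * w X * v X by rewrite ler_wpM2r ?(ltW (v0 _)) //; lra.
  by rewrite -mulrA [w X * _]mulrC vw mulr1.
have T1 : \sum_(1 <= d < X) \sum_(1 <= e < Z | (d * e < Z)%N) (v d * h d) * v e <=
   2 * X%:R * `|P X| + 2 * m%:R + 3.
  have -> : \sum_(1 <= d < X) \sum_(1 <= e < Z | (d * e < Z)%N) (v d * h d) * v e =
     2 * X%:R * P X + u Z * \sum_(1 <= d < X) v d * h d +
     \sum_(1 <= d < X) (v d * h d) * ((u (Nd d) - u Z) + 2 * (w (Nd d) - X%:R * v d)).
    rewrite /P !mulr_sumr -!big_split /=; apply: eq_big_nat => d /andP[d0 _].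
    rewrite inner //; have -> : \sum_(1 <= e < Nd d) v e = u (Nd d) + 2 * w (Nd d) by rewrite /u; ring.
    by rewrite -vv //; ring.
  have B1 : 2 * X%:R * P X <= 2 * X%:R * `|P X| by rewrite ler_wpM2l ?ler_norm // mulr_ge0.
  have B2 : u Z * \sum_(1 <= d < X) v d * h d <= 2 * m%:R.
    apply: le_trans (ler_norm _) _; rewrite normrM; apply: ler_pM => //.
      have /andP[] := u_bound Z0 => ? ?; rewrite ler_norml; apply/andP; lra.
    by have := @sum_hv 1 X (ltn0Sn 0); rewrite /v nexp_1 mul1r.
  have B3 : \sum_(1 <= d < X) (v d * h d) * ((u (Nd d) - u Z) + 2 * (w (Nd d) - X%:R * v d)) <= 3.
    apply: (@le_trans _ _ (\sum_(1 <= d < X) 3 * X%:R^-1)); last first.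
      rewrite big_const_nat iter_addr_0 -[X in X <= _]mulr_natr mulrAC.
      by rewrite ler_pdivrMr // ler_wpM2l // ler_nat leq_subr.
    rewrite !big_nat; apply: ler_sum => d /andP[d0 dX].
    have /andP[D1 D2] := u_diff (ltn0Sn (Z.-1 %/ d)) (NdZ d); rewrite -/(Nd d) in D1 D2.
    have vd := v0 d; set c := X%:R * v d; have c0 : 0 < c by rewrite mulr_gt0.
    have wN := w0 (Nd d); have wwN : w (Nd d) * w (Nd d) = (Nd d)%:R by rewrite ww.
    have dR : 0 < d%:R :> R by rewrite ltr0n.
    have cc : c * c * d%:R = Z%:R by rewrite /c mulrACA vv // -ZE mulfVK // gt_eqF.
    have cw2 : c * c <= w (Nd d) * w (Nd d).
      by rewrite wwN -(ler_pM2r dR) cc mulrC Nd_lo.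
    have wc2 : w (Nd d) * w (Nd d) <= c * c + 1.
      by rewrite wwN -(ler_pM2r dR) mulrDl cc mul1r mulrC Nd_hi.
    have cw : c <= w (Nd d) by rewrite -(@ler_pXn2r _ 2) ?nnegrE ?(ltW c0) ?(ltW wN) // !expr2.
    have wc : (w (Nd d) - c) * c <= 1.
      have : (w (Nd d) - c) * c <= (w (Nd d) - c) * w (Nd d) + (w (Nd d) - c) * c.
        by rewrite lerDr mulr_ge0 ?subr_ge0 // ltW.
      move/le_trans; apply; lra.
    have vN : v (Nd d) * c <= 1 by rewrite -(vw (Nd d)) ler_wpM2l // ltW.
    set q := _ + _.
    have hq : `|q| * c <= 3.
      have : `|q| <= v (Nd d) + 2 * (w (Nd d) - c).
        have vZ := v0 Z.
        by rewrite /q -/c ler_norml; apply/andP; lra.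
      move=> Hq; have := ler_wpM2r (ltW c0) Hq; lra.
    rewrite ler_pdivlMr //.
    apply: (@le_trans _ _ (`|h d| * (`|q| * c))).
      rewrite mulrCA -!mulrA [h d * _]mulrC.
      apply: le_trans (ler_norm _) _; rewrite !normrM.
      by rewrite (ger0_norm (ltW vd)) (ger0_norm (ltW XR)) /c; rewrite le_eqVlt; apply/orP; left; apply/eqP; ring.
    apply: le_trans (ler_wpM2r _ (h_le1 d)) _; last by rewrite mul1r.
    by rewrite mulr_ge0 // ltW.
  lra.
by apply: le_trans (lerD T1 T2) _; have := ler0n R m; lra.
Qed.

Lemma partial_sum_large : exists X, (1 < X)%N /\ 3 * m%:R / X%:R < `|P X|.
Proof.
apply: contrapT => H.
have {}H X : (1 < X)%N -> `|P X| <= 3 * m%:R / X%:R.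
  by move=> X1; rewrite leNgt; apply/negP => HX; apply: H; exists X.
(* This is [2 * 3 m + 5 m + 3], the upper bound that would follow for every [X]; the harmonic sum
   outgrows it. *)
set B : R := 11 * m%:R + 3.
have [T1 T2] := truncn_itvP (expR_ge0 B).
set X := (Num.truncn (expR B)).+2.
have X1 : (1 < X)%N by [].
have XR : 0 < X%:R :> R by rewrite ltr0n.
have lX : B < ln X%:R.
  apply: lnr_lt => //; apply: (lt_trans T2); by rewrite ltr_nat.
have := le_trans (harmonic_ge R (ltnW X1)) (le_trans (lower X) (upper (ltnW X1))).
have := H X X1; rewrite ler_pdivlMr // => HP.
have -> : 2 * X%:R * `|P X| = 2 * (`|P X| * X%:R) by ring.
move: lX; rewrite /B; move: (_ * X%:R) HP => y; lra.
Qed.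

(** Here the 3 of [partial_sum_large] is spent: beyond [X] Abel summation costs [m / X], and below
    [X] the change of exponent costs another [m / X] once [e <= m / X ^ 2]. *)
Lemma sign_L_lower : exists c e0 : R, [/\ 0 < c, 0 < e0 & exists X, forall (e : R) M, 0 < e -> e <= e0 ->
  (X <= M)%N -> c <= `|\sum_(1 <= n < M) nexp (1 + e) n * h n|].
Proof.
have [X [X1 HX]] := partial_sum_large.
have X0 := ltnW X1.
have XR : 0 < X%:R :> R by rewrite ltr0n.
have mR : 0 < m%:R :> R by rewrite ltr0n.
exists (m%:R / X%:R), (m%:R / (X%:R * X%:R)); split; rewrite ?divr_gt0 ?mulr_gt0 //.
exists X => e M e0 ee XM; rewrite (@big_cat_nat _ _ _ X) //=.
have tail : `|\sum_(X <= n < M) nexp (1 + e) n * h n| <= m%:R / X%:R.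
  have [MX|XM'] := leqP M X; first by rewrite big_geq // normr0 divr_ge0.
  apply: le_trans (abel_sum (B := m%:R) XM' _ _ _) _.
  - by move=> L _; have := periodic_sum_bound X L m0 hp hs h_le1; rewrite mulr1.
  - exact: nexp_ge0.
  - by move=> l Xl _; apply: nexp_le; [lra|rewrite leqnSn andbT; apply: leq_trans Xl].
  rewrite mulrC ler_wpM2l // -nexp1 // nexp_ler //; lra.
have head : `|P X - \sum_(1 <= n < X) nexp (1 + e) n * h n| <= m%:R / X%:R.
  rewrite /P -sumrB; apply: le_trans (ler_norm_sum _ _ _) _.
  apply: (@le_trans _ _ (\sum_(1 <= n < X) e)); last first.
    rewrite big_const_nat iter_addr_0 -[X in X <= _]mulr_natr.
    apply: (@le_trans _ _ (e * X%:R)); first by rewrite ler_wpM2l ?(ltW e0) // ler_nat leq_subr.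
    rewrite ler_pdivlMr // -mulrA.
    by move: ee; rewrite ler_pdivlMr ?mulr_gt0.
  rewrite !big_nat; apply: ler_sum => n /andP[n0 nX].
  rewrite mulrC -mulrBl normrM; apply: (@le_trans _ _ (`|n%:R^-1 - nexp (1 + e) n| * 1)).
    by rewrite ler_wpM2l // h_le1.
  rewrite mulr1 nexpD nexp1 // -{1}[n%:R^-1]mulr1 -mulrBr.
  have nR : 0 < n%:R :> R by rewrite ltr0n.
  rewrite ger0_norm; last by rewrite mulr_ge0 ?invr_ge0 ?subr_ge0 ?nexp_le1 // ltW.
  rewrite mulrC ler_pdivrMr //.
  have := expR_ge1Dx (- (e * ln n%:R)); rewrite /nexp => H1.
  have : e * ln n%:R <= e * n%:R by rewrite ler_wpM2l ?(ltW e0) // ltW // ln_sublinear.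
  lra.
set S := \sum_(1 <= n < X) _ in head *; set T := \sum_(X <= n < M) _ in tail *.
have H1 : `|P X| <= `|P X - S| + `|S| by rewrite -{1}(subrK S (P X)) ler_normD.
have H2 : `|S| <= `|S + T| + `|T| by rewrite -{1}(addrK T S) ler_normB.
move: HX; rewrite -mulrA; lra.
Qed.

End Nonvanishing.

(** * Scales without bad characters *)

Section GoodScales.
Variables (R : realType) (A : nat).
Implicit Types (chi : nat -> R[i]) (e : R) (i j m n M N : nat).

Lemma ln2_ge : 2^-1 <= ln 2 :> R.
Proof.
rewrite -ler_expR lnK ?posrE //.
have H := expR_ge1Dx (- 2^-1 : R); have p := expR_gt0 (2^-1 : R).
have : expR 2^-1 * (1 - 2^-1) <= 1 :> R.
  by rewrite -[X in _ <= X](expRxMexpNx_1 2^-1); apply: ler_wpM2l => //; exact: ltW.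
lra.
Qed.

Lemma ln2_le1 : ln 2 <= 1 :> R.
Proof.
rewrite -ler_expR lnK ?posrE //; have := expR_ge1Dx (1 : R); lra.
Qed.

Lemma pow512 i : (512 ^+ i) ^+ 4 = (2 ^+ i) ^+ 36 :> R.
Proof.
have -> : 512 = 2 ^+ 9 :> R by ring.
by rewrite -!exprM; congr (_ ^+ _); lia.
Qed.

Lemma pow1024 i : 1024 ^+ i = (2 ^+ i) ^+ 10 :> R.
Proof.
have -> : 1024 = 2 ^+ 10 :> R by ring.
by rewrite -!exprM; congr (_ ^+ _); lia.
Qed.

Lemma poly_lt_exp (C : R) a : exists i0, forall i, (i0 <= i)%N -> C * (1 + i%:R) ^+ a < 2 ^+ i.
Proof.
set k : R := (a.+1)`!%:R * 2 ^+ a.+1 * expR 2^-1.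
have k0 : 0 < k by rewrite !mulr_gt0 ?expR_gt0 ?exprn_gt0 // ltr0n fact_gt0.
exists (Num.truncn (`|C| * k)).+1 => i Hi.
have iC : `|C| * k < i%:R.
  have /truncn_itvP [_ H] : 0 <= `|C| * k by rewrite mulr_ge0 // ltW.
  by apply: lt_le_trans H _; rewrite ler_nat.
have x0 : 0 < 1 + i%:R :> R by rewrite ltr_pwDl.
have := @pow_fact_le R (1 + i%:R) 2 a.+1 (ltW x0) (ltr0n _ 2).
rewrite ler_pdivrMr ?ltr0n ?fact_gt0 // => H.
have E2 : expR (i%:R / 2) <= 2 ^+ i :> R.
  rewrite -[X in _ <= X ^+ i](@lnK R 2) ?posrE // -expRM_natl ler_expR.
  by rewrite ler_wpM2l // ln2_ge.
have H2 : (1 + i%:R) ^+ a.+1 <= k * 2 ^+ i.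
  apply: (le_trans H); have -> : (1 + i%:R) / 2 = 2^-1 + i%:R / 2 :> R by lra.
  rewrite expRD /k.
  have -> : 2 ^+ a.+1 * (expR 2^-1 * expR (i%:R / 2)) * (a.+1)`!%:R =
     (a.+1)`!%:R * 2 ^+ a.+1 * expR 2^-1 * expR (i%:R / 2) :> R by ring.
  by rewrite ler_wpM2l // ltW.
rewrite -(ltr_pM2l k0); apply: lt_le_trans H2; rewrite exprS mulrA.
rewrite ltr_pM2r ?exprn_gt0 // mulrC.
apply: le_lt_trans (_ : _ <= `|C| * k) _; first by rewrite ler_wpM2r ?ler_norm // ltW.
lra.
Qed.

(* Scales: [L] is evaluated at [1 + ei i] for all moduli up to [Qi i], and the Euler product is cut at [Ni i]. *)
Definition ei i : R := (1024 ^+ i)^-1.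
Definition Qi i : nat := (2 ^ (A * i))%N.
Definition Ni i : nat := maxn (Qi i) (Num.truncn (expR (4 * (1024 ^+ i) ^+ 2 : R))).+1.

Lemma ei_gt0 i : 0 < ei i. Proof. by rewrite invr_gt0 exprn_gt0. Qed.
Lemma ei_le1 i : ei i <= 1.
Proof. by rewrite invf_le1 ?exprn_gt0 // exprn_ege1 // ler1n. Qed.
Lemma eiS i : ei i = 1024 * ei i.+1.
Proof. by rewrite /ei exprS invfM mulrA mulfV ?mul1r // pnatr_eq0. Qed.

Lemma Ni_gt0 i : (0 < Ni i)%N. Proof. by rewrite /Ni leq_max orbT. Qed.
Lemma Qi_le_Ni i : (Qi i <= Ni i)%N. Proof. exact: leq_maxl. Qed.

Lemma Qi_mono i j : (i <= j)%N -> (Qi i <= Qi j)%N.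
Proof. by move=> ij; rewrite leq_exp2l // leq_mul2l ij orbT. Qed.

Lemma Ni_mono i j : (i <= j)%N -> (Ni i <= Ni j)%N.
Proof.
move=> ij; rewrite geq_max /Ni !leq_max Qi_mono //=; apply/orP; right.
rewrite ltnS; apply: le_truncn; rewrite ler_expR ler_wpM2l //.
apply: lerXn2r; rewrite ?nnegrE ?exprn_ge0 //.
by rewrite ler_weXn2l // ler1n.
Qed.

Lemma nexp_Ni i N : (Ni i <= N)%N -> nexp (ei i) N <= ei i / 4.
Proof.
move=> HN; have N0 := leq_trans (Ni_gt0 i) HN.
set Y : R := 1024 ^+ i; have Y0 : 0 < Y by rewrite exprn_gt0.
have lN : 4 * Y ^+ 2 <= ln N%:R.
  have [_ H] := truncn_itvP (expR_ge0 (4 * Y ^+ 2)).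
  apply/ltW/lnr_lt => //; apply: lt_le_trans H _; rewrite ler_nat.
  by apply: leq_trans HN; exact: leq_maxr.
have Y4 : 0 < 4 * Y by rewrite mulr_gt0.
have -> : ei i / 4 = (4 * Y)^-1 by rewrite invfM mulrC.
apply: le_trans (expRN_le Y4); rewrite /nexp ler_expR lerN2 /ei -/Y.
rewrite [X in _ <= X]mulrC ler_pdivlMr //; apply: le_trans lN.
by rewrite -mulrA -expr2.
Qed.

Lemma lnQ i : ln (Qi i)%:R = (A * i)%:R * ln 2 :> R.
Proof. by rewrite /Qi natrX lnXn // mulr_natl. Qed.

Lemma lnQ_le i : ln (Qi i)%:R <= A%:R * i%:R :> R.
Proof. by rewrite lnQ natrM ler_piMr ?mulr_ge0 // ln2_le1. Qed.

(** The primes up to [Qi i] change an Euler product by at most powers of [1 + i], negligible against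
    [2 ^+ i]. Leaving them out frees the comparison of two characters from the primes dividing their
    moduli. *)
Lemma small_prime_bound : (0 < A)%N -> exists G : R, 1 <= G /\
  forall i, (2 <= i)%N -> expR (psm R (Qi i)) <= G * (1 + i%:R).
Proof.
move=> A0; have [C1 [C10 H]] := prime_recip_sum R.
exists (1 + C1 * (1 + A%:R)); split; first by rewrite lerDl mulr_ge0 ?addr_ge0 // ltW.
move=> i i2; apply: le_trans (H _ _) _.
  rewrite lnQ; have h2 := ln2_ge.
  have : 2 <= (A * i)%:R :> R by rewrite ler_nat (leq_trans i2) // leq_pmull.
  move=> h3; have : 2 * 2^-1 <= (A * i)%:R * ln 2 :> R by apply: ler_pM; rewrite ?invr_ge0.
  lra.
apply: (@le_trans _ _ (C1 * ((1 + A%:R) * (1 + i%:R)))).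
  rewrite ler_wpM2l ?(ltW C10) //; have := lnQ_le i.
  have := ler0n R A; have := ler0n R i; lra.
rewrite mulrA ler_wpM2r ?addr_ge0 //; lra.
Qed.

Variable G : R.
Hypothesis G1 : 1 <= G.
Hypothesis HG : forall i, (2 <= i)%N -> expR (psm R (Qi i)) <= G * (1 + i%:R).

Definition Gi i : R := G * (1 + i%:R).

Lemma Gi_ge1 i : 1 <= Gi i.
Proof.
have := ler0n R i; rewrite /Gi => i0.
by rewrite -[1]mulr1; apply: ler_pM => //; lra.
Qed.

Let Gi_gt0 i : 0 < Gi i. Proof. exact: lt_le_trans (Gi_ge1 i). Qed.

Let e_ge1 i : 1 <= 1 + ei i. Proof. by rewrite lerDl ltW // ei_gt0. Qed.

Lemma nE_small_le chi i : cmul chi -> (2 <= i)%N -> nE chi (1 + ei i) 0 (Qi i) <= Gi i.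
Proof. by move=> cc i2; apply: le_trans (HG i2); apply: nE_le_psm. Qed.

Lemma nE_small_ge chi i : cmul chi -> (2 <= i)%N -> (Gi i ^+ 2)^-1 <= nE chi (1 + ei i) 0 (Qi i).
Proof.
move=> cc i2; apply: le_trans (nE_ge_psm _ cc (e_ge1 i)).
rewrite expRN lef_pV2 ?posrE ?exprn_gt0 ?expR_gt0 // expRM_natl.
by apply: lerXn2r; rewrite ?nnegrE ?expR_ge0 ?(ltW (Gi_gt0 i)) // HG.
Qed.

Lemma nE_split chi i N : (Qi i <= N)%N ->
  nE chi (1 + ei i) 0 N = nE chi (1 + ei i) 0 (Qi i) * nE chi (1 + ei i) (Qi i) N.
Proof. by move=> QN; rewrite (@nE_cat _ _ _ 0 (Qi i)) ?QN. Qed.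

Lemma euler_scale chi i N : cmul chi -> (Ni i <= N)%N -> exists M0, forall M, (M0 <= M)%N ->
   2^-1 <= nc (Ls chi (1 + ei i) 0 M) * nE chi (1 + ei i) 0 N <= 3 / 2.
Proof.
move=> cc HN; apply: euler_L => //; first exact: ei_gt0.
  exact: leq_trans (Ni_gt0 i) HN.
exact: nexp_Ni.
Qed.

(* A bad character makes [L (1 + ei i) chi] at most about [(ei i) ^ (9/10)]: [512 ^ i = (1024 ^ i) ^ (9/10)]. *)
Definition bad i m chi := [/\ (0 < m <= Qi i)%N, dchar m chi, nonprincipal m chi &
  512 ^+ i <= nE chi (1 + ei i) (Qi i) (Ni i)].

Lemma not_bad_lower i m chi : (2 <= i)%N -> (0 < m <= Qi i)%N -> dchar m chi -> nonprincipal m chi ->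
  ~ bad i m chi ->
  exists M0, forall M, (M0 <= M)%N -> (2 * 512 ^+ i * Gi i)^-1 <= nc (Ls chi (1 + ei i) 0 M).
Proof.
move=> i2 mQ D NP nb; have cc := dchar_cmul D.
have [M0 H] := euler_scale cc (leqnn (Ni i)); exists M0 => M HM.
have /andP[H1 _] := H M HM.
have E1 : nE chi (1 + ei i) (Qi i) (Ni i) <= 512 ^+ i.
  by rewrite leNgt; apply/negP => E; apply: nb; split => //; exact: ltW.
have E2 : nE chi (1 + ei i) 0 (Ni i) <= Gi i * 512 ^+ i.
  rewrite nE_split ?Qi_le_Ni //; apply: ler_pM => //; rewrite ?nE_ge0 //.
  exact: nE_small_le.
rewrite -[X in X <= _]mul1r ler_pdivrMr; last by apply: mulr_gt0; [rewrite mulr_gt0 ?exprn_gt0|exact: Gi_gt0].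
have := ler_wpM2l (nc_ge0 (Ls chi (1 + ei i) 0 M)) E2; lra.
Qed.

(** The losses of [transfer]: 1536 is the step 512 between consecutive thresholds times the 3 lost
    by two uses of [euler_L]; 12276 is [2 * 1023 * 6], the cost in [nE_mono] of dividing [ei] by
    1024; [G ^+ 3] comes from the primes below the cuts. *)
Definition Dc : R := 1536 * expR (12276 * expR 1) * G ^+ 3.
Definition Di i : R := Dc * (1 + i%:R) ^+ 3.

Lemma Dc_ge : 1536 <= Dc.
Proof.
have h1 : 1 <= expR (12276 * expR 1) :> R.
  by rewrite -[X in X <= _]expR0 ler_expR mulr_ge0 ?expR_ge0.
have h2 : 1 <= G ^+ 3 by rewrite exprn_ege1.
rewrite /Dc -mulrA -[X in X <= _]mulr1 ler_wpM2l //.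
by rewrite -[X in X <= _]mulr1; apply: ler_pM.
Qed.

Lemma Di_ge1 i : 1 <= Di i.
Proof.
have h1 := Dc_ge; have h2 : 1 <= (1 + i%:R) ^+ 3 :> R by rewrite exprn_ege1 // lerDl.
rewrite -[1]mulr1; apply: ler_pM => //; lra.
Qed.

(** The products up to [Ni i] and up to [Ni i.+1] measure the same value of [L], so they are
    comparable; then the exponent is moved to the next scale at bounded cost. Since [Di] is
    polynomial in [i], a bad character stays almost bad. *)
Lemma transfer chi i : cmul chi -> (2 <= i)%N ->
  512 ^+ i <= nE chi (1 + ei i) (Qi i) (Ni i) ->
  512 ^+ i.+1 <= Di i.+1 * nE chi (1 + ei i.+1) (Qi i.+1) (Ni i.+1).
Proof.
move=> cc i2 Hb; set N' := Ni i.+1.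
have NN : (Ni i <= N')%N by apply: Ni_mono.
have [M0 H0] := euler_scale cc (leqnn (Ni i)); have [M1 H1] := euler_scale cc NN.
have /andP[a1 a2] := H0 (maxn M0 M1) (leq_maxl _ _).
have /andP[b1 b2] := H1 (maxn M0 M1) (leq_maxr _ _).
set L := nc _ in a1 a2 b1 b2.
have L0 : 0 < L.
  rewrite lt_neqAle nc_ge0 andbT; apply/eqP => LE; move: a1; rewrite -LE mul0r; lra.
have s1 : 512 ^+ i <= Gi i ^+ 2 * nE chi (1 + ei i) 0 (Ni i).
  rewrite nE_split ?Qi_le_Ni // mulrA -[X in X <= _]mul1r; apply: ler_pM => //.
    by rewrite exprn_ge0.
  by rewrite -ler_pdivrMl ?exprn_gt0 // mulr1; apply: nE_small_ge.
have s2 : nE chi (1 + ei i) 0 (Ni i) <= 3 * nE chi (1 + ei i) 0 N'.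
  rewrite -(ler_pM2l L0); lra.
have ep := ei_gt0 i.+1; have ep1 := ei_le1 i.+1.
have s3 : nE chi (1 + ei i) 0 N' <= nE chi (1 + ei i.+1) 0 N' * expR (12276 * expR 1).
  apply: le_trans (nE_mono (s' := 1 + ei i.+1) 0 N' cc _ _) _ => //.
    by rewrite lerD2l (eiS i) ler_peMl ?(ltW ep) // ler1n.
  rewrite ler_wpM2l ?nE_ge0 // ler_expR.
  have H := sum_Lam_le N'.+1 ep ep1.
  have d0 : 0 <= 2 * ((1 + ei i) - (1 + ei i.+1)) by rewrite mulr_ge0 // (eiS i); lra.
  apply: le_trans (ler_wpM2l d0 H) _.
  by rewrite (eiS i) le_eqVlt; apply/orP; left; apply/eqP; field; rewrite gt_eqF.
have s4 : nE chi (1 + ei i.+1) 0 N' <= Gi i.+1 * nE chi (1 + ei i.+1) (Qi i.+1) N'.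
  rewrite nE_split ?Qi_le_Ni // ler_wpM2r ?nE_ge0 //.
  by apply: nE_small_le => //; exact: leq_trans i2 _.
have GG : Gi i <= Gi i.+1.
  by rewrite /Gi ler_wpM2l ?(le_trans ler01 G1) // lerD2l ler_nat.
set F := nE chi (1 + ei i.+1) (Qi i.+1) N' in s4 *; have F0 : 0 <= F by exact: nE_ge0.
set E := expR _ in s3; have E0 : 0 <= E by exact: expR_ge0.
have -> : Di i.+1 * F = 512 * (Gi i.+1 ^+ 2 * (3 * (Gi i.+1 * F * E))).
  by rewrite /Di /Dc -/E /Gi !exprMn; ring.
rewrite exprS ler_wpM2l //; apply: (le_trans s1).
apply: ler_pM; rewrite ?exprn_ge0 ?nE_ge0 ?(ltW (Gi_gt0 i)) //.
  by apply: lerXn2r; rewrite ?nnegrE ?(ltW (Gi_gt0 _)).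
apply: (le_trans s2); rewrite ler_wpM2l //; apply: (le_trans s3).
by rewrite ler_wpM2r.
Qed.

(* [E(1)^3 E(chi1)^2 E(chi2)^2 E(chi1 conj chi2)^2] stays bounded for the inverse Euler products [E]
   because [|1 + chi1 + chi2|^2 >= 0]:  two large
   factors force the last one to be small, which only happens for a principal character. *)
Lemma repel_equiv : exists i0, forall i, (i0 <= i)%N -> forall m1 m2 chi1 chi2,
  (0 < m1 <= Qi i)%N -> (0 < m2 <= Qi i)%N -> dchar m1 chi1 -> dchar m2 chi2 ->
  512 ^+ i <= Di i * nE chi1 (1 + ei i) (Qi i) (Ni i) ->
  512 ^+ i <= Di i * nE chi2 (1 + ei i) (Qi i) (Ni i) ->
  forall n, coprime n (m1 * m2) -> chi1 n = chi2 n.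
Proof.
pose KC : R := 6 * expR 1 * (1 + 2 * A%:R).
pose Z : R := expR 12 * 8 * 8 * Dc ^+ 4 * 4 * KC ^+ 2 * G ^+ 2.
have [i0 Hi0] := poly_lt_exp Z 16.
exists (maxn 2 i0) => i; rewrite geq_max => /andP[i2 ii].
move=> m1 m2 chi1 chi2 /andP[m10 m1Q] /andP[m20 m2Q] D1 D2 B1 B2 n cn.
apply: contrapT => Hn.
have cc1 := dchar_cmul D1; have cc2 := dchar_cmul D2.
have D12 := dchar_mulJ D1 D2; rewrite -/(conjmul chi1 chi2) in D12.
have c12 := dchar_cmul D12.
have NP : nonprincipal (m1 * m2) (conjmul chi1 chi2).
  exists n => // Hc; apply: Hn.
  move: cn; rewrite coprimeMr => /andP[_ cn2].
  have n2 : nc (chi2 n) = 1 by case: D2 => _ _ + _; apply.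
  have uu : (chi2 n)^* * chi2 n = 1.
    rewrite mulrC -sqr_normc -ncE n2 expr1n //.
  by rewrite -[LHS]mulr1 -uu mulrA; move: Hc; rewrite /conjmul => ->; rewrite mul1r.
have m12 : (0 < m1 * m2)%N by rewrite muln_gt0 m10.
have [M0 H0] := euler_scale c12 (leqnn (Ni i)).
have /andP[a1 _] := H0 M0 (leqnn _).
have HL := Ls_bound 0 M0 m12 D12 NP (ei_gt0 i); rewrite expr1 in HL.
have x0 : 0 <= i%:R :> R by []. 
have HK : Kc R (m1 * m2) <= KC * (1 + i%:R).
  rewrite /Kc /KC -!mulrA ler_wpM2l // ler_wpM2l ?expR_ge0 //.
  have l1 : ln (m1 * m2)%:R <= 2 * (A%:R * i%:R) :> R.
    rewrite lnrM //; have := lnQ_le i.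
    have := ler_lnr R m10 m1Q; have := ler_lnr R m20 m2Q; lra.
  have := ler0n R A; lra.
have K0 : 0 < KC * (1 + i%:R).
  by apply: lt_le_trans HK; apply: lt_le_trans (Kc_ge1 R _).
set X := nE (conjmul chi1 chi2) (1 + ei i) (Qi i) (Ni i).
have E12 : 1 <= 2 * (KC * (1 + i%:R)) * Gi i * X.
  rewrite nE_split ?Qi_le_Ni // -/X in a1.
  have b1 := nE_small_le c12 i2; have X0 : 0 <= X by exact: nE_ge0.
  set L := nc _ in a1 HL; set S := nE _ _ _ _ in a1 b1.
  have : L * (S * X) <= (KC * (1 + i%:R)) * (Gi i * X).
    apply: ler_pM; rewrite ?nc_ge0 ?mulr_ge0 ?nE_ge0 //; first exact: le_trans HL HK.
    by rewrite ler_wpM2r.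
  lra.
have Y1 : 1 <= 1024 ^+ i :> R by rewrite exprn_ege1 // ler1n.
set E1 := nE (one_char R) (1 + ei i) (Qi i) (Ni i).
have HE1 : 1 <= 4 * 1024 ^+ i * E1.
  have := nE_one_ge (Qi i) (Ni i) (ei_gt0 i); rewrite -/E1 /ei invrK => H.
  have q0 : 0 < 2 * (1 + 1024 ^+ i) :> R by lra.
  move: H; rewrite -[X in X <= _]mul1r ler_pdivrMr // => H.
  have E10 : 0 <= E1 by exact: nE_ge0.
  have := ler_wpM2r E10 (_ : 2 * (1 + 1024 ^+ i) <= 4 * 1024 ^+ i :> R).
  by move=> /(_ ltac:(lra)); lra.
have rep := @repulsion R chi1 chi2 (1 + ei i) (Qi i) (Ni i) (e_ge1 i)
   (fun n => let: And3 _ _ h := cc1 in h n) (fun n => let: And3 _ _ h := cc2 in h n).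
rewrite -/X -/E1 in rep.
set U1 := nE chi1 _ _ _ in B1 rep; set U2 := nE chi2 _ _ _ in B2 rep.
have D0 : 0 <= Di i by apply: le_trans (Di_ge1 i).
have U10 : 0 <= U1 by exact: nE_ge0. 
have U20 : 0 <= U2 by exact: nE_ge0.
have X0 : 0 <= X by exact: nE_ge0.
have E10 : 0 <= E1 by exact: nE_ge0.
have p5 : 0 <= 512 ^+ i :> R by rewrite exprn_ge0.
have sqm (x y : R) : 0 <= x -> x <= y -> x ^+ 2 <= y ^+ 2.
  by move=> h1 h2; apply: lerXn2r; rewrite ?nnegrE // (le_trans h1).
have t1 := sqm _ _ p5 B1; have t2 := sqm _ _ p5 B2.
have t3 := sqm _ _ ler01 E12.
have t0 : 1 <= (4 * 1024 ^+ i * E1) ^+ 3 by rewrite exprn_ege1.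
have big : (512 ^+ i) ^+ 4 <= expR 12 * ((4 * 1024 ^+ i) ^+ 3 * (Di i ^+ 4 *
    (2 * (KC * (1 + i%:R)) * Gi i) ^+ 2)).
  apply: (@le_trans _ _ ((4 * 1024 ^+ i * E1) ^+ 3 * (((Di i * U1) ^+ 2 * (Di i * U2) ^+ 2) *
     (2 * (KC * (1 + i%:R)) * Gi i * X) ^+ 2))).
    rewrite -[X in X <= _]mul1r; apply: ler_pM; rewrite ?exprn_ge0 //.
    rewrite -[X in X <= _]mulr1; apply: ler_pM; rewrite ?exprn_ge0 //; last by move: t3; rewrite expr1n.
    by rewrite (exprD _ 2 2); apply: ler_pM; rewrite ?exprn_ge0.
  set a := 4 * 1024 ^+ i; set b := Di i; set c := 2 * _ * Gi i.
  have -> : (a * E1) ^+ 3 * ((b * U1) ^+ 2 * (b * U2) ^+ 2 * (c * X) ^+ 2) =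
    (E1 ^+ 3 * (U1 ^+ 2 * U2 ^+ 2 * X ^+ 2)) * (a ^+ 3 * (b ^+ 4 * c ^+ 2)) by ring.
  apply: ler_wpM2r; last exact: rep.
  apply: mulr_ge0; first by rewrite exprn_ge0 // /a mulr_ge0 ?exprn_ge0.
  by apply: mulr_ge0; rewrite ?sqr_ge0 // exprn_ge0.
(* The left side is [2 ^ (36 i)], the right side [2 ^ (30 i)] times a polynomial of degree 16. The
   threshold exponent 9/10 has to exceed 3/4 here, and to stay below 1 for the saving in
   [small_char_bound]. *)
have e1 := pow512 i; have e2 := pow1024 i.
have := Hi0 i ii; rewrite /Z => small.
have p0 : 1 <= 2 ^+ i :> R by rewrite exprn_ege1 // ler1n.
move: big; rewrite e1 e2 /Di /Gi.
have -> : expR 12 * ((4 * (2 ^+ i) ^+ 10) ^+ 3 * ((Dc * (1 + i%:R) ^+ 3) ^+ 4 *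
   (2 * (KC * (1 + i%:R)) * (G * (1 + i%:R))) ^+ 2)) =
  (expR 12 * 8 * 8 * Dc ^+ 4 * 4 * KC ^+ 2 * G ^+ 2 * (1 + i%:R) ^+ 16) * (2 ^+ i) ^+ 30 by ring.
rewrite leNgt => /negP; apply.
apply: (@lt_le_trans _ _ (2 ^+ i * (2 ^+ i) ^+ 30)).
  by rewrite ltr_pM2r // !exprn_gt0.
by rewrite -exprS ler_weXn2l.
Qed.

Lemma nEJ chi s a b : nE (fun n => (chi n)^*) s a b = nE chi s a b.
Proof.
apply: eq_bigr => p _; rewrite -[RHS]ncJ; congr nc.
have E : ((nexp s p)%:C)^* = (nexp s p)%:C by exact: conjc_real.
by rewrite /Efac -{1}E -rmorphM /= -{1}(conjc1 R) -rmorphB.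
Qed.

(* If every large scale had a bad character, all of them would agree with a single real one, contradicting [sign_L_lower]. *)
Lemma exists_good i0 : exists i, (i0 <= i)%N /\ forall m chi, ~ bad i m chi.
Proof.
apply: contrapT => Hno.
have [f Hf] : exists f : nat -> nat * (nat -> R[i]), forall i, (i0 <= i)%N -> bad i (f i).1 (f i).2.
  have [i|f Hf] := @choice _ _ (fun i (y : nat * (nat -> R[i])) => (i0 <= i)%N -> bad i y.1 y.2).
    apply: contrapT => H; apply: Hno; exists i.
    have i0i : (i0 <= i)%N.
      by apply: contrapT => /negP h; apply: H; exists (0%N, fun=> 0); rewrite (negbTE h).
    by split => // m chi B; apply: H; exists (m, chi).
  by exists f.
have [r0 Hr] := repel_equiv.
set i1 := maxn i0 (maxn 2 r0).
have i1i0 d : (i0 <= i1 + d)%N by rewrite (leq_trans _ (leq_addr _ _)) // leq_maxl.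
have i12 d : (2 <= i1 + d)%N by rewrite (leq_trans _ (leq_addr _ _)) // /i1 !leq_max leqnn orbT.
have i1r d : (r0 <= i1 + d)%N by rewrite (leq_trans _ (leq_addr _ _)) // /i1 !leq_max leqnn !orbT.
have weak i m chi : bad i m chi -> 512 ^+ i <= Di i * nE chi (1 + ei i) (Qi i) (Ni i).
  by case=> _ _ _ H; apply: (le_trans H); rewrite ler_peMl ?nE_ge0 // Di_ge1.
(* [transfer] carries the bad character of one scale to the next, where [repel_equiv] identifies it
   with the one chosen there, except at primes dividing a modulus; these lie below the cut. *)
have agree d p : prime p -> (Qi (i1 + d) < p)%N -> (f (i1 + d)%N).2 p = (f i1).2 p.
  move=> pp; elim: d => [|d IH] Qp; first by rewrite addn0.
  have QQ : (Qi (i1 + d) <= Qi (i1 + d.+1))%N by apply: Qi_mono; rewrite leq_add2l.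
  rewrite -IH; last exact: leq_ltn_trans Qp.
  have [/andP[m10 m1] D1 NP1 b1] := Hf _ (i1i0 d).
  have B2 := Hf _ (i1i0 d.+1); have [/andP[m20 m2] D2 NP2 b2] := B2.
  apply/esym; apply: (Hr (i1 + d.+1)%N (i1r _) (f (i1 + d)%N).1 (f (i1 + d.+1)%N).1) => //.
  - by rewrite m10 (leq_trans m1).
  - by rewrite m20.
  - by rewrite addnS; apply: transfer => //; exact: dchar_cmul D1.
  - exact: weak B2.
  - rewrite prime_coprime // Euclid_dvdM // negb_or !gtnNdvd //.
      exact: leq_ltn_trans m2 Qp.
    exact: leq_ltn_trans m1 (leq_ltn_trans QQ Qp).
have [/andP[m0 mQ] D NP _] := Hf _ (i1i0 0); rewrite addn0 in m0 mQ D NP.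
set chi := (f i1).2 in D NP agree; set m := (f i1).1 in m0 mQ D NP.
have cc := dchar_cmul D.
have big i : (i1 <= i)%N -> 512 ^+ i <= nE chi (1 + ei i) (Qi i) (Ni i).
  move=> ii; have [_ _ _ b] := Hf i (leq_trans (leq_maxl _ _) ii); apply: (le_trans b).
  rewrite le_eqVlt; apply/orP; left; apply/eqP; rewrite /nE big_nat_cond [RHS]big_nat_cond.
  apply: eq_bigr => p /andP[/andP[Qp _] pp]; rewrite /Efac.
  by have := agree (i - i1)%N p pp; rewrite subnKC // => ->.
(* The quantity [nE] does not change under conjugation, so a character and its conjugate are bad
   together and must agree. *)
have real n : complex.Im (chi n) = 0.
  have [cn|ncn] := boolP (coprime n m); last by case: D => _ _ _ ->.
  have B : bad i1 m chi by have := Hf _ (i1i0 0); rewrite addn0.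
  have DJ := dcharJ D.
  have E : chi n = (chi n)^*.
    apply: (Hr i1 _ m m chi (fun n => (chi n)^*)) => //; rewrite ?m0 ?mQ //.
    - by have := i1r 0%N; rewrite addn0.
    - exact: weak B.
    - by rewrite nEJ; exact: weak B.
    - by rewrite coprimeMr cn.
  by move: E; case: (chi n) => u v /= [] ?; lra.
pose h n := complex.Re (chi n).
have hE n : chi n = (h n)%:C by rewrite /h; move: (real n); case: (chi n) => u v /= ->.
have hM a b : h (a * b)%N = h a * h b.
  by apply: complexI; rewrite rmorphM /= -!hE; case: D => ->.
have h1 : h 1%N = 1 by apply: complexI; rewrite -hE (dchar1 D).
have hv n : [\/ h n = -1, h n = 0 | h n = 1].
  have [cn|ncn] := boolP (coprime n m); last first.
    by constructor 2; apply: complexI; rewrite -hE; case: D => _ _ _ ->.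
  have : nc (chi n) = 1 by case: D => _ _ H _; apply: H.
  rewrite hE nc_real => H; have [hp|hn] := leP 0 (h n).
    by constructor 3; rewrite -H ger0_norm.
  by constructor 1; rewrite -H ltr0_norm // opprK.
have hp : periodic m h by move=> n; rewrite /h; case: D => _ -> _ _.
have hs : psum m h = 0 by rewrite /psum -Re_sum -/(psum m chi) (dchar_psum m0 D NP).
have [c [e0 [c0 e00 [X HX]]]] := sign_L_lower hM h1 hv m0 hp hs.
have [r1 H1] := poly_lt_exp (3 / 2 * G ^+ 2 / c) 2.
have [r2 H2] := poly_lt_exp e0^-1 0.
set i := maxn i1 (maxn r1 r2).
have ii1 : (i1 <= i)%N by exact: leq_maxl.
have i2 : (2 <= i)%N by apply: leq_trans ii1; have := i12 0%N; rewrite addn0.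
have ir1 : (r1 <= i)%N by rewrite /i !leq_max leqnn orbT.
have ir2 : (r2 <= i)%N by rewrite /i !leq_max leqnn !orbT.
have ee : ei i <= e0.
  have := H2 i ir2; rewrite expr0 mulr1 => H.
  rewrite /ei -[e0]invrK lef_pV2 ?posrE ?invr_gt0 ?exprn_gt0 //.
  by apply: (le_trans (ltW H)); apply: lerXn2r; rewrite ?nnegrE // ler_nat.
have [M0 HM0] := euler_scale cc (leqnn (Ni i)).
have /andP[_ a2] := HM0 (maxn M0 X) (leq_maxl _ _).
have cL : c <= nc (Ls chi (1 + ei i) 0 (maxn M0 X)).
  apply: le_trans (HX _ _ (ei_gt0 i) ee (leq_maxr M0 X)) _.
  apply: le_trans (nc_Re _); rewrite Re_sum le_eqVlt; apply/orP; left; apply/eqP; congr `|_|.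
  by apply: eq_bigr => n _; rewrite Re_mulr wt0.
have s1 : 512 ^+ i <= Gi i ^+ 2 * nE chi (1 + ei i) 0 (Ni i).
  rewrite nE_split ?Qi_le_Ni // mulrA -[X in X <= _]mul1r; apply: ler_pM => //.
    by rewrite exprn_ge0.
  - by rewrite -ler_pdivrMl ?exprn_gt0 // mulr1; apply: nE_small_ge.
  - exact: big.
set U := nE chi _ 0 _ in a2 s1; have U0 : 0 <= U by exact: nE_ge0.
(* Nonvanishing bounds the Euler product for all small [e], whereas by [big] it grows like
   [512 ^+ i] up to polynomial factors. *)
have s2 : c * 512 ^+ i <= 3 / 2 * Gi i ^+ 2.
  apply: (@le_trans _ _ (Gi i ^+ 2 * (c * U))); first by rewrite mulrCA ler_wpM2l // ltW.
  rewrite mulrC ler_wpM2r ?exprn_ge0 ?(ltW (Gi_gt0 i)) //.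
  by apply: le_trans a2; rewrite ler_wpM2r.
have HH := H1 i ir1.
have E : 3 / 2 * G ^+ 2 / c * (1 + i%:R) ^+ 2 = (3 / 2 * Gi i ^+ 2) / c by rewrite /Gi; ring.
rewrite E ltr_pdivrMr // in HH.
have p5 : 2 ^+ i <= 512 ^+ i :> R by apply: lerXn2r; rewrite ?nnegrE // ler_nat.
have := ler_wpM2r (ltW c0) p5; lra.
Qed.

End GoodScales.

Section SmallCharacterBound.
Variable R : realType.

(** At a scale without bad characters the lower bound [l] for [L] has inverse [512 ^+ i] up to a
    polynomial, so each of the [j + 1] factors in [recurrence_bound] is below [1024 ^+ i] by [2 ^ i]
    over a polynomial, hence by any fixed [2 ^ a]. As [j = 10 i] and [Y = 2 ^ j], the total saving
    exceeds [Y ^ a]. *)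
Lemma small_char_bound (A a : nat) : (0 < A)%N -> forall i0, exists i, (i0 <= i)%N /\
  forall m (chi : nat -> R[i]), (0 < m <= 2 ^ (A * i))%N -> dchar m chi -> nonprincipal m chi ->
  exists M0, forall M, (M0 <= M)%N ->
  nc (As chi (1 + ei R i) (10 * i) M) <= (1024 ^+ i / 2 ^+ a) ^+ (10 * i).+1.
Proof.
move=> A0 i0; have [G [G1 HG]] := small_prime_bound R A0.
pose KC : R := 6 * expR 1 * (1 + A%:R).
have [r0 H0] := poly_lt_exp (8 * KC ^+ 2 * (2 * G) * 2 ^+ a) 3.
have [i [ii Hi]] := exists_good G1 HG (maxn i0 (maxn 2 r0)).
exists i; split; first by apply: leq_trans ii; exact: leq_maxl.
have i2 : (2 <= i)%N by apply: leq_trans ii; rewrite !leq_max leqnn orbT.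
have ir : (r0 <= i)%N by apply: leq_trans ii; rewrite !leq_max leqnn !orbT.
move=> m chi mQ D NP; have /andP[m0 mQ'] := mQ.
have cc := dchar_cmul D.
have [M1 H1] := not_bad_lower G1 HG i2 mQ D NP (Hi m chi).
have [M2 H2] := As_recs (10 * i) cc (ei_gt0 R i) (ei_le1 R i).
exists (maxn M1 M2) => M; rewrite geq_max => /andP[h1 h2].
set l := (2 * 512 ^+ i * Gi G i)^-1 in H1.
have Gp : 1 <= Gi G i by exact: Gi_ge1.
have p5 : 1 <= 512 ^+ i :> R by rewrite exprn_ege1 // ler1n.
have q0 : 0 < 2 * 512 ^+ i * Gi G i by apply: mulr_gt0; [apply: mulr_gt0 => //|]; lra.
have q1 : 1 <= 2 * 512 ^+ i * Gi G i.
  by rewrite -[X in X <= _]mulr1; apply: ler_pM => //; lra.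
have l0 : 0 < l by rewrite invr_gt0.
have l1 : l <= 1 by rewrite invf_le1.
have := @recurrence_bound R (fun i' => Ls chi (1 + ei R i) i' M)
  (fun i' => As chi (1 + ei R i) i' M) (Kc R m) l (10 * i) (Kc_ge1 R m) l0 l1.
move=> /(_ (fun i' _ => Ls_bound i' M m0 D NP (ei_gt0 R i)) (H1 M h1) (H2 M h2) (10 * i)%N (leqnn _)).
move/le_trans; apply; apply: lerXn2r; rewrite ?nnegrE.
- by apply: divr_ge0; [rewrite mulr_ge0 ?sqr_ge0|exact: ltW].
- by rewrite divr_ge0 ?exprn_ge0.
have HK : Kc R m <= KC * (1 + i%:R).
  rewrite /Kc /KC -[X in _ <= X]mulrA; apply: ler_wpM2l; first by rewrite mulr_ge0 ?expR_ge0.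
  have := @lnQ_le R A i; have := ler_lnr R m0 mQ'; have := ler0n R A; have := ler0n R i.
  rewrite /Qi; lra.
have HK2 : Kc R m ^+ 2 <= (KC * (1 + i%:R)) ^+ 2.
  apply: lerXn2r; rewrite ?nnegrE ?(le_trans ler01 (Kc_ge1 R m)) //.
  exact: le_trans (le_trans ler01 (Kc_ge1 R m)) HK.
rewrite /l invrK ler_pdivlMr ?exprn_gt0 //.
apply: (@le_trans _ _ (8 * (KC * (1 + i%:R)) ^+ 2 * (2 * 512 ^+ i * Gi G i) * 2 ^+ a)).
  rewrite ler_wpM2r ?exprn_ge0 // ler_wpM2r ?(ltW q0) //; exact: ler_wpM2l.
have -> : 8 * (KC * (1 + i%:R)) ^+ 2 * (2 * 512 ^+ i * Gi G i) * 2 ^+ a =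
  (8 * KC ^+ 2 * (2 * G) * 2 ^+ a * (1 + i%:R) ^+ 3) * 512 ^+ i by rewrite /Gi; ring.
have -> : 1024 ^+ i = 2 ^+ i * 512 ^+ i :> R by rewrite -exprMn; congr (_ ^+ _); ring.
by rewrite ler_wpM2r ?(le_trans ler01 p5) // ltW // H0.
Qed.

End SmallCharacterBound.

(** * Orthogonality of Dirichlet characters *)

Lemma closed_prim_root_exists (C : numClosedFieldType) n : (n > 0)%N ->
  exists z : C, n.-primitive_root z.
Proof.
pose p : {poly C} := 'X^n - 1; have [r Dp] := closed_field_poly_normal p.
move=> n_gt0; rewrite (monicP _) ?monicXnsubC // scale1r in Dp.
have rn1 : all n.-unity_root r by apply/allP=> z; rewrite -root_prod_XsubC -Dp.
have sz_r : (n < (size r).+1)%N by rewrite -(size_prod_XsubC r id) -Dp size_XnsubC.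
have [|z] := hasP (has_prim_root n_gt0 rn1 _ sz_r); last by exists z.
by rewrite -separable_prod_XsubC -Dp separable_Xn_sub_1 // pnatr_eq0 -lt0n.
Qed.

Section AbelianCharacters.
Variables (R : realType) (gT : finGroupType).
Hypothesis cG : abelian [set: gT].
Let K := #|[set: gT]|.
Let K0 : (0 < K)%N := cardG_gt0 [set: gT]%G.
Variable z : R[i].
Hypothesis zP : K.-primitive_root z.

(** A homomorphism into the [K]-th roots of unity, stored by its exponents. Characters with values
    in [algC] are carried to [R[i]] by reading the same exponents with another primitive root. *)
Let hom (e : {ffun gT -> 'I_K}) :=
  [forall x, forall y, z ^+ (e (x * y)%g) == z ^+ (e x) * z ^+ (e y)].

Let homP e : hom e -> forall x y, z ^+ (e (x * y)%g) = z ^+ (e x) * z ^+ (e y).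
Proof. by move=> /forallP H x y; apply/eqP; move: (H x) => /forallP. Qed.

(** The irreducible characters separate points, and those of an abelian group are linear. *)
Lemma abelian_separating g : g != 1%g -> exists2 e, hom e & z ^+ (e g) != 1.
Proof.
move=> g1; have [w wP] := C_prim_root_exists K0.
have [i Hi] : exists i, g \notin cfker 'chi[[set: gT]%G]_i.
  apply/existsP; rewrite -negb_forall; apply: contra g1 => /forallP H.
  have : g \in \bigcap_i cfker 'chi[[set: gT]%G]_i by apply/bigcapP => i _; exact: H.
  by rewrite TI_cfker_irr inE.
have Li : 'chi[[set: gT]%G]_i \is a linear_char by apply/char_abelianP.
have root x : 'chi[[set: gT]%G]_i x ^+ K = 1.
  by rewrite -(lin_charX Li) ?inE // expg_cardG ?inE // (lin_char1 Li).
have pw x := prim_rootP wP (root x).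
pose e : {ffun gT -> 'I_K} := [ffun x => sval (pw x)].
have eE x : 'chi[[set: gT]%G]_i x = w ^+ (e x) by rewrite ffunE; exact: (svalP (pw x)).
exists e.
  apply/forallP => x; apply/forallP => y; rewrite -exprD (eq_prim_root_expr zP).
  by rewrite -(eq_prim_root_expr wP) exprD -!eE (lin_charM Li) ?inE.
apply: contra Hi => H; rewrite cfkerEirr inE (lin_char1 Li) eE.
by rewrite -(expr0 w) (eq_prim_root_expr wP) -(eq_prim_root_expr zP) expr0.
Qed.

Let mulh (e0 e : {ffun gT -> 'I_K}) : {ffun gT -> 'I_K} :=
  [ffun x => Ordinal (ltn_pmod (e0 x + e x) K0)].

Let mulhE e0 e x : z ^+ (mulh e0 e x) = z ^+ (e0 x) * z ^+ (e x).
Proof. by rewrite ffunE /= (prim_expr_mod zP) exprD. Qed.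

Let zX0 n : z ^+ n != 0.
Proof.
apply: expf_neq0; apply/eqP => z0; have := prim_expr_order zP.
by rewrite z0 expr0n eqn0Ngt K0 /= => /eqP; rewrite eq_sym oner_eq0.
Qed.

(** Multiplying by a homomorphism that is not 1 at [g] permutes the terms and rescales the sum. *)
Lemma sum_hom (g : gT) : \sum_(e | hom e) z ^+ (e g) = (#|[pred e | hom e]|)%:R * (g == 1%g)%:R.
Proof.
have [->|g1] := eqVneq g 1%g.
  rewrite mulr1 -sum1_card natr_sum; apply: eq_bigr => e /homP H.
  by apply: (mulfI (zX0 (e 1%g))); rewrite -H mulg1 mulr1.
have [e0 h0 n1] := abelian_separating g1; rewrite mulr0.
have inj : injective (mulh e0).
  move=> e e' /ffunP H; apply/ffunP => x; apply/val_inj.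
  have : z ^+ (e x) = z ^+ (e' x).
    by apply: (mulfI (zX0 (e0 x))); rewrite -!mulhE H.
  by move/eqP; rewrite (eq_prim_root_expr zP) !modn_small ?ltn_ord // => /eqP.
have hE e : hom (mulh e0 e) = hom e.
  apply/eq_forallb => x; apply/eq_forallb => y; rewrite !mulhE (homP h0).
  rewrite mulrACA; apply/eqP/eqP => [|->] //; apply: mulfI.
  by apply: mulf_neq0; exact: zX0.
have E : \sum_(e | hom e) z ^+ (e g) = z ^+ (e0 g) * \sum_(e | hom e) z ^+ (e g).
  rewrite {1}(reindex_inj inj) mulr_sumr; apply: eq_big => e; first exact: hE.
  by rewrite mulhE.
apply/eqP; move/eqP: E; rewrite eq_sym -subr_eq0 -{2}[\sum_(_ | _) _]mul1r -mulrBl mulf_eq0 subr_eq0.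
by rewrite (negbTE n1).
Qed.

Lemma card_hom_gt0 : (0 < #|[pred e | hom e]|)%N.
Proof.
apply/card_gt0P; exists [ffun=> Ordinal K0]; rewrite inE.
by apply/forallP => x; apply/forallP => y; rewrite !ffunE /= expr0 mulr1.
Qed.

Lemma nc_prim_root n : nc (z ^+ n) = 1.
Proof.
have H : nc z ^+ K = 1 by rewrite -ncX (prim_expr_order zP) nc1.
rewrite ncX; have -> : nc z = 1; last by rewrite expr1n.
by apply/eqP; rewrite -(@pexpr_eq1 _ _ K) ?nc_ge0 // H.
Qed.

Lemma homs_family : exists (T : nat) (V : 'I_T -> gT -> R[i]), [/\ (0 < T)%N,
  forall k x y, V k (x * y)%g = V k x * V k y, forall k x, nc (V k x) = 1 &
  forall g, \sum_(k < T) V k g = T%:R * (g == 1%g)%:R].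
Proof.
exists #|[pred e | hom e]|, (fun k x => z ^+ (@enum_val _ [pred e | hom e] k x)); split.
- exact: card_hom_gt0.
- by move=> k x y; have := enum_valP k; rewrite inE => /homP.
- by move=> k x; exact: nc_prim_root.
- move=> g; rewrite -sum_hom -(big_enum_val (fun e : {ffun gT -> 'I_K} => z ^+ (e g))).
  by apply: eq_bigl => e; rewrite inE.
Qed.

End AbelianCharacters.

Section DirichletBasis.
Variable R : realType.

(** The characters of the unit group of ['Z_m], extended by 0. For [m <= 1] the type ['Z_m] is not
    the ring of residues modulo [m], whence [1 < m]. *)
Lemma dchar_basis (m : nat) : (1 < m)%N ->
  exists (T : nat) (X : 'I_T -> nat -> R[i]), [/\ (0 < T)%N, forall k, dchar m (X k) &
   forall a n, coprime a m -> \sum_(k < T) (X k a)^* * X k n = T%:R * (n == a %[mod m])%:R].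
Proof.
move=> m1; pose gT : finGroupType := {unit 'Z_m}.
have cG : abelian [set: gT] by exact: (units_Zp_abelian m).
have [z zP] := @closed_prim_root_exists R[i] _ (cardG_gt0 [set: gT]%G).
have [T [V [T0 VM V1 VS]]] := homs_family cG zP.
pose u (n : nat) : gT := insubd (1%g : gT) (n%:R : 'Z_m).
have uE n : coprime n m -> val (u n) = n%:R :> 'Z_m.
  by move=> cn; rewrite /u val_insubd unitZpE // coprime_sym cn.
have uM a b : coprime a m -> coprime b m -> u (a * b)%N = (u a * u b)%g.
  move=> ca cb; apply: val_inj; rewrite /= uE ?coprimeMl ?ca //.
  by rewrite natrM -!uE.
have uP n : u (n + m)%N = u n.
  by rewrite /u natrD pchar_Zp // addr0.
have V11 k : V k 1%g = 1.
  have := VM k 1%g 1%g; rewrite mulg1 => H.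
  have v0 : V k 1%g != 0.
    by apply/eqP => v; have := V1 k 1%g; rewrite v nc0 => /eqP; rewrite eq_sym oner_eq0.
  by apply: (mulfI v0); rewrite -H mulr1.
exists T, (fun k n => if coprime n m then V k (u n) else 0); split => //.
  move=> k; split => [a b|n|a|a].
  - by rewrite coprimeMl; case: (boolP (coprime a m)) => ca; case: (boolP (coprime b m)) => cb;
      rewrite /= ?mulr0 ?mul0r // uM.
  - by rewrite uP -(coprime_modl (n + m)) modnDr coprime_modl.
  - by move=> ->.
  - by move=> /negbTE ->.
move=> a n ca; rewrite ca; case: (boolP (coprime n m)) => cn; last first.
  rewrite big1 => [|k _]; last by rewrite mulr0.
  case: eqP => [H|]; last by rewrite mulr0.
  by move: cn; rewrite -coprime_modl H coprime_modl ca.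
have conjE k : (V k (u a))^* = V k (u a)^-1%g.
  have v0 : V k (u a) != 0.
    by apply/eqP => v; have := V1 k (u a); rewrite v nc0 => /eqP; rewrite eq_sym oner_eq0.
  by apply: (mulfI v0); rewrite -VM mulgV V11 -sqr_normc -ncE V1 expr1n.
transitivity (\sum_(k < T) V k ((u a)^-1 * u n)%g).
  by apply: eq_bigr => k _; rewrite VM -conjE.
rewrite VS -eq_mulVg1; congr (_ * (nat_of_bool _)%:R).
apply/eqP/eqP => [H|H].
  have := congr1 val H; rewrite !uE // => /(congr1 val).
  by rewrite /= !val_Zp_nat // => ->.
by apply: val_inj; rewrite /= !uE // -(Zp_nat_mod m1 a) -(Zp_nat_mod m1 n) H.
Qed.

End DirichletBasis.

(** * Vaughan's identity and bilinear sums *)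

Section LocalFactors.
Variables (R : realType) (k : nat).
Implicit Types (q n m l : nat).

Definition hit q n := has (fun i => (q %| n + i)%N) (iota 1 k).

Definition zg q : R := k%:R / (q.-1)%:R.

(* On integers prime to [q] this is the indicator of [hit] minus its density among
   reduced residues; the value 0 at multiples of [q] gives it mean zero on every dilate. *)
Definition ze q n : R := if hit q n then 1 - zg q else if (q %| n)%N then 0 else - zg q.

Lemma hit_periodic q : periodic q (hit q).
Proof. by move=> n; apply: eq_has => i; rewrite addnAC dvdn_addl. Qed.

Lemma ze_periodic q : periodic q (ze q).
Proof. by move=> n; rewrite /ze hit_periodic dvdn_addl. Qed.

Lemma hit_dvd q n : (k < q)%N -> (q %| n)%N -> hit q n = false.
Proof.
move=> kq qn; apply/hasPn => i; rewrite mem_iota dvdn_addr // => /andP[i0 ik].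
apply/negP => /(dvdn_leq i0); lia.
Qed.

Lemma ze_dvd q n : (k < q)%N -> (q %| n)%N -> ze q n = 0.
Proof. by move=> kq qn; rewrite /ze hit_dvd // qn. Qed.

Lemma ze_hit q n : ~~ (q %| n)%N -> ze q n = (hit q n)%:R - zg q.
Proof. by move=> /negbTE H; rewrite /ze H; case: (hit q n); rewrite /= ?sub0r. Qed.

Lemma zg_ge0 q : 0 <= zg q.
Proof. by rewrite divr_ge0. Qed.

Lemma zg_le1 q : (k < q)%N -> zg q <= 1.
Proof.
case: q => [|[|q]]; [by []|by rewrite /zg invr0 mulr0|].
by move=> kq; rewrite /zg ler_pdivrMr ?ltr0n // mul1r ler_nat.
Qed.

Lemma ze_norm q n : (k < q)%N -> `|ze q n| <= 1.
Proof.
move=> kq; have := zg_ge0 q; have := zg_le1 kq; rewrite /ze.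
case: ifP => _; first by move=> *; rewrite ger0_norm; lra.
by case: ifP => _ *; rewrite ?normr0 // normrN ger0_norm.
Qed.

Lemma hit_small q n : (k < q)%N -> (n < q)%N -> hit q n = (q - k <= n)%N.
Proof.
move=> kq nq; apply/hasP/idP => [[i ]|H].
  rewrite mem_iota => /andP[i0 ik] /dvdnP[[ | [ | c]] E]; lia.
exists (q - n)%N; first by rewrite mem_iota; lia.
by rewrite subnKC // ltnW.
Qed.

Lemma sum_ze_gen (F : R -> R) q : (k.+1 < q)%N -> F 0 = 0 ->
  psum q (fun n => F (ze q n)) = F (- zg q) *+ (q - k).-1 + F (1 - zg q) *+ k.
Proof.
move=> kq F0; have kq' := ltnW kq; rewrite /psum -(big_mkord xpredT (fun n => F (ze q n))).
rewrite (@big_cat_nat _ _ _ (q - k)) ?leq_subr //=; congr (_ + _).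
  rewrite big_ltn ?subn_gt0 // ze_dvd ?dvdn0 // F0 add0r.
  rewrite (eq_big_nat _ _ (F2 := fun=> F (- zg q))) ?sumr_const_nat ?subn1 //.
  move=> n /andP[n0 nk]; have nq : (n < q)%N by lia.
  by rewrite /ze hit_small // leqNgt nk /= gtnNdvd.
rewrite (eq_big_nat _ _ (F2 := fun=> F (1 - zg q))) ?sumr_const_nat ?subKn // 1?ltnW //.
by move=> n /andP[nk nq]; rewrite /ze hit_small // nk.
Qed.

Lemma zgK q : (k.+1 < q)%N -> zg q *+ (q - k).-1 = k%:R * (1 - zg q).
Proof.
move=> kq; have q0 : (q.-1)%:R != 0 :> R by rewrite pnatr_eq0; lia.
have -> : (q - k).-1 = (q.-1 - k)%N by lia.
rewrite -[LHS]mulr_natr natrB; last by lia.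
by rewrite /zg; field.
Qed.

Lemma sum_ze q m : prime q -> (k.+1 < q)%N -> psum q (fun l => ze q (m * l)) = 0.
Proof.
move=> pq kq; have kq' := ltnW kq.
have [qm|qm] := boolP (q %| m)%N.
  by rewrite /psum big1 // => l _; rewrite ze_dvd // dvdn_mulr.
rewrite (psum_affine 0 (prime_gt0 pq) _ (ze_periodic q)); last by rewrite coprime_sym prime_coprime.
rewrite (@sum_ze_gen id) // mulNrn zgK // -mulr_natl; ring.
Qed.

(** Hits are rare: although [ze] takes values of size about 1, its mean absolute value is at most
    [2 k / q]. This is the source of the denominator in [zmass]. *)
Lemma sum_ze_norm q m : prime q -> (k.+1 < q)%N -> psum q (fun l => `|ze q (m * l)|) <= 2 * k%:R.
Proof.
move=> pq kq; have kq' := ltnW kq.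
have g0 := zg_ge0 q; have g1 := zg_le1 kq'; have k0 := ler0n R k.
have [qm|qm] := boolP (q %| m)%N.
  rewrite /psum big1 => [|l _]; first by rewrite mulr_ge0.
  by rewrite ze_dvd ?normr0 // dvdn_mulr.
rewrite (psum_affine 0 (prime_gt0 pq) (g := fun n => `|ze q n|)) //; first last.
- by move=> n; rewrite ze_periodic.
- by rewrite coprime_sym prime_coprime.
rewrite (@sum_ze_gen Num.norm) ?normr0 // normrN !ger0_norm ?subr_ge0 // zgK // -mulr_natl.
have : 0 <= k%:R * zg q by rewrite mulr_ge0.
rewrite !mulrBr; lra.
Qed.

End LocalFactors.

Section SubsetSums.
Variables (R : realType) (I : finType).
Implicit Types (U T : {set I}).

Lemma prod_setD (F G : I -> R) : \prod_i (F i + G i) =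
  \sum_(U : {set I}) (\prod_(i in U) F i * \prod_(i in ~: U) G i).
Proof.
rewrite bigA_distr; apply: eq_bigr => U _.
rewrite [in RHS](big_mkcond (mem U)) [X in _ * X]big_mkcond -big_split /=.
by apply: eq_bigr => i _; rewrite inE; case: (i \in U); rewrite ?mulr1 ?mul1r.
Qed.

Lemma prod_set1D (F : I -> R) : \prod_i (1 + F i) = \sum_(U : {set I}) \prod_(i in U) F i.
Proof.
rewrite (eq_bigr (fun i => F i + 1)) => [|i _]; last by rewrite addrC.
by rewrite prod_setD; apply: eq_bigr => U _; rewrite big1_eq mulr1.
Qed.

Lemma sum_set_subset (P : pred {set I}) (F : {set I} -> R) : (forall U, 0 <= F U) ->
  \sum_(U | P U) F U <= \sum_U F U.
Proof. by move=> F0; rewrite big_mkcond; apply: ler_sum => U _; case: ifP. Qed.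

End SubsetSums.

Section SievePrimes.
Variables (R : realType) (I : finType) (q : I -> nat) (k W : nat).
Hypotheses (qI : injective q) (qP : forall i, prime (q i)) (qk : forall i, (k.+1 < q i)%N).
Hypotheses (qW : forall i, coprime (q i) W) (W0 : (0 < W)%N).
Implicit Types (U T : {set I}) (n m l : nat).

Let qk' i : (k < q i)%N := ltnW (qk i).

Definition rad U := (\prod_(i in U) q i)%N.
Definition zeU U n : R := \prod_(i in U) ze R k (q i) n.

Lemma rad_gt0 U : (0 < rad U)%N.
Proof. by apply: prodn_cond_gt0 => i _; apply: prime_gt0. Qed.

Lemma radE U : rad U = (\prod_(p <- [seq q i | i <- enum U]) p)%N.
Proof. by rewrite big_map big_enum. Qed.

Lemma prod_set_seq (V : comNzRingType) U (F : nat -> V) :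
  \prod_(i in U) F (q i) = \prod_(p <- [seq q i | i <- enum U]) F p.
Proof. by rewrite big_map big_enum. Qed.

Lemma psum_set (V : comNzRingType) U (F : nat -> nat -> V) (g : nat -> V) m : (0 < m)%N ->
  (forall i, i \in U -> coprime (q i) m) -> (forall p, periodic p (F p)) -> periodic m g ->
  psum (rad U * m) (fun n => \prod_(i in U) F (q i) n * g n) =
  \prod_(i in U) psum (q i) (F (q i)) * psum m g.
Proof.
move=> m0 cm pF pg; rewrite radE (prod_set_seq U (fun p => psum p (F p))).
rewrite -psum_prod // ?map_inj_uniq ?enum_uniq //.
- by apply: eq_bigr => n _; rewrite (prod_set_seq U (fun p => F p n)).
- by apply/allP => p /mapP[i _ ->].
- by apply/allP => p /mapP[i ]; rewrite mem_enum => iU ->; exact: cm.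
Qed.

Lemma periodic_set (V : comNzRingType) U (F : nat -> nat -> V) : (forall p, periodic p (F p)) ->
  periodic (rad U) (fun n => \prod_(i in U) F (q i) n).
Proof.
move=> pF n; rewrite radE !(prod_set_seq U (fun p => F p _)).
by have := @periodic_prod V [seq q i | i <- enum U] F (fun p _ => pF p) n.
Qed.

Lemma zeU_norm U n : `|zeU U n| <= 1.
Proof.
rewrite /zeU; elim/big_ind: _ => [|x y x1 y1|i _]; first by rewrite normr1.
  by rewrite normrM mulr_ile1.
exact: ze_norm.
Qed.

Lemma ze_mul_periodic q0 m : periodic q0 (fun l => ze R k q0 (m * l)).
Proof.
move=> l; rewrite mulnDr; exact: (periodicMl m (@ze_periodic R k q0)).
Qed.

Lemma zeU_mul_periodic U m : periodic (rad U) (fun l => zeU U (m * l)).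
Proof. exact: (@periodic_set _ U (fun p l => ze R k p (m * l)) (fun p => @ze_mul_periodic p m)). Qed.

Lemma zeU_mean0 U g m m' : U != set0 -> (0 < m')%N ->
  (forall i, i \in U -> coprime (q i) m') -> periodic m' g ->
  psum (rad U * m') (fun l => zeU U (m * l) * g l) = 0.
Proof.
move=> /set0Pn[i iU] m0 cm pg.
rewrite (@psum_set _ U (fun p l => ze R k p (m * l)) g) //; last by move=> p; exact: ze_mul_periodic.
by rewrite (bigD1 i) //= sum_ze ?mul0r.
Qed.

Lemma zeU_norm_mean U m :
  psum (rad U) (fun l => `|zeU U (m * l)|) <= (2 * k%:R) ^+ #|U|.
Proof.
have := @psum_set _ U (fun p l => `|ze R k p (m * l)|) (fun=> 1) 1.
rewrite muln1 => H; rewrite (_ : psum _ _ = psum (rad U) (fun n => \prod_(i in U) `|ze R k (q i) (m * n)| * 1)).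
  rewrite H //; last by move=> p l; rewrite ze_mul_periodic.
    rewrite /psum big_ord1 mulr1 -prodr_const; apply: ler_prod => i _.
    by rewrite sumr_ge0 //=; exact: sum_ze_norm.
  by move=> i _; rewrite coprimen1.
by apply: eq_bigr => l _; rewrite mulr1 normr_prod.
Qed.

End SievePrimes.

Section DivisorSums.
Variable R : realType.

Definition tau n := size (divisors n).

(** The map sending [d] to its gcd with [a] and the complementary quotient is an injection into
    pairs of divisors. *)
Lemma tauM a b : (0 < a)%N -> (0 < b)%N -> (tau (a * b) <= tau a * tau b)%N.
Proof.
move=> a0 b0; rewrite /tau.
pose f d := (gcdn d a, d %/ gcdn d a)%N.
have fi : injective f.
  by move=> x y [E1 E2]; rewrite -(divnK (dvdn_gcdl x a)) -(divnK (dvdn_gcdl y a)) E2 E1.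
rewrite -(size_map f) -(size_allpairs pair).
apply: uniq_leq_size; first by rewrite map_inj_uniq // divisors_uniq.
move=> z /mapP[d]; rewrite -dvdn_divisors ?muln_gt0 ?a0 // => dab ->.
have d0 : (0 < d)%N by apply: dvdn_gt0 dab; rewrite muln_gt0 a0.
have g0 : (0 < gcdn d a)%N by rewrite gcdn_gt0 d0.
apply: allpairs_f; rewrite -dvdn_divisors ?dvdn_gcdr //.
rewrite -(@Gauss_dvdr _ (a %/ gcdn d a)).
  rewrite -(dvdn_pmul2l g0) mulnC divnK ?dvdn_gcdl // mulnA [(gcdn d a * _)%N]mulnC divnK ?dvdn_gcdr //.
rewrite /coprime -(eqn_pmul2l g0) muln1 muln_gcdr ![(gcdn d a * (_ %/ _))%N]mulnC.
by rewrite !divnK ?dvdn_gcdl ?dvdn_gcdr.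
Qed.

(** Induction on [c]: one factor [tau n] is written as a sum over [n = d * e], and
    submultiplicativity of the others bounds the result by the square of the previous sum; hence the
    exponent [2 ^ c]. *)
Lemma sum_tau_pow c N : (0 < N)%N ->
  \sum_(1 <= n < N.+1) (tau n)%:R ^+ c / n%:R <= (1 + ln N%:R) ^+ (2 ^ c) :> R.
Proof.
move=> N0; elim: c => [|c IH].
  rewrite expr1; under eq_bigr do rewrite expr0 mul1r.
  exact: harmonic_le.
pose F d e : R := (tau (d * e))%:R ^+ c / (d * e)%:R.
have S0 : 0 <= \sum_(1 <= n < N.+1) (tau n)%:R ^+ c / n%:R :> R.
  by apply: sumr_ge0 => n _; rewrite divr_ge0 ?exprn_ge0.
apply: (@le_trans _ _ ((\sum_(1 <= n < N.+1) (tau n)%:R ^+ c / n%:R) ^+ 2)); last first.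
  by rewrite expnS mulnC exprM lerXn2r ?nnegrE // exprn_ge0 // addr_ge0 ?lnr_ge0.
have -> : \sum_(1 <= n < N.+1) (tau n)%:R ^+ c.+1 / n%:R =
  \sum_(1 <= n < N.+1) \sum_(d <- divisors n) F d (n %/ d)%N.
  apply: eq_big_nat => n /andP[n0 nN].
  rewrite (eq_big_seq (fun=> (tau n)%:R ^+ c / n%:R)); last first.
    by move=> d; rewrite -dvdn_divisors // /F => dn; rewrite [(d * _)%N]mulnC divnK.
  by rewrite big_const_seq count_predT iter_addr_0 -[RHS]mulr_natl exprS mulrA.
rewrite sum_convolution expr2 mulr_suml.
rewrite [X in X <= _]big_nat_cond [X in _ <= X]big_nat_cond; apply: ler_sum => d /andP[/andP[d0 dN] _].
rewrite mulr_sumr; apply: (@le_trans _ _ (\sum_(1 <= e < N.+1) F d e)).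
  by apply: ler_sum_nat_cond => e _; rewrite /F divr_ge0 ?exprn_ge0.
rewrite [X in X <= _]big_nat_cond [X in _ <= X]big_nat_cond; apply: ler_sum => e /andP[/andP[e0 eN] _].
rewrite /F mulrACA -invfM -natrM -exprMn -natrM; apply: ler_wpM2r; first by rewrite invr_ge0.
by rewrite lerXn2r ?nnegrE // ler_nat tauM.
Qed.

End DivisorSums.

Section Vaughan.
Variables (R : realType) (M V : nat) (f : nat -> R).
Hypotheses (f0 : forall n, (n <= V)%N -> f n = 0) (f1 : forall n, (M <= n)%N -> f n = 0).
Implicit Types (d e l m n : nat).

Definition mulo m : R := if (m <= V)%N then mu R m else 0.
Definition Lamlo d : R := if (d <= V)%N then Lam R d else 0.
Definition Lamhi d : R := if (d <= V)%N then 0 else Lam R d.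
(** By [sum_mu] this is the divisor sum of [mu] restricted to [m > V], so it vanishes for
    [1 <= e <= V]. *)
Definition vbeta e : R := (e == 1%N)%:R - \sum_(m <- divisors e) mulo m.

Lemma vbeta_lo e : (0 < e <= V)%N -> vbeta e = 0.
Proof.
move=> /andP[e0 eV]; rewrite /vbeta -(sum_mu R e0); apply/eqP; rewrite subr_eq0; apply/eqP.
apply: eq_big_seq => m; rewrite -dvdn_divisors // => /(dvdn_leq e0) H.
by rewrite /mulo (leq_trans H).
Qed.

Lemma vbeta_norm e : (0 < e)%N -> `|vbeta e| <= (tau e)%:R.
Proof.
move=> e0; rewrite /vbeta -(sum_mu R e0) -sumrB.
apply: le_trans (ler_norm_sum _ _ _) _.
apply: (@le_trans _ _ (\sum_(m <- divisors e) 1)).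
  by apply: ler_sum => m _; rewrite /mulo; case: ifP => _; rewrite ?subrr ?normr0 ?subr0 // mu_norm.
by rewrite big_const_seq count_predT iter_addr_0.
Qed.

(** As Dirichlet convolutions: [Lamhi] with [vbeta] is [Lamhi] minus its convolution with [mulo] and
    1, and [Lamhi] with 1 is [ln] minus the convolution of [Lamlo] with 1. The values of [Lam] up to
    [V] do not contribute, because [f] vanishes there. *)
Lemma vaughan : \sum_(1 <= n < M) Lam R n * f n =
  \sum_(1 <= m < M) mulo m * \sum_(1 <= l < M) ln l%:R * f (m * l)%N
  - \sum_(1 <= m < M) mulo m * \sum_(1 <= d < M) Lamlo d * \sum_(1 <= l < M) f (m * d * l)%N
  + \sum_(1 <= d < M) \sum_(1 <= e < M) Lamhi d * vbeta e * f (d * e)%N.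
Proof.
have E1 : \sum_(1 <= n < M) Lam R n * f n = \sum_(1 <= n < M) Lamhi n * f n.
  by apply: eq_bigr => n _; rewrite /Lamhi; case: leqP => // H; rewrite f0 // !mulr0.
have E2 d : (0 < d)%N -> \sum_(1 <= e < M) f (d * e)%N * \sum_(m <- divisors e) mulo m =
   \sum_(1 <= m < M) mulo m * \sum_(1 <= l < M) f (m * d * l)%N.
  move=> d0.
  transitivity (\sum_(1 <= n < M) \sum_(m <- divisors n) mulo m * f (d * (m * (n %/ m)))%N).
    apply: eq_big_nat => n /andP[n0 _]; rewrite mulr_sumr; apply: eq_big_seq => m.
    by rewrite -dvdn_divisors // => dn; rewrite mulrC [(m * _)%N]mulnC divnK.
  rewrite (sum_convolution M (fun m e => mulo m * f (d * (m * e))%N)); apply: eq_bigr => m _.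
  rewrite mulr_sumr big_mkcond; apply: eq_bigr => e _.
  rewrite mulnCA mulnA; case: ltnP => // H.
  by rewrite f1 ?mulr0 // mulnAC (leq_trans H) // leq_pmulr.
have E3 m : (0 < m)%N -> \sum_(1 <= d < M) Lam R d * \sum_(1 <= l < M) f (m * d * l)%N =
    \sum_(1 <= l < M) ln l%:R * f (m * l)%N.
  move=> m0.
  transitivity (\sum_(1 <= n < M) \sum_(d <- divisors n) Lam R d * f (m * (d * (n %/ d)))%N).
    rewrite (sum_convolution M (fun d e => Lam R d * f (m * (d * e))%N)); apply: eq_bigr => d _.
    rewrite mulr_sumr [in RHS]big_mkcond; apply: eq_bigr => e _.
    rewrite mulnA; case: ltnP => // H.
    by rewrite f1 ?mulr0 // -mulnA (leq_trans H) // leq_pmull.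
  apply: eq_big_nat => n /andP[n0 _]; rewrite -(sum_Lam R n0) mulr_suml; apply: eq_big_seq => d.
  by rewrite -dvdn_divisors // => dn; rewrite [(d * _)%N]mulnC divnK.
have E4 : \sum_(1 <= d < M) \sum_(1 <= e < M) Lamhi d * vbeta e * f (d * e)%N =
   \sum_(1 <= d < M) Lamhi d * f d -
   \sum_(1 <= d < M) Lamhi d * \sum_(1 <= m < M) mulo m * \sum_(1 <= l < M) f (m * d * l)%N.
  rewrite -sumrB; apply: eq_big_nat => d /andP[d0 dM].
  rewrite -E2 // -mulrBr; under eq_bigr do rewrite -mulrA.
  rewrite -mulr_sumr; congr (_ * _).
  rewrite (eq_bigr (fun e => (e == 1%N)%:R * f (d * e)%N -
    f (d * e)%N * \sum_(m <- divisors e) mulo m)) => [|e _]; last by rewrite /vbeta; ring.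
  rewrite sumrB; congr (_ - _); rewrite big_ltn; last exact: leq_ltn_trans d0 dM.
  rewrite eqxx mul1r muln1 big_nat_cond big1 ?addr0 // => e /andP[/andP[e1 _] _].
  by rewrite (gtn_eqF e1) mul0r.
have E5 : \sum_(1 <= m < M) mulo m * \sum_(1 <= l < M) ln l%:R * f (m * l)%N =
  \sum_(1 <= m < M) mulo m * \sum_(1 <= d < M) Lamlo d * \sum_(1 <= l < M) f (m * d * l)%N +
  \sum_(1 <= d < M) Lamhi d * \sum_(1 <= m < M) mulo m * \sum_(1 <= l < M) f (m * d * l)%N.
  have -> : \sum_(1 <= d < M) Lamhi d * \sum_(1 <= m < M) mulo m * \sum_(1 <= l < M) f (m * d * l)%N =
    \sum_(1 <= m < M) mulo m * \sum_(1 <= d < M) Lamhi d * \sum_(1 <= l < M) f (m * d * l)%N.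
    under eq_bigr do rewrite mulr_sumr.
    rewrite exchange_big; apply: eq_bigr => m _ /=; rewrite mulr_sumr.
    by apply: eq_bigr => d _; rewrite mulrCA.
  rewrite -big_split; apply: eq_big_nat => m /andP[m0 _] /=.
  rewrite -mulrDr -E3 // -big_split /=; congr (_ * _); apply: eq_bigr => d _.
  by rewrite -mulrDl /Lamlo /Lamhi; case: ifP; rewrite ?add0r ?addr0.
by rewrite E1 E4 E5; ring.
Qed.

End Vaughan.

Section Tools.
Variable R : realType.

Lemma discriminant_le (A B C : R) : 0 <= B ->
  (forall x, 0 <= x ^+ 2 * B - 2 * x * C + A) -> C ^+ 2 <= A * B.
Proof.
move=> B0' H; have [B0|B0] := ltP 0 B.
  have := H (C / B); have -> : (C / B) ^+ 2 * B - 2 * (C / B) * C + A = A - C ^+ 2 / B.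
    by field; rewrite gt_eqF.
  by rewrite subr_ge0 ler_pdivrMr.
have -> : B = 0 by apply/le_anti; rewrite B0.
rewrite mulr0; have [->|C0] := eqVneq C 0; first by rewrite expr0n.
have := H ((A + 1) / (2 * C)); have -> : B = 0 by apply/le_anti; rewrite B0.
have -> : ((A + 1) / (2 * C)) ^+ 2 * 0 - 2 * ((A + 1) / (2 * C)) * C + A = - 1 by field.
by rewrite oppr_ge0 ler10.
Qed.

Lemma cauchy_sum (J : Type) (r : seq J) (P : pred J) (t u y : J -> R) :
  (forall i, P i -> 0 <= t i) ->
  (\sum_(i <- r | P i) t i * u i * y i) ^+ 2 <=
  (\sum_(i <- r | P i) t i * u i ^+ 2) * (\sum_(i <- r | P i) t i * y i ^+ 2).
Proof.
move=> t0; apply: discriminant_le => [|x].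
  by apply: sumr_ge0 => i Pi; rewrite mulr_ge0 ?sqr_ge0 ?t0.
have -> : x ^+ 2 * (\sum_(i <- r | P i) t i * y i ^+ 2) - 2 * x * (\sum_(i <- r | P i) t i * u i * y i)
  + \sum_(i <- r | P i) t i * u i ^+ 2 = \sum_(i <- r | P i) t i * (x * y i - u i) ^+ 2.
  rewrite !mulr_sumr -sumrB -big_split /=; apply: eq_bigr => i _; ring.
by apply: sumr_ge0 => i Pi; rewrite mulr_ge0 ?sqr_ge0 ?t0.
Qed.

Lemma sum_window (F : nat -> R) u v N M : (u <= v)%N -> (N <= M)%N ->
  \sum_(u <= l < M) (if (v <= l < N)%N then F l else 0) = \sum_(v <= l < N) F l.
Proof. by move=> uv NM; rewrite -big_mkcond (big_nat_widenl v u) // (big_nat_widen _ N M). Qed.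

Lemma window_abel (x h : nat -> R) m H X v N : (0 < m)%N -> periodic m h ->
  (forall n, `|h n| <= H) -> 0 <= X -> (forall l, (v <= l < N)%N -> 0 <= x l <= X) ->
  (forall l, (v <= l)%N -> (l.+1 < N)%N -> x l.+1 <= x l) ->
  `|\sum_(v <= l < N) x l * h l - psum m h / m%:R * \sum_(v <= l < N) x l| <= X * (m%:R * (2 * H)).
Proof.
move=> m0 ph hH X0 xX xd; have H0 : 0 <= H by apply: le_trans (hH 0%N).
have mH : 0 <= m%:R * (2 * H) by rewrite !mulr_ge0.
have [vN|Nv] := ltnP v N; last by rewrite !big_geq // mulr0 subr0 normr0 mulr_ge0.
apply: (le_trans (periodic_abel m0 ph hH vN _ xd)).
  have /xX/andP[] // : (v <= N.-1 < N)%N by lia.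
apply: ler_wpM2r => //; have /xX/andP[] // : (v <= v < N)%N by rewrite leqnn.
Qed.

Lemma sum_recip_le v M : \sum_(v.+1 <= l < M) l%:R^-1 <= 1 + ln M%:R :> R.
Proof.
case: M => [|M]; first by rewrite big_geq // addr_ge0 ?lnr_ge0.
apply: (@le_trans _ _ (\sum_(1 <= l < M.+1) l%:R^-1)).
  rewrite (@big_nat_widenl _ _ _ v.+1 1) //; apply: ler_sum_nat_cond => i _; by rewrite invr_ge0.
case: M => [|M]; first by rewrite big_geq // addr_ge0 ?lnr_ge0.
apply: le_trans (harmonic_le R _) _ => //.
by rewrite lerD2l ler_lnr.
Qed.

Lemma sum_normM_le (J : finType) (P : pred J) (F G : J -> R) : (forall i, P i -> `|F i| <= G i) ->
  `|\sum_(i | P i) F i| <= \sum_(i | P i) G i.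
Proof. by move=> H; apply: le_trans (ler_norm_sum _ _ _) _; exact: ler_sum. Qed.

Lemma sum_nat_norm_le m n (F G : nat -> R) : (forall i, (m <= i < n)%N -> `|F i| <= G i) ->
  `|\sum_(m <= i < n) F i| <= \sum_(m <= i < n) G i.
Proof.
move=> H; apply: le_trans (ler_norm_sum _ _ _) _.
rewrite [X in X <= _]big_nat_cond [X in _ <= X]big_nat_cond; apply: ler_sum => i /andP[Hi _].
exact: H.
Qed.

Lemma ler_sum_nat' m n (F G : nat -> R) : (forall i, (m <= i < n)%N -> F i <= G i) ->
  \sum_(m <= i < n) F i <= \sum_(m <= i < n) G i.
Proof.
move=> H; rewrite [X in X <= _]big_nat_cond [X in _ <= X]big_nat_cond; apply: ler_sum => i /andP[Hi _].
exact: H.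
Qed.

End Tools.

Section Bilinear.
Variables (R : realType) (I : finType) (q : I -> nat) (k W b : nat).
Hypotheses (qI : injective q) (qP : forall i, prime (q i)) (qk : forall i, (k.+1 < q i)%N).
Hypotheses (qW : forall i, coprime (q i) W) (W0 : (0 < W)%N).
Variables (w : nat -> R) (N0 M V : nat) (B : R).
Hypotheses (V0 : (0 < V)%N) (VN : (V <= N0)%N) (NM : (N0 < M)%N).
Hypothesis w_ge0 : forall n, 0 <= w n.
Hypothesis w_le : forall n, (0 < n)%N -> w n <= B / n%:R.
Hypothesis w_decr : forall n n', (N0 < n)%N -> (n <= n')%N -> w n' <= w n.
Hypothesis w_ldecr : forall n n', (N0 < n)%N -> (n <= n')%N -> ln n'%:R * w n' <= ln n%:R * w n.
Hypothesis w_sqdecr : forall n n', (N0 < n)%N -> (n <= n')%N -> n'%:R * w n' ^+ 2 <= n%:R * w n ^+ 2.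
Implicit Types (U T : {set I}) (n m l d e : nat).

Let B0 : 0 <= B.
Proof. by have := w_le (ltn0Sn 0); rewrite divr1; apply: le_trans. Qed.

Let L : R := 1 + ln M%:R.
Let L1 : 1 <= L. Proof. by rewrite lerDl lnr_ge0. Qed.
Let L0 : 0 <= L. Proof. exact: le_trans ler01 L1. Qed.
Let M0 : (0 < M)%N. Proof. exact: leq_trans NM. Qed.

Definition phiW U n : R := (n == b %[mod W])%:R * zeU R q k U n.
Definition wcut n : R := if (N0 < n < M)%N then w n else 0.

Let indW_periodic m : periodic W (fun l => (m * l == b %[mod W])%:R : R).
Proof. by move=> l; rewrite mulnDr addnC modnMDl. Qed.

Lemma phi_norm U n : `|phiW U n| <= 1.
Proof.
rewrite normrM mulr_ile1 ?(zeU_norm R qk) // ger0_norm ?ler0n //; by case: (_ == _).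
Qed.

Lemma phi_norm_ze U n : `|phiW U n| <= `|zeU R q k U n|.
Proof.
rewrite normrM ger0_norm ?ler0n // -[X in _ <= X]mul1r ler_wpM2r //; by case: (_ == _).
Qed.

Lemma phi_periodic U m : periodic (rad q U * W) (fun l => phiW U (m * l)).
Proof.
move=> l; rewrite /phiW (periodicMl _ (indW_periodic m)).
by rewrite [(rad q U * W)%N]mulnC (periodicMl _ (@zeU_mul_periodic R I q k U m)).
Qed.

Lemma phi_mean0 U m : U != set0 -> psum (rad q U * W) (fun l => phiW U (m * l)) = 0.
Proof.
move=> U0; rewrite -[RHS](@zeU_mean0 R I q k qI qP qk U (fun l => (m * l == b %[mod W])%:R) m W) //.
  by apply: eq_bigr => l _; rewrite /phiW mulrC.
Qed.

Lemma fw_ge0 n : 0 <= wcut n.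
Proof. by rewrite /wcut; case: ifP. Qed.

Lemma fw_le n : (0 < n)%N -> wcut n <= B / n%:R.
Proof. by move=> n0; rewrite /wcut; case: ifP => _; [exact: w_le|rewrite divr_ge0]. Qed.

Lemma win_mul m l : (0 < m)%N -> (N0 < m * l < M)%N = ((N0 %/ m).+1 <= l < (M.-1 %/ m).+1)%N.
Proof.
move=> m0; rewrite ltn_divLR // [(l * m)%N]mulnC; congr (_ && _).
by rewrite ltnS leq_divRL // [(l * m)%N]mulnC; case: (M) M0.
Qed.

(** The long variable runs over an interval with a monotone weight, and [phiW] has mean 0 on every
    dilate, so only one period is lost, whatever [m] is. *)
Lemma type_one (x : nat -> R) X U m : U != set0 -> (0 < m)%N -> 0 <= X ->
  (forall n, (N0 < n < M)%N -> 0 <= x n <= X) ->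
  (forall n n', (N0 < n)%N -> (n <= n')%N -> x n' <= x n) ->
  `|\sum_(1 <= l < M) (if (N0 < m * l < M)%N then x (m * l)%N else 0) * phiW U (m * l)|
   <= X * ((rad q U * W)%:R * 2).
Proof.
move=> U0 m0 X0 xX xd.
rewrite (eq_big_nat _ _ (F2 := fun l => if ((N0 %/ m).+1 <= l < (M.-1 %/ m).+1)%N
   then x (m * l)%N * phiW U (m * l) else 0)); last first.
  by move=> l _; rewrite win_mul //; case: ifP => //; rewrite mul0r.
rewrite sum_window //; last by case: (M) M0 => // M' _; rewrite ltnS leq_div.
have := @window_abel R (fun l => x (m * l)%N) _ _ 1 X (N0 %/ m).+1 (M.-1 %/ m).+1 _ (phi_periodic U m) _ X0.
rewrite phi_mean0 // mul0r mul0r subr0 mulr1; apply.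
- by rewrite muln_gt0 W0 rad_gt0.
- by move=> n; exact: phi_norm.
- by move=> l H; apply: xX; rewrite win_mul.
- move=> l H _; apply: xd; last by rewrite leq_mul.
  by move: H; rewrite ltn_divLR // mulnC.
Qed.

(** The weight of [e] once the square is opened: Cauchy's inequality is applied with weight [1 / e],
    and the square of [e * G e] leaves one factor [e]. *)
Definition ker d d' e : R := e%:R * wcut (d * e) * wcut (d' * e).

Lemma ker_ge0 d d' e : 0 <= ker d d' e.
Proof. by rewrite !mulr_ge0 ?fw_ge0. Qed.

Lemma ker_le d d' e : (0 < d)%N -> (0 < d')%N -> (0 < e)%N ->
  ker d d' e <= B ^+ 2 / (d%:R * d'%:R) * e%:R^-1.
Proof.
move=> d0 d0' e0; have eR : 0 < e%:R :> R by rewrite ltr0n.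
apply: (@le_trans _ _ (e%:R * (B / (d * e)%:R) * (B / (d' * e)%:R))).
  apply: ler_pM; rewrite ?fw_ge0 ?mulr_ge0 ?fw_ge0 ?fw_le ?muln_gt0 ?d0' //.
  by apply: ler_wpM2l => //; rewrite fw_le // muln_gt0 d0.
rewrite !natrM le_eqVlt; apply/orP; left; apply/eqP; field.
by rewrite !gt_eqF ?ltr0n.
Qed.

(** Up to the constant [d * d'], the square of the kernel is a product of two values of
    [n * w n ^+ 2]; this is the purpose of [w_sqdecr]. *)
Lemma ker_decr d d' e : (0 < d)%N -> (0 < d')%N -> (N0 < d * e)%N -> (N0 < d' * e)%N ->
  e.+1%:R * w (d * e.+1) * w (d' * e.+1) <= e%:R * w (d * e) * w (d' * e).
Proof.
move=> d0 d0' H H'; have dd : 0 < d%:R * d'%:R :> R by rewrite mulr_gt0 ?ltr0n.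
have P n : 0 <= n%:R * w (d * n) * w (d' * n) by rewrite !mulr_ge0.
rewrite -(ler_sqr (P _) (P _)) -(ler_pM2l dd).
have E n : d%:R * d'%:R * (n%:R * w (d * n) * w (d' * n)) ^+ 2 =
  ((d * n)%:R * w (d * n) ^+ 2) * ((d' * n)%:R * w (d' * n) ^+ 2) by rewrite !natrM; ring.
rewrite !E; apply: ler_pM; rewrite ?mulr_ge0 ?sqr_ge0 //.
  by apply: w_sqdecr => //; rewrite leq_mul.
by apply: w_sqdecr => //; rewrite leq_mul.
Qed.

Lemma ker_abel d d' h m : (0 < d)%N -> (0 < d')%N -> (0 < m)%N -> periodic m h ->
  (forall n, `|h n| <= 1) ->
  `|\sum_(V.+1 <= e < M) ker d d' e * h e| <= `|psum m h / m%:R| * (B ^+ 2 / (d%:R * d'%:R) * L)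
     + B ^+ 2 / (d%:R * d'%:R) / V%:R * (m%:R * 2).
Proof.
move=> d0 d0' m0 ph h1; set BB := B ^+ 2 / _.
have BB0 : 0 <= BB by rewrite divr_ge0 ?sqr_ge0 ?mulr_ge0.
pose x e := e%:R * w (d * e) * w (d' * e).
pose v := (maxn V (maxn (N0 %/ d) (N0 %/ d'))).+1.
pose N := (minn (M.-1 %/ d) (M.-1 %/ d')).+1.
have NM' : (N <= M)%N.
  rewrite /N -[X in (_ <= X)%N](prednK M0) ltnS; apply: leq_trans (geq_minl _ _) (leq_div _ _).
have kE h' : \sum_(V.+1 <= e < M) ker d d' e * h' e = \sum_(v <= e < N) x e * h' e.
  rewrite -(@sum_window _ _ V.+1 v N M) //; last by rewrite ltnS leq_maxl.
  apply: eq_big_nat => e /andP[Ve eM]; rewrite /ker /wcut !win_mul //.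
  have -> : (v <= e < N)%N = ((N0 %/ d).+1 <= e < (M.-1 %/ d).+1)%N && ((N0 %/ d').+1 <= e < (M.-1 %/ d').+1)%N.
    rewrite /v /N !ltnS !gtn_max Ve /= leq_min; case: (_ < _)%N; case: (_ < _)%N; case: (_ <= _)%N => //=.
  by case: ifP => _; case: ifP => _ //=; rewrite ?(mulr0,mul0r).
have xX l : (v <= l < N)%N -> 0 <= x l <= BB / V%:R.
  move=> /andP[vl lN]; rewrite !mulr_ge0 //=.
  have Vl : (V < l)%N by apply: leq_trans vl; rewrite ltnS leq_maxl.
  have lR : (0 < l)%N by exact: leq_ltn_trans Vl.
  have -> : x l = ker d d' l.
    rewrite /ker /wcut !win_mul //; move: vl lN; rewrite /v /N !ltnS !gtn_max leq_min.
    by move=> /and3P[_ -> ->] /andP[-> ->].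
  apply: le_trans (ker_le d0 d0' lR) _; apply: ler_wpM2l => //.
  by rewrite lef_pV2 ?posrE ?ltr0n // ler_nat ltnW.
have xd l : (v <= l)%N -> (l.+1 < N)%N -> x l.+1 <= x l.
  rewrite /v !gtn_max => /and3P[_]; rewrite !ltn_divLR // ![(l * _)%N]mulnC => h2 h3 _.
  exact: ker_decr.
have A := window_abel m0 ph h1 (divr_ge0 BB0 (ler0n _ V)) xX xd.
rewrite mulr1 in A; rewrite kE -[X in `|X|](subrK (psum m h / m%:R * \sum_(v <= l < N) x l)).
apply: le_trans (ler_normD _ _) _; rewrite addrC; apply: lerD => //.
rewrite normrM; apply: ler_wpM2l => //.
have := kE (fun=> 1); under eq_bigr do rewrite mulr1; under [RHS]eq_bigr do rewrite mulr1.
move=> <-; rewrite ger0_norm; last by apply: sumr_ge0 => e _; exact: ker_ge0.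
apply: (@le_trans _ _ (\sum_(V.+1 <= e < M) BB * e%:R^-1)).
  by apply: ler_sum_nat' => e /andP[Ve _]; apply: ker_le => //; exact: leq_ltn_trans Ve.
by rewrite -mulr_sumr; apply: ler_wpM2l => //; exact: sum_recip_le.
Qed.

Definition zm U d d' : R :=
  psum (rad q U) (fun l => `|zeU R q k U (d * l)| * `|zeU R q k U (d' * l)|) / (rad q U)%:R.

Lemma rad_coprime U i m : coprime (q i) m -> i \notin U -> coprime (q i) (rad q U * m).
Proof.
move=> cm iU; rewrite coprimeMr cm andbT /rad; apply: (big_ind (coprime (q i))).
- exact: coprimen1.
- by move=> x y cx cy; rewrite coprimeMr cx.
- move=> j jU; rewrite prime_coprime // dvdn_prime2 //; apply: contraNneq iU => /qI ->; exact: jU.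
Qed.

(** The prime [q i] occurs in only one of the two sets, so by the Chinese remainder theorem its
    factor, of mean 0, splits off. *)
Lemma pair_mean0 U U' d d' i : i \in U -> i \notin U' ->
  psum (rad q U * rad q U' * W) (fun e => phiW U (d * e) * phiW U' (d' * e)) = 0.
Proof.
move=> iU iU'; have -> : (rad q U * rad q U' * W = q i * (rad q (U :\ i) * (rad q U' * W)))%N.
  by rewrite /rad (big_setD1 i) //= -!mulnA.
pose g e := (d * e == b %[mod W])%:R * zeU R q k (U :\ i) (d * e) * phiW U' (d' * e).
rewrite (_ : psum _ _ = psum (q i * (rad q (U :\ i) * (rad q U' * W)))
   (fun e => ze R k (q i) (d * e) * g e)); last first.
  by apply: eq_bigr => e _; rewrite /g {1}/phiW /zeU (big_setD1 i) //=; ring.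
rewrite psum_mul ?sum_ze ?mul0r ?muln_gt0 ?(rad_gt0 qP) ?W0 ?(prime_gt0 (qP _)) //.
- by rewrite rad_coprime ?setD11 // rad_coprime.
- exact: ze_mul_periodic.
- move=> e; rewrite /g; congr (_ * _ * _).
  + by rewrite mulnA (periodicMl _ (indW_periodic d)).
  + by rewrite [(rad q (U :\ i) * _)%N]mulnC (periodicMl _ (@zeU_mul_periodic R I q k (U :\ i) d)).
  + by rewrite (periodicMl _ (phi_periodic U' d')).
Qed.

Lemma pair_bound U U' d d' : (0 < d)%N -> (0 < d')%N ->
  `|\sum_(V.+1 <= e < M) ker d d' e * (phiW U (d * e) * phiW U' (d' * e))| <=
    (U == U')%:R * zm U d d' * (B ^+ 2 / (d%:R * d'%:R) * L)
     + B ^+ 2 / (d%:R * d'%:R) / V%:R * ((rad q U * rad q U' * W)%:R * 2).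
Proof.
move=> d0 d0'; set m := (rad q U * rad q U' * W)%N.
have m0 : (0 < m)%N by rewrite !muln_gt0 !rad_gt0.
have ph : periodic m (fun e => phiW U (d * e) * phiW U' (d' * e)).
  move=> e; congr (_ * _).
    by have -> : m = (rad q U' * (rad q U * W))%N; [rewrite /m -mulnA mulnCA|exact: (periodicMl _ (phi_periodic U d))].
  by rewrite /m -mulnA; exact: (periodicMl _ (phi_periodic U' d')).
have h1 e : `|phiW U (d * e) * phiW U' (d' * e)| <= 1 by rewrite normrM mulr_ile1 ?phi_norm.
apply: le_trans (ker_abel d0 d0' m0 ph h1) _; rewrite lerD2r; apply: ler_wpM2r.
  by rewrite mulr_ge0 // divr_ge0 ?sqr_ge0 ?mulr_ge0.
have [UE|UU'] := eqVneq U U'; last first.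
  rewrite mul0r; have -> : psum m (fun e => phiW U (d * e) * phiW U' (d' * e)) = 0; last by rewrite mul0r normr0.
  have [i ] : exists i, (i \in U) != (i \in U').
    apply/existsP; apply: contraR UU'; rewrite negb_exists => /forallP H.
    by apply/eqP/setP => i; have := H i; rewrite negbK => /eqP.
  case: (boolP (i \in U)) => iU; case: (boolP (i \in U')) => iU' // _.
    exact: pair_mean0 iU iU'.
  rewrite /m [(rad q U * _)%N]mulnC -[RHS](pair_mean0 d' d iU' iU).
  by apply: eq_bigr => e _; rewrite mulrC.
subst U'; rewrite mul1r /zm normrM normfV (@ger0_norm _ m%:R) ?ler0n //.
have mE : m = (rad q U * (rad q U * W))%N by rewrite /m mulnA.
rewrite ler_pdivrMr ?ltr0n // mE natrM mulrA divfK ?pnatr_eq0 -?lt0n ?rad_gt0 // mulr_natr.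
rewrite -(@psum_dil R (rad q U) (rad q U * W) (fun l => `|zeU R q k U (d * l)| * `|zeU R q k U (d' * l)|)) ?rad_gt0 //.
  apply: le_trans (ler_norm_sum _ _ _) _; apply: ler_sum => e _.
  by rewrite normrM ler_pM ?phi_norm_ze.
by move=> e; rewrite !(@zeU_mul_periodic R I q k U).
Qed.

Let Lh d : R := Lamhi R V d.
Let Lh_ge0 d : 0 <= Lh d. Proof. by rewrite /Lh /Lamhi; case: ifP => // _; exact: Lam_ge0. Qed.

Let Lh_le d : (0 < d < M)%N -> Lh d <= L.
Proof.
move=> /andP[d0 dM]; rewrite /Lh /Lamhi; case: ifP => // _.
apply: le_trans (Lam_le R d0) _; apply: le_trans (ler_lnr R d0 (ltnW dM)) _.
by rewrite lerDr.
Qed.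

(** A bound for the mean of [|zeU U|] over a period, from [zeU_norm_mean]. *)
Definition zmass U : R := (2 * k%:R) ^+ #|U| / (rad q U)%:R.

Lemma zmass_ge0 U : 0 <= zmass U.
Proof. by rewrite divr_ge0 ?exprn_ge0 ?mulr_ge0. Qed.

Lemma sum_Lamhi_sq : \sum_(1 <= d < M) Lh d ^+ 2 / d%:R <= L ^+ 3.
Proof.
apply: (@le_trans _ _ (\sum_(1 <= d < M) L ^+ 2 * d%:R^-1)).
  apply: ler_sum_nat' => d /andP[d0 dM]; apply: ler_wpM2r; first by rewrite invr_ge0.
  by rewrite lerXn2r ?nnegrE ?Lh_ge0 ?Lh_le ?d0.
rewrite -mulr_sumr [X in _ <= X]exprSr; apply: ler_wpM2l; first exact: sqr_ge0.
exact: sum_recip_le.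
Qed.

Lemma sum_Lamhi : \sum_(1 <= d < M) Lh d / d%:R <= L ^+ 2.
Proof.
apply: (@le_trans _ _ (\sum_(1 <= d < M) L * d%:R^-1)).
  apply: ler_sum_nat' => d /andP[d0 dM]; apply: ler_wpM2r; first by rewrite invr_ge0.
  by rewrite Lh_le ?d0.
by rewrite -mulr_sumr expr2; apply: ler_wpM2l => //; exact: sum_recip_le.
Qed.

Lemma sum_ze_recip U l :
  \sum_(V.+1 <= d < M) `|zeU R q k U (d * l)| / d%:R <= zmass U * L + 2 * (rad q U)%:R / V%:R.
Proof.
have r0 : (0 < rad q U)%N by rewrite rad_gt0.
have ph : periodic (rad q U) (fun d => `|zeU R q k U (l * d)|).
  by move=> d; rewrite (@zeU_mul_periodic R I q k U l).
have h1 d : `| `|zeU R q k U (l * d)| | <= 1 by rewrite normr_id zeU_norm.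
have V1 : 0 <= V%:R^-1 :> R by rewrite invr_ge0.
have xX d : (V.+1 <= d < M)%N -> 0 <= (d%:R^-1 : R) <= V%:R^-1.
  move=> /andP[Vd _]; rewrite invr_ge0 ler0n lef_pV2 ?posrE ?ltr0n ?(leq_trans _ Vd) //.
  by rewrite ler_nat ltnW.
have xd d : (V.+1 <= d)%N -> (d.+1 < M)%N -> d.+1%:R^-1 <= d%:R^-1 :> R.
  by move=> Vd _; rewrite lef_pV2 ?posrE ?ltr0n ?(leq_trans _ Vd) // ler_nat.
have := window_abel r0 ph h1 V1 xX xd; rewrite mulr1.
set S := \sum_(_ <= _ < _) _ * _; set T := \sum_(_ <= _ < _) _; set K := psum _ _.
have -> : \sum_(V.+1 <= d < M) `|zeU R q k U (d * l)| / d%:R = S.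
  by apply: eq_bigr => d _; rewrite mulrC [(d * l)%N]mulnC.
have TL : T <= L by exact: sum_recip_le.
have T0 : 0 <= T by apply: sumr_ge0 => d _; rewrite invr_ge0.
have KZ : K / (rad q U)%:R <= zmass U.
  by apply: ler_wpM2r; [rewrite invr_ge0|exact: zeU_norm_mean].
move=> /(le_trans (ler_norm _)); rewrite lerBlDl => /le_trans; apply; apply: lerD.
  apply: ler_pM => //; rewrite divr_ge0 //; exact: sumr_ge0.
by rewrite mulrC [_ * 2]mulrC.
Qed.

(** The double sum is the mean over [l] of the square of a sum over [d]. Cauchy's inequality takes
    one factor [zmass] from the sum over [d] and leaves another to the mean over [l]. Together they
    are of order [1 / rad ^ 2], which saves a factor [Q0] over the moduli beyond [Q0]. *)
Lemma sum_zm U : \sum_(1 <= d < M) \sum_(1 <= d' < M) (Lh d / d%:R) * (Lh d' / d'%:R) * zm U d d' <=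
  L ^+ 3 * zmass U * (zmass U * L + 2 * (rad q U)%:R / V%:R).
Proof.
have r0 : (0 < rad q U)%N by rewrite rad_gt0.
have rR : 0 < (rad q U)%:R :> R by rewrite ltr0n.
pose z d l := `|zeU R q k U (d * l)|.
have z1 d l : 0 <= z d l <= 1 by rewrite normr_ge0 zeU_norm.
set Z := zmass U * L + _.
have Z0 : 0 <= Z.
  apply: addr_ge0; first by apply: mulr_ge0 => //; exact: zmass_ge0.
  by rewrite divr_ge0 // mulr_ge0.
have -> : \sum_(1 <= d < M) \sum_(1 <= d' < M) (Lh d / d%:R) * (Lh d' / d'%:R) * zm U d d' =
   (\sum_(l < rad q U) (\sum_(1 <= d < M) (Lh d / d%:R) * z d l) ^+ 2) / (rad q U)%:R.
  rewrite mulr_suml; under [RHS]eq_bigr => l _.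
    rewrite expr2 mulr_suml mulr_suml; under eq_bigr => d _ do rewrite mulr_sumr mulr_suml.
    over.
  rewrite [RHS]exchange_big; apply: eq_bigr => d _ /=; rewrite [RHS]exchange_big; apply: eq_bigr => d' _ /=.
  rewrite /zm /psum mulr_suml mulr_sumr; apply: eq_bigr => l _; rewrite /z; ring.
rewrite ler_pdivrMr //.
apply: (@le_trans _ _ (\sum_(l < rad q U) (\sum_(1 <= d < M) Lh d ^+ 2 / d%:R * z d l) * Z)).
  apply: ler_sum => l _.
  have E : \sum_(1 <= d < M) Lh d / d%:R * z d l = \sum_(1 <= d < M | (V < d)%N) (z d l / d%:R) * Lh d * 1.
    rewrite [RHS]big_mkcond; apply: eq_bigr => d _; rewrite /Lh /Lamhi ltnNge; case: leqP => _ /=; ring.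
  rewrite E.
  have CS := @cauchy_sum R nat (index_iota 1 M) (fun d => V < d)%N (fun d => z d l / d%:R) Lh (fun=> 1).
  apply: (le_trans (CS _)) => {CS} /=.
    by move=> d _; rewrite divr_ge0 //; case/andP: (z1 d l).
  apply: ler_pM.
  - by apply: sumr_ge0 => d _; rewrite mulr_ge0 ?sqr_ge0 // divr_ge0 //; case/andP: (z1 d l).
  - by apply: sumr_ge0 => d _; rewrite mulr_ge0 ?sqr_ge0 // divr_ge0 //; case/andP: (z1 d l).
  - rewrite big_mkcond; apply: ler_sum => d _; case: ifP => _.
      by rewrite le_eqVlt; apply/orP; left; apply/eqP; ring.
    by rewrite mulr_ge0 ?divr_ge0 ?sqr_ge0 //; case/andP: (z1 d l).
  - under eq_bigr do rewrite expr1n mulr1.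
    rewrite -(big_nat_widenl V.+1 1 M xpredT) //; exact: sum_ze_recip.
rewrite -mulr_suml exchange_big /= [X in _ <= X]mulrAC; apply: ler_wpM2r => //.
apply: (@le_trans _ _ (\sum_(1 <= d < M) Lh d ^+ 2 / d%:R * (zmass U * (rad q U)%:R))).
  apply: ler_sum => d _; rewrite -mulr_sumr; apply: ler_wpM2l; first by rewrite divr_ge0 ?sqr_ge0.
  rewrite /zmass divfK ?gt_eqF //; exact: zeU_norm_mean.
rewrite -mulr_suml -[X in _ <= X]mulrA; apply: ler_wpM2r; first by apply: mulr_ge0 => //; exact: zmass_ge0.
exact: sum_Lamhi_sq.
Qed.

Section Family.
Variables (P : pred {set I}) (c : {set I} -> R) (R1 : nat).
Hypothesis PR : forall U, P U -> (rad q U <= R1)%N.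

Let Phi n := \sum_(U | P U) c U * phiW U n.
Let E : R := B ^+ 2 / V%:R * ((R1 ^ 2 * W)%:R * 2).
Let S1 : R := \sum_(U | P U) `|c U|.

Let E0 : 0 <= E.
Proof. by rewrite mulr_ge0 ?divr_ge0 ?mulr_ge0 ?sqr_ge0. Qed.

Lemma inner_bound d d' : (0 < d)%N -> (0 < d')%N ->
  `|\sum_(V.+1 <= e < M) ker d d' e * (Phi (d * e) * Phi (d' * e))| <=
  (d%:R * d'%:R)^-1 * (B ^+ 2 * L * (\sum_(U | P U) c U ^+ 2 * zm U d d') + E * S1 ^+ 2).
Proof.
move=> d0 d0'.
have -> : \sum_(V.+1 <= e < M) ker d d' e * (Phi (d * e) * Phi (d' * e)) =
  \sum_(U | P U) \sum_(U' | P U') c U * c U' *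
    \sum_(V.+1 <= e < M) ker d d' e * (phiW U (d * e) * phiW U' (d' * e)).
  under eq_bigr => e _.
    rewrite /Phi mulr_suml mulr_sumr; under eq_bigr => U _ do rewrite mulr_sumr mulr_sumr.
    over.
  rewrite exchange_big; apply: eq_bigr => U _ /=; rewrite exchange_big; apply: eq_bigr => U' _ /=.
  rewrite mulr_sumr; apply: eq_bigr => e _; ring.
set D := (d%:R * d'%:R : R); have D0 : 0 <= D^-1 by rewrite invr_ge0 mulr_ge0.
apply: (@le_trans _ _ (\sum_(U | P U) \sum_(U' | P U')
   (D^-1 * (B ^+ 2 * L) * ((U == U')%:R * (`|c U| * `|c U'| * zm U d d')) + D^-1 * E * (`|c U| * `|c U'|)))).
  apply: sum_normM_le => U PU; apply: sum_normM_le => U' PU'.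
  rewrite normrM normrM; apply: le_trans (ler_wpM2l _ (pair_bound U U' d0 d0')) _; first by rewrite mulr_ge0.
  have H : B ^+ 2 / D / V%:R * ((rad q U * rad q U' * W)%:R * 2) <= D^-1 * E.
    rewrite /E; set x := (_ * W)%:R; set y := (_ * W)%:R.
    have -> : B ^+ 2 / D / V%:R * (x * 2) = D^-1 * (B ^+ 2 / V%:R * (x * 2)) by ring.
    rewrite /x /y; apply: ler_wpM2l => //.
    apply: ler_wpM2l; first by rewrite divr_ge0 ?sqr_ge0.
    by apply: ler_wpM2r => //; rewrite ler_nat leq_mul2r -mulnn leq_mul ?PR ?orbT.
  rewrite mulrDr -/D; apply: lerD.
    by rewrite le_eqVlt; apply/orP; left; apply/eqP; ring.
  by rewrite mulrC; apply: ler_wpM2r => //; rewrite mulr_ge0.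
rewrite [X in _ <= X]mulrDr; under eq_bigr do rewrite big_split /=.
rewrite big_split /=; apply: lerD.
  rewrite [X in _ <= X]mulrA mulr_sumr; apply: ler_sum => U PU.
  rewrite (bigD1 U) //= big1 ?addr0 => [|U' /andP[_ n]]; last first.
    by rewrite eq_sym (negbTE n) mul0r mulr0.
  by rewrite eqxx mul1r -normrM ger0_norm -?expr2 ?sqr_ge0.
rewrite /S1 [X in _ <= X]mulrA expr2 mulr_suml mulr_sumr; apply: ler_sum => U PU.
by rewrite mulr_sumr mulr_sumr.
Qed.

(* Cauchy's inequality over [e] with all sets [U] inside the square: off-diagonal pairs have mean zero, so no large sieve is needed. *)
Theorem bilinear_bound :
  (\sum_(U | P U) c U * \sum_(1 <= d < M) \sum_(1 <= e < M)
      Lamhi R V d * vbeta R V e * (wcut (d * e) * phiW U (d * e))) ^+ 2 <=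
  L ^+ 4 * (B ^+ 2 * L * (\sum_(U | P U) c U ^+ 2 *
      (L ^+ 3 * zmass U * (zmass U * L + 2 * (rad q U)%:R / V%:R))) + E * S1 ^+ 2 * L ^+ 4).
Proof.
pose G e := \sum_(1 <= d < M) Lh d * (wcut (d * e) * Phi (d * e)).
have -> : \sum_(U | P U) c U * \sum_(1 <= d < M) \sum_(1 <= e < M)
      Lamhi R V d * vbeta R V e * (wcut (d * e) * phiW U (d * e)) =
   \sum_(1 <= e < M | (V < e)%N) e%:R^-1 * vbeta R V e * (e%:R * G e).
  transitivity (\sum_(1 <= e < M) vbeta R V e * G e).
    rewrite /G; under [RHS]eq_bigr => e _.
      rewrite mulr_sumr; under eq_bigr => d _ do rewrite /Phi mulr_sumr mulr_sumr mulr_sumr.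
      over.
    under [LHS]eq_bigr => U _.
      rewrite mulr_sumr; under eq_bigr => d _ do rewrite mulr_sumr.
      over.
    rewrite exchange_big [RHS]exchange_big; apply: eq_bigr => d _ /=.
    rewrite exchange_big; apply: eq_bigr => e _ /=; apply: eq_bigr => U _; rewrite /Lh; ring.
  rewrite [RHS]big_mkcond; apply: eq_big_nat => e /andP[e0 _].
  case: ltnP => H; last by rewrite vbeta_lo ?mul0r // e0.
  by rewrite mulrACA mulVf ?mul1r // pnatr_eq0 -lt0n.
have CS := @cauchy_sum R nat (index_iota 1 M) (fun e => V < e)%N (fun e => e%:R^-1) (vbeta R V)
  (fun e => e%:R * G e).
apply: (le_trans (CS _)) => {CS} /=; first by move=> e _; rewrite invr_ge0.
apply: ler_pM; try by apply: sumr_ge0 => e _; rewrite mulr_ge0 ?invr_ge0 ?sqr_ge0.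
  apply: (@le_trans _ _ (\sum_(1 <= e < M) (tau e)%:R ^+ 2 / e%:R)).
    rewrite big_mkcond; apply: ler_sum_nat' => e /andP[e0 _]; case: ifP => _.
      rewrite mulrC; apply: ler_wpM2r; first by rewrite invr_ge0.
      rewrite -[vbeta R V e ^+ 2]real_normK ?num_real // lerXn2r ?nnegrE //; exact: vbeta_norm.
    by rewrite divr_ge0 ?sqr_ge0.
  apply: le_trans (sum_tau_pow R 2 M0); apply: ler_sum_nat_widen => // e _.
  by rewrite divr_ge0 ?exprn_ge0.
have -> : \sum_(1 <= e < M | (V < e)%N) e%:R^-1 * (e%:R * G e) ^+ 2 =
  \sum_(1 <= d < M) \sum_(1 <= d' < M) Lh d * Lh d' *
     \sum_(V.+1 <= e < M) ker d d' e * (Phi (d * e) * Phi (d' * e)).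
  rewrite -(big_nat_widenl V.+1 1 M xpredT) //.
  transitivity (\sum_(V.+1 <= e < M) e%:R * (G e * G e)).
    apply: eq_big_nat => e /andP[Ve _]; have eR : e%:R != 0 :> R by rewrite pnatr_eq0 -lt0n (leq_trans _ Ve).
    by field.
  under eq_bigr => e _.
    rewrite {1}/G mulr_suml mulr_sumr; under eq_bigr => d _ do rewrite /G mulr_sumr mulr_sumr.
    over.
  rewrite exchange_big; apply: eq_bigr => d _ /=; rewrite exchange_big; apply: eq_bigr => d' _ /=.
  rewrite mulr_sumr; apply: eq_bigr => e _; rewrite /ker; ring.
apply: (@le_trans _ _ (\sum_(1 <= d < M) \sum_(1 <= d' < M) (Lh d / d%:R) * (Lh d' / d'%:R) *
   (B ^+ 2 * L * (\sum_(U | P U) c U ^+ 2 * zm U d d') + E * S1 ^+ 2))).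
  apply: ler_sum_nat' => d /andP[d0 _]; apply: ler_sum_nat' => d' /andP[d0' _].
  rewrite mulrACA -invfM -[X in _ <= X]mulrA; apply: ler_wpM2l; first by rewrite mulr_ge0.
  exact: le_trans (ler_norm _) (inner_bound d0 d0').
have -> : \sum_(1 <= d < M) \sum_(1 <= d' < M) (Lh d / d%:R) * (Lh d' / d'%:R) *
   (B ^+ 2 * L * (\sum_(U | P U) c U ^+ 2 * zm U d d') + E * S1 ^+ 2) =
  \sum_(1 <= d < M) \sum_(1 <= d' < M) (Lh d / d%:R) * (Lh d' / d'%:R) *
   (B ^+ 2 * L * (\sum_(U | P U) c U ^+ 2 * zm U d d')) +
  \sum_(1 <= d < M) \sum_(1 <= d' < M) (Lh d / d%:R) * (Lh d' / d'%:R) * (E * S1 ^+ 2).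
  rewrite -big_split; apply: eq_bigr => d _; rewrite -big_split; apply: eq_bigr => d' _.
  exact: mulrDr.
apply: lerD.
  have -> : \sum_(1 <= d < M) \sum_(1 <= d' < M) (Lh d / d%:R) * (Lh d' / d'%:R) *
     (B ^+ 2 * L * (\sum_(U | P U) c U ^+ 2 * zm U d d')) =
     B ^+ 2 * L * \sum_(U | P U) c U ^+ 2 * \sum_(1 <= d < M) \sum_(1 <= d' < M)
        (Lh d / d%:R) * (Lh d' / d'%:R) * zm U d d'.
    rewrite mulr_sumr; under [RHS]eq_bigr => U _.
      rewrite !mulr_sumr; under eq_bigr => d _ do rewrite !mulr_sumr.
      over.
    rewrite [RHS]exchange_big; apply: eq_bigr => d _ /=; rewrite [RHS]exchange_big; apply: eq_bigr => d' _ /=.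
    rewrite !mulr_sumr; apply: eq_bigr => U _; ring.
  apply: ler_wpM2l; first by rewrite mulr_ge0 ?sqr_ge0.
  by apply: ler_sum => U _; apply: ler_wpM2l; [exact: sqr_ge0|exact: sum_zm].
under eq_bigr do rewrite -mulr_suml.
rewrite -mulr_suml mulrC; apply: ler_wpM2l; first by rewrite mulr_ge0 ?sqr_ge0.
under eq_bigr do rewrite -mulr_sumr.
rewrite -mulr_suml -expr2 [X in _ <= X](_ : _ = (L ^+ 2) ^+ 2); last by rewrite -exprM.
rewrite lerXn2r ?nnegrE ?sqr_ge0 ?sum_Lamhi //.
by apply: sumr_ge0 => d _; rewrite divr_ge0.
Qed.

End Family.
End Bilinear.

Section LargeModuli.
Variables (R : realType) (I : finType) (q : I -> nat) (k W b : nat).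
Hypotheses (qI : injective q) (qP : forall i, prime (q i)) (qk : forall i, (k.+1 < q i)%N).
Hypotheses (qW : forall i, coprime (q i) W) (W0 : (0 < W)%N).
Variables (w : nat -> R) (N0 M V : nat) (B : R).
Hypotheses (V0 : (0 < V)%N) (VN : (V <= N0)%N) (NM : (N0 < M)%N).
Hypothesis w_ge0 : forall n, 0 <= w n.
Hypothesis w_le : forall n, (0 < n)%N -> w n <= B / n%:R.
Hypothesis w_decr : forall n n', (N0 < n)%N -> (n <= n')%N -> w n' <= w n.
Hypothesis w_ldecr : forall n n', (N0 < n)%N -> (n <= n')%N -> ln n'%:R * w n' <= ln n%:R * w n.
Hypothesis w_sqdecr : forall n n', (N0 < n)%N -> (n <= n')%N -> n'%:R * w n' ^+ 2 <= n%:R * w n ^+ 2.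
Implicit Types (U T : {set I}) (n m l d e : nat).

Let B0 : 0 <= B.
Proof. by have := w_le (ltn0Sn 0); rewrite divr1; apply: le_trans. Qed.

Let L : R := 1 + ln M%:R.
Let L1 : 1 <= L. Proof. by rewrite lerDl lnr_ge0. Qed.
Let L0 : 0 <= L. Proof. exact: le_trans ler01 L1. Qed.
Let N00 : (0 < N0)%N. Proof. exact: leq_trans VN. Qed.

Let phi := (@phiW R I q k W b).
Let fw := (wcut w N0 M).

Definition tsum U : R := \sum_(1 <= n < M) Lam R n * (fw n * phi U n).
Definition tbil U : R := \sum_(1 <= d < M) \sum_(1 <= e < M)
      Lamhi R V d * vbeta R V e * (fw (d * e) * phi U (d * e)).

Let ln_le_L n : (n < M)%N -> ln n%:R <= L :> R.
Proof.
case: n => [|n] nM; first by rewrite ln0 // (le_trans _ L1).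
by apply: le_trans (ler_lnr R _ (ltnW nM)) _; rewrite ?lerDr.
Qed.

Let sum_lo (F : nat -> R) X : 0 <= X -> (forall m, (0 < m < M)%N -> (m <= V)%N -> F m <= X) ->
  (forall m, (V < m)%N -> F m = 0) -> \sum_(1 <= m < M) F m <= V%:R * X.
Proof.
move=> X0 FX F0; have VM : (V.+1 <= M)%N by exact: leq_ltn_trans VN NM.
rewrite (@big_cat_nat _ _ _ V.+1) //= [X in _ + X]big_nat_cond [X in _ + X]big1 ?addr0; last first.
  by move=> m /andP[/andP[Vm _] _]; exact: F0.
apply: (@le_trans _ _ (\sum_(1 <= m < V.+1) X)).
  by apply: ler_sum_nat' => m /andP[m0 mV]; apply: FX; rewrite ?m0 //=; exact: leq_trans mV VM.
by rewrite sumr_const_nat subn1 mulr_natl.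
Qed.

Let norm_mulo m : `|mulo R V m| <= 1.
Proof. by rewrite /mulo; case: ifP => _; rewrite ?mu_norm ?normr0. Qed.

(** In the two linear sums of Vaughan's identity the short variables take at most [V ^ 2] values and
    [type_one] handles the long one. The factor [ln l] is written as [ln (m l) - ln m], so that the
    weight remains a monotone function of the product. *)
Lemma tsum_bilinear U : U != set0 ->
  `|tsum U - tbil U| <= 6 * V%:R ^+ 2 * L * W%:R * (rad q U)%:R * B / N0%:R.
Proof.
move=> U0; pose f n := fw n * phi U n.
have f0 n : (n <= V)%N -> f n = 0.
  by move=> nV; rewrite /f /fw /wcut ltnNge (leq_trans nV VN) mul0r.
have f1 n : (M <= n)%N -> f n = 0.
  by move=> nM; rewrite /f /fw /wcut [(n < M)%N]ltnNge nM andbF mul0r.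
have BN : 0 <= B / N0%:R by rewrite divr_ge0.
set r2 : R := (rad q U * W)%:R * 2.
have r20 : 0 <= r2 by rewrite mulr_ge0.
have wX n : (N0 < n < M)%N -> 0 <= w n <= B / N0%:R.
  move=> /andP[Nn _]; rewrite w_ge0 /=; apply: (le_trans (w_le (leq_trans (ltn0Sn _) Nn))).
  by apply: ler_wpM2l => //; rewrite lef_pV2 ?posrE ?ltr0n ?(leq_trans _ Nn) // ler_nat ltnW.
have lwX n : (N0 < n < M)%N -> 0 <= ln n%:R * w n <= L * (B / N0%:R).
  move=> H; have /andP[w0 w1] := wX n H; rewrite mulr_ge0 ?lnr_ge0 //=.
  by apply: ler_pM; rewrite ?lnr_ge0 // ln_le_L //; case/andP: H.
have I1 m : (0 < m)%N -> `|\sum_(1 <= l < M) f (m * l)%N| <= B / N0%:R * r2.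
  move=> m0; have := @type_one R I q k W b qI qP qk qW W0 N0 M NM w _ U m U0 m0 BN wX w_decr.
  by congr (`|_| <= _); apply: eq_bigr => l _.
have I2 m : (0 < m)%N -> `|\sum_(1 <= l < M) ln (m * l)%:R * f (m * l)%N| <= L * (B / N0%:R) * r2.
  move=> m0; have := @type_one R I q k W b qI qP qk qW W0 N0 M NM (fun n => ln n%:R * w n)
     _ U m U0 m0 (mulr_ge0 L0 BN) lwX w_ldecr; congr (`|_| <= _).
  by apply: eq_bigr => l _; rewrite /f /fw /wcut; case: ifP => _; rewrite ?mul0r ?mulr0 // mulrA.
have X1 : 0 <= 2 * L * (B / N0%:R) * r2.
  by apply: mulr_ge0 => //; apply: mulr_ge0 => //; exact: mulr_ge0.
have X2 : 0 <= B / N0%:R * r2 by exact: mulr_ge0.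
have X3 : 0 <= L * (B / N0%:R * r2) by exact: mulr_ge0.
have X4 : 0 <= V%:R * (L * (B / N0%:R * r2)) by exact: mulr_ge0.
rewrite /tsum (vaughan f0 f1) -/(tbil U) addrK.
set S1 := \sum_(1 <= m < M) _; set S2 := \sum_(1 <= m < M) _.
have H1 : `|S1| <= V%:R * (2 * L * (B / N0%:R) * r2).
  apply: (le_trans (sum_nat_norm_le (G := fun m => `|mulo R V m| * (2 * L * (B / N0%:R) * r2)) _)).
    move=> m /andP[m0 mM]; rewrite normrM; apply: ler_wpM2l => //.
    have -> : \sum_(1 <= l < M) ln l%:R * f (m * l)%N =
       \sum_(1 <= l < M) ln (m * l)%:R * f (m * l)%N - ln m%:R * \sum_(1 <= l < M) f (m * l)%N.
      rewrite mulr_sumr -sumrB; apply: eq_big_nat => l /andP[l0 _].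
      by rewrite lnrM // -mulrBl; congr (_ * _); rewrite addrC addKr.
    apply: le_trans (ler_normB _ _) _; rewrite normrM (@ger0_norm _ (ln _)) ?lnr_ge0 //.
    have H3 : ln m%:R * `|\sum_(1 <= l < M) f (m * l)%N| <= L * (B / N0%:R * r2).
      by apply: ler_pM; rewrite ?lnr_ge0 ?ln_le_L // I1.
    by have := I2 m m0; lra.
  apply: sum_lo => //.
    by move=> m _ _; rewrite -[X in _ <= X]mul1r; apply: ler_wpM2r.
  by move=> m Vm; rewrite /mulo leqNgt Vm normr0 mul0r.
have H2 : `|S2| <= V%:R * (V%:R * (L * (B / N0%:R * r2))).
  apply: (le_trans (sum_nat_norm_le (G := fun m => `|mulo R V m| * (V%:R * (L * (B / N0%:R * r2)))) _)).
    move=> m /andP[m0 mM]; rewrite normrM; apply: ler_wpM2l => //.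
    apply: (le_trans (sum_nat_norm_le (G := fun d => Lamlo R V d * (B / N0%:R * r2)) _)).
      move=> d /andP[d0 _]; rewrite normrM (@ger0_norm _ (Lamlo _ _ _)).
        apply: ler_wpM2l; first by rewrite /Lamlo; case: ifP => // _; exact: Lam_ge0.
        by apply: I1; rewrite muln_gt0 m0.
      by rewrite /Lamlo; case: ifP => // _; exact: Lam_ge0.
    apply: sum_lo => //.
      move=> d /andP[d0 dM] _; apply: ler_wpM2r => //.
      rewrite /Lamlo; case: ifP => // _; apply: (le_trans (Lam_le R d0)); exact: ln_le_L.
    by move=> d Vd; rewrite /Lamlo leqNgt Vd mul0r.
  apply: sum_lo => //.
    by move=> m _ _; rewrite -[X in _ <= X]mul1r; apply: ler_wpM2r.
  by move=> m Vm; rewrite /mulo leqNgt Vm normr0 mul0r.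
apply: le_trans (ler_normB _ _) _; apply: le_trans (lerD H1 H2) _.
have V1 : 1 <= V%:R :> R by rewrite ler1n.
have -> : 6 * V%:R ^+ 2 * L * W%:R * (rad q U)%:R * B / N0%:R =
   3 * (V%:R * V%:R) * (L * (B / N0%:R * r2)) by rewrite /r2 natrM; ring.
have -> : V%:R * (2 * L * (B / N0%:R) * r2) = 2 * V%:R * (L * (B / N0%:R * r2)) by ring.
have VV : V%:R <= V%:R * V%:R :> R by rewrite ler_peMr.
rewrite [X in _ + X]mulrA -mulrDl; apply: ler_wpM2r => //; lra.
Qed.

Definition eprod (x : R) : R := \prod_i (1 + x / (q i)%:R).

Lemma eprodE x : eprod x = \sum_(U : {set I}) x ^+ #|U| / (rad q U)%:R.
Proof.
rewrite /eprod prod_set1D; apply: eq_bigr => U _.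
rewrite prodf_div prodr_const; congr (_ / _).
by rewrite /rad natr_prod.
Qed.

Lemma eprod_le x y : 0 <= x -> x <= y -> eprod x <= eprod y.
Proof.
move=> x0 xy; apply: ler_prod => i _; rewrite addr_ge0 ?divr_ge0 //= lerD2l.
by apply: ler_wpM2r => //; rewrite invr_ge0.
Qed.

Lemma eprod_ge1 x : 0 <= x -> 1 <= eprod x.
Proof.
move=> x0; apply: le_trans (eprod_le (lexx 0) x0).
by rewrite /eprod big1 // => i _; rewrite mul0r addr0.
Qed.

Lemma sum_pow_le (P : pred {set I}) x R1 : 0 <= x -> (forall U, P U -> (rad q U <= R1)%N) ->
  \sum_(U | P U) x ^+ #|U| <= R1%:R * eprod x.
Proof.
move=> x0 PR; rewrite eprodE mulr_sumr.
apply: (@le_trans _ _ (\sum_(U | P U) R1%:R * (x ^+ #|U| / (rad q U)%:R))).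
  apply: ler_sum => U PU; rewrite mulrCA -[X in X <= _]mulr1; apply: ler_wpM2l; first exact: exprn_ge0.
  by rewrite ler_pdivlMr ?ltr0n ?rad_gt0 // mul1r ler_nat PR.
by apply: sum_set_subset => U; rewrite !mulr_ge0 ?exprn_ge0 ?invr_ge0.
Qed.

(** In the hypothesis on [X], the term [1 / Q0] comes from complete periods on the diagonal of
    [bilinear_bound], and the term over [V] from incomplete periods. *)
Lemma large_moduli (C : nat) (Q0 R1 : nat) (X : R) : (0 < k)%N -> (0 < C)%N -> (0 < Q0)%N -> (0 < R1)%N ->
  0 <= X -> Q0%:R^-1 + 4 * R1%:R ^+ 4 * W%:R / V%:R <= X ^+ 2 ->
  \sum_(U | (U != set0) && (Q0 < rad q U <= R1)%N) C%:R ^+ #|U| * `|tsum U| <=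
  B * L ^+ 5 * eprod (4 * k%:R ^+ 2 * C%:R ^+ 2) * X +
   6 * V%:R ^+ 2 * L * W%:R * R1%:R ^+ 2 * B * eprod (4 * k%:R ^+ 2 * C%:R ^+ 2) / N0%:R.
Proof.
move=> k0 C0 Q00 R10 X0 HX; pose P U := (U != set0) && (Q0 < rad q U <= R1)%N.
set x : R := 4 * _ * _; set Pi := eprod x.
have kR : 1 <= k%:R :> R by rewrite ler1n.
have CR : 1 <= C%:R :> R by rewrite ler1n.
have C0R : 0 <= C%:R :> R by [].
have PR U : P U -> (rad q U <= R1)%N by move=> /and3P[].
have Pi1 : 1 <= Pi by apply: eprod_ge1; rewrite !mulr_ge0 ?sqr_ge0.
have Pi0 : 0 <= Pi by exact: le_trans ler01 Pi1.
have kk : k%:R <= k%:R ^+ 2 :> R by rewrite expr2 ler_peMr.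
have CC : C%:R <= C%:R ^+ 2 :> R by rewrite expr2 ler_peMr.
have CC1 : 1 <= C%:R ^+ 2 :> R by lra.
have kk1 : 1 <= k%:R ^+ 2 :> R by lra.
have S1le : \sum_(U | P U) C%:R ^+ #|U| <= R1%:R * Pi.
  apply: le_trans (sum_pow_le C0R PR) _; apply: ler_wpM2l => //; apply: eprod_le => //.
  rewrite /x; nra.
(* The signs turn the sum of absolute values into a linear form, to which [bilinear_bound]
   applies. *)
pose c U : R := Num.sg (tbil U) * C%:R ^+ #|U|.
have cU U : c U ^+ 2 <= (C%:R ^+ 2) ^+ #|U|.
  rewrite /c exprMn exprAC -[X in _ <= X]mul1r; apply: ler_wpM2r; first by rewrite !exprn_ge0.
  by case: sgrP => _; rewrite ?expr0n ?sqrrN ?expr1n.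
have cN U : `|c U| <= C%:R ^+ #|U|.
  rewrite /c normrM (ger0_norm (exprn_ge0 _ C0R)) -[X in _ <= X]mul1r; apply: ler_wpM2r; first exact: exprn_ge0.
  by rewrite normr_sg; case: (_ == _).
have S1'le : \sum_(U | P U) `|c U| <= R1%:R * Pi.
  by apply: le_trans S1le; apply: ler_sum => U _; exact: cN.
have BL := @bilinear_bound R I q k W b qI qP qk qW W0 w N0 M V B V0 NM w_ge0 w_le w_sqdecr P c R1 PR.
have E1 : \sum_(U | P U) C%:R ^+ #|U| * `|tbil U| = \sum_(U | P U) c U * tbil U.
  by apply: eq_bigr => U _; rewrite /c normrEsg mulrA [_ * Num.sg _]mulrC.
have Z1 : \sum_(U | P U) c U ^+ 2 * (L ^+ 3 * zmass R q k U * (zmass R q k U * L + 2 * (rad q U)%:R / V%:R)) <=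
   L ^+ 4 * (Pi / Q0%:R) + L ^+ 3 * (2 * (R1%:R * Pi) / V%:R).
  apply: (@le_trans _ _ (\sum_(U | P U) (L ^+ 4 * (Q0%:R^-1 * (x ^+ #|U| / (rad q U)%:R)) +
      L ^+ 3 * (2 / V%:R * x ^+ #|U|)))).
    apply: ler_sum => U PU; have rR : 0 < (rad q U)%:R :> R by rewrite ltr0n rad_gt0.
    have Q0R : 0 < Q0%:R :> R by rewrite ltr0n.
    pose z : R := (2 * k%:R) ^+ #|U|; have z0 : 0 <= z by rewrite exprn_ge0 ?mulr_ge0.
    have -> : L ^+ 3 * zmass R q k U * (zmass R q k U * L + 2 * (rad q U)%:R / V%:R) =
       L ^+ 4 * (z ^+ 2 / (rad q U)%:R ^+ 2) + L ^+ 3 * (2 / V%:R * z).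
      by rewrite /zmass -/z; field; rewrite !pnatr_eq0 -!lt0n V0 rad_gt0.
    have xz : (C%:R ^+ 2) ^+ #|U| * z ^+ 2 = x ^+ #|U|.
      by rewrite /z [(2 * k%:R) ^+ _ ^+ 2]exprAC -exprMn /x; congr (_ ^+ _); ring.
    have xz1 : (C%:R ^+ 2) ^+ #|U| * z <= x ^+ #|U|.
      rewrite /z -exprMn lerXn2r ?nnegrE ?mulr_ge0 ?sqr_ge0 //.
      rewrite /x [X in _ <= X]mulrC; apply: ler_wpM2l; first exact: sqr_ge0.
      lra.
    rewrite mulrDr; apply: lerD.
      rewrite mulrCA; apply: ler_wpM2l; first exact: exprn_ge0.
      rewrite mulrA; apply: (@le_trans _ _ (x ^+ #|U| / (rad q U)%:R ^+ 2)).
        by apply: ler_wpM2r; rewrite ?invr_ge0 ?sqr_ge0 // -xz; apply: ler_wpM2r => //; exact: sqr_ge0.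
      rewrite mulrCA; apply: ler_wpM2l; first by rewrite exprn_ge0 ?mulr_ge0 ?sqr_ge0.
      rewrite expr2 invfM; apply: ler_wpM2r; first by rewrite invr_ge0 ltW.
      by rewrite lef_pV2 ?posrE // ler_nat ltnW //; case/and3P: PU.
    rewrite mulrCA; apply: ler_wpM2l; first exact: exprn_ge0.
    rewrite mulrCA; apply: ler_wpM2l; first by rewrite divr_ge0.
    by apply: le_trans xz1; apply: ler_wpM2r.
  rewrite big_split /= -!mulr_sumr; apply: lerD; apply: ler_wpM2l; rewrite ?exprn_ge0 //.
    rewrite mulrC; apply: ler_wpM2r; first by rewrite invr_ge0.
    rewrite /Pi eprodE; apply: sum_set_subset => U.
    by rewrite divr_ge0 ?exprn_ge0 ?mulr_ge0 ?sqr_ge0.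
  rewrite [X in _ <= X]mulrAC; apply: ler_wpM2l; first by rewrite divr_ge0.
  by apply: sum_pow_le => //; rewrite !mulr_ge0 ?sqr_ge0.
have RHS : \sum_(U | P U) C%:R ^+ #|U| * `|tbil U| <= B * L ^+ 5 * Pi * X.
  have l0 : 0 <= \sum_(U | P U) C%:R ^+ #|U| * `|tbil U|.
    by apply: sumr_ge0 => U _; rewrite mulr_ge0 ?exprn_ge0.
  have r0 : 0 <= B * L ^+ 5 * Pi * X by rewrite !mulr_ge0 ?exprn_ge0.
  rewrite -(ler_sqr l0 r0) E1; apply: (le_trans BL).
  have S2 : (\sum_(U | P U) `|c U|) ^+ 2 <= (R1%:R * Pi) ^+ 2.
    by rewrite lerXn2r ?nnegrE ?mulr_ge0 //; apply: sumr_ge0.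
  set E := B ^+ 2 / V%:R * _; have E0 : 0 <= E by rewrite mulr_ge0 ?divr_ge0 ?mulr_ge0 ?sqr_ge0.
  apply: (@le_trans _ _ (L ^+ 4 * (B ^+ 2 * L * (L ^+ 4 * (Pi / Q0%:R) + L ^+ 3 * (2 * (R1%:R * Pi) / V%:R)) +
     E * (R1%:R * Pi) ^+ 2 * L ^+ 4))).
    apply: ler_wpM2l; first exact: exprn_ge0.
    apply: lerD; first by apply: ler_wpM2l => //; rewrite mulr_ge0 ?sqr_ge0.
    by apply: ler_wpM2r; [exact: exprn_ge0|exact: ler_wpM2l].
  have -> : (B * L ^+ 5 * Pi * X) ^+ 2 = B ^+ 2 * L ^+ 10 * Pi ^+ 2 * X ^+ 2 by ring.
  apply: (@le_trans _ _ (B ^+ 2 * L ^+ 10 * Pi ^+ 2 * (Q0%:R^-1 + 4 * R1%:R ^+ 4 * W%:R / V%:R))); last first.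
    by apply: ler_wpM2l; rewrite ?mulr_ge0 ?exprn_ge0.
  have -> : L ^+ 4 * (B ^+ 2 * L * (L ^+ 4 * (Pi / Q0%:R) + L ^+ 3 * (2 * (R1%:R * Pi) / V%:R)) +
     E * (R1%:R * Pi) ^+ 2 * L ^+ 4) =
     B ^+ 2 * (L ^+ 9 * (Pi / Q0%:R) + L ^+ 8 * ((2 * (R1%:R * Pi) + 2 * R1%:R ^+ 4 * W%:R * Pi ^+ 2) / V%:R)).
    by rewrite /E natrM natrX; ring.
  have -> : B ^+ 2 * L ^+ 10 * Pi ^+ 2 * (Q0%:R^-1 + 4 * R1%:R ^+ 4 * W%:R / V%:R) =
     B ^+ 2 * (L ^+ 10 * (Pi ^+ 2 / Q0%:R) + L ^+ 10 * (4 * R1%:R ^+ 4 * W%:R * Pi ^+ 2 / V%:R)) by ring.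
  apply: ler_wpM2l; first exact: sqr_ge0.
  have L89 : L ^+ 8 <= L ^+ 10 by rewrite ler_weXn2l.
  have L99 : L ^+ 9 <= L ^+ 10 by rewrite ler_weXn2l.
  have PiPi : Pi <= Pi ^+ 2 by rewrite expr2 ler_peMr.
  have R1R : 1 <= R1%:R :> R by rewrite ler1n.
  have W1R : 1 <= W%:R :> R by rewrite ler1n.
  have R4 : R1%:R <= R1%:R ^+ 4 * W%:R :> R.
    rewrite -[X in X <= _]mulr1; apply: ler_pM => //.
    by rewrite -[X in X <= _]expr1 ler_weXn2l.
  have Vi : 0 <= V%:R^-1 :> R by rewrite invr_ge0.
  have W4 : 0 <= R1%:R ^+ 4 * W%:R :> R by rewrite mulr_ge0 ?exprn_ge0.
  have W5 : 0 <= R1%:R ^+ 4 * W%:R * Pi ^+ 2 by rewrite mulr_ge0 ?sqr_ge0.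
  have W6 : 0 <= R1%:R * Pi by rewrite mulr_ge0.
  have W7 : 0 <= 2 * (R1%:R * Pi) + 2 * R1%:R ^+ 4 * W%:R * Pi ^+ 2.
    by rewrite -!mulrA in W5 *; lra.
  apply: lerD.
    apply: ler_pM => //; rewrite ?exprn_ge0 ?divr_ge0 //.
    by apply: ler_wpM2r => //; rewrite invr_ge0.
  apply: ler_pM => //; rewrite ?exprn_ge0 //; first by rewrite divr_ge0.
  apply: ler_wpM2r => //.
  by have := ler_pM (ler0n R R1) Pi0 R4 PiPi; rewrite -!mulrA; lra.
apply: (@le_trans _ _ (\sum_(U | P U) (C%:R ^+ #|U| * `|tbil U| +
   C%:R ^+ #|U| * (6 * V%:R ^+ 2 * L * W%:R * R1%:R * B / N0%:R)))).
  apply: ler_sum => U PU; rewrite -mulrDr; apply: ler_wpM2l; first exact: exprn_ge0.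
  rewrite -[X in `|X|](subrK (tbil U)) addrC; apply: (le_trans (ler_normD _ _)); rewrite lerD2l.
  apply: le_trans (tsum_bilinear _) _; first by case/andP: PU.
  apply: ler_wpM2r; first by rewrite invr_ge0.
  apply: ler_wpM2r => //; apply: ler_wpM2l; last by rewrite ler_nat PR.
  by rewrite !mulr_ge0 ?exprn_ge0.
rewrite big_split /= -mulr_suml; apply: lerD => //.
apply: (@le_trans _ _ (R1%:R * Pi * (6 * V%:R ^+ 2 * L * W%:R * R1%:R * B / N0%:R))).
  apply: ler_wpM2r => //; rewrite divr_ge0 //; do 2 apply: mulr_ge0 => //.
  by apply: mulr_ge0 => //; rewrite !mulr_ge0 ?sqr_ge0.
by rewrite le_eqVlt; apply/orP; left; apply/eqP; ring.
Qed.

End LargeModuli.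

(** * Small moduli and the window *)

Section MeanZero.
Variable R : realType.

(** A function supported on residues prime to [m] expands in characters. The principal one has
    coefficient [psum m f = 0], and the number [T] of characters cancels, so that [m * H] is all
    that the coefficients cost. *)
Lemma mean_zero_sum (m j : nat) (s H delta : R) (f : nat -> R) : (1 < m)%N -> 0 <= delta ->
  (forall chi, dchar m chi -> nonprincipal m chi ->
     exists M0, forall M, (M0 <= M)%N -> nc (As chi s j M) <= delta) ->
  periodic m f -> (forall n, `|f n| <= H) -> (forall n, ~~ coprime n m -> f n = 0) ->
  psum m f = 0 ->
  exists M0, forall M, (M0 <= M)%N ->
    `|\sum_(1 <= n < M) Lam R n * wt j s n * f n| <= m%:R * H * delta.
Proof.
move=> m1 d0 Hchi pf fH f0 ps; have [T [X [T0 DX OX]]] := dchar_basis R m1.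
have H0 : 0 <= H by apply: le_trans (fH 0%N).
pose c k : R[i] := \sum_(a < m) (f a)%:C * (X k a)^*.
have cle k : nc (c k) <= m%:R * H.
  apply: le_trans (nc_sum _ _ _) _.
  apply: (@le_trans _ _ (\sum_(a < m) H)); last by rewrite sumr_const card_ord mulr_natl.
  apply: ler_sum => a _; rewrite ncM ncJ nc_real -[X in _ <= X]mulr1; apply: ler_pM => //.
    exact: nc_ge0.
  have [_ _ h1 h0] := DX k; have [ca|ca] := boolP (coprime a m); first by rewrite h1.
  by rewrite h0 // nc0.
have cf n : T%:R * (f n)%:C = \sum_(k < T) c k * X k n.
  rewrite /c; under eq_bigr do rewrite mulr_suml.
  have m0 : (0 < m)%N by exact: ltnW.
  rewrite exchange_big /= (bigD1 (Ordinal (ltn_pmod n m0))) //= [X in _ + X]big1 => [|a an].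
    rewrite addr0.
    have [cn|cn] := boolP (coprime n m).
      have := OX (n %% m)%N n _; rewrite coprime_modl => /(_ cn); rewrite modn_mod eqxx mulr1 => E.
      by under eq_bigr do rewrite -mulrA; rewrite -mulr_sumr E periodic_mod // mulrC.
    by rewrite f0 // periodic_mod // f0 // mulr0 big1 // => k _; rewrite !mul0r.
  have [ca|ca] := boolP (coprime a m).
    under eq_bigr do rewrite -mulrA; rewrite -mulr_sumr OX //.
    case: eqP => [E|]; last by rewrite mulr0 mulr0.
    by case/eqP: an; apply: val_inj; rewrite /= E modn_small.
  by rewrite big1 // => k _; rewrite f0 // !mul0r.
have Hk k : exists M0, forall M, (M0 <= M)%N -> nc (c k * As (X k) s j M) <= m%:R * H * delta.
  have [NP|P] := pselect (nonprincipal m (X k)).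
    have [M0 HM] := Hchi _ (DX k) NP; exists M0 => M MM; rewrite ncM; apply: ler_pM => //.
    - exact: nc_ge0.
    - exact: nc_ge0.
    - exact: HM.
  have ck0 : c k = 0.
    transitivity ((psum m f)%:C); last by rewrite ps rmorph0.
    rewrite /c /psum rmorph_sum; apply: eq_bigr => a _ /=.
    have [ca|ca] := boolP (coprime a m); last by rewrite f0 // rmorph0 mul0r.
    suff -> : X k a = 1 by rewrite rmorph1 mulr1.
    by apply: contra_notP P => XA; exists (nat_of_ord a).
  by exists 0%N => M _; rewrite ck0 mul0r nc0 !mulr_ge0.
have [M0 HM0] := choice Hk.
exists (\max_(k < T) M0 k) => M MM.
have TR : 0 < T%:R :> R by rewrite ltr0n.
rewrite -(ler_pM2l TR) -nc_real.
have -> : T%:R * nc (\sum_(1 <= n < M) Lam R n * wt j s n * f n)%:C =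
   nc (\sum_(k < T) c k * As (X k) s j M).
  have -> : T%:R = nc (T%:R : R[i]) by rewrite -(rmorph_nat (real_complex R)) nc_real ger0_norm.
  rewrite -ncM rmorph_sum mulr_sumr; congr nc.
  rewrite /As; under [RHS]eq_bigr do rewrite mulr_sumr.
  rewrite exchange_big; apply: eq_bigr => n _ /=.
  rewrite [in LHS]rmorphM /= mulrCA cf mulr_sumr; apply: eq_bigr => k _; rewrite mulrCA //.
apply: le_trans (nc_sum _ _ _) _.
apply: (@le_trans _ _ (\sum_(k < T) m%:R * H * delta)); last by rewrite sumr_const card_ord -[X in X <= _]mulr_natl.
by apply: ler_sum => k _; apply: HM0; apply: leq_trans MM; exact: leq_bigmax.
Qed.

End MeanZero.

Section Scale.
Variables (R : realType) (i : nat).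
Let j := (10 * i)%N.
(** [Y = 2 ^ j = 1024 ^ i = 1 / ei i]. Since [j] is the binary logarithm of [Y], every factor
    [c ^+ j] is a fixed power of [Y], and all losses and gains can be counted in such powers. *)
Definition Ysc : R := 2 ^+ j.
Let Y := Ysc.
Let w := wt j (1 + ei R i).

Lemma Y_gt0 : 0 < Y. Proof. exact: exprn_gt0. Qed.
Lemma eiE : ei R i = Y^-1.
Proof. by rewrite /ei /Y /Ysc pow1024 -exprM mulnC. Qed.
Lemma wtE n : (0 < n)%N -> w n = ln n%:R ^+ j / j`!%:R * nexp (ei R i) n / n%:R.
Proof. by move=> n0; rewrite /w /wt nexpD nexp1 //; ring. Qed.

Lemma wt_scale_le n : (0 < n)%N -> w n <= Y ^+ j / n%:R.
Proof.
move=> n0; rewrite wtE //; apply: ler_wpM2r; first by rewrite invr_ge0.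
have := @pow_fact_le R (ln n%:R) Y j (lnr_ge0 _ _) Y_gt0 => H.
apply: (@le_trans _ _ (Y ^+ j * expR (ln n%:R / Y) * nexp (ei R i) n)).
  by apply: ler_wpM2r; [exact: nexp_ge0|].
by rewrite /nexp eiE -mulrA [Y^-1 * _]mulrC expRxMexpNx_1 mulr1.
Qed.

(** For [ln n <= j Y / h] the inequality [j ^ j / j! <= expR 1 ^+ j] bounds the logarithmic factor
    by [(expR 1 * Y / h) ^+ j]; the gain [h ^ (- j)] is as large a power of [Y] as desired. *)
Lemma lower_tail (h : R) N0 : 0 < h -> (0 < N0)%N -> h * ln N0%:R <= j%:R * Y ->
  \sum_(1 <= n < N0.+1) Lam R n * w n <= (Y * (expR 1 / h)) ^+ j * (6 * expR 1 * Y).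
Proof.
move=> h0 N00 HN; have e0 : 0 < ei R i := ei_gt0 R i.
apply: (@le_trans _ _ (\sum_(1 <= n < N0.+1) (Y * (expR 1 / h)) ^+ j * (Lam R n * nexp (1 + ei R i) n))).
  apply: ler_sum_nat' => n /andP[n0 nN]; rewrite [X in _ <= X]mulrCA; apply: ler_wpM2l; first exact: Lam_ge0.
  rewrite /w /wt; apply: ler_wpM2r; first exact: nexp_ge0.
  have ln_le : ln n%:R <= j%:R * (Y / h).
    by rewrite mulrA ler_pdivlMr // mulrC; apply: le_trans HN; rewrite ler_pM2l // ler_lnr.
  apply: (@le_trans _ _ ((j%:R * (Y / h)) ^+ j / j`!%:R)).
    apply: ler_wpM2r; first by rewrite invr_ge0.
    have P0 : 0 <= j%:R * (Y / h) by rewrite mulr_ge0 // divr_ge0 // ltW // Y_gt0.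
    by rewrite lerXn2r ?nnegrE ?lnr_ge0.
  have := @pow_fact_le R j%:R 1 j (ler0n _ _) ltr01; rewrite expr1n mul1r divr1 => H.
  have -> : Y * (expR 1 / h) = expR 1 * (Y / h) by ring.
  rewrite [X in X / _]exprMn [X in _ <= X]exprMn mulrAC; apply: ler_wpM2r; first by rewrite exprn_ge0 // divr_ge0 // ltW // Y_gt0.
  by apply: (le_trans H); rewrite -expRM_natl mulr1.
rewrite -mulr_sumr; apply: ler_wpM2l.
  by rewrite exprn_ge0 // mulr_ge0 ?(ltW Y_gt0) // divr_ge0 ?expR_ge0 // ltW.
apply: le_trans (sum_Lam_le _ e0 (ei_le1 R i)) _.
by rewrite eiE invrK.
Qed.

(** [wt_tail] at [ln n >= h j Y]: for large [h] the decay [expR (- (h / 4)) ^+ j] beats the loss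
    [4 ^+ j]. *)
Lemma upper_tail (h : R) N1 M : (0 < N1)%N -> h * (j%:R * Y) <= ln N1%:R ->
  \sum_(N1 <= n < M) Lam R n * w n <= (Y * (4 * expR (- (h / 4)))) ^+ j * (12 * expR 1 * Y).
Proof.
move=> N10 HN; have e0 : 0 < ei R i := ei_gt0 R i.
have [NM|MN] := ltnP N1 M; last first.
  rewrite big_geq // mulr_ge0 ?exprn_ge0 ?mulr_ge0 ?expR_ge0 ?(ltW Y_gt0) //.
apply: (@le_trans _ _ (\sum_(1 <= n < M) (Y * (4 * expR (- (h / 4)))) ^+ j * (Lam R n * nexp (1 + ei R i / 2) n))).
  have P0 n : 0 <= (Y * (4 * expR (- (h / 4)))) ^+ j * (Lam R n * nexp (1 + ei R i / 2) n).
    apply: mulr_ge0; first by rewrite exprn_ge0 // !mulr_ge0 ?expR_ge0 ?(ltW Y_gt0).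
    by apply: mulr_ge0; [exact: Lam_ge0|exact: nexp_ge0].
  rewrite (@big_cat_nat _ _ _ N1 1) //=; last exact: ltnW.
  rewrite -[X in X <= _]add0r; apply: lerD; first exact: sumr_ge0.
  apply: ler_sum_nat' => n /andP[Nn nM]; rewrite [X in _ <= X]mulrCA; apply: ler_wpM2l; first exact: Lam_ge0.
  apply: le_trans (wt_tail j e0 N10 Nn) _; apply: ler_wpM2r; first exact: nexp_ge0.
  have Y0 := Y_gt0; rewrite eiE invrK.
  have -> : (Y * (4 * expR (- (h / 4)))) ^+ j = (4 * Y) ^+ j * expR (- (h / 4)) ^+ j.
    by rewrite -exprMn; congr (_ ^+ _); ring.
  apply: ler_wpM2l; first by rewrite exprn_ge0 // mulr_ge0 // ltW.
  rewrite /nexp -expRM_natl ler_expR mulrN lerN2.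
  have H : h * j%:R <= ln N1%:R / Y by rewrite ler_pdivlMr // -mulrA.
  have -> : Y^-1 / 4 * ln N1%:R = ln N1%:R / Y / 4 by ring.
  by rewrite mulrA [j%:R * h]mulrC; apply: ler_wpM2r; rewrite ?invr_ge0.
rewrite -mulr_sumr; apply: ler_wpM2l.
  by rewrite exprn_ge0 // !mulr_ge0 ?expR_ge0 ?(ltW Y_gt0).
have e1 := ei_le1 R i.
apply: le_trans (sum_Lam_le _ _ _) _; [lra|lra|].
by rewrite eiE invf_div invrK le_eqVlt; apply/orP; left; apply/eqP; ring.
Qed.

Lemma fact_le_pow n : (n`! <= n ^ n)%N.
Proof.
elim: n => // n IH; rewrite factS expnS leq_mul2l /=; apply: leq_trans IH _.
by case: n => // n; rewrite leq_exp2r.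
Qed.

(** Inside the window the weight falls short of the bound in [wt_scale_le] by a factor [c ^+ j]
    only, a fixed power of [Y]. *)
Lemma window_wt (th : R) n : 0 < th -> th < 1 -> (0 < n)%N -> th * (j%:R * Y) < ln n%:R ->
   ln n%:R <= j%:R * Y / th -> Y ^+ j * (th * expR (- th^-1)) ^+ j / n%:R <= w n.
Proof.
move=> t0 t1 n0 l1 l2; rewrite wtE //; apply: ler_wpM2r; first by rewrite invr_ge0.
have Y0 := Y_gt0.
rewrite -exprMn mulrA exprMn; apply: ler_pM.
- by rewrite exprn_ge0 // mulr_ge0 // ltW.
- by rewrite exprn_ge0 // expR_ge0.
- rewrite ler_pdivlMr ?ltr0n ?fact_gt0 //.
  apply: (@le_trans _ _ ((Y * th) ^+ j * (j ^ j)%:R)).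
    by apply: ler_wpM2l; [rewrite exprn_ge0 // mulr_ge0 // ltW|rewrite ler_nat fact_le_pow].
  rewrite natrX -exprMn lerXn2r ?nnegrE ?lnr_ge0 ?mulr_ge0 ?(ltW Y0) ?(ltW t0) //.
  have -> : Y * th * j%:R = th * (j%:R * Y) by ring.
  exact: ltW.
- rewrite -expRM_natl /nexp ler_expR mulrN lerN2 eiE mulrC.
  by rewrite ler_pdivrMr // mulrAC.
Qed.

Let wE n : w n = ln n%:R ^+ j / j`!%:R * nexp (1 + ei R i) n. Proof. by []. Qed.
Let s0 : 0 <= 1 + ei R i. Proof. by rewrite addr_ge0 // ltW // ei_gt0. Qed.
Let s1 : 1 <= 1 + ei R i. Proof. by rewrite lerDl ltW // ei_gt0. Qed.

Section Monotone.
Variable N0 : nat.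
Hypothesis HN : 2 * j.+1%:R <= ln N0%:R :> R.

Let N00 : (0 < N0)%N.
Proof.
case: N0 HN => // HN'; exfalso; move: HN'; rewrite ln0 //.
have : 0 < j.+1%:R :> R by rewrite ltr0n.
lra.
Qed.

Let ln_big n : (N0 < n)%N -> 2 * j.+1%:R <= ln n%:R :> R.
Proof. by move=> Nn; apply: le_trans HN _; rewrite ler_lnr // ltnW. Qed.

Let big_cond n a : (N0 < n)%N -> (a <= 2 * j.+1)%N -> a%:R <= (1 + ei R i) * ln n%:R.
Proof.
move=> Nn aj; have l0 := lnr_ge0 R n.
apply: (@le_trans _ _ (2 * j.+1)%:R); first by rewrite ler_nat.
rewrite natrM; apply: le_trans (ln_big Nn) _.
by rewrite -[X in X <= _]mul1r; apply: ler_wpM2r.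
Qed.

Lemma scale_decr n n' : (N0 < n)%N -> (n <= n')%N -> w n' <= w n.
Proof.
move=> Nn nn; apply: wt_decr => //; last exact: leq_trans Nn.
by apply: big_cond => //; lia.
Qed.

Lemma scale_ldecr n n' : (N0 < n)%N -> (n <= n')%N -> ln n'%:R * w n' <= ln n%:R * w n.
Proof.
move=> Nn nn; rewrite /w !ln_wt; apply: ler_wpM2l => //; apply: wt_decr => //; last exact: leq_trans Nn.
by apply: big_cond => //; lia.
Qed.

(** [n * w n ^+ 2] is proportional to [ln n ^+ (2 j) * n ^ (- 1 - 2 e)], which decreases from
    [ln n = 2 j] on; hence the 2 in the hypothesis on [N0]. *)
Lemma scale_sqdecr n n' : (N0 < n)%N -> (n <= n')%N -> n'%:R * w n' ^+ 2 <= n%:R * w n ^+ 2.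
Proof.
move=> Nn nn; have n0 : (0 < n)%N by exact: leq_trans Nn.
have E m : (0 < m)%N -> m%:R * w m ^+ 2 = (j`!%:R ^+ 2)^-1 *
    (ln m%:R ^+ (2 * j) * expR (- ((1 + 2 * ei R i) * ln m%:R))).
  move=> m0; rewrite wE /nexp -[X in X * _](@lnK R m%:R) ?posrE ?ltr0n //.
  have -> : - ((1 + 2 * ei R i) * ln m%:R) = ln m%:R + 2%:R * (- ((1 + ei R i) * ln m%:R)) by ring.
  rewrite expRD expRM_natl mulnC exprM !exprMn exprVn; ring.
have e0 := ei_gt0 R i.
rewrite !E //; last exact: leq_trans nn.
apply: ler_wpM2l; first by rewrite invr_ge0 sqr_ge0.
apply: pow_exp_decr; rewrite ?lnr_ge0 ?ler_lnr //; first lra.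
have l0 := lnr_ge0 R n.
apply: (@le_trans _ _ (ln n%:R)); last by rewrite -[X in X <= _]mul1r; apply: ler_wpM2r => //; lra.
apply: le_trans (ln_big Nn); rewrite natrM ler_pM2l // ler_nat; exact: leqnSn.
Qed.

End Monotone.

Lemma scale_ge0 n : 0 <= w n.
Proof. exact: wt_ge0. Qed.

Section Window.
Variables (N0 M W : nat) (tl delta : R) (Q : nat).
Hypotheses (NM : (N0 < M)%N) (W1 : (1 < W)%N) (WN : (W <= N0)%N) (WQ : (W <= Q)%N).
Hypothesis Hlow : \sum_(1 <= n < N0.+1) Lam R n * w n <= tl.
Hypothesis Hup : forall M', \sum_(M <= n < M') Lam R n * w n <= tl.
Hypothesis d0 : 0 <= delta.
Hypothesis Hchi : forall m chi, (0 < m <= Q)%N -> dchar m chi -> nonprincipal m chi ->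
  exists M0, forall M', (M0 <= M')%N -> nc (As chi (1 + ei R i) j M') <= delta.

Let fw := wcut w N0 M.

Let LW_ge0 n : 0 <= Lam R n * w n.
Proof. by apply: mulr_ge0; [exact: Lam_ge0|exact: scale_ge0]. Qed.

Let Lamfw_ge0 n : 0 <= Lam R n * fw n.
Proof. by apply: mulr_ge0; [exact: Lam_ge0|apply: fw_ge0; exact: scale_ge0]. Qed.

Lemma window_sum (f : nat -> R) M' : (forall n, `|f n| <= 1) -> (M <= M')%N ->
  `|\sum_(1 <= n < M) Lam R n * (fw n * f n)| <= `|\sum_(1 <= n < M') Lam R n * w n * f n| + 2 * tl.
Proof.
move=> f1 MM; have N0M' : (N0.+1 <= M')%N by exact: leq_trans MM.
have -> : \sum_(1 <= n < M) Lam R n * (fw n * f n) = \sum_(N0.+1 <= n < M) Lam R n * w n * f n.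
  rewrite (@big_cat_nat _ _ _ N0.+1) //= big_nat big1 ?add0r => [|n /andP[_ nN]].
    by apply: eq_big_nat => n H; rewrite /fw /wcut H mulrA.
  by rewrite /fw /wcut ltnNge -ltnS nN mul0r mulr0.
rewrite [X in _ <= `|X| + _](@big_cat_nat _ _ _ N0.+1) //= [X in _ <= `|_ + X| + _](@big_cat_nat _ _ _ M) //=.
set a := \sum_(1 <= _ < _) _; set m := \sum_(N0.+1 <= _ < _) _; set c := \sum_(M <= _ < _) _.
have B u v : `|\sum_(u <= n < v) Lam R n * w n * f n| <= \sum_(u <= n < v) Lam R n * w n.
  apply: sum_nat_norm_le => n _; rewrite normrM (ger0_norm (LW_ge0 n)) -[X in _ <= X]mulr1.
  exact: ler_wpM2l.
have ha : `|a| <= tl := le_trans (B _ _) Hlow.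
have hc : `|c| <= tl := le_trans (B _ _) (Hup M').
rewrite [X in `|X| <= _](_ : m = (a + (m + c)) - a - c); last by ring.
by apply: le_trans (ler_normB _ _) _; have := ler_normB (a + (m + c)) a; lra.
Qed.

(** The character estimates hold for sums up to a sufficiently large [M']; the window differs from
    such a sum by the two tails. *)
Lemma window_mean_zero m (f : nat -> R) : (1 < m <= Q)%N -> periodic m f -> (forall n, `|f n| <= 1) ->
  (forall n, ~~ coprime n m -> f n = 0) -> psum m f = 0 ->
  `|\sum_(1 <= n < M) Lam R n * (fw n * f n)| <= m%:R * delta + 2 * tl.
Proof.
move=> /andP[m1 mQ] pf f1 f0 ps.
have H chi : dchar m chi -> nonprincipal m chi ->
  exists M0, forall M', (M0 <= M')%N -> nc (As chi (1 + ei R i) j M') <= delta.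
  by apply: Hchi; rewrite mQ ltnW.
have [M0 HM] := mean_zero_sum m1 d0 H pf f1 f0 ps.
apply: le_trans (window_sum f1 (leq_maxl M M0)) _; rewrite lerD2r.
by apply: le_trans (HM _ (leq_maxr M M0)) _; rewrite mulr1.
Qed.

Definition nonprime_mass : R := \sum_(1 <= n < M | ~~ prime n) Lam R n * fw n.
Definition class_mass b : R := \sum_(1 <= n < M) Lam R n * (fw n * (n == b %[mod W])%:R).

(** The difference of the two class indicators has mean 0, so no main term for primes in
    progressions has to be computed. *)
Lemma class_mass_close b b' : coprime b W -> coprime b' W ->
  `|class_mass b' - class_mass b| <= W%:R * delta + 2 * tl.
Proof.
move=> cb cb'; pose f n : R := (n == b' %[mod W])%:R - (n == b %[mod W])%:R.
have -> : class_mass b' - class_mass b = \sum_(1 <= n < M) Lam R n * (fw n * f n).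
  by rewrite /class_mass -sumrB; apply: eq_bigr => n _; rewrite /f; ring.
apply: window_mean_zero; rewrite ?W1 //.
- by move=> n; rewrite /f modnDr.
- by move=> n; rewrite /f; case: (_ == _); case: (_ == _); rewrite /= ?subrr ?subr0 ?sub0r ?normrN ?normr0 ?normr1.
- move=> n cn; rewrite /f; have H c : coprime c W -> (n == c %[mod W]) = false.
    by move=> cc; apply: contraNF cn => /eqP E; rewrite -coprime_modl E coprime_modl.
  by rewrite !H // subrr.
- have H c : psum W (fun n => (n == c %[mod W])%:R : R) = 1.
    have W0 : (0 < W)%N by exact: ltnW.
    rewrite /psum (bigD1 (Ordinal (ltn_pmod c W0))) //= modn_mod eqxx big1 ?addr0 // => a an.
    case: eqP => // E; case/eqP: an; apply: val_inj => /=; rewrite -E modn_small //.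
  by rewrite /f /psum sumrB; have := H b; have := H b'; rewrite /psum => -> ->; rewrite subrr.
Qed.

(** The reduced classes share the mass almost equally, while a class not prime to [W] contains no
    prime beyond [N0 >= W]. *)
Lemma class_mass_lower b : coprime b W ->
  \sum_(1 <= n < M) Lam R n * fw n <=
  nonprime_mass + W%:R * (class_mass b + (W%:R * delta + 2 * tl)).
Proof.
move=> cb; have W0 : (0 < W)%N by exact: ltnW.
have sum1 n : \sum_(c < W) (n == c %[mod W])%:R = 1 :> R.
  rewrite (bigD1 (Ordinal (ltn_pmod n W0))) //= modn_mod eqxx big1 ?addr0 // => a an.
  case: eqP => // E; case/eqP: an; apply: val_inj => /=; rewrite E modn_small //.
have -> : \sum_(1 <= n < M) Lam R n * fw n = \sum_(c < W) class_mass c.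
  rewrite /class_mass exchange_big; apply: eq_bigr => n _ /=.
  by rewrite -mulr_sumr -mulr_sumr sum1 mulr1.
have cm0 c : 0 <= class_mass c.
  by apply: sumr_ge0 => n _; rewrite mulrA mulr_ge0 ?Lamfw_ge0.
rewrite (bigID (fun c : 'I_W => coprime c W)) /= addrC; apply: lerD.
  rewrite /class_mass exchange_big /nonprime_mass [X in _ <= X]big_mkcond /=.
  apply: ler_sum_nat' => n /andP[n0 nM].
  case: ifP => pn.
    rewrite -mulr_sumr -mulr_sumr mulrA -[X in _ <= X]mulr1; apply: ler_wpM2l; first exact: Lamfw_ge0.
    by rewrite -[X in _ <= X](sum1 n) [X in _ <= X](bigID (fun c : 'I_W => coprime c W)) /= lerDr; apply: sumr_ge0.
  rewrite -mulr_sumr -mulr_sumr; have [nN|Nn] := leqP n N0.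
    by rewrite /fw /wcut ltnNge nN mul0r mulr0.
  rewrite big1 ?mulr0 // => c cc; case: eqP => // E; case/negP: cc.
  rewrite -coprime_modl -E coprime_modl prime_coprime; last by apply: negbFE.
  by apply/negP => /(dvdn_leq W0); rewrite leqNgt (leq_ltn_trans WN).
apply: (@le_trans _ _ (\sum_(c < W | coprime c W) (class_mass b + (W%:R * delta + 2 * tl)))).
  apply: ler_sum => c cc; rewrite -lerBlDl; exact: le_trans (ler_norm _) (class_mass_close cb cc).
have X0 : 0 <= class_mass b + (W%:R * delta + 2 * tl).
  apply: addr_ge0 => //; exact: le_trans (normr_ge0 _) (class_mass_close cb cb).
rewrite sumr_const -[X in X <= _]mulr_natl; apply: ler_wpM2r => //.
by rewrite ler_nat; apply: leq_trans (max_card _) _; rewrite card_ord.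
Qed.

Lemma small_modulus (I : finType) (q : I -> nat) (k b : nat) (U : {set I}) :
  injective q -> (forall t, prime (q t)) -> (forall t, (k.+1 < q t)%N) ->
  (forall t, coprime (q t) W) -> coprime b W -> U != set0 -> (rad q U * W <= Q)%N ->
  `|tsum q k W b w N0 M U| <= (rad q U * W)%:R * delta + 2 * tl.
Proof.
move=> qI qP qk qW cb U0 rQ; have W0 : (0 < W)%N by exact: ltnW.
have r0 := rad_gt0 qP U.
apply: window_mean_zero.
- by rewrite rQ andbT (leq_trans W1) // leq_pmull.
- by move=> n; have := @phi_periodic R I q k W b U 1 n; rewrite !mul1n.
- by move=> n; exact: phi_norm.
- move=> n; rewrite coprimeMr negb_and => /orP[cn|cn]; rewrite /phiW; last first.
    have -> : (n == b %[mod W]) = false; last by rewrite mul0r.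
    by apply: contraNF cn => /eqP E; rewrite -coprime_modl E coprime_modl.
  have [t tU tn] : exists2 t, t \in U & (q t %| n)%N.
    apply/exists_inP; apply: contraR cn; rewrite negb_exists_in => /forall_inP H.
    rewrite /rad; apply: (big_ind (coprime n)); [exact: coprimen1| |].
      by move=> x y cx cy; rewrite coprimeMr cx.
    by move=> t tU; rewrite coprime_sym prime_coprime // H.
  by rewrite /zeU (bigD1 t) //= ze_dvd ?mul0r ?mulr0 // ltnW.
- have := @phi_mean0 R I q k W b qI qP qk qW W0 U 1 U0.
  by rewrite /psum; under eq_bigr do rewrite mul1n.
Qed.

End Window.

End Scale.

(** [Lam_window] at [e = 1 / (j Y)], with the weight bounded below by [window_wt]. *)
Lemma full_mass_lower (R : realType) : exists (C : nat) (h : R), 0 < h /\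
  exists i0 : nat, forall i N0 M, (i0 <= i)%N -> (0 < N0)%N ->
    h * ln N0%:R <= (10 * i)%:R * Ysc R i -> h * ((10 * i)%:R * Ysc R i) <= ln M%:R ->
    Ysc R i ^+ (10 * i) / Ysc R i ^+ C <=
     \sum_(1 <= n < M) Lam R n * wcut (wt (10 * i) (1 + ei R i)) N0 M n.
Proof.
have [th [c [t0 t1 c0 HW]]] := Lam_window R.
(* With this [C] the loss [(th * expR (- th^-1)) ^+ j] of the window is at worst [Y ^ (- C)]. *)
have [C HC] : exists C, (2 ^+ C)^-1 <= th * expR (- th^-1).
  have P : 0 < th * expR (- th^-1) by rewrite mulr_gt0 ?expR_gt0.
  have [C HC] := poly_lt_exp (th * expR (- th^-1))^-1 0.
  exists C; have := HC C (leqnn _); rewrite expr0 mulr1 => /ltW.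
  by rewrite -lef_pV2 ?posrE ?invr_gt0 ?exprn_gt0 // invrK.
have tp : 0 < th^-1 by rewrite invr_gt0.
have th1 : 1 < th^-1 by rewrite invf_gt1.
exists C, (2 * th^-1); split; first by rewrite mulr_gt0.
have [i1 Hi1] := poly_lt_exp (c^-1 + th^-1) 0.
exists i1.+1 => i N0 M ii N00 HN0 HM; set j := (10 * i)%N; set Y := Ysc R i.
have Y0 : 0 < Y := Y_gt0 R i.
have i0 : (0 < i)%N by exact: leq_ltn_trans ii.
have j1 : 1 <= j%:R :> R by rewrite ler1n muln_gt0.
have Yi : c^-1 + th^-1 <= Y.
  have := Hi1 i (ltnW ii); rewrite expr0 mulr1 => /ltW/le_trans; apply.
  by rewrite /Y /Ysc ler_weXn2l ?ler1n // leq_pmull.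
have jY : c^-1 + th^-1 <= j%:R * Y by apply: (le_trans Yi); rewrite ler_peMl // ltW.
have cp : 0 < c^-1 by rewrite invr_gt0.
have jY0 : 0 < j%:R * Y by lra.
have M1 : (0 < M)%N.
  case: (M) HM => // HM; exfalso; move: HM; rewrite ln0 // leNgt => /negP[].
  by apply: mulr_gt0 => //; exact: mulr_gt0.
have := HW (j%:R * Y)^-1 M; rewrite invr_gt0 jY0 => /(_ isT).
rewrite -[th]invrK lef_pV2 ?posrE ?invr_gt0 //.
rewrite !invrK => /(_ _)/(_ _).
have h1 : th^-1 <= j%:R * Y by lra.
have h2 : expR (j%:R * Y) < M%:R.
  rewrite -[X in _ < X](@lnK R) ?posrE ?ltr0n // ltr_expR; apply: lt_le_trans HM.
  have : 1 * (j%:R * Y) < th^-1 * (j%:R * Y) by rewrite ltr_pM2r.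
  have : 0 < th^-1 * (j%:R * Y) by rewrite mulr_gt0.
  rewrite -/j -/Y mul1r -[2 / th * _]mulrA; lra.
move=> /(_ h1 h2) H.
have e1 : 1 <= c * (j%:R * Y).
  have := ler_wpM2l (ltW c0) jY; have := mulr_gt0 c0 tp.
  rewrite mulrDr mulfV ?gt_eqF //; lra.
apply: (@le_trans _ _ (\sum_(1 <= n < M | (th * (j%:R * Y) < ln n%:R) && (ln n%:R <= (j%:R * Y) / th))
   Lam R n * (Y ^+ j * (th * expR (- th^-1)) ^+ j / n%:R))); last first.
  rewrite big_mkcond; apply: ler_sum_nat' => n /andP[n0 nM]; case: ifP => [/andP[l1 l2]|_]; last first.
    by apply: mulr_ge0; [exact: Lam_ge0|apply: fw_ge0 => m; exact: scale_ge0].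
  apply: ler_wpM2l; first exact: Lam_ge0.
  rewrite /wcut nM andbT; have -> : (N0 < n)%N; last exact: window_wt.
  rewrite ltnNge; apply/negP => nN; have := ler_lnr R n0 nN; move: HN0.
  rewrite -mulrA -ler_pdivlMl // [th^-1 * _]mulrC ler_pdivrMr //.
  have : 0 < th * (j%:R * Y) by rewrite mulr_gt0.
  rewrite -/j -/Y [2^-1 * _ * th]mulrAC; lra.
have E : \sum_(1 <= n < M | (th * (j%:R * Y) < ln n%:R) && (ln n%:R <= (j%:R * Y) / th))
   Lam R n * (Y ^+ j * (th * expR (- th^-1)) ^+ j / n%:R) =
   Y ^+ j * (th * expR (- th^-1)) ^+ j *
   \sum_(1 <= n < M | (th * (j%:R * Y) < ln n%:R) && (ln n%:R <= (j%:R * Y) / th)) Lam R n / n%:R.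
  by rewrite mulr_sumr; apply: eq_bigr => n _; ring.
rewrite E -mulrA; apply: ler_wpM2l; first by rewrite exprn_ge0 // ltW.
rewrite -[X in X <= _]mulr1; apply: ler_pM => //; first by rewrite invr_ge0 exprn_ge0 // ltW.
  rewrite /Y /Ysc -/j -exprM mulnC exprM -exprVn lerXn2r ?nnegrE ?invr_ge0 ?exprn_ge0 //.
  by rewrite mulr_ge0 ?expR_ge0 // ltW.
by apply: le_trans e1 _; apply: le_trans H _; rewrite invf_div.
Qed.

(** * The Selberg sieve with penalties *)

Section QuadraticForm.
Variables (R : realType) (I : finType) (g : I -> R).
Hypothesis g01 : forall i, 0 <= g i <= 1.
Implicit Types (S T U : {set I}) (x : I -> R) (y t : {set I} -> R).

Let g0 i : 0 <= g i. Proof. by case/andP: (g01 i). Qed.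
Let g1 i : g i <= 1. Proof. by case/andP: (g01 i). Qed.

Lemma sum_set_prod (F : I -> bool -> R) :
  \sum_(T : {set I}) \prod_i F i (i \in T) = \prod_i (F i true + F i false).
Proof.
rewrite bigA_distr; apply: eq_bigr => T _; apply: eq_bigr => i _.
by case: (i \in T).
Qed.

Lemma prod_in_set (F : I -> R) T : \prod_(i in T) F i = \prod_i (if i \in T then F i else 1).
Proof. by rewrite big_mkcond. Qed.

(* Multiplication table of the variables [x i] that satisfy [x^2 = (1 - 2 g) x + g (1 - g)], as [ze] does away from multiples of [q]. *)
Definition cf1 i (a b r : bool) : R :=
  if a then (if b then (if r then 1 - 2 * g i else g i * (1 - g i)) else r%:R)
  else (if b then r%:R else (~~ r)%:R).
Definition cf T T' S : R := \prod_i cf1 i (i \in T) (i \in T') (i \in S).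

Lemma prod_mulE x T T' : (forall i, x i ^+ 2 = (1 - 2 * g i) * x i + g i * (1 - g i)) ->
  (\prod_(i in T) x i) * (\prod_(i in T') x i) = \sum_S cf T T' S * \prod_(i in S) x i.
Proof.
move=> xx; rewrite !prod_in_set -big_split /=.
under [RHS]eq_bigr => S _ do rewrite /cf prod_in_set -big_split /=.
rewrite (sum_set_prod (fun i r => cf1 i (i \in T) (i \in T') r * if r then x i else 1)).
apply: eq_bigr => i _; rewrite /cf1; have := xx i; rewrite expr2 => H.
by case: (i \in T); case: (i \in T'); rewrite ?H /= ?mul1r ?mulr1 ?mul0r ?addr0 ?add0r.
Qed.

(** The square of the sieve sum with coefficients [y], expanded by the multiplication table, with
    each product over [S] replaced by [t S]. For [t = tauS] it is a weighted sum of squares, see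
    [sum_quadratic]. *)
Definition qform y t : R := \sum_T \sum_T' y T * y T' * \sum_S cf T T' S * t S.

(** The variables behave like independent ones of mean 0 and variance [g * (1 - g)]: products over
    distinct sets are orthogonal. *)
Lemma cf_set0 T T' : cf T T' set0 = (T == T')%:R * \prod_(i in T) (g i * (1 - g i)).
Proof.
have [<-|TT] := eqVneq T T'.
  rewrite mul1r prod_in_set; apply: eq_bigr => i _.
  by rewrite /cf1 inE; case: (i \in T).
rewrite mul0r; have [i Hi] : exists i, (i \in T) != (i \in T').
  apply/existsP; apply: contraR TT; rewrite negb_exists => /forallP H.
  by apply/eqP/setP => i; have := H i; rewrite negbK => /eqP.
rewrite /cf (bigD1 i) //= /cf1 inE; move: Hi.
by case: (i \in T); case: (i \in T') => //=; rewrite mul0r.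
Qed.

Lemma cf_support T T' S : cf T T' S != 0 -> S \subset T :|: T'.
Proof.
move=> H; apply/subsetP => i iS; rewrite inE; apply: contraNT H; rewrite negb_or => /andP[iT iT'].
by rewrite /cf (bigD1 i) //= /cf1 (negbTE iT) (negbTE iT') iS mul0r.
Qed.

Lemma qformD y t t' : qform y (fun S => t S + t' S) = qform y t + qform y t'.
Proof.
rewrite -big_split; apply: eq_bigr => T _; rewrite -big_split; apply: eq_bigr => T' _ /=.
by rewrite -mulrDr -big_split; congr (_ * _); apply: eq_bigr => S _; rewrite mulrDr.
Qed.

Lemma qform_delta y (X : R) : qform y (fun S => if S == set0 then X else 0) =
  X * \sum_T y T ^+ 2 * \prod_(i in T) (g i * (1 - g i)).
Proof.
rewrite mulr_sumr; apply: eq_bigr => T _.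
rewrite (bigD1 T) //= [X in _ + X]big1 ?addr0 => [|T' TT].
  rewrite (bigD1 set0) //= big1 ?addr0 => [|S /negbTE ->]; last by rewrite mulr0.
  by rewrite cf_set0 !eqxx mul1r; ring.
rewrite (bigD1 set0) //= big1 ?addr0 => [|S /negbTE ->]; last by rewrite mulr0.
by rewrite cf_set0 eq_sym (negbTE TT) mul0r mul0r mulr0.
Qed.

(** An index of [S] lies in [T], in [T'] or in both, which weighs at most [c + c + c ^+ 2]. An index
    outside [S] lies in both or in neither, which weighs at most [1 + c ^+ 2 * g i]. *)
Lemma qform_bound y t (c : R) (P : pred {set I}) : 0 <= c -> (forall T, `|y T| <= c ^+ #|T|) ->
  (forall T T' S, y T != 0 -> y T' != 0 -> S \subset T :|: T' -> P S) ->
  `|qform y t| <= \prod_i (1 + c ^+ 2 * g i) * \sum_(S | P S) (2 * c + c ^+ 2) ^+ #|S| * `|t S|.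
Proof.
move=> c0 yc HP; pose a1 i (a b r : bool) : R := c ^+ a * c ^+ b *
  (if a then (if b then (if r then 1 else g i) else r%:R) else (if b then r%:R else (~~ r)%:R)).
have a10 i a b r : 0 <= a1 i a b r.
  by apply: mulr_ge0; [rewrite mulr_ge0 ?exprn_ge0|case: a; case: b; case: r].
have cT T : c ^+ #|T| = \prod_i c ^+ (i \in T).
  rewrite -prodr_const prod_in_set; apply: eq_bigr => i _; by case: (i \in T).
apply: (@le_trans _ _ (\sum_(T : {set I}) \sum_(T' : {set I}) \sum_(S | P S) (\prod_i a1 i (i \in T) (i \in T') (i \in S)) * `|t S|)).
  apply: sum_normM_le => T _; apply: sum_normM_le => T' _.
  have r0 : 0 <= \sum_(S | P S) (\prod_i a1 i (i \in T) (i \in T') (i \in S)) * `|t S|.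
    by apply: sumr_ge0 => S _; rewrite mulr_ge0 ?prodr_ge0.
  have [yT|yT] := eqVneq (y T) 0; first by rewrite yT !mul0r normr0.
  have [yT'|yT'] := eqVneq (y T') 0; first by rewrite yT' mulr0 mul0r normr0.
  rewrite (bigID P) /= [X in _ * (_ + X)]big1 ?addr0 => [|S PS]; last first.
    have [-> |H] := eqVneq (cf T T' S) 0; first by rewrite mul0r.
    by case/negP: PS; exact: HP yT yT' (cf_support H).
  rewrite mulr_sumr; apply: sum_normM_le => S _; rewrite mulrA normrM; apply: ler_wpM2r => //.
  rewrite !normrM; apply: (@le_trans _ _ (c ^+ #|T| * c ^+ #|T'| *
    \prod_i (if i \in T then (if i \in T' then (if i \in S then 1 else g i) else (i \in S)%:R) else
      (if i \in T' then (i \in S)%:R else (i \notin S)%:R)))).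
    apply: ler_pM; rewrite ?mulr_ge0 ?normr_ge0 //; first by apply: ler_pM.
    rewrite normr_prod; apply: ler_prod => i _; rewrite normr_ge0 /= /cf1.
    have gi0 := g0 i; have gi1 := g1 i.
    case: (i \in T); case: (i \in T'); case: (i \in S); rewrite /= ?normr0 ?normr1 //.
      by rewrite ler_norml; apply/andP; split; lra.
    rewrite ger0_norm; last by rewrite mulr_ge0 // subr_ge0.
    by rewrite -[X in _ <= X]mulr1; apply: ler_wpM2l => //; lra.
  rewrite !cT -!big_split /=; apply: ler_prod => i _; rewrite lexx andbT.
  exact: (a10 i (i \in T) (i \in T') (i \in S)).
have -> : \sum_(T : {set I}) \sum_(T' : {set I}) \sum_(S | P S) (\prod_i a1 i (i \in T) (i \in T') (i \in S)) * `|t S| =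
  \sum_(S | P S) (\prod_i (a1 i true true (i \in S) + a1 i true false (i \in S) +
                   (a1 i false true (i \in S) + a1 i false false (i \in S)))) * `|t S|.
  under eq_bigr do rewrite exchange_big /=.
  rewrite exchange_big; apply: eq_bigr => S _ /=.
  under eq_bigr do rewrite -mulr_suml; rewrite -mulr_suml; congr (_ * _).
  under [LHS]eq_bigr => T _ do rewrite (sum_set_prod (fun i b => a1 i (i \in T) b (i \in S))).
  by rewrite (sum_set_prod (fun i a => a1 i a true (i \in S) + a1 i a false (i \in S))).
rewrite mulr_sumr; apply: ler_sum => S _; rewrite mulrA; apply: ler_wpM2r => //.
rewrite -prodr_const prod_in_set -big_split /=; apply: ler_prod => i _.
have c2 : 0 <= c ^+ 2 by exact: sqr_ge0.
have cg : 0 <= c ^+ 2 * g i by rewrite mulr_ge0.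
apply/andP; split; first by do 2 (apply: addr_ge0; try exact: addr_ge0).
rewrite /a1; case: (i \in S) => /=; rewrite ?expr0 ?expr1 ?mul1r ?mulr1 ?mulr0 ?addr0 ?add0r.
  rewrite -expr2; have : 0 <= (c ^+ 2 * g i) * (2 * c + c ^+ 2) by rewrite mulr_ge0 // addr_ge0 // mulr_ge0.
  rewrite mulrDl mul1r; lra.
by rewrite -expr2 addrC.
Qed.

End QuadraticForm.

Section SelbergMass.
Variables (R : realType) (I : finType) (q : I -> nat) (k : nat).
Hypotheses (qP : forall i, prime (q i)) (qk : forall i, (k.+1 < q i)%N).
Variable (u m : nat) (K : R).
Hypotheses (u1 : 1 <= ln u%:R :> R) (m0 : (0 < m)%N).
Hypothesis HK : forall z, 1 <= ln z%:R :> R ->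
  \sum_(i | (q i <= z)%N) ln (q i)%:R / (q i)%:R <= K * ln z%:R.
Hypothesis mK : 8 * k%:R * K <= m%:R.
Hypothesis qD : forall i, (q i <= u ^ m)%N.
Implicit Types (S T U : {set I}).

Let g i : R := zg R k (q i).
Let h i : R := g i / (1 - g i).
Let D := (u ^ m)%N.
Let lD : R := ln D%:R.

Let lDE : lD = m%:R * ln u%:R.
Proof.
have u0 : (0 < u)%N by case: u u1 => //; rewrite ln0 // => H; have := lt_le_trans ltr01 H; rewrite ltxx.
by rewrite /lD /D natrX lnXn ?ltr0n // mulr_natl.
Qed.

Let m1 : 1 <= m%:R :> R. Proof. by rewrite ler1n. Qed.
Let lD1 : 1 <= lD. Proof. by rewrite lDE; apply: le_trans u1 _; rewrite ler_peMl // (le_trans ler01). Qed.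
Let lD0 : 0 < lD. Proof. exact: lt_le_trans ltr01 lD1. Qed.

Lemma gE i : g i = k%:R / ((q i)%:R - 1).
Proof. by rewrite /g /zg -subn1 natrB // prime_gt0. Qed.

Let qR i : k%:R + 2 <= (q i)%:R :> R.
Proof. by have := qk i; rewrite -(ler_nat R) -addn2 natrD. Qed.

Let k0 : 0 <= k%:R :> R. Proof. exact: ler0n. Qed.

Lemma g_bounds i : 0 <= g i /\ (k%:R + 1)^-1 <= 1 - g i.
Proof.
have H := qR i; have k0' := k0; split; first exact: zg_ge0.
have p1 : 0 < (q i)%:R - 1 :> R by lra.
have p2 : 0 < k%:R + 1 :> R by lra.
rewrite gE -[X in _ <= X - _](@divff _ ((q i)%:R - 1)) ?gt_eqF // -mulrBl.
rewrite -[X in X <= _]mul1r ler_pdivrMr // mulrAC ler_pdivlMr // mul1r.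
have : 0 <= k%:R * ((q i)%:R - 1 - k%:R - 1) :> R by rewrite mulr_ge0 //; lra.
nra.
Qed.

Lemma g_le i : g i <= 2 * k%:R / (q i)%:R.
Proof.
have H := qR i; have k0' := k0; rewrite gE ler_pdivlMr; last lra.
rewrite mulrAC ler_pdivrMr; last lra.
have : 0 <= k%:R * ((q i)%:R - 2) :> R by rewrite mulr_ge0 //; lra.
nra.
Qed.

Let gg i : 0 < 1 - g i.
Proof.
have [_ H] := g_bounds i; apply: lt_le_trans H; rewrite invr_gt0; have := k0; lra.
Qed.

Lemma h_ge0 i : 0 <= h i.
Proof. by apply: divr_ge0; [case: (g_bounds i)|exact: ltW]. Qed.

Lemma h_le i : h i <= (k%:R + 1) * (2 * k%:R) / (q i)%:R.
Proof.
have [g0 g1] := g_bounds i; rewrite /h mulrC -mulrA; apply: ler_pM => //.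
- by rewrite invr_ge0 ltW.
- rewrite -[X in _ <= X]invrK lef_pV2 ?posrE ?invr_gt0 //; have := k0; lra.
- exact: g_le.
Qed.

(* Selberg's weights in the variables that diagonalise the main term; [Csel] comes from Rankin's trick. *)
Definition Fw T : R := Num.max 0 (1 - ln (rad q T)%:R / lD).
Definition hprod T : R := \prod_(i in T) h i.

Lemma hprod_ge0 T : 0 <= hprod T.
Proof. by apply: prodr_ge0 => i _; exact: h_ge0. Qed.

Lemma Fw_01 T : 0 <= Fw T <= 1.
Proof.
by rewrite /Fw le_max lexx ge_max ler01 /= gerBl divr_ge0 ?lnr_ge0 // ltW.
Qed.

Lemma Fw_supp T : Fw T != 0 -> (rad q T <= D)%N.
Proof.
apply: contraNT; rewrite -ltnNge => H; apply/eqP; rewrite /Fw; apply/max_idPl.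
rewrite subr_le0 ler_pdivlMr // mul1r; apply: ler_lnr; last exact: ltnW.
by rewrite lt0n; apply/eqP => D0; move: lD0; rewrite /lD D0 ln0 // ltxx.
Qed.

Lemma ln_rad T : ln (rad q T)%:R = \sum_(i in T) ln (q i)%:R :> R.
Proof.
suff [] : (0 < rad q T)%N /\ ln (rad q T)%:R = \sum_(i in T) ln (q i)%:R :> R by [].
rewrite /rad; elim/big_rec2: _ => [|i y x _ [x0 IH]]; first by rewrite ln1.
split; first by rewrite muln_gt0 prime_gt0.
by rewrite (@lnrM R _ _ (prime_gt0 (qP i)) x0) IH.
Qed.

Lemma Fw_diff T i : i \notin T -> `|Fw T - Fw (i |: T)| <= ln (q i)%:R / lD.
Proof.
move=> iT; have l0 : 0 <= ln (q i)%:R / lD by rewrite divr_ge0 ?lnr_ge0 // ltW.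
have E : ln (rad q (i |: T))%:R / lD = ln (q i)%:R / lD + ln (rad q T)%:R / lD.
  by rewrite !ln_rad big_setU1 //= mulrDl.
rewrite /Fw E; set a := ln (rad q T)%:R / lD; rewrite !maxElt.
case: ltP => h1; case: ltP => h2; rewrite ler_norml; apply/andP; split; lra.
Qed.

Definition Smass : R := \sum_T hprod T * Fw T ^+ 2.
Definition Csel : R := 8 * expR (2 * k%:R * (k%:R + 1) * K * m%:R).

Lemma Smass_ge1 : 1 <= Smass.
Proof.
rewrite /Smass (bigD1 set0) //= /hprod big_set0 mul1r /Fw ln_rad big_set0 mul0r subr0.
rewrite max_r // expr1n lerDl; apply: sumr_ge0 => T _; apply: mulr_ge0; last exact: sqr_ge0.
exact: hprod_ge0.
Qed.

(** Primes between [u] and [u ^ m] enlarge the product by the bounded exponential in [Csel]. For the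
    primes up to [u], [mK] makes the mean of [ln (rad T)] at most [lD / 4]; by Markov's inequality
    half of the mass has [ln (rad T) <= lD / 2], where [Fw T >= 1 / 2]. The factors 2 and 4 lost
    here give the 8. *)
Lemma hprod_total : \prod_i (1 + h i) <= Csel * Smass.
Proof.
pose hu i := if (q i <= u)%N then h i else 0.
have hu0 i : 0 <= hu i by rewrite /hu; case: ifP => // _; exact: h_ge0.
pose Hu := \prod_i (1 + hu i).
have Hu0 : 0 <= Hu by apply: prodr_ge0 => i _; rewrite addr_ge0.
have u0 : 0 < ln u%:R :> R := lt_le_trans ltr01 u1.
have K0 : 0 <= K * ln u%:R.
  by apply: le_trans (HK u1); apply: sumr_ge0 => i _; rewrite divr_ge0 ?lnr_ge0.
have K0' : 0 <= K by move: K0; rewrite pmulr_lge0.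
have S1 : \prod_i (1 + h i) <= Hu * expR (2 * k%:R * (k%:R + 1) * K * m%:R).
  have -> : \prod_i (1 + h i) = Hu * \prod_(i | (u < q i)%N) (1 + h i).
    rewrite /Hu [X in _ = _ * X]big_mkcond -big_split /=; apply: eq_bigr => i _.
    by rewrite /hu ltnNge; case: (_ <= _)%N; rewrite /= ?mulr1 ?addr0 ?mul1r.
  apply: ler_wpM2l => //.
  apply: (@le_trans _ _ (\prod_(i | (u < q i)%N) expR (h i))).
    by apply: ler_prod => i _; rewrite addr_ge0 ?h_ge0 //= expR_ge1Dx.
  rewrite -expR_sum ler_expR.
  apply: (@le_trans _ _ (\sum_(i | (u < q i)%N) (k%:R + 1) * (2 * k%:R) / ln u%:R * (ln (q i)%:R / (q i)%:R))).
    apply: ler_sum => i uq; apply: le_trans (h_le i) _.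
    have q0 : 0 < (q i)%:R :> R by rewrite ltr0n prime_gt0.
    have lq : ln u%:R <= ln (q i)%:R :> R.
      by apply: ler_lnr; [case: (u) u0 => //; rewrite ln0 // ltxx|exact: ltnW].
    rewrite -[X in _ <= X]mulrA; apply: ler_wpM2l; first by rewrite !mulr_ge0 ?addr_ge0.
    by rewrite mulrA; apply: ler_peMl; rewrite ?invr_ge0 ?(ltW q0) // ler_pdivlMl // mulr1.
  rewrite -mulr_sumr.
  apply: (@le_trans _ _ ((k%:R + 1) * (2 * k%:R) / ln u%:R * (K * lD))).
    apply: ler_wpM2l; first by rewrite divr_ge0 ?mulr_ge0 ?addr_ge0 // ltW.
    apply: le_trans (HK lD1); rewrite big_mkcond [X in _ <= X]big_mkcond; apply: ler_sum => i _.
    by rewrite qD; case: ifP => // _; rewrite divr_ge0 ?lnr_ge0.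
  rewrite lDE le_eqVlt; apply/orP; left; apply/eqP; field; by rewrite gt_eqF.
have S2 : \sum_(T : {set I}) (\prod_(i in T) hu i) * ln (rad q T)%:R <= Hu * (lD / 4).
  have -> : \sum_(T : {set I}) (\prod_(i in T) hu i) * ln (rad q T)%:R =
     \sum_i ln (q i)%:R * (hu i / (1 + hu i)) * Hu.
    under eq_bigr => T _ do rewrite ln_rad [\sum_(i in T) _]big_mkcond mulr_sumr /=.
    rewrite exchange_big; apply: eq_bigr => i _ /=.
    have -> : \sum_(T : {set I}) (\prod_(j in T) hu j) * (if i \in T then ln (q i)%:R else 0) =
      ln (q i)%:R * \sum_(T : {set I}) \prod_j (if j == i then (if j \in T then hu j else 0) else (if j \in T then hu j else 1)).
      rewrite mulr_sumr; apply: eq_bigr => T _; case: ifP => iT.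
        rewrite mulrC prod_in_set; congr (_ * _); apply: eq_bigr => j _.
        by case: eqP => // ->; rewrite iT.
      by rewrite mulr0 (bigD1 i) //= eqxx iT mul0r mulr0.
    rewrite (sum_set_prod (fun j a => if j == i then (if a then hu j else 0) else (if a then hu j else 1))).
    rewrite (bigD1 i) //= eqxx addr0 -!mulrA; congr (_ * _); rewrite /Hu [in RHS](bigD1 i) //=.
    have n0 : 1 + hu i != 0 by rewrite gt_eqF // ltr_pwDl.
    rewrite mulKf //; congr (_ * _).
    by apply: eq_bigr => j /negbTE ->; rewrite addrC.
  rewrite -mulr_suml mulrC; apply: ler_wpM2l => //.
  apply: (@le_trans _ _ (\sum_(i | (q i <= u)%N) 2 * k%:R * (ln (q i)%:R / (q i)%:R))).
    rewrite [X in _ <= X]big_mkcond; apply: ler_sum => i _; rewrite /hu; case: ifP => _; last by rewrite mul0r mulr0.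
    have -> : h i / (1 + h i) = g i.
      by rewrite /h; field; rewrite subrK oner_eq0 gt_eqF.
    have := ler_wpM2r (lnr_ge0 R (q i)) (g_le i); rewrite [g i * _]mulrC => /le_trans; apply.
    by rewrite mulrAC mulrA.
  rewrite -mulr_sumr; apply: (@le_trans _ _ (2 * k%:R * (K * ln u%:R))).
    by apply: ler_wpM2l; [rewrite mulr_ge0|exact: HK].
  rewrite ler_pdivlMr // lDE -mulrA -mulrA; have := ler_wpM2r (ltW u0) mK.
  rewrite -!mulrA; lra.
have S3 : Hu <= 2 * (4 * Smass).
  have HuE : Hu = \sum_(T : {set I}) \prod_(i in T) hu i by rewrite /Hu prod_set1D.
  have hu_h T : 0 <= \prod_(i in T) hu i <= hprod T.
    rewrite prodr_ge0 //=; apply: ler_prod => i _; rewrite hu0 /hu; case: ifP => //= _; exact: h_ge0.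
  have S4 : \sum_(T : {set I} | lD / 2 < ln (rad q T)%:R) \prod_(i in T) hu i <= Hu / 2.
    have l2 : 0 < lD / 2 by rewrite divr_gt0.
    rewrite -(ler_pM2r l2) mulr_suml.
    apply: (@le_trans _ _ (\sum_(T : {set I}) (\prod_(i in T) hu i) * ln (rad q T)%:R)); last first.
      by apply: le_trans S2 _; lra.
    rewrite big_mkcond; apply: ler_sum => T _; case: ifP => H.
      by apply: ler_wpM2l; [case/andP: (hu_h T)|exact: ltW].
    by apply: mulr_ge0; [case/andP: (hu_h T)|exact: lnr_ge0].
  have S5 : \sum_(T : {set I} | ~~ (lD / 2 < ln (rad q T)%:R)) \prod_(i in T) hu i <= 4 * Smass.
    rewrite /Smass mulr_sumr [X in X <= _]big_mkcond; apply: ler_sum => T _; case: ifP => H; last first.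
      by apply: mulr_ge0 => //; apply: mulr_ge0; [exact: hprod_ge0|exact: sqr_ge0].
    have F2 : 2^-1 <= Fw T.
      rewrite /Fw le_max; apply/orP; right; move: H; rewrite -leNgt => H.
      rewrite lerBrDl -lerBrDr; have : ln (rad q T)%:R / lD <= 2^-1 by rewrite ler_pdivrMr // mulrC.
      lra.
    have F4 : 1 <= 4 * Fw T ^+ 2 by rewrite expr2; nra.
    rewrite mulrCA; case/andP: (hu_h T) => _ /le_trans; apply.
    by apply: ler_peMr => //; exact: hprod_ge0.
  have E := HuE; rewrite (bigID (fun T : {set I} => lD / 2 < ln (rad q T)%:R)) /= in E.
  move: (lerD S4 S5); rewrite -E; clearbody Hu; lra.
apply: le_trans S1 _; rewrite /Csel [X in _ <= X]mulrAC; apply: ler_wpM2r; first exact: expR_ge0.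
by apply: le_trans S3 _; rewrite mulrA -natrM.
Qed.

Section SieveSum.
Variables (rho : nat -> R) (M : nat).
Hypothesis rho_ge0 : forall n, 0 <= rho n.
Hypothesis rho_q : forall n i, rho n != 0 -> ~~ (q i %| n)%N.

Definition tauS U : R := \sum_(1 <= n < M) rho n * zeU R q k U n.
(** The sign is that of the Moebius function, and the division turns the diagonal weight
    [g * (1 - g)] into [h], see [ysel_sq]. *)
Definition ysel T : R := (-1) ^+ #|T| * Fw T / \prod_(i in T) (1 - g i).
Definition Nsel n : R := \sum_T ysel T * zeU R q k T n.

Let c : R := k.+1%:R.
Let C2 : R := 2 * c + c ^+ 2.
Let Pc : R := \prod_i (1 + c ^+ 2 * g i).
Let Z i n : R := (hit k (q i) n)%:R.
(** The level is [D ^ 3]: two factors [D] from the square and one from the prime of a penalty. The 2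
    in [2 * C2] pays for the choice of that prime in [U], since [#|U| <= 2 ^ #|U|]. *)
Definition errS : R :=
  \sum_(U | (U != set0) && (rad q U <= D ^ 3)%N) (2 * C2) ^+ #|U| * `|tauS U|.

Let g01 i : 0 <= g i <= 1.
Proof. by case: (g_bounds i) => -> H /=; have := gg i; lra. Qed.

Lemma rad_dvd S T : S \subset T -> (rad q S %| rad q T)%N.
Proof. by move=> /setIidPr ST; rewrite /rad [X in (_ %| X)%N](big_setID S) /= ST dvdn_mulr. Qed.

Lemma rad_subU S T T' : S \subset T :|: T' -> (rad q S <= rad q T * rad q T')%N.
Proof.
move=> H; apply: (@leq_trans (rad q (T :|: T'))).
  by apply: dvdn_leq (rad_dvd H); exact: rad_gt0.
have -> : rad q (T :|: T') = (rad q T * rad q (T' :\: T))%N.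
  by rewrite /rad [LHS](big_setID T) /= setUK setDUl setDv set0U.
rewrite leq_mul2l; apply/orP; right; apply: dvdn_leq; first exact: rad_gt0.
by apply: rad_dvd; exact: subsetDl.
Qed.

Lemma c_pow_inv T : (\prod_(i in T) (1 - g i))^-1 <= c ^+ #|T|.
Proof.
rewrite -prodfV -prodr_const; apply: ler_prod => i _; rewrite invr_ge0 ltW //=.
have [_ H] := g_bounds i; rewrite -[X in _ <= X]invrK lef_pV2 ?posrE ?invr_gt0 ?ltr0n //.
by rewrite /c -natr1.
Qed.

Let pg0 T : 0 < \prod_(i in T) (1 - g i).
Proof. by apply: prodr_gt0. Qed.

Lemma ysel_le T : `|ysel T| <= c ^+ #|T|.
Proof.
rewrite /ysel !normrM normrX normrN1 expr1n mul1r normfV (gtr0_norm (pg0 T)).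
have /andP[F0 F1] := Fw_01 T; rewrite ger0_norm //.
apply: le_trans (c_pow_inv T); apply: ler_piMl => //; by rewrite invr_ge0 ltW.
Qed.

Lemma ysel_sq T : ysel T ^+ 2 * \prod_(i in T) (g i * (1 - g i)) = hprod T * Fw T ^+ 2.
Proof.
rewrite /ysel /hprod /h big_split /= [X in _ = X * _]big_split /= prodfV !exprMn sqrr_sign mul1r.
by have := pg0 T => ?; field; rewrite gt_eqF.
Qed.

(** The coefficients of [Nsel] at integers hit by [q i]: there [ze] equals [1 - g i], so the terms
    of [T] and [i |: T] merge. *)
Definition yq i T : R := if i \in T then 0 else ysel T + (1 - g i) * ysel (i |: T).

Lemma yqE i T : i \notin T -> yq i T = (-1) ^+ #|T| * (Fw T - Fw (i |: T)) / \prod_(j in T) (1 - g j).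
Proof.
move=> iT; rewrite /yq (negbTE iT) /ysel big_setU1 //= cardsU1 iT add1n exprS.
have := gg i; have := pg0 T => ? ?; field; by rewrite !gt_eqF.
Qed.

Lemma yq_le i T : `|yq i T| <= c ^+ #|T|.
Proof.
have [iT|iT] := boolP (i \in T); first by rewrite /yq iT normr0 exprn_ge0.
rewrite yqE // !normrM normrX normrN1 expr1n mul1r normfV (gtr0_norm (pg0 T)).
apply: le_trans (c_pow_inv T); apply: ler_piMl; first by rewrite invr_ge0 ltW.
have /andP[F0 F1] := Fw_01 T; have /andP[G0 G1] := Fw_01 (i |: T).
by rewrite ler_norml; apply/andP; split; lra.
Qed.

Lemma yq_sq i : \sum_T yq i T ^+ 2 * \prod_(j in T) (g j * (1 - g j)) <=
  (ln (q i)%:R / lD) ^+ 2 * (Csel * Smass).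
Proof.
have l0 : 0 <= ln (q i)%:R / lD by rewrite divr_ge0 ?lnr_ge0 // ltW.
apply: (@le_trans _ _ (\sum_T (ln (q i)%:R / lD) ^+ 2 * hprod T)); last first.
  by rewrite -mulr_sumr; apply: ler_wpM2l; [exact: sqr_ge0|rewrite -prod_set1D; exact: hprod_total].
apply: ler_sum => T _; have [iT|iT] := boolP (i \in T).
  rewrite /yq iT expr0n /= mul0r; apply: mulr_ge0; [exact: sqr_ge0|exact: hprod_ge0].
have -> : yq i T ^+ 2 * \prod_(j in T) (g j * (1 - g j)) = (Fw T - Fw (i |: T)) ^+ 2 * hprod T.
  rewrite yqE // /hprod /h big_split /= [X in _ = _ * X]big_split /= prodfV !exprMn sqrr_sign mul1r.
  by have := pg0 T => ?; field; rewrite gt_eqF.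
apply: ler_wpM2r; first exact: hprod_ge0.
rewrite -[X in X <= _]real_normK ?num_real // lerXn2r ?nnegrE //; exact: Fw_diff.
Qed.

Lemma ysel_supp T : ysel T != 0 -> (rad q T <= D)%N.
Proof. by move=> H; apply: Fw_supp; apply: contraNneq H => F0; rewrite /ysel F0 mulr0 mul0r. Qed.

Lemma yq_supp i T : yq i T != 0 -> i \notin T /\ (rad q T <= D)%N.
Proof.
move=> H; have iT : i \notin T by apply: contraNN H => iT; rewrite /yq iT.
split => //; move: H; rewrite /yq (negbTE iT) => H.
have [y0|y0] := eqVneq (ysel T) 0; last exact: ysel_supp.
have {}H : ysel (i |: T) != 0 by apply: contraNneq H => ->; rewrite y0 mulr0 addr0.
apply: leq_trans (ysel_supp H); apply: dvdn_leq; first exact: rad_gt0.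
by apply: rad_dvd; exact: subsetUr.
Qed.

Let zsq n : rho n != 0 -> forall i, ze R k (q i) n ^+ 2 = (1 - 2 * g i) * ze R k (q i) n + g i * (1 - g i).
Proof.
move=> rn i; rewrite ze_hit ?rho_q //; rewrite -/(g i); case: (hit _ _ _) => /=; ring.
Qed.

Lemma sum_quadratic (y : {set I} -> R) :
  \sum_(1 <= n < M) rho n * (\sum_T y T * zeU R q k T n) ^+ 2 = qform g y tauS.
Proof.
rewrite /qform.
transitivity (\sum_(1 <= n < M) \sum_T \sum_T' y T * y T' * \sum_S cf g T T' S * (rho n * zeU R q k S n)).
  apply: eq_bigr => n _; have [rn|rn] := eqVneq (rho n) 0.
    rewrite rn mul0r big1 // => T _; rewrite big1 // => T' _; rewrite big1 ?mulr0 // => S _.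
    by rewrite mul0r mulr0.
  rewrite expr2 mulr_suml mulr_sumr; apply: eq_bigr => T _.
  rewrite mulr_sumr mulr_sumr; apply: eq_bigr => T' _.
  under [in RHS]eq_bigr do rewrite mulrCA.
  rewrite -mulr_sumr -(prod_mulE _ _ (zsq rn)) /zeU; ring.
rewrite exchange_big; apply: eq_bigr => T _ /=; rewrite exchange_big; apply: eq_bigr => T' _ /=.
rewrite -mulr_sumr; congr (_ * _); rewrite exchange_big; apply: eq_bigr => S _ /=.
by rewrite /tauS mulr_sumr.
Qed.

Lemma sum_with_insert i (F : {set I} -> R) :
  \sum_(T : {set I} | i \in T) F T = \sum_(T : {set I} | i \notin T) F (i |: T).
Proof.
rewrite (reindex_onto (fun T => i |: T) (fun T => T :\ i)) /=; last by move=> T iT; rewrite setD1K.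
apply: eq_bigl => T; rewrite setU11 /=; apply/eqP/idP => [<-|iT]; first by rewrite setD11.
by rewrite setU1K.
Qed.

Let Nq i n : R := \sum_T yq i T * zeU R q k T n.

Lemma Nsel_hit i n : rho n != 0 -> Z i n * Nsel n = Z i n * Nq i n.
Proof.
move=> rn; rewrite /Nsel (bigID (fun T : {set I} => i \in T)) /= sum_with_insert -big_split /=.
rewrite /Nq [in RHS](bigID (fun T : {set I} => i \in T)) /= [X in _ * (X + _)]big1 ?add0r => [|T iT]; last first.
  by rewrite /yq iT mul0r.
rewrite !mulr_sumr; apply: eq_bigr => T iT.
rewrite /yq (negbTE iT) {1}/zeU big_setU1 //= -/(zeU R q k T n) ze_hit ?rho_q // -/(g i) /Z.
by case: (hit _ _ _) => /=; ring.
Qed.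

Lemma sum_quadratic_ze i :
  \sum_(1 <= n < M) rho n * (ze R k (q i) n * Nq i n ^+ 2) =
  qform g (yq i) (fun S => if i \in S then 0 else tauS (i |: S)).
Proof.
rewrite /qform.
transitivity (\sum_(1 <= n < M) \sum_T \sum_T' yq i T * yq i T' *
   \sum_S cf g T T' S * (if i \in S then 0 else rho n * zeU R q k (i |: S) n)).
  apply: eq_bigr => n _; have [rn|rn] := eqVneq (rho n) 0.
    rewrite rn mul0r big1 // => T _; rewrite big1 // => T' _; rewrite big1 ?mulr0 // => S _.
    by case: ifP; rewrite ?mul0r mulr0.
  rewrite expr2 /Nq mulr_suml !mulr_sumr; apply: eq_bigr => T _.
  rewrite !mulr_sumr; apply: eq_bigr => T' _.
  have [y0|y0] := eqVneq (yq i T) 0; first by rewrite y0 !mul0r !mulr0.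
  have [y0'|y0'] := eqVneq (yq i T') 0; first by rewrite y0' ?(mulr0,mul0r).
  have [iT _] := yq_supp y0; have [iT' _] := yq_supp y0'.
  transitivity (yq i T * yq i T' * \sum_S cf g T T' S * (rho n * (ze R k (q i) n * zeU R q k S n))).
    have -> : \sum_S cf g T T' S * (rho n * (ze R k (q i) n * zeU R q k S n)) =
       rho n * ze R k (q i) n * \sum_S cf g T T' S * zeU R q k S n.
      by rewrite mulr_sumr; apply: eq_bigr => S _; ring.
    by rewrite -(prod_mulE _ _ (zsq rn)) /zeU; ring.
  congr (_ * _); apply: eq_bigr => S _; case: ifP => iS; last by rewrite /zeU big_setU1 ?iS.
  have [-> |/cf_support/subsetP/(_ _ iS)] := eqVneq (cf g T T' S) 0; first by rewrite !mul0r.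
  by rewrite inE (negbTE iT) (negbTE iT').
rewrite exchange_big; apply: eq_bigr => T _ /=; rewrite exchange_big; apply: eq_bigr => T' _ /=.
rewrite -mulr_sumr; congr (_ * _); rewrite exchange_big; apply: eq_bigr => S _ /=.
by rewrite -mulr_sumr; case: ifP => // _; rewrite big1_eq.
Qed.

Let c0 : 0 <= c. Proof. exact: ler0n. Qed.
Let c1 : 1 <= c. Proof. by rewrite ler1n. Qed.
Let C21 : 1 <= C2. Proof. by rewrite /C2; have := c1; have := sqr_ge0 c; lra. Qed.
Let C20 : 0 <= C2. Proof. exact: le_trans ler01 C21. Qed.
Let Pc0 : 0 <= Pc.
Proof. by apply: prodr_ge0 => i _; rewrite addr_ge0 // mulr_ge0 ?sqr_ge0 //; case/andP: (g01 i). Qed.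
Let X := tauS set0.
Let D0 : (0 < D)%N.
Proof. by rewrite lt0n; apply/eqP => D0; move: lD0; rewrite /lD D0 ln0 // ltxx. Qed.

Lemma errS_ge0 : 0 <= errS.
Proof. by apply: sumr_ge0 => U _; rewrite mulr_ge0 ?exprn_ge0 // mulr_ge0. Qed.

Lemma qform_main (y : {set I} -> R) : (forall T, `|y T| <= c ^+ #|T|) ->
  (forall T, y T != 0 -> (rad q T <= D)%N) ->
  `|qform g y tauS - X * \sum_T y T ^+ 2 * \prod_(j in T) (g j * (1 - g j))| <= Pc * errS.
Proof.
move=> yc yD; rewrite -(qform_delta g y X).
have -> : qform g y tauS - qform g y (fun S => if S == set0 then X else 0) =
   qform g y (fun S => if S == set0 then 0 else tauS S).
  apply/eqP; rewrite subr_eq; apply/eqP; rewrite -qformD; congr qform.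
  by apply: funext => S; case: eqP => [->|_]; rewrite ?add0r ?addr0.
apply: (le_trans (@qform_bound R I g g01 y _ c (fun S => (rad q S <= D ^ 2)%N) c0 yc _)).
  move=> T T' S yT yT' /rad_subU H; apply: leq_trans H _.
  by rewrite -mulnn leq_mul ?yD.
apply: ler_wpM2l => //; rewrite /errS big_mkcond [X in _ <= X]big_mkcond; apply: ler_sum => S _.
case: (S == set0) => /=; first by rewrite normr0 mulr0; case: ifP.
case: ifP => H; last by case: ifP => // _; rewrite mulr_ge0 ?exprn_ge0 ?mulr_ge0.
rewrite (_ : (rad q S <= D ^ 3)%N = true); last by rewrite (leq_trans H) // expnS leq_pmull.
apply: ler_wpM2r => //; rewrite lerXn2r ?nnegrE ?mulr_ge0 //; have := C20; rewrite -/C2; lra.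
Qed.

Lemma sum_qform_ze : \sum_i `|qform g (yq i) (fun S => if i \in S then 0 else tauS (i |: S))| <= Pc * errS.
Proof.
apply: (@le_trans _ _ (\sum_i Pc * \sum_(S : {set I} | (i \notin S) && (rad q S <= D ^ 2)%N) C2 ^+ #|S| * `|tauS (i |: S)|)).
  apply: ler_sum => i _.
  apply: (le_trans (@qform_bound R I g g01 (yq i) _ c (fun S => (i \notin S) && (rad q S <= D ^ 2)%N) c0 (yq_le i) _)).
    move=> T T' S /yq_supp[iT rT] /yq_supp[iT' rT'] ST; apply/andP; split.
      by apply/negP => /(subsetP ST); rewrite inE (negbTE iT) (negbTE iT').
    by apply: leq_trans (rad_subU ST) _; rewrite -mulnn leq_mul.
  apply: ler_wpM2l => //; apply: ler_sum => S /andP[/negbTE -> _].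
  exact: lexx.
rewrite -mulr_sumr; apply: ler_wpM2l => //.
apply: (@le_trans _ _ (\sum_i \sum_(S : {set I} | i \in S) (if (rad q S <= D ^ 3)%N then C2 ^+ #|S| * `|tauS S| else 0))).
  apply: ler_sum => i _; rewrite sum_with_insert big_mkcondr; apply: ler_sum => S iS.
  have rE : rad q (i |: S) = (q i * rad q S)%N by rewrite /rad big_setU1.
  case: ifP => H; last by case: ifP => // _; rewrite mulr_ge0 ?exprn_ge0.
  rewrite rE (_ : (q i * rad q S <= D ^ 3)%N = true); last by rewrite expnS leq_mul // qD.
  by apply: ler_wpM2r => //; rewrite cardsU1 iS ler_weXn2l // leq_addl.
rewrite (exchange_big_dep xpredT) //= /errS [X in _ <= X]big_mkcond; apply: ler_sum => S _.
rewrite sumr_const -[X in X <= _]mulr_natl; have [->|S0] := eqVneq S set0; first by rewrite cards0 mul0r.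
rewrite /=; case: ifP => _; last by rewrite mulr0.
rewrite mulrA; apply: ler_wpM2r => //; rewrite exprMn; apply: ler_wpM2r; first exact: exprn_ge0.
by rewrite -natrX ler_nat ltnW // ltn_expl.
Qed.

(* The quadratic form of [Nsel] conditioned on [hit (q i)] involves only the differences [Fw T - Fw (i |: T)],
   which are at most [ln (q i) / lD]. *)
Theorem selberg_lower (C0 : R) (pen : I -> R) : 0 <= C0 -> (forall i, 0 <= pen i <= C0 + 1) ->
  X * Smass * (C0 - Csel * \sum_i pen i * g i * (ln (q i)%:R / lD) ^+ 2)
    - Pc * errS * (C0 + (C0 + 1) * (1 + \sum_i g i)) <=
  \sum_(1 <= n < M) rho n * (Nsel n ^+ 2 * (C0 - \sum_i pen i * Z i n)).
Proof.
move=> C00 Hpen; have E0 := errS_ge0.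
have PE : 0 <= Pc * errS by exact: mulr_ge0.
have X0 : 0 <= X.
  by apply: sumr_ge0 => n _; rewrite mulr_ge0 // /zeU big_set0.
have -> : \sum_(1 <= n < M) rho n * (Nsel n ^+ 2 * (C0 - \sum_i pen i * Z i n)) =
  C0 * qform g ysel tauS - \sum_i pen i * (g i * qform g (yq i) tauS +
     qform g (yq i) (fun S => if i \in S then 0 else tauS (i |: S))).
  have -> : \sum_i pen i * (g i * qform g (yq i) tauS +
       qform g (yq i) (fun S => if i \in S then 0 else tauS (i |: S))) =
     \sum_(1 <= n < M) rho n * \sum_i pen i * (g i * Nq i n ^+ 2 + ze R k (q i) n * Nq i n ^+ 2).
    transitivity (\sum_i \sum_(1 <= n < M) rho n * (pen i * (g i * Nq i n ^+ 2 + ze R k (q i) n * Nq i n ^+ 2))).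
      apply: eq_bigr => i _; rewrite -sum_quadratic -sum_quadratic_ze mulr_sumr -big_split mulr_sumr /=.
      by apply: eq_bigr => n _; rewrite -/(Nq i n); ring.
    by rewrite exchange_big; apply: eq_bigr => n _; rewrite mulr_sumr.
  rewrite -sum_quadratic mulr_sumr -sumrB; apply: eq_bigr => n _ /=.
  rewrite mulrBr mulrBr mulrCA -/(Nsel n); congr (_ - _); first by ring.
  rewrite !mulr_sumr; apply: eq_bigr => i _.
  have [rn|rn] := eqVneq (rho n) 0; first by rewrite rn ?(mul0r, mulr0, addr0).
  (* [Z] is idempotent, so in [Nsel n ^+ 2 * Z i n] both factors [Nsel] may be replaced by
     [Nq i]. *)
  have H := Nsel_hit i rn; have ZZ : Z i n * Z i n = Z i n by rewrite /Z; case: (hit _ _ _); rewrite /= ?mulr1 ?mulr0.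
  have -> : rho n * (Nsel n ^+ 2 * (pen i * Z i n)) = pen i * rho n * (Z i n * Nsel n) * (Z i n * Nsel n).
    by rewrite -{1}ZZ; ring.
  rewrite H ze_hit ?rho_q // -/(g i) -/(Z i n) -/(Nq i n).
  have -> : pen i * rho n * (Z i n * Nq i n) * (Z i n * Nq i n) = pen i * rho n * (Z i n * Z i n) * Nq i n ^+ 2 by ring.
  by rewrite ZZ; ring.
have Q1 : X * Smass - Pc * errS <= qform g ysel tauS.
  have := qform_main ysel_le ysel_supp; under eq_bigr do rewrite ysel_sq.
  rewrite -/Smass ler_norml => /andP[H _]; lra.
have Q2 i : qform g (yq i) tauS <= X * ((ln (q i)%:R / lD) ^+ 2 * (Csel * Smass)) + Pc * errS.
  have := qform_main (yq_le i) (fun T H => (yq_supp H).2); rewrite ler_norml => /andP[_ H].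
  have := ler_wpM2l X0 (yq_sq i); lra.
have Q3 : \sum_i pen i * (g i * qform g (yq i) tauS +
     qform g (yq i) (fun S => if i \in S then 0 else tauS (i |: S))) <=
     X * Smass * (Csel * \sum_i pen i * g i * (ln (q i)%:R / lD) ^+ 2) +
     Pc * errS * ((C0 + 1) * (1 + \sum_i g i)).
  apply: (@le_trans _ _ (\sum_i ((X * Smass * Csel) * (pen i * g i * (ln (q i)%:R / lD) ^+ 2) +
     Pc * errS * (C0 + 1) * g i + (C0 + 1) * `|qform g (yq i) (fun S => if i \in S then 0 else tauS (i |: S))|))).
    apply: ler_sum => i _; have /andP[p0 p1] := Hpen i; have /andP[g0 _] := g01 i.
    set A := qform _ _ tauS; set B := qform _ _ _.
    have H1 : pen i * B <= (C0 + 1) * `|B|.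
      apply: le_trans (ler_wpM2l p0 (ler_norm B)) _; exact: ler_wpM2r.
    have H2 : pen i * g i * A <= pen i * g i * (X * ((ln (q i)%:R / lD) ^+ 2 * (Csel * Smass)) + Pc * errS).
      by apply: ler_wpM2l; [exact: mulr_ge0|exact: Q2].
    have H3 : pen i * g i * (Pc * errS) <= (C0 + 1) * g i * (Pc * errS).
      by apply: ler_wpM2r => //; apply: ler_wpM2r.
    rewrite mulrDr mulrA; apply: lerD => //; apply: (le_trans H2).
    rewrite mulrDr; apply: lerD; first by rewrite le_eqVlt; apply/orP; left; apply/eqP; ring.
    by apply: (le_trans H3); rewrite le_eqVlt; apply/orP; left; apply/eqP; ring.
  have E1 a (H : I -> R) : \sum_i a * H i = a * \sum_i H i by rewrite mulr_sumr.
  rewrite big_split big_split /= (E1 _ (fun i => pen i * g i * (ln (q i)%:R / lD) ^+ 2)) (E1 _ g).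
  rewrite (E1 _ (fun i => `|qform g (yq i) (fun S => if i \in S then 0 else tauS (i |: S))|)).
  have := ler_wpM2l (addr_ge0 C00 ler01) sum_qform_ze; set B := \sum_i `|_|.
  set G := \sum_i g i; set F := \sum_i _ * _ * _ => HB.
  have -> : X * Smass * (Csel * F) + Pc * errS * ((C0 + 1) * (1 + G)) =
    X * Smass * Csel * F + Pc * errS * (C0 + 1) * G + (C0 + 1) * (Pc * errS) by ring.
  by rewrite lerD2l.
have := ler_wpM2l C00 Q1; move: Q3.
set S := \sum_i _ * (_ + _); set F := \sum_i _ * _ * _; set G := \sum_i _.
move=> H1 H2; apply: le_trans (lerB H2 H1).
by rewrite le_eqVlt; apply/orP; left; apply/eqP; ring.
Qed.

End SieveSum.

End SelbergMass.

(** * Large square divisors and moments of the sieve weights *)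

Section SquareDivisors.
Variable R : realType.

(* The bound [iota 1 n] makes [sqdiv S 0] false. *)
Definition sqdiv S n := has (fun s => (S < s)%N && (s ^ 2 %| n)%N) (iota 1 n).

Lemma sqdivI S s n : (0 < n)%N -> (S < s)%N -> (s ^ 2 %| n)%N -> sqdiv S n.
Proof.
move=> n0 Ss sn; apply/hasP; exists s; last by rewrite Ss.
rewrite mem_iota add1n ltnS (leq_ltn_trans (leq0n S) Ss) /=.
apply: leq_trans (dvdn_leq n0 sn); rewrite -mulnn leq_pmulr //.
exact: leq_ltn_trans Ss.
Qed.

Lemma sum_inv_sq S N : (0 < S)%N -> \sum_(S.+1 <= s < N) (s%:R ^+ 2)^-1 <= S%:R^-1 :> R.
Proof.
move=> S0; have [SN|NS] := ltnP S.+1 N; last by rewrite big_geq // invr_ge0.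
apply: (@le_trans _ _ (\sum_(S.+1 <= s < N) ((s.-1)%:R^-1 - (s.-1).+1%:R^-1))).
  apply: ler_sum_nat' => -[//|s] /andP[Ss _].
  have s0 : 0 < s%:R :> R by rewrite ltr0n; exact: leq_trans S0 Ss.
  rewrite /= -natr1 -subr_ge0.
  have -> : s%:R^-1 - (s%:R + 1)^-1 - ((s%:R + 1) ^+ 2)^-1 = ((s%:R + 1) ^+ 2)^-1 / s%:R :> R.
    by field; rewrite !gt_eqF // ltr_wpDr.
  by rewrite divr_ge0 ?invr_ge0 ?sqr_ge0 ?ltW.
have -> : \sum_(S.+1 <= s < N) ((s.-1)%:R^-1 - (s.-1).+1%:R^-1) = \sum_(S <= s < N.-1) (s%:R^-1 - s.+1%:R^-1) :> R.
  by case: N SN => // N _; rewrite big_add1.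
rewrite -[X in X <= _]opprK -sumrN; under eq_bigr do rewrite opprB.
rewrite (telescope_sumr (fun s => s%:R^-1)); last by case: N SN => // N; rewrite ltnS => /ltnW.
by rewrite opprB gerBl invr_ge0.
Qed.

Lemma sum_sqdiv S N : (0 < S)%N -> \sum_(1 <= n < N | sqdiv S n) n%:R^-1 <= (1 + ln N%:R) / S%:R :> R.
Proof.
move=> S0.
apply: (@le_trans _ _ (\sum_(1 <= n < N) \sum_(S.+1 <= s < N | (s ^ 2 %| n)%N) n%:R^-1)).
  rewrite big_mkcond; apply: ler_sum_nat' => n /andP[n0 nN]; case: ifP => [/hasP[s]|_]; last first.
    by apply: sumr_ge0 => s _; rewrite invr_ge0.
  rewrite mem_iota add1n ltnS => /andP[s0 sn] /andP[Ss sd].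
  rewrite big_mkcond (bigD1_seq s) ?iota_uniq //=; last first.
    by rewrite mem_index_iota Ss (leq_ltn_trans sn).
  by rewrite sd lerDl; apply: sumr_ge0 => r _; case: ifP => // _; rewrite invr_ge0.
rewrite (exchange_big_dep xpredT) //=.
apply: (@le_trans _ _ (\sum_(S.+1 <= s < N) (s%:R ^+ 2)^-1 * (1 + ln N%:R))); last first.
  rewrite -mulr_suml mulrC; apply: ler_wpM2l; last exact: sum_inv_sq.
  by rewrite addr_ge0 ?lnr_ge0.
apply: ler_sum_nat' => s /andP[Ss _]; have s0 : (0 < s)%N by exact: leq_trans Ss.
have s20 : (0 < s ^ 2)%N by rewrite expn_gt0 s0.
have := sum_multiples N xpredT (fun n => n%:R^-1 : R) s20; rewrite /= => ->.
under eq_bigl do rewrite andbT.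
under eq_bigr do rewrite natrM invfM natrX.
apply: (@le_trans _ _ (\sum_(1 <= n < N) (s%:R ^+ 2)^-1 * n%:R^-1)).
  by apply: ler_sum_nat_cond => n _; rewrite mulr_ge0 ?invr_ge0 ?sqr_ge0.
rewrite -mulr_sumr; apply: ler_wpM2l; first by rewrite invr_ge0 sqr_ge0.
exact: sum_recip_le.
Qed.

(** For [a >= 2] the exponent [a./2] is at least [a / 3], so [p ^ (a./2)] already exceeds [S]. *)
Lemma prime_power_sqdiv p a S : prime p -> (1 < a)%N -> (S ^ 3 < p ^ a)%N -> sqdiv S (p ^ a).
Proof.
move=> pp a1 H; have p0 := prime_gt0 pp.
apply: (@sqdivI S (p ^ (a./2))); first by rewrite expn_gt0 p0.
  rewrite -(@ltn_exp2r _ _ 3) //; apply: leq_trans H _.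
  rewrite -expnM leq_exp2l ?prime_gt1 //.
  have := odd_double_half a; case: (odd a); lia.
rewrite -expnM dvdn_exp2l //; have := odd_double_half a; lia.
Qed.

Lemma shift_sum (F : nat -> R) t k N : (t <= k)%N -> (forall n, 0 <= F n) ->
  \sum_(1 <= n < N) F (n + t)%N / n%:R <= k.+1%:R * \sum_(1 <= n < (N + k)%N) F n / n%:R.
Proof.
move=> tk F0; rewrite mulr_sumr.
apply: (@le_trans _ _ (\sum_(1 <= n < N) k.+1%:R * (F (n + t)%N / (n + t)%:R))).
  apply: ler_sum_nat' => n /andP[n0 _]; have nR : 0 < n%:R :> R by rewrite ltr0n.
  have ntR : 0 < (n + t)%:R :> R by rewrite ltr0n addn_gt0 n0.
  rewrite mulrCA; apply: ler_wpM2l => //; rewrite ler_pdivlMr // ler_pdivrMl // -natrM ler_nat; nia.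
have E := big_addn 1 (N + t) t xpredT (fun n => k.+1%:R * (F n / n%:R)); rewrite addnK in E; rewrite -E.
have F1 n : 0 <= k.+1%:R * (F n / n%:R) by rewrite mulr_ge0 ?divr_ge0.
apply: (@le_trans _ _ (\sum_(1 <= i < N + t) k.+1%:R * (F i / i%:R))).
  rewrite (@big_nat_widenl _ _ _ (1 + t) 1) ?leq_addr //; exact: ler_sum_nat_cond.
by apply: ler_sum_nat_widen => //; rewrite leq_add2l.
Qed.

End SquareDivisors.

Section TauOmega.
Variables (I : finType) (q : I -> nat).
Hypotheses (qI : injective q) (qP : forall i, prime (q i)).

Lemma rad_mem (U : {set I}) i : (q i %| rad q U)%N = (i \in U).
Proof.
apply/idP/idP => [H|iU]; last by rewrite /rad (bigD1 i) //= dvdn_mulr.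
apply: contraTT H => iU; rewrite -prime_coprime // -[rad q U]muln1.
exact: (@rad_coprime I q qI qP U i 1 (coprimen1 _) iU).
Qed.

Lemma rad_dvd_all (U : {set I}) n : (forall i, i \in U -> (q i %| n)%N) -> (rad q U %| n)%N.
Proof.
move=> H; have [k] := ubnP #|U|; elim: k => // k IH in U H *.
have [->|[i iU]] := set_0Vmem U; first by rewrite /rad big_set0 dvd1n.
rewrite ltnS => Uk; rewrite /rad (big_setD1 i) //= Gauss_dvd; last first.
  rewrite -[X in coprime _ X]muln1.
  exact: (@rad_coprime I q qI qP (U :\ i) i 1 (coprimen1 _) (negbT (setD11 i U))).
rewrite H // IH //; first by move=> t; rewrite inE => /andP[_]; exact: H.
by apply: leq_trans Uk; rewrite (cardsD1 i U) iU.
Qed.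

(** Distinct sets of sieve primes dividing [n] have distinct products, and these are divisors of
    [n]. *)
Lemma pow2_omega_tau n : (0 < n)%N -> (2 ^ #|[set i | (q i %| n)%N]| <= tau n)%N.
Proof.
move=> n0; set A := [set i | _]; rewrite -card_powerset cardE -(size_map (rad q)).
apply: uniq_leq_size.
  rewrite map_inj_uniq ?enum_uniq // => U U' E; apply/setP => i; by rewrite -!rad_mem E.
move=> r /mapP[U]; rewrite mem_enum inE => /subsetP UA ->.
rewrite -dvdn_divisors //; apply: rad_dvd_all => i /UA; by rewrite inE.
Qed.

End TauOmega.

Section NselBound.
Variables (R : realType) (I : finType) (q : I -> nat) (k : nat).
Hypotheses (qI : injective q) (qP : forall i, prime (q i)) (qk : forall i, (k.+1 < q i)%N).
Variable (u m : nat).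
Hypotheses (u1 : 1 <= ln u%:R :> R) (m0 : (0 < m)%N).
Let c : R := k.+1%:R.

Let Ns := @Nsel R I q k u m.

Lemma Nsel_norm n : `|Ns n| <=
  (1 + c) ^+ #|[set i | hit k (q i) n]| * \prod_i (1 + c * zg R k (q i)).
Proof.
apply: (@le_trans _ _ (\sum_(T : {set I}) \prod_(i in T) (c * `|ze R k (q i) n|))).
  apply: sum_normM_le => T _; rewrite normrM big_split /= prodr_const; apply: ler_pM => //.
    exact: (@ysel_le R I q k qP qk u m).
  by rewrite normr_prod.
rewrite -prod_set1D -prodr_const [X in _ <= X * _]big_mkcond -big_split /=.
apply: ler_prod => i _; have c0 : 0 <= c by [].
rewrite addr_ge0 ?mulr_ge0 //= inE.
have g0 := @zg_ge0 R k (q i); have k1 := ltnW (qk i); have g1 := @zg_le1 R k _ k1.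
have cg : 0 <= c * zg R k (q i) by exact: mulr_ge0.
case: ifP => H.
  have z1 := @ze_norm R k _ n k1; have := ler_wpM2l c0 z1; rewrite mulr1 => H1.
  apply: (@le_trans _ _ ((1 + c) * 1)); first by rewrite mulr1 lerD2l.
  by apply: ler_wpM2l; [rewrite addr_ge0|rewrite lerDl].
rewrite mul1r lerD2l; apply: ler_wpM2l => //; rewrite /ze H.
by case: ifP => _; rewrite ?normr0 // normrN ger0_norm.
Qed.

Lemma hit_card n : (#|[set i | hit k (q i) n]| <= \sum_(1 <= t < k.+1) #|[set i | (q i %| n + t)%N]|)%N.
Proof.
rewrite -sum1_card big_mkcond; under [X in (_ <= X)%N]eq_bigr do rewrite -sum1_card big_mkcond.
rewrite exchange_big; apply: leq_sum => i _ /=; rewrite inE; case: (boolP (hit k (q i) n)) => // /hasP[t].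
rewrite mem_iota add1n => /andP[t0 tk] H.
by rewrite (bigD1_seq t) ?iota_uniq ?mem_index_iota ?t0 //= inE H leq_addr.
Qed.

Hypothesis k0 : (0 < k)%N.

(** By pigeonhole one shift receives at least a [k]-th part of the hits, and [pow2_omega_tau]
    applies to it. *)
Lemma hit_pow_le a n :
  2 ^+ (a * #|[set i | hit k (q i) n]|) <= \sum_(1 <= t < k.+1) (tau (n + t))%:R ^+ (a * k) :> R.
Proof.
set w := #|_|; pose om t := #|[set i | (q i %| n + t)%N]|.
have /hasP[t] : has (fun t => w <= k * om t)%N (index_iota 1 k.+1).
  apply: contraT => /hasPn H; have w0 : (0 < w)%N.
    have /H : 1%N \in index_iota 1 k.+1 by rewrite mem_index_iota /= ltnS.
    by rewrite -ltnNge; apply: leq_ltn_trans.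
  have := hit_card n; rewrite -/w leqNgt => /negP[].
  rewrite -(ltn_pmul2l k0) big_distrr /=; apply: (@leq_ltn_trans (k * w.-1)); last first.
    by rewrite ltn_pmul2l // prednK.
  rewrite big_seq; apply: (@leq_trans (\sum_(t <- index_iota 1 k.+1 | t \in index_iota 1 k.+1) w.-1)).
    apply: leq_sum => t /H; rewrite -ltnNge -/(om t); case: (w) w0 => // w' _; by rewrite ltnS.
  by rewrite -big_seq sum_nat_const_nat subn1.
rewrite mem_index_iota => /andP[t0 tk] H.
apply: (@le_trans _ _ ((tau (n + t))%:R ^+ (a * k))); last first.
  rewrite (bigD1_seq t) ?iota_uniq ?mem_index_iota ?t0 //= lerDl.
  by apply: sumr_ge0 => s _; rewrite exprn_ge0.
apply: (@le_trans _ _ (2 ^+ (a * (k * om t)))); first by rewrite ler_weXn2l ?ler1n // leq_mul2l H orbT.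
rewrite mulnA mulnC exprM -natrX lerXn2r ?nnegrE // ler_nat.
by apply: pow2_omega_tau => //; rewrite addn_gt0 t0 orbT.
Qed.

Let P1 : R := \prod_i (1 + c * zg R k (q i)).
(** As [1 + c = k + 2] is below [2 ^ (k + 2)], this exponent turns the fourth moment of [Nsel] into
    a moment of [tau]. *)
Let a4 := (4 * k.+2)%N.
Variable M : nat.
Let Lk : R := 1 + ln (M + k)%:R.

Let Lk1 : 1 <= Lk. Proof. by rewrite lerDl lnr_ge0. Qed.
Let P10 : 0 <= P1.
Proof. by apply: prodr_ge0 => i _; rewrite addr_ge0 // mulr_ge0 // zg_ge0. Qed.

Lemma sum_tau_shift t a : (t <= k)%N ->
  \sum_(1 <= n < M) (tau (n + t))%:R ^+ a / n%:R <= k.+1%:R * Lk ^+ (2 ^ a) :> R.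
Proof.
move=> tk; apply: le_trans (shift_sum (F := fun n => (tau n)%:R ^+ a) _ tk _) _.
  by move=> n; rewrite exprn_ge0.
apply: ler_wpM2l => //; apply: (@le_trans _ _ (\sum_(1 <= n < (M + k).+1) (tau n)%:R ^+ a / n%:R)).
  by apply: ler_sum_nat_widen => // n _; rewrite divr_ge0 ?exprn_ge0.
by apply: sum_tau_pow; rewrite addn_gt0 k0 orbT.
Qed.

Lemma sum_Nsel4 : \sum_(1 <= n < M) n%:R^-1 * Ns n ^+ 4 <=
  P1 ^+ 4 * (k%:R * (k.+1%:R * Lk ^+ (2 ^ (a4 * k)))).
Proof.
apply: (@le_trans _ _ (\sum_(1 <= n < M) P1 ^+ 4 * (\sum_(1 <= t < k.+1) (tau (n + t))%:R ^+ (a4 * k) / n%:R))).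
  apply: ler_sum_nat' => n /andP[n0 _]; rewrite -mulr_suml [X in _ <= X]mulrA [X in X <= _]mulrC.
  apply: ler_wpM2r; first by rewrite invr_ge0.
  have -> : Ns n ^+ 4 = `|Ns n| ^+ 4 by rewrite -normrX ger0_norm // (_ : 4 = 2 * 2)%N // exprM sqr_ge0.
  apply: (@le_trans _ _ (((1 + c) ^+ #|[set i | hit k (q i) n]| * P1) ^+ 4)).
    have X0 : 0 <= (1 + c) ^+ #|[set i | hit k (q i) n]| * P1.
      by apply: mulr_ge0 => //; rewrite exprn_ge0 // addr_ge0.
    by rewrite lerXn2r ?nnegrE // Nsel_norm.
  rewrite exprMn mulrC; apply: ler_wpM2l; first exact: exprn_ge0.
  apply: le_trans (hit_pow_le a4 n); rewrite -exprM [(#|_| * 4)%N]mulnC /a4 -mulnA.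
  rewrite [X in _ <= X](_ : _ = (2 ^+ k.+2) ^+ (4 * #|[set i | hit k (q i) n]|)); last first.
    by rewrite -exprM; congr (_ ^+ _); rewrite !mulnA [(k.+2 * 4)%N]mulnC.
  rewrite lerXn2r ?nnegrE ?addr_ge0 ?exprn_ge0 // /c addrC natr1 -natrX ler_nat ltnW // ltn_expl //.
rewrite -mulr_sumr; apply: ler_wpM2l; first exact: exprn_ge0.
rewrite exchange_big /=; apply: (@le_trans _ _ (\sum_(1 <= t < k.+1) k.+1%:R * Lk ^+ (2 ^ (a4 * k)))).
  by apply: ler_sum_nat' => t /andP[_ tk]; exact: sum_tau_shift.
by rewrite sumr_const_nat subn1 -[X in X <= _]mulr_natl.
Qed.

Definition badsq S n := has (fun t => sqdiv S (n + t)) (iota 1 k).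

Lemma sum_badsq S : (0 < S)%N ->
  \sum_(1 <= n < M) n%:R^-1 * (badsq S n)%:R <= k%:R * (k.+1%:R * (Lk / S%:R)).
Proof.
move=> S0; apply: (@le_trans _ _ (\sum_(1 <= n < M) \sum_(1 <= t < k.+1) (sqdiv S (n + t))%:R / n%:R)).
  apply: ler_sum_nat' => n /andP[n0 _]; rewrite -mulr_suml mulrC; apply: ler_wpM2r; first by rewrite invr_ge0.
  rewrite /badsq; case: hasP => /= [[t]|_]; last by apply: sumr_ge0.
  rewrite mem_iota add1n => /andP[t0 tk] H.
  rewrite (bigD1_seq t) ?iota_uniq ?mem_index_iota ?t0 //= H lerDl; exact: sumr_ge0.
rewrite exchange_big /=; apply: (@le_trans _ _ (\sum_(1 <= t < k.+1) k.+1%:R * (Lk / S%:R))).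
  apply: ler_sum_nat' => t /andP[_ tk].
  apply: (le_trans (@shift_sum R (fun n => (sqdiv S n)%:R) t k M tk _)) => //.
  apply: ler_wpM2l => //; apply: le_trans (sum_sqdiv R (M + k) S0).
  rewrite [X in _ <= X]big_mkcond; apply: ler_sum => n _; case: ifP => _ /=; rewrite ?mul0r ?mul1r //.
by rewrite sumr_const_nat subn1 -[X in X <= _]mulr_natl.
Qed.

(** Cauchy's inequality separates the rare event [badsq], of density [1 / S] up to a logarithm, from
    the fourth moment of [Nsel], which is a power of the logarithm times [P1 ^+ 4]. *)
Lemma bad_mass (rho : nat -> R) G S : (0 < S)%N -> 0 <= G ->
  (forall n, (0 < n)%N -> 0 <= rho n <= G / n%:R) ->
  (\sum_(1 <= n < M) rho n * (badsq S n)%:R * Ns n ^+ 2) ^+ 2 <=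
  (G * k%:R * k.+1%:R) ^+ 2 * (P1 ^+ 4 * Lk ^+ (2 ^ (a4 * k)).+1) / S%:R.
Proof.
move=> S0 G0 Hr.
have E : \sum_(1 <= n < M) rho n * (badsq S n)%:R * Ns n ^+ 2 =
  \sum_(1 <= n < M | (0 < n)%N) rho n * (badsq S n)%:R * Ns n ^+ 2.
  by rewrite [RHS]big_mkcond; apply: eq_big_nat => n /andP[-> _].
rewrite E; have CS := @cauchy_sum R nat (index_iota 1 M) (fun n => 0 < n)%N rho (fun n => (badsq S n)%:R) (fun n => Ns n ^+ 2).
apply: (le_trans (CS _)) => /= {CS}; first by move=> n /Hr /andP[].
have Lk0 : 0 <= Lk := le_trans ler01 Lk1.
apply: (@le_trans _ _ ((G * (k%:R * (k.+1%:R * (Lk / S%:R)))) * (G * (P1 ^+ 4 * (k%:R * (k.+1%:R * Lk ^+ (2 ^ (a4 * k)))))))); last first.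
  by rewrite le_eqVlt; apply/orP; left; apply/eqP; rewrite [Lk ^+ _.+1]exprS; ring.
apply: ler_pM.
- by apply: sumr_ge0 => n /Hr /andP[r0 _]; rewrite mulr_ge0 ?sqr_ge0.
- by apply: sumr_ge0 => n /Hr /andP[r0 _]; rewrite mulr_ge0 ?sqr_ge0.
- apply: le_trans (ler_wpM2l G0 (sum_badsq S0)); rewrite mulr_sumr big_mkcond; apply: ler_sum_nat' => n /andP[n0 _].
  rewrite n0; have /andP[r0 r1] := Hr n n0; rewrite mulrA; case: (badsq S n); rewrite /= ?expr0n /= ?mulr0 ?expr1n ?mulr1 //.
- apply: le_trans (ler_wpM2l G0 sum_Nsel4); rewrite mulr_sumr big_mkcond; apply: ler_sum_nat' => n /andP[n0 _].
  rewrite n0; have /andP[r0 r1] := Hr n n0; rewrite [X in _ <= X]mulrA -exprM; apply: ler_wpM2r => //.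
  by rewrite exprM sqr_ge0.
Qed.

End NselBound.

Section SieveIndex.
Variables (R : realType) (D W : nat).

Definition sprimes := [seq p <- iota 0 D.+1 | prime p && coprime p W].
Definition sq (i : 'I_(size sprimes)) := nth 0%N sprimes i.

Lemma sq_mem i : sq i \in sprimes. Proof. by rewrite mem_nth. Qed.

Lemma sq_inj : injective sq.
Proof.
move=> i j /eqP; rewrite nth_uniq ?ltn_ord //; first by move=> /eqP /val_inj.
by rewrite filter_uniq // iota_uniq.
Qed.

Lemma sq_prime i : prime (sq i).
Proof. by have := sq_mem i; rewrite mem_filter => /andP[/andP[]]. Qed.

Lemma sq_coprime i : coprime (sq i) W.
Proof. by have := sq_mem i; rewrite mem_filter => /andP[/andP[]]. Qed.

Lemma sq_le i : (sq i <= D)%N.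
Proof. by have := sq_mem i; rewrite mem_filter mem_iota => /andP[_]. Qed.

Lemma sq_onto p : prime p -> coprime p W -> (p <= D)%N -> exists i, sq i = p.
Proof.
move=> pp cp pD; have H : p \in sprimes by rewrite mem_filter pp cp mem_iota.
have Hi : (index p sprimes < size sprimes)%N by rewrite index_mem.
by exists (Ordinal Hi); rewrite /sq nth_index.
Qed.

Lemma sum_sq (P : pred nat) (F : nat -> R) : (forall n, 0 <= F n) ->
  \sum_(i | P (sq i)) F (sq i) <= \sum_(1 <= p < D.+1 | prime p && P p) F p.
Proof.
move=> F0; have -> : \sum_(i | P (sq i)) F (sq i) = \sum_(p <- sprimes | P p) F p.
  by rewrite (big_nth 0%N) big_mkord.
rewrite big_filter_cond -[iota 0 D.+1]/(index_iota 0 D.+1) big_ltn_cond //= big_mkcond [X in _ <= X]big_mkcond.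
apply: ler_sum_nat' => p _; case: (prime p) => //=; case: (coprime _ _) => //=.
by case: ifP.
Qed.

Lemma sum_sq_log z : 1 <= ln z%:R :> R ->
  \sum_(i | (sq i <= z)%N) ln (sq i)%:R / (sq i)%:R <= 6 * expR 1 ^+ 2 * ln z%:R :> R.
Proof.
move=> z1; apply: le_trans (mertens_upper z1).
have F0 n : 0 <= ln n%:R / n%:R :> R by rewrite divr_ge0 ?lnr_ge0.
apply: le_trans (sum_sq (fun p => p <= z)%N F0) _.
have [Dz|zD] := leqP D.+1 z.+1.
  apply: (@le_trans _ _ (\sum_(1 <= p < D.+1 | prime p) ln p%:R / p%:R)).
    by rewrite big_mkcond [X in _ <= X]big_mkcond; apply: ler_sum => p _; case: (prime p) => //=; case: ifP.
  rewrite big_mkcond [X in _ <= X]big_mkcond; apply: ler_sum_nat_widen => // p _; by case: ifP.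
rewrite big_mkcond (@big_cat_nat _ _ _ z.+1) //= ?(ltnW zD) // [X in _ + X]big_nat_cond [X in _ + X]big1 ?addr0.
  by rewrite [X in _ <= X]big_mkcond; apply: ler_sum => p _; case: (prime p) => //=; case: ifP.
by move=> p /andP[/andP[zp _] _]; rewrite [(p <= z)%N]leqNgt zp andbF.
Qed.

End SieveIndex.

Lemma err_factor (R : realFieldType) (C G P : R) : 0 <= C -> G <= P -> 0 <= P ->
  C + (C + 1) * (1 + G) <= 2 * (C + 1) * (1 + P).
Proof. move=> C0 GP P0; nra. Qed.

Lemma one_le_gap (R : realFieldType) (c C s t : R) : 1 + c * t <= C -> 0 <= c -> s <= t ->
  1 <= C - c * s.
Proof. by move=> H c0 st; have := ler_wpM2l c0 st; lra. Qed.

Lemma gap_pos (R : realFieldType) (S A e E X b B Y : R) : A - e <= S -> X <= A -> e <= E -> b <= B ->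
  E + B < Y -> Y <= X -> 0 < S - b.
Proof. move=> *; lra. Qed.

Lemma exponent_order m n : (30 * m + 6 < n)%N ->
  [/\ ((10 * m + 2) * 3 < n)%N, (12 * m + 2 <= (10 * m + 2) * 3)%N & (m <= (10 * m + 2) * 3)%N].
Proof. by move=> H; split; lia. Qed.

Lemma sieve_exponent_ge k c : (k.+1 ^ 2 <= c)%N -> (0 < k)%N ->
  (2 * k * k.+1 ^ 2 <= 4 * k ^ 2 * c ^ 2)%N /\ (c <= 4 * k ^ 2 * c ^ 2)%N.
Proof. by move=> H k0; split; nia. Qed.

Lemma prod_primes_dvd (s : seq nat) n : uniq s -> all prime s -> all (fun r => r %| n)%N s ->
  (\prod_(r <- s) r %| n)%N.
Proof.
elim: s => [|r s IH] /=; first by rewrite big_nil dvd1n.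
move=> /andP[rs us] /andP[pr ps] /andP[rn sn]; rewrite big_cons Gauss_dvd ?rn ?IH //.
rewrite big_seq; apply: (big_ind (coprime r)); first exact: coprimen1.
  by move=> x y cx cy; rewrite coprimeMr cx.
move=> t ts; rewrite prime_coprime // dvdn_prime2 //; last exact: (allP ps).
by apply: contraNneq rs => ->.
Qed.

Lemma expn_le_prod (s : seq nat) d : all (fun r => d <= r)%N s -> (d ^ size s <= \prod_(r <- s) r)%N.
Proof.
elim: s => [|r s IH] /=; first by rewrite big_nil.
by move=> /andP[dr ds]; rewrite big_cons expnS leq_mul ?IH.
Qed.

(** * The sieve for shifts of a prime in a fixed residue class *)

Section Assembly.
Variables (R : realType) (k W b i u m n1 z c0 : nat) (Q0 Qb : nat) (delta tl Xq : R).
Let j := (10 * i)%N.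
Let B : R := Ysc R i ^+ j.
Let w := wt j (1 + ei R i).
Let K : R := 6 * expR 1 ^+ 2.
(** All cuts are powers of [u]. [V] exceeds [R1 ^ 4 = u ^ (12 m)] for the bilinear sums,
    [N0 = u ^ (30 m + 6)] exceeds [V ^ 2 * R1 ^ 2 = u ^ (30 m + 4)] for the linear ones, and [S0]
    exceeds [R1] for the prime powers. *)
Let D := (u ^ m)%N.
Let R1 := (D ^ 3)%N.
Let S0 := (u ^ (10 * m + 2))%N.
Let V := (u ^ (12 * m + 2))%N.
Let N0 := (S0 ^ 3)%N.
Let M := (u ^ n1)%N.
Let Lk : R := 1 + ln (M + k)%:R.
Let C0 : R := c0%:R.

Hypotheses (k0 : (0 < k)%N) (W1 : (1 < W)%N) (cb : coprime b W).
Hypothesis HW : forall p, prime p -> (p <= k.+1)%N -> (p %| W)%N.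
Hypotheses (u1 : 1 <= ln u%:R :> R) (m0 : (0 < m)%N) (mK : 8 * k%:R * K <= m%:R).
Hypotheses (n1m : (30 * m + 6 < n1)%N) (WN : (W <= N0)%N).
Hypothesis HN : 2 * j.+1%:R <= ln N0%:R :> R.
Hypothesis Hlow : \sum_(1 <= n < N0.+1) Lam R n * w n <= tl.
Hypothesis Hup : forall M', \sum_(M <= n < M') Lam R n * w n <= tl.
Hypothesis d0 : 0 <= delta.
Hypothesis Hchi : forall (m : nat) chi, (0 < m <= Qb)%N -> dchar m chi -> nonprincipal m chi ->
  exists M0, forall M', (M0 <= M')%N -> nc (As chi (1 + ei R i) j M') <= delta.
Hypotheses (Q00 : (0 < Q0)%N) (QQ : (Q0 * W <= Qb)%N).
Hypotheses (Xq0 : 0 <= Xq) (HX : Q0%:R^-1 + 4 * R1%:R ^+ 4 * W%:R / V%:R <= Xq ^+ 2).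

Let I := 'I_(size (sprimes D W)).
Let q : I -> nat := @sq D W.
Let qI : injective q := @sq_inj D W.
Let qP : forall t, prime (q t) := @sq_prime D W.
Let qW : forall t, coprime (q t) W := @sq_coprime D W.
Let qD t : (q t <= u ^ m)%N := @sq_le D W t.
Let qk t : (k.+1 < q t)%N.
Proof.
rewrite ltnNge; apply/negP => H; have := qW t; rewrite prime_coprime //.
by rewrite (HW (qP t) H).
Qed.

Let u0 : (1 < u)%N.
Proof.
rewrite ltnNge; apply/negP => H; have : ln u%:R <= 0 :> R by rewrite ln_le0 // lern1.
by move=> H2; have := lt_le_trans ltr01 (le_trans u1 H2); rewrite ltxx.
Qed.

Let u00 : (0 < u)%N := ltnW u0.
Let NM : (N0 < M)%N.
Proof. by rewrite /N0 /S0 /M -expnM ltn_exp2l //; case: (exponent_order n1m). Qed.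
Let VN : (V <= N0)%N.
Proof. by rewrite /N0 /S0 /V -expnM leq_exp2l //; case: (exponent_order n1m). Qed.
Let V0 : (0 < V)%N. Proof. by rewrite expn_gt0 u00. Qed.
Let M0 : (0 < M)%N. Proof. exact: leq_trans NM. Qed.
Let W0 : (0 < W)%N := ltnW W1.
Let WQ : (W <= Qb)%N. Proof. by apply: leq_trans QQ; rewrite leq_pmull. Qed.

Let w_ge0 n : 0 <= w n := scale_ge0 R i n.
Let w_le n : (0 < n)%N -> w n <= B / n%:R := @wt_scale_le R i n.
Let B0 : 0 <= B. Proof. by rewrite exprn_ge0 // ltW // Y_gt0. Qed.

Let fw := wcut w N0 M.
Let L : R := 1 + ln M%:R.
Let L1 : 1 <= L. Proof. by rewrite lerDl lnr_ge0. Qed.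
Let L0 : 0 <= L := le_trans ler01 L1.
Let LLk : L <= Lk. Proof. by rewrite lerD2l; apply: ler_lnr => //; rewrite leq_addr. Qed.
Let Lk1 : 1 <= Lk := le_trans L1 LLk.
Let Lk0 : 0 <= Lk := le_trans ler01 Lk1.

Let PP := nonprime_mass R i N0 M.

Let Lamfw_le n : (0 < n < M)%N -> Lam R n * fw n <= L * B / n%:R.
Proof.
move=> /andP[n0 nM]; rewrite -mulrA; apply: ler_pM.
- exact: Lam_ge0.
- exact: fw_ge0.
- apply: le_trans (Lam_le R n0) _; apply: le_trans (ler_lnr R n0 (ltnW nM)) _; by rewrite lerDr.
- exact: fw_le.
Qed.

Let Lamfw_ge0 n : 0 <= Lam R n * fw n.
Proof. by apply: mulr_ge0; [exact: Lam_ge0|exact: fw_ge0]. Qed.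

(** A proper prime power beyond [N0 = S0 ^ 3] has a square divisor [s ^ 2] with [s > S0], by
    [prime_power_sqdiv]. *)
Lemma nonprime_mass_le : PP <= L ^+ 2 * B / S0%:R.
Proof.
have S00 : (0 < S0)%N by rewrite expn_gt0 u00.
apply: (@le_trans _ _ (\sum_(1 <= n < M | sqdiv S0 n) L * B * n%:R^-1)).
  rewrite /PP /nonprime_mass big_mkcond [X in _ <= X]big_mkcond; apply: ler_sum_nat' => n nM.
  have X0 : 0 <= L * B * n%:R^-1 by rewrite mulr_ge0 ?invr_ge0 // mulr_ge0.
  case: ifP => pn; last by case: ifP.
  case: ifP => sn; first exact: Lamfw_le.
  have [->|ln0] := eqVneq (Lam R n) 0; first by rewrite mul0r.
  have [p [a [pp a0 nE]]] := Lam_neq0 ln0.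
  rewrite -/w -/(wcut w N0 M n) -/fw /fw /wcut; case: ifP => [/andP[N0n _]|_]; last by rewrite mulr0.
  move: sn; rewrite nE prime_power_sqdiv // -?nE //.
  by case: (a) a0 nE pn => [//|[|//]] _ ->; rewrite expn1 pp.
rewrite -mulr_sumr; apply: le_trans (ler_wpM2l _ (sum_sqdiv R M S00)) _; first exact: mulr_ge0.
by rewrite -/L le_eqVlt; apply/orP; left; apply/eqP; ring.
Qed.

Definition rho n : R := if prime n then Lam R n * (fw n * (n == b %[mod W])%:R) else 0.

Let rho_ge0 n : 0 <= rho n.
Proof. by rewrite /rho; case: ifP => // _; rewrite mulrA mulr_ge0. Qed.

Lemma rho_neq0 n : rho n != 0 -> [/\ prime n, (N0 < n < M)%N & n = b %[mod W]].
Proof.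
rewrite /rho; case: ifP => pn; last by rewrite eqxx.
rewrite /fw /wcut; case: ifP => [H|_]; last by rewrite mul0r mulr0 eqxx.
case: (eqVneq (n %% W)%N (b %% W)%N) => E; last by rewrite !mulr0 eqxx.
by [].
Qed.

Let DN : (D <= N0)%N.
Proof. by rewrite /D /N0 /S0 -expnM leq_exp2l //; case: (exponent_order n1m). Qed.

Let rho_q n t : rho n != 0 -> ~~ (q t %| n)%N.
Proof.
move=> /rho_neq0[pn /andP[Nn _] _]; rewrite dvdn_prime2 //; apply/eqP => E.
by have := qD t; rewrite E leqNgt (leq_ltn_trans _ Nn).
Qed.

Let ts := tsum q k W b w N0 M.

Let norm_le (A B' : R) x : `|A - B'| <= x -> `|A| <= `|B'| + x.
Proof. by move=> H; rewrite -[A](subrK B') addrC; apply: le_trans (ler_normD _ _) _; rewrite lerD2l. Qed.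

Let PP0 : 0 <= PP. Proof. by apply: sumr_ge0. Qed.

Lemma tauS_tsum U : `|tauS q k rho M U - ts U| <= PP.
Proof.
rewrite /tauS /ts /tsum -sumrB /PP /nonprime_mass [X in _ <= X]big_mkcond; apply: sum_nat_norm_le => n _.
rewrite /rho /phiW; case: (prime n) => /=; first by rewrite -!mulrA subrr normr0.
rewrite mul0r sub0r normrN -/fw mulrA normrM (ger0_norm (Lamfw_ge0 n)) -[X in _ <= X]mulr1.
by apply: ler_wpM2l => //; exact: (@phi_norm R I q k W b qk U n).
Qed.

Let C3n := (2 * (2 * k.+1 + k.+1 ^ 2))%N.
Let C3 : R := C3n%:R.
(** The exponent produced by [large_moduli]. It dominates the exponents of the other Euler products,
    so the single quantity [Pi] bounds them all. *)
Definition xpi : nat := (4 * k ^ 2 * C3n ^ 2)%N.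
Let Pi : R := @eprod R I q xpi%:R.

Let C3E : 2 * (2 * k.+1%:R + k.+1%:R ^+ 2) = C3 :> R.
Proof. by rewrite -natrX -(natrM R 2 k.+1) -natrD -natrM. Qed.

Let C31 : 1 <= C3. Proof. by rewrite ler1n. Qed.
Let C30 : 0 <= C3 := le_trans ler01 C31.

Let xpiE : xpi%:R = 4 * k%:R ^+ 2 * C3 ^+ 2 :> R.
Proof. by rewrite -(natrX R k) -(natrX R C3n) -!natrM. Qed.

Let Pi1 : 1 <= Pi. Proof. exact: eprod_ge1. Qed.
Let Pi0 : 0 <= Pi := le_trans ler01 Pi1.

Let xpi_ge : (2 * k * k.+1 ^ 2 <= xpi)%N.
Proof.
apply: (sieve_exponent_ge _ k0).1; rewrite /C3n; apply: leq_trans (leq_pmull _ _) => //.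
by rewrite leq_addl.
Qed.

Let C3_xpi : C3 <= xpi%:R.
Proof.
rewrite ler_nat; apply: (sieve_exponent_ge _ k0).2; rewrite /C3n; apply: leq_trans (leq_pmull _ _) => //.
by rewrite leq_addl.
Qed.

Let sum_pow_Pi (P : pred {set I}) r : (forall U, P U -> (rad q U <= r)%N) ->
  \sum_(U | P U) C3 ^+ #|U| <= r%:R * Pi.
Proof.
move=> Pr; apply: le_trans (sum_pow_le qP C30 Pr) _; apply: ler_wpM2l => //.
exact: eprod_le.
Qed.

(** Moduli up to [Q0] are treated by characters, those between [Q0] and [R1] by the bilinear bound;
    the last term accounts for prime powers. *)
Lemma errS_le : errS q k u m rho M <=
   Q0%:R * Pi * (Q0%:R * W%:R * delta + 2 * tl) +
   (B * L ^+ 5 * Pi * Xq + 6 * V%:R ^+ 2 * L * W%:R * R1%:R ^+ 2 * B * Pi / N0%:R) +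
   R1%:R * Pi * PP.
Proof.
have tl0 : 0 <= tl.
  by apply: le_trans (Hup M); rewrite big_geq.
rewrite /errS C3E -/D -/R1.
apply: (@le_trans _ _ (\sum_(U | (U != set0) && (rad q U <= R1)%N) (C3 ^+ #|U| * `|ts U| + C3 ^+ #|U| * PP))).
  apply: ler_sum => U _; rewrite -mulrDr; apply: ler_wpM2l; first exact: exprn_ge0.
  exact: norm_le (tauS_tsum U).
rewrite big_split /=; apply: lerD; last first.
  by rewrite -mulr_suml; apply: ler_wpM2r => //; apply: sum_pow_Pi => U /andP[].
rewrite (bigID (fun U => rad q U <= Q0)%N) /=; apply: lerD.
  apply: (@le_trans _ _ (\sum_(U | (U != set0) && (rad q U <= R1)%N && (rad q U <= Q0)%N) C3 ^+ #|U| * (Q0%:R * W%:R * delta + 2 * tl))).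
    apply: ler_sum => U /andP[/andP[U0 _] UQ]; apply: ler_wpM2l; first exact: exprn_ge0.
    have rQ : (rad q U * W <= Q0 * W)%N by rewrite leq_mul2r UQ orbT.
    apply: le_trans (@small_modulus R i N0 M W tl delta Qb NM W1 Hlow Hup d0 Hchi I q k b U qI qP qk qW cb U0 (leq_trans rQ QQ)) _.
    by rewrite lerD2r; apply: ler_wpM2r => //; rewrite -natrM ler_nat.
  rewrite -mulr_suml; apply: ler_wpM2r; first by rewrite addr_ge0 ?mulr_ge0.
  by apply: sum_pow_Pi => U /andP[].
have k1 : (0 < C3n)%N by [].
have R10 : (0 < R1)%N by rewrite !expn_gt0 u00.
have := @large_moduli R I q k W b qI qP qk qW W0 w N0 M V B V0 VN NM w_ge0 w_le
  (scale_decr HN) (scale_ldecr HN) (scale_sqdecr HN) C3n Q0 R1 Xq k0 k1 Q00 R10 Xq0 HX.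
rewrite -/L -xpiE -/Pi; apply: le_trans; rewrite le_eqVlt; apply/orP; left; apply/eqP.
by apply: eq_bigl => U; rewrite -ltnNge -andbA [(rad q U <= R1)%N && _]andbC.
Qed.

Lemma X_lower Full : Full <= \sum_(1 <= n < M) Lam R n * fw n ->
  (Full - PP) / W%:R - (W%:R * delta + 2 * tl) - PP <= tauS q k rho M set0.
Proof.
move=> HF; have := class_mass_lower NM W1 WN WQ Hlow Hup d0 Hchi cb.
rewrite -/PP => H1; have WR : 0 < W%:R :> R by rewrite ltr0n.
have H2 : (Full - PP) / W%:R <= class_mass R i N0 M W b + (W%:R * delta + 2 * tl).
  rewrite ler_pdivrMr // mulrC lerBlDl; exact: le_trans HF H1.
have : class_mass R i N0 M W b - PP <= tauS q k rho M set0.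
  rewrite /class_mass /PP /nonprime_mass [X in _ - X]big_mkcond -sumrB; apply: ler_sum => n _.
  rewrite /rho /zeU big_set0 mulr1; case: (prime n) => /=; first by rewrite subr0.
  rewrite subr_le0 mulrA -/fw -[X in _ <= X]mulr1; apply: ler_wpM2l => //; by case: (_ == _).
lra.
Qed.

Let lz : R := ln z%:R / ln D%:R.
Hypotheses (z1 : 1 <= ln z%:R :> R) (zD : (z <= D)%N) (kM : (k <= M)%N).
Hypothesis HC0 : 1 + Csel k m K * (2 * k%:R * K * (1 + (C0 + 1) * lz ^+ 2)) <= C0.

Let a4k := (4 * k.+2 * k)%N.
Let P1 : R := \prod_t (1 + k.+1%:R * zg R k (q t)).

Let zg2 t : zg R k (q t) <= 2 * k%:R / (q t)%:R := @g_le R I q k qP qk t.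

Let prod_le_Pi (x : nat) : (x <= k.+1 ^ 2)%N -> \prod_t (1 + x%:R * zg R k (q t)) <= Pi.
Proof.
move=> xk; apply: ler_prod => t _; have g0 := zg_ge0 R k (q t).
apply/andP; split; first by apply: addr_ge0 => //; exact: mulr_ge0.
rewrite lerD2l; apply: (@le_trans _ _ (x%:R * (2 * k%:R / (q t)%:R))); first by apply: ler_wpM2l.
rewrite !mulrA; apply: ler_wpM2r; first by rewrite invr_ge0.
rewrite -!natrM ler_nat; apply: leq_trans xpi_ge; rewrite mulnC [(x * _)%N]mulnC mulnA.
by rewrite [(k * 2)%N]mulnC leq_mul2l xk orbT.
Qed.

(** A hit by a prime up to [z] costs more than the allowance [C0], and any other hit costs 1. A
    positive balance therefore excludes all small primes and leaves at most [c0] hits. *)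
Let pen t : R := if (q t <= z)%N then C0 + 1 else 1.
Let C00 : 0 <= C0. Proof. exact: ler0n. Qed.

(** The 1 comes from all primes up to [D]. The extra charge [C0] on primes up to [z] is weighed down
    by the square of [lz], which is why the circular condition [HC0] can be met. *)
Lemma sum_pen : \sum_t pen t * zg R k (q t) * (ln (q t)%:R / ln D%:R) ^+ 2 <=
  2 * k%:R * K * (1 + (C0 + 1) * lz ^+ 2).
Proof.
have lD : 0 < ln D%:R :> R.
  rewrite /D natrX lnXn ?ltr0n // pmulrn_lgt0 //; exact: lt_le_trans u1.
have lD1 : 1 <= ln D%:R :> R.
  apply: le_trans u1 _; apply: ler_lnr => //; rewrite -[X in (X <= _)%N]expn1 leq_exp2l //.
have part (y : nat) : 1 <= ln y%:R :> R -> 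
   \sum_(t | (q t <= y)%N) zg R k (q t) * (ln (q t)%:R / ln D%:R) ^+ 2 <= 2 * k%:R * K * (ln y%:R / ln D%:R) ^+ 2.
  move=> y1; have ly : 0 < ln y%:R :> R := lt_le_trans ltr01 y1.
  apply: (@le_trans _ _ (\sum_(t | (q t <= y)%N) 2 * k%:R * ln y%:R / ln D%:R ^+ 2 * (ln (q t)%:R / (q t)%:R))).
    apply: ler_sum => t ty; have q0 : 0 < (q t)%:R :> R by rewrite ltr0n prime_gt0.
    have lq : ln (q t)%:R <= ln y%:R :> R by apply: ler_lnr => //; exact: prime_gt0.
    have l0 := lnr_ge0 R (q t).
    apply: (@le_trans _ _ (2 * k%:R / (q t)%:R * (ln (q t)%:R * ln y%:R / ln D%:R ^+ 2))).
      apply: ler_pM; rewrite ?zg_ge0 ?sqr_ge0 ?zg2 //.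
      rewrite expr_div_n; apply: ler_wpM2r; first by rewrite invr_ge0 sqr_ge0.
      by rewrite expr2; apply: ler_wpM2l.
    by rewrite le_eqVlt; apply/orP; left; apply/eqP; ring.
  rewrite -mulr_sumr; apply: le_trans (ler_wpM2l _ (sum_sq_log D W y1)) _.
    by rewrite divr_ge0 ?sqr_ge0 // !mulr_ge0 // ltW.
  by rewrite le_eqVlt; apply/orP; left; apply/eqP; rewrite /K; field; rewrite gt_eqF.
apply: (@le_trans _ _ (\sum_(t | (q t <= D)%N) zg R k (q t) * (ln (q t)%:R / ln D%:R) ^+ 2 +
  (C0 + 1) * \sum_(t | (q t <= z)%N) zg R k (q t) * (ln (q t)%:R / ln D%:R) ^+ 2)).
  rewrite mulr_sumr [X in _ <= X + _]big_mkcond [X in _ <= _ + X]big_mkcond -big_split /=; apply: ler_sum => t _.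
  rewrite qD /pen; set x := zg _ _ _; set y := (_ / _) ^+ 2.
  have xy : 0 <= x * y by rewrite mulr_ge0 ?sqr_ge0 // zg_ge0.
  by case: ifP => _; rewrite -mulrA; lra.
rewrite [X in _ <= X]mulrDr mulr1; apply: lerD.
  by apply: le_trans (part D lD1) _; rewrite divff ?gt_eqF // expr1n mulr1.
have := ler_wpM2l (addr_ge0 C00 ler01) (part z z1); rewrite -/lz => /le_trans; apply.
by rewrite le_eqVlt; apply/orP; left; apply/eqP; ring.
Qed.

(** The final inequality makes the weighted sum of allowance minus penalties minus [C0 * badsq]
    positive, so this balance is positive at some [n] with [rho n != 0]. Primes above [D] are
    counted by size: [n + t <= 2 * M <= u ^ (n1 + 1)] and [D >= u] permit at most [n1 + 1] of
    them. *)
Theorem sieve_conclusion (Full : R) (Bd : R) :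
  Full <= \sum_(1 <= n < M) Lam R n * fw n ->
  0 <= Bd -> (Lk * B * k%:R * k.+1%:R) ^+ 2 * (Pi ^+ 4 * Lk ^+ (2 ^ a4k).+1) / z%:R <= Bd ^+ 2 ->
  Pi * (Q0%:R * Pi * (Q0%:R * W%:R * delta + 2 * tl) +
   (B * L ^+ 5 * Pi * Xq + 6 * V%:R ^+ 2 * L * W%:R * R1%:R ^+ 2 * B * Pi / N0%:R) +
   R1%:R * Pi * PP) * (2 * (C0 + 1) * (1 + Pi)) + C0 * Bd <
    (Full - PP) / W%:R - (W%:R * delta + 2 * tl) - PP ->
  exists p, [/\ prime p, p = b %[mod W] & forall t, (0 < t <= k)%N ->
    (forall r, prime r -> ~~ (r %| W)%N -> (r %| p + t)%N -> (z < r)%N /\ ~~ (r ^ 2 %| p + t)%N) /\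
    (size [seq r <- primes (p + t) | ~~ (r %| W)%N] <= c0 + n1.+1)%N].
Proof.
move=> HF Bd0 HBd Hfin.
have X0 := X_lower HF; set X := tauS q k rho M set0 in X0.
have SL := @selberg_lower R I q k qP qk u m K u1 m0 (fun y => @sum_sq_log R D W y) mK qD
  rho M rho_ge0 rho_q C0 pen C00 _.
have Hpen t : 0 <= pen t <= C0 + 1.
  by rewrite /pen; case: ifP => _; rewrite ?lexx ?ler01 ?addr_ge0 //= lerDr.
have {}SL := SL Hpen.
set S := \sum_(1 <= n < M) rho n * (_ * (_ - _)) in SL.
have Sm := @Smass_ge1 R I q k qP qk u m.
have E0 := errS_le; set E := _ + R1%:R * Pi * PP in E0 Hfin.
have e0 : 0 <= errS q k u m rho M by exact: errS_ge0.
have E00 : 0 <= E := le_trans e0 E0.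
set Pc := \prod_t (1 + k.+1%:R ^+ 2 * _) in SL.
have Pc1 : Pc <= Pi by rewrite /Pc -natrX; exact: prod_le_Pi.
have Pc0 : 0 <= Pc.
  apply: prodr_ge0 => t _; apply: addr_ge0 => //; apply: mulr_ge0; [exact: sqr_ge0|exact: zg_ge0].
set G := \sum_t zg R k (q t) in SL.
have G0 : 0 <= G by apply: sumr_ge0 => t _; exact: zg_ge0.
have GPi : G <= Pi.
  apply: le_trans (prod_le_Pi (x := 1) _); last by rewrite expn_gt0.
  rewrite (eq_bigr (fun t => 1 + zg R k (q t))) => [|t _]; last by rewrite mul1r.
  rewrite prod_set1D /G (bigID (fun U : {set I} => #|U| == 1%N)) /= -[X in X <= _]addr0; apply: lerD; last first.
    by apply: sumr_ge0 => U _; apply: prodr_ge0 => t _; exact: zg_ge0.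
  rewrite (eq_bigl (fun U => U \in [set [set t] | t : I])); last first.
    by move=> U; apply/cards1P/imsetP => [[t ->]|[t _ ->]]; [exists t|exists t].
  rewrite big_imset /=; last by move=> s t _ _; exact: set1_inj.
  by apply: ler_sum => t _; rewrite big_set1.
have Err1 : Pc * errS q k u m rho M * (C0 + (C0 + 1) * (1 + G)) <= Pi * E * (2 * (C0 + 1) * (1 + Pi)).
  apply: ler_pM.
  - exact: mulr_ge0.
  - by rewrite addr_ge0 // mulr_ge0 ?addr_ge0.
  - exact: ler_pM.
  - exact: err_factor.
have Bad := @bad_mass R I q k qI qP qk u m k0 M rho (Lk * B) z.
set bad := \sum_(1 <= n < M) _ in Bad.
have z0 : (0 < z)%N.
  by rewrite lt0n; apply/eqP => z0; move: z1; rewrite z0 ln0 // => H; have := lt_le_trans ltr01 H; rewrite ltxx.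
have BdB : bad <= Bd.
  have bad0 : 0 <= bad.
    apply: sumr_ge0 => n _; apply: mulr_ge0; last exact: sqr_ge0.
    by apply: mulr_ge0.
  rewrite -(ler_sqr bad0 Bd0); apply: le_trans HBd; apply: le_trans (Bad z0 _ _) _.
  - exact: mulr_ge0.
  - move=> n n0; rewrite rho_ge0 /=; have [nM|Mn] := ltnP n M; last first.
      have -> : rho n = 0; last by rewrite divr_ge0 // mulr_ge0.
      by apply/eqP; apply: contraTT Mn => /rho_neq0[_ /andP[_ H] _]; rewrite -ltnNge.
    rewrite /rho; case: ifP => _; last by rewrite divr_ge0 // mulr_ge0.
    apply: (@le_trans _ _ (Lam R n * fw n)).
      rewrite mulrA -[X in _ <= X]mulr1; apply: ler_wpM2l => //; by case: (_ == _).
    apply: le_trans (Lamfw_le _) _; first by rewrite n0.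
    by apply: ler_wpM2r; [rewrite invr_ge0|exact: ler_wpM2r].
  - apply: ler_wpM2r; first by rewrite invr_ge0.
    apply: ler_wpM2l; first exact: sqr_ge0.
    apply: ler_wpM2r; first exact: exprn_ge0.
    have p10 : 0 <= P1 by apply: prodr_ge0 => t _; rewrite addr_ge0 // mulr_ge0 // zg_ge0.
    rewrite lerXn2r ?nnegrE //; apply: prod_le_Pi; rewrite -mulnn leq_pmulr //.
have Main : X <= X * Smass R q k u m * (C0 - Csel k m K * \sum_t pen t * zg R k (q t) * (ln (q t)%:R / ln D%:R) ^+ 2).
  have Xp : 0 <= X.
    by apply: sumr_ge0 => n _; rewrite /zeU big_set0 mulr1.
  have Cs0 : 0 <= Csel k m K by rewrite mulr_ge0 ?expR_ge0.
  rewrite -mulrA; apply: ler_peMr => //; rewrite -[X in X <= _]mulr1; apply: ler_pM => //.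
  exact: one_le_gap sum_pen.
have pos : 0 < S - C0 * bad.
  exact: gap_pos SL Main Err1 (ler_wpM2l C00 BdB) Hfin X0.
have E2 : S - C0 * bad = \sum_(1 <= n < M) rho n * Nsel R q k u m n ^+ 2 *
   (C0 - \sum_t pen t * (hit k (q t) n)%:R - C0 * (badsq k z n)%:R).
  by rewrite /S /bad mulr_sumr -sumrB; apply: eq_bigr => n _; ring.
have [n [rn Hn]] : exists n, rho n != 0 /\
   0 < C0 - \sum_t pen t * (hit k (q t) n)%:R - C0 * (badsq k z n)%:R.
  apply: contrapT => H; move: pos; rewrite E2 ltNge => /negP[].
  apply: sumr_le0 => n _; have [->|rn] := eqVneq (rho n) 0; first by rewrite !mul0r.
  apply: mulr_ge0_le0; first by rewrite mulr_ge0 ?sqr_ge0.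
  by rewrite leNgt; apply/negP => Hy; apply: H; exists n.
have [pn /andP[Nn nM] nb] := rho_neq0 rn.
have pZ0 t : 0 <= pen t * (hit k (q t) n)%:R by apply: mulr_ge0 => //; case/andP: (Hpen t).
have sZ0 : 0 <= \sum_t pen t * (hit k (q t) n)%:R by apply: sumr_ge0.
have nbad : ~~ badsq k z n.
  by apply/negP => H; move: Hn; rewrite H /= mulr1 addrAC subrr add0r oppr_gt0 ltNge sZ0.
have sZ : \sum_t pen t * (hit k (q t) n)%:R < C0.
  by move: Hn; rewrite (negbTE nbad) mulr0 subr0 subr_gt0.
have hcard : (#|[set t | hit k (q t) n]| <= c0)%N.
  rewrite -(ler_nat R) -sum1_card natr_sum; apply: le_trans (ltW sZ).
  rewrite big_mkcond; apply: ler_sum => t _; rewrite inE; case: (hit _ _ _); last by rewrite mulr0.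
  by rewrite mulr1 /pen; case: ifP => // _; rewrite lerDr.
exists n; split => // t /andP[t0 tk].
have nt0 : (0 < n + t)%N by rewrite addn_gt0 t0 orbT.
have hitI s : (q s %| n + t)%N -> hit k (q s) n.
  by move=> H; apply/hasP; exists t => //; rewrite mem_iota t0 add1n ltnS.
split.
  move=> r pr rW rd; have cr : coprime r W by rewrite prime_coprime.
  have zr : (z < r)%N.
    rewrite ltnNge; apply/negP => rz; have [s sE] := sq_onto pr cr (leq_trans rz zD).
    have hs : hit k (q s) n by apply: hitI; rewrite /q sE.
    move: sZ; rewrite (bigD1 s) //= hs mulr1 /pen {1}/q sE rz ltNge => /negP[].
    apply: (@le_trans _ _ (C0 + 1)); first by rewrite lerDl.
    by rewrite lerDl; apply: sumr_ge0 => s' _; exact: pZ0.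
  split => //; apply/negP => r2; case/negP: nbad; apply/hasP; exists t; last exact: sqdivI zr r2.
  by rewrite mem_iota t0 add1n ltnS.
set A := [seq r <- _ | _].
have uA : uniq A by rewrite filter_uniq // primes_uniq.
have Ap r : r \in A -> [/\ prime r, ~~ (r %| W)%N & (r %| n + t)%N].
  by rewrite mem_filter mem_primes => /andP[-> /and3P[-> _ ->]].
rewrite -(count_predC (fun r => r <= D)%N A) -!size_filter; apply: leq_add.
  apply: leq_trans hcard; rewrite cardE -(size_map q); apply: uniq_leq_size; first exact: filter_uniq.
  move=> r; rewrite mem_filter => /andP[rD /Ap[pr rW rd]].
  have cr : coprime r W by rewrite prime_coprime.
  have [s sE] := sq_onto pr cr rD; apply/mapP; exists s => //.
  by rewrite mem_enum inE; apply: hitI; rewrite /q sE.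
set A2 := filter _ A; have H1 : (D ^ size A2 <= n + t)%N.
  apply: leq_trans (expn_le_prod _) (dvdn_leq nt0 (prod_primes_dvd _ _ _)).
  - by apply/allP => r; rewrite mem_filter /= -ltnNge => /andP[/ltnW].
  - exact: filter_uniq.
  - by apply/allP => r; rewrite mem_filter => /andP[_ /Ap[]].
  - by apply/allP => r; rewrite mem_filter => /andP[_ /Ap[]].
rewrite -(leq_exp2l _ _ u0); apply: (@leq_trans (D ^ size A2)).
  by rewrite /D -expnM leq_exp2l // leq_pmull.
apply: leq_trans H1 _; rewrite expnS -/M; apply: (@leq_trans (2 * M)).
  by rewrite mul2n -addnn; apply: leq_add; [exact: ltnW|exact: leq_trans tk kM].
by rewrite leq_mul2r u0 orbT.
Qed.

End Assembly.

Ltac pos := repeat first [assumption | exact: ler01 | exact: ler0n | apply: exprn_ge0 | apply: addr_ge0 | apply: mulr_ge0].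
Ltac mono := repeat first [exact: lexx | assumption | apply: ler_pM; [pos|pos| |]].

Lemma choice_gap (R : realFieldType) (P C z7 z6 z5 zy q w t p e8 : R) : 0 < zy ->
  P <= 5 * z7 -> C <= z5 -> zy - z6 <= q -> w <= z6 -> t <= z6 -> p <= z6 ->
  z7 <= z6 -> z6 <= z5 -> z5 <= zy * e8 -> zy * e8 <= zy * 64^-1 ->
  P + C < q - (w + t) - p.
Proof. move=> *; lra. Qed.

(** * Choice of the parameters *)

Section Numeric.
Variables (R : realFieldType) (Y y : R).
Hypotheses (Y8 : 8 <= Y) (yE : y = Y^-1).

Let Y0 : 0 < Y. Proof. by apply: lt_le_trans Y8; rewrite ltr0n. Qed.
Let Y1 : 1 <= Y. Proof. by apply: le_trans Y8; rewrite ler1n. Qed.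
Let y0 : 0 < y. Proof. by rewrite yE invr_gt0. Qed.
Let y1 : y <= 1. Proof. by rewrite yE invf_le1. Qed.
Let Yy : Y * y = 1. Proof. by rewrite yE mulfV // gt_eqF. Qed.

Let Y2 : 2 <= Y. Proof. by apply: le_trans Y8; rewrite ler_nat. Qed.
Let Y6 : 6 <= Y. Proof. by apply: le_trans Y8; rewrite ler_nat. Qed.

Lemma powYy p r t : (t + p <= r)%N -> Y ^+ p * y ^+ r <= y ^+ t.
Proof.
move=> H; have -> : r = (p + (r - p))%N by lia.
rewrite exprD mulrA -exprMn Yy expr1n mul1r.
by apply: ler_wiXn2l; [exact: ltW|exact: y1|lia].
Qed.

(* [Y] is a large power of two and [y] its inverse: all error terms are powers of [y] relative to [B], with exponents chosen in the order [C1, T, T2, A2, a, b, T3]. *)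
Lemma numeric_choice (F C1 T T2 A2 a b T3 : nat) (B Pi L W delta tl G4 PP RP C0 Bd : R) :
  T = (C1 + 6)%N -> T2 = (T + 2 * F + 2)%N -> A2 = (11 + F + T2)%N ->
  a = (4 * A2 + F + 2 + T2)%N -> b = (2 * A2 + F + 3 + T2)%N ->
  (F + 4 + T2 <= T3)%N -> 0 < B -> 0 <= Pi <= Y ^+ F -> 1 <= Pi -> 0 <= L <= Y ^+ 2 -> 1 <= W <= Y ->
  0 <= delta <= B * Y * y ^+ a -> 0 <= tl <= B * Y ^+ 2 * y ^+ b -> 0 <= G4 <= y ^+ T3 ->
  0 <= PP <= B * Y ^+ 4 * y ^+ T3 -> 0 <= RP <= B * Y ^+ 4 * y ^+ T3 ->
  0 <= C0 -> 4 * (C0 + 1) <= Y -> 0 <= Bd <= B * y ^+ T ->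
  Pi * (Y ^+ (2 * A2) * Pi * (Y ^+ (2 * A2) * W * delta + 2 * tl) +
     (B * L ^+ 5 * Pi * (2 * y ^+ A2) + 6 * L * W * Pi * B * G4) + Pi * RP) * (2 * (C0 + 1) * (1 + Pi))
    + C0 * Bd < (B * y ^+ C1 - PP) / W - (W * delta + 2 * tl) - PP.
Proof.
move=> HT HT2 HA2 Ha Hb HT3 B0 /andP[P0 PF] P1 /andP[L0 LY] /andP[W1 WY] /andP[d0 dY] /andP[t0 tY]
  /andP[g0 gY] /andP[p0 pY] /andP[r0 rY] C0p CY /andP[b0 bY].
have B0' := ltW B0; have W0 : 0 <= W by lra.
have O0 : 0 <= Y by exact: ltW.
have o0 : 0 <= y by exact: ltW.
have YX n : 0 <= Y ^+ n by rewrite exprn_ge0 // ltW.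
have yX n : 0 <= y ^+ n by rewrite exprn_ge0 // ltW.
have fin x p r t : 0 <= x -> x <= B * (Y ^+ p * y ^+ r) -> (t + p <= r)%N -> x <= B * y ^+ t.
  by move=> x0 H1 H2; apply: (le_trans H1); apply: ler_wpM2l => //; exact: powYy.
have t1 : Y ^+ (2 * A2) * Pi * (Y ^+ (2 * A2) * W * delta) <= B * y ^+ T2.
  apply: (fin _ (2 * A2 + F + (2 * A2 + 1 + 1))%N a).
  - by pos.
  - have -> : B * (Y ^+ (2 * A2 + F + (2 * A2 + 1 + 1)) * y ^+ a) =
      Y ^+ (2 * A2) * Y ^+ F * (Y ^+ (2 * A2) * Y * (B * Y * y ^+ a)) by rewrite !exprD !expr1; ring.
    by mono.
  - clear -HT HT2 HA2 Ha Hb; lia.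
have t2 : Y ^+ (2 * A2) * Pi * (2 * tl) <= B * y ^+ T2.
  apply: (fin _ (2 * A2 + F + (1 + 2))%N b).
  - by pos.
  - have -> : B * (Y ^+ (2 * A2 + F + (1 + 2)) * y ^+ b) =
      Y ^+ (2 * A2) * Y ^+ F * (Y * (B * Y ^+ 2 * y ^+ b)) by rewrite !exprD !expr1; ring.
    by mono.
  - clear -HT HT2 HA2 Ha Hb; lia.
have L5 : L ^+ 5 <= Y ^+ 10.
  by rewrite (_ : 10 = 2 * 5)%N // exprM lerXn2r ?nnegrE ?exprn_ge0 // ltW.
have t3 : B * L ^+ 5 * Pi * (2 * y ^+ A2) <= B * y ^+ T2.
  apply: (fin _ (10 + F + 1)%N A2).
  - by pos.
  - have -> : B * (Y ^+ (10 + F + 1) * y ^+ A2) = B * Y ^+ 10 * Y ^+ F * (Y * y ^+ A2) by rewrite !exprD !expr1; ring.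
    by mono.
  - clear -HT HT2 HA2 Ha Hb; lia.
have t4 : 6 * L * W * Pi * B * G4 <= B * y ^+ T2.
  apply: (fin _ (1 + 2 + 1 + F)%N T3).
  - by pos.
  - have -> : B * (Y ^+ (1 + 2 + 1 + F) * y ^+ T3) = Y * Y ^+ 2 * Y * Y ^+ F * B * y ^+ T3 by rewrite !exprD !expr1; ring.
    by mono.
  - clear -HT HT2 HT3; lia.
have t5 : Pi * RP <= B * y ^+ T2.
  apply: (fin _ (F + 4)%N T3).
  - by pos.
  - have -> : B * (Y ^+ (F + 4) * y ^+ T3) = Y ^+ F * (B * Y ^+ 4 * y ^+ T3) by rewrite !exprD; ring.
    by mono.
  - clear -HT HT2 HT3; lia.
set E := _ + Pi * RP; have EY : E <= 5 * (B * y ^+ T2) by rewrite /E mulrDr; lra.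
have E0 : 0 <= E by rewrite /E; pos.
have f1 : 2 * (C0 + 1) * (1 + Pi) <= Y * Y ^+ F.
  apply: (@le_trans _ _ (4 * (C0 + 1) * Pi)); last by mono.
  rewrite -subr_ge0 (_ : _ - _ = 2 * ((C0 + 1) * (Pi - 1))); last by ring.
  apply: mulr_ge0; first by pos.
  by apply: mulr_ge0; [pos|rewrite subr_ge0].
have big : Pi * E * (2 * (C0 + 1) * (1 + Pi)) <= 5 * (B * y ^+ (T + 1)).
  apply: (@le_trans _ _ (Y ^+ F * (5 * (B * y ^+ T2)) * (Y * Y ^+ F))).
    by mono.
  have -> : Y ^+ F * (5 * (B * y ^+ T2)) * (Y * Y ^+ F) = 5 * (B * (Y ^+ (F + 1 + F) * y ^+ T2)) by rewrite !exprD expr1; ring.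
  apply: ler_wpM2l => //; apply: ler_wpM2l => //; apply: powYy; clear -HT HT2 HA2 Ha Hb; lia.
have Wd : W * delta <= B * y ^+ T.
  apply: (fin _ 2%N a); first by pos.
  - have -> : B * (Y ^+ 2 * y ^+ a) = Y * (B * Y * y ^+ a) by ring.
    by mono.
  - clear -HT HT2 HA2 Ha Hb; lia.
have tt : 2 * tl <= B * y ^+ T.
  apply: (fin _ 3%N b); first by pos.
  - have -> : B * (Y ^+ 3 * y ^+ b) = Y * (B * Y ^+ 2 * y ^+ b) by ring.
    by mono.
  - clear -HT HT2 HA2 Ha Hb; lia.
have pp : PP <= B * y ^+ T.
  apply: (fin _ 4%N T3) => //; first by rewrite mulrA.
  clear -HT HT2 HT3; lia.
have cb : C0 * Bd <= Y * (B * y ^+ T) by apply: ler_pM => //; lra.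
have yT n : y ^+ (C1 + n) = y ^+ C1 * y ^+ n by rewrite exprD.
have yC : 0 < y ^+ C1 by rewrite exprn_gt0.
set Z := B * y ^+ C1; have Z0 : 0 < Z by rewrite mulr_gt0.
have BT : B * y ^+ T = Z * y ^+ 6 by rewrite HT yT mulrA.
have BT1 : B * y ^+ (T + 1) = Z * y ^+ 7 by rewrite HT -addnA yT mulrA.
clearbody Z.
have y8 : y <= 8^-1 by rewrite yE lef_pV2 ?posrE.
rewrite BT1 in big; rewrite BT in Wd tt pp cb.
have y5 : Y * (Z * y ^+ 6) = Z * y ^+ 5 by rewrite exprS mulrCA [Y * _]mulrA Yy mul1r.
rewrite y5 in cb.
have y76 : Z * y ^+ 7 <= Z * y ^+ 6 by apply: ler_wpM2l; [exact: ltW|exact: ler_wiXn2l].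
have y65 : Z * y ^+ 6 <= Z * y ^+ 5 by apply: ler_wpM2l; [exact: ltW|exact: ler_wiXn2l].
have y51 : Z * y ^+ 5 <= Z * y * (8^-1) ^+ 4.
  rewrite -mulrA; apply: ler_wpM2l; first exact: ltW.
  rewrite exprS; apply: ler_wpM2l; first exact: ltW.
  by rewrite lerXn2r // nnegrE ?invr_ge0.
have q1 : Z * y - Z * y ^+ 6 <= (Z - PP) / W.
  have zy : 0 <= Z - Z * y ^+ 6.
    rewrite subr_ge0 -[X in _ <= X]mulr1; apply: ler_wpM2l; first exact: ltW.
    by apply: exprn_ile1; [exact: o0|exact: y1].
  have Wi : y <= W^-1 by rewrite yE lef_pV2 ?posrE // (lt_le_trans ltr01).
  have Wi1 : W^-1 <= 1 by rewrite invf_le1 // (lt_le_trans ltr01).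
  apply: (@le_trans _ _ ((Z - Z * y ^+ 6) / W)); last first.
    by apply: ler_wpM2r; [rewrite invr_ge0|rewrite lerD2l lerN2].
  apply: (@le_trans _ _ ((Z - Z * y ^+ 6) * y)); last exact: ler_wpM2l.
  rewrite mulrBl lerD2l lerN2 -[X in _ <= X]mulr1; apply: ler_wpM2l => //.
  by apply: mulr_ge0; [exact: ltW|exact: yX].
have Zy0 : 0 < Z * y by rewrite mulr_gt0.
have e8 : (8^-1) ^+ 4 <= 64^-1 :> R.
  by rewrite exprVn lef_pV2 ?posrE ?exprn_gt0 // -natrX ler_nat.
exact: choice_gap Zy0 big cb q1 Wd tt pp y76 y65 y51 (ler_wpM2l (ltW Zy0) e8).
Qed.

End Numeric.

Section SmallFacts.
Variable R : realType.

Lemma expR1_le4 : expR 1 <= 4 :> R.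
Proof.
have -> : 4 = expR (2 * ln 2) :> R by rewrite expRM_natl lnK ?posrE // -natrX.
rewrite ler_expR; have := @ln2_ge R; lra.
Qed.

Lemma expR1_mul c : (c <= 12)%N -> c%:R * expR 1 <= 1024 :> R.
Proof.
rewrite -(ler_nat R) => c12; have := expR1_le4; have := expR_ge0 (1 : R); nra.
Qed.

Lemma double_le4 (x : R) : 0 <= x -> x + x <= 2 ^+ 2 * x.
Proof. move=> x0; rewrite -natrX; lra. Qed.

Lemma lower_ratio (b h : nat) : (2 ^ (b + 4) <= h)%N -> expR 1 / h%:R <= (2 ^+ b)^-1 :> R.
Proof.
move=> H; have h0 : 0 < h%:R :> R by rewrite ltr0n (leq_trans _ H) // expn_gt0.
rewrite ler_pdivrMr // mulrC ler_pdivlMr ?exprn_gt0 //.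
apply: (@le_trans _ _ (4 * 2 ^+ b)); first by rewrite ler_wpM2r ?exprn_ge0 // expR1_le4.
rewrite -natrX -natrM ler_nat; apply: leq_trans H; rewrite expnD mulnC leq_pmul2l ?expn_gt0 //.
Qed.

Lemma upper_ratio (b h : nat) : (2 ^ (b + 4) <= h)%N -> 4 * expR (- (h%:R / 4)) <= (2 ^+ b)^-1 :> R.
Proof.
move=> H; have h0 : 0 < h%:R :> R by rewrite ltr0n (leq_trans _ H) // expn_gt0.
have h4 : 0 < h%:R / 4 :> R by rewrite divr_gt0.
have b0 : 0 < 2 ^+ b :> R by rewrite exprn_gt0.
rewrite expRN; apply: (@le_trans _ _ (4 / (h%:R / 4))).
  rewrite ler_pM2l // lef_pV2 ?posrE ?expR_gt0 //.
  by apply: le_trans (expR_ge1Dx _); rewrite lerDr.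
have Hb : 2 ^+ b * 16 <= h%:R :> R.
  by move: H; rewrite -(ler_nat R) natrX exprD -[2 ^+ 4]natrX.
have -> : 4 / (h%:R / 4) = 16 / h%:R :> R by field; rewrite gt_eqF.
by rewrite ler_pdivrMr // mulrC ler_pdivlMr // mulrC.
Qed.

Lemma eprod_le_expR (D W x : nat) (C : R) : 1 <= ln D%:R :> R ->
  expR (psm R D) <= C -> @eprod R _ (@sq D W) x%:R <= C ^+ x.
Proof.
move=> D1 HC; apply: (@le_trans _ _ (expR (psm R D) ^+ x)); last first.
  by rewrite lerXn2r ?nnegrE ?expR_ge0 // (le_trans (expR_ge0 _) HC).
rewrite -expRM_natl; apply: (@le_trans _ _ (expR (\sum_t x%:R / (@sq D W t)%:R))).
  rewrite expR_sum; apply: ler_prod => t _; rewrite expR_ge1Dx andbT.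
  by rewrite addr_ge0 // divr_ge0.
rewrite ler_expR -mulr_sumr; apply: ler_wpM2l => //.
have F0 n : 0 <= n%:R^-1 :> R by rewrite invr_ge0.
have := @sum_sq R D W xpredT (fun n => n%:R^-1) F0.
by rewrite (eq_bigl (fun p => prime p)) // => p; rewrite andbT.
Qed.

End SmallFacts.

Lemma choice_sizes (h m hh T3 j : nat) : (hh + T3 <= j)%N -> hh = (h * (30 * m + 6))%N ->
  (T3 <= 2 ^ (j - hh))%N /\ (h * (30 * m + 6) <= 2 ^ hh)%N.
Proof.
move=> H E; split; last by rewrite -E ltnW // ltn_expl.
by apply: leq_trans (ltnW (ltn_expl _ _)) => //; rewrite leq_subRL ?(leq_trans _ H) ?leq_addr.
Qed.

Lemma power_count1 u m :
  ((u ^ (12 * m + 2)) ^ 2 * ((u ^ m) ^ 3) ^ 2 * u = u ^ (30 * m + 5))%N.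
Proof. by rewrite -!expnM -!expnD -expnSr; congr (_ ^ _)%N; lia. Qed.

Lemma power_count2 u m : (((u ^ m) ^ 3) ^ 4 * u = u ^ (12 * m + 1))%N.
Proof. by rewrite -!expnM -expnSr; congr (_ ^ _)%N; lia. Qed.

Lemma choice_arith (A i j d : nat) : j = (10 * i)%N -> (10 <= j)%N -> (j <= d)%N ->
  (2 * j.+1 * 2 <= 6 * d)%N /\ ((20 * A + 1) * i = j * (2 * A) + i)%N.
Proof. by move=> *; split; nia. Qed.

Section Choice.
Variables (R : realType) (k W b B0 m c0 C1 i h : nat) (C2 h1 : R).
Variables (F T T2 A2 a bb A' T3 hh n1 : nat).
Let Y : R := Ysc R i.
Let y : R := Y^-1.
Let j := (10 * i)%N.
Let B : R := Y ^+ j.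
Let E := (2 ^ (4 * k.+2 * k))%N.
(** Chosen so that [2 ^ hh * d = j * Y]: then [ln u] is a fixed fraction of the position [j Y] of
    the window, and [D], [V], [N0] and [M] can be constant powers of [u]. *)
Let e := (2 ^ (j - hh))%N.
Let d := (j * e)%N.
Let u := (2 ^ d)%N.
Let D := (u ^ m)%N.
(** [z = Y ^ (2 A')] and [Q0 = Y ^ (2 A2)] are fixed powers of [Y], tiny beside [u = Y ^ e]. *)
Let z := (2 ^ (j * (2 * A')))%N.
Let M := (u ^ n1)%N.
Let N0 := ((u ^ (10 * m + 2)) ^ 3)%N.
Let S0 := (u ^ (10 * m + 2))%N.
Let V := (u ^ (12 * m + 2))%N.
Let R1 := (D ^ 3)%N.
Let Q0 := (2 ^ (j * (2 * A2)))%N.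
Let Lk : R := 1 + ln (M + k)%:R.
Let L : R := 1 + ln M%:R.
Let delta : R := (1024 ^+ i / 2 ^+ a) ^+ j.+1.
Let tl : R := B * Y ^+ 2 * y ^+ bb.
Let K : R := 6 * expR 1 ^+ 2.

Hypotheses (ET : T = (C1 + 6)%N) (ET2 : T2 = (T + 2 * F + 2)%N) (EA2 : A2 = (11 + F + T2)%N)
  (Ea : a = (4 * A2 + F + 2 + T2)%N) (Ebb : bb = (2 * A2 + F + 3 + T2)%N)
  (EA' : A' = (T + 4 + 2 * F + E)%N) (Ehh : hh = (h * (30 * m + 6))%N)
  (En1 : n1 = (2 * h * 2 ^ hh + 30 * m + 7)%N) (EF : F = (2 * xpi k)%N).
Hypotheses (T3a : (F + 4 + T2 <= T3)%N) (T3b : (2 * A2 + 2 <= T3)%N) (T3c : (2 * A' * c0.+1 <= T3)%N).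
Hypotheses (k0 : (0 < k)%N) (W1 : (1 < W)%N) (cb : coprime b W).
Hypothesis HW : forall p, prime p -> (p <= k.+1)%N -> (p %| W)%N.
Hypotheses (m0 : (0 < m)%N) (mK : 8 * k%:R * K <= m%:R).
Hypothesis Hc0 : 1 + Csel k m K * (2 * k%:R * K * 2) <= c0%:R.
Hypotheses (C20 : 0 < C2) (HC2 : forall Q, 1 <= ln Q%:R :> R -> expR (psm R Q) <= C2 * (1 + ln Q%:R)).
Hypotheses (h1h : h1 <= h%:R) (hb : (2 ^ (bb + 4) <= h)%N).
Hypothesis Hfull : forall N0 M, (0 < N0)%N -> h1 * ln N0%:R <= j%:R * Y -> h1 * (j%:R * Y) <= ln M%:R ->
  B / Y ^+ C1 <= \sum_(1 <= n < M) Lam R n * wcut (wt j (1 + ei R i)) N0 M n.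
Hypothesis Hchi : forall (q : nat) chi, (0 < q <= 2 ^ ((20 * A2 + 1) * i))%N ->
  dchar q chi -> nonprincipal q chi ->
  exists M0, forall M, (M0 <= M)%N -> nc (As chi (1 + ei R i) j M) <= delta.
Hypotheses (i1 : (0 < i)%N) (hj : (hh + T3 <= j)%N) (Wi : (W <= 2 ^ i)%N) (ki : (k * k.+1 <= 2 ^ j)%N).
Hypotheses (B0i : (B0 <= 2 ^ j)%N) (ci : (4 * c0.+1 <= 2 ^ j)%N) (ni : (n1.+2 * j <= 2 ^ j)%N).
Hypothesis Ci : C2 * (1 + m%:R) * j%:R <= Y.

Let natY n : (2 ^ (j * n))%:R = Y ^+ n :> R. Proof. by rewrite expnM !natrX. Qed.
Let Ynat : Y = (2 ^ j)%:R. Proof. by rewrite natrX. Qed.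
Let j10 : (10 <= j)%N. Proof. by rewrite leq_pmulr. Qed.
Let j00 : (0 < j)%N. Proof. exact: leq_trans j10. Qed.
Let Y1024 : 1024 <= Y.
Proof.
have -> : 1024 = 2 ^+ 10 :> R by clear; ring.
by rewrite Ynat natrX ler_weXn2l // ler1n.
Qed.
Let Y8 : 8 <= Y. Proof. by apply: le_trans Y1024; rewrite ler_nat. Qed.
Let Y1 : 1 <= Y. Proof. by apply: le_trans Y1024; rewrite ler1n. Qed.
Let Y0 : 0 < Y. Proof. exact: lt_le_trans ltr01 Y1. Qed.
Let Y00 : 0 <= Y. Proof. exact: ltW. Qed.
Let y0 : 0 < y. Proof. by rewrite invr_gt0. Qed.
Let YX n : 0 < Y ^+ n. Proof. exact: exprn_gt0. Qed.
Let yX n : 0 < y ^+ n. Proof. exact: exprn_gt0. Qed.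
Let YyX n : Y ^+ n * y ^+ n = 1. Proof. by rewrite -exprMn mulfV ?gt_eqF // expr1n. Qed.
Let B00 : 0 < B. Proof. exact: YX. Qed.
Let B01 : 0 <= B. Proof. exact: ltW. Qed.

Let eT3 : (T3 <= e)%N. Proof. exact: (choice_sizes hj Ehh).1. Qed.
Let hmH : (h * (30 * m + 6) <= 2 ^ hh)%N. Proof. exact: (choice_sizes hj Ehh).2. Qed.
Let hhj : (hh <= j)%N. Proof. exact: leq_trans (leq_addr _ _) hj. Qed.
Let eH : (2 ^ hh * e = 2 ^ j)%N. Proof. by rewrite -expnD subnKC. Qed.
Let e0 : (0 < e)%N. Proof. by rewrite expn_gt0. Qed.
Let e_le : (e <= 2 ^ j)%N. Proof. by rewrite leq_exp2l // leq_subr. Qed.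
Let dH : (2 ^ hh)%:R * d%:R = j%:R * Y.
Proof. by rewrite Ynat -natrM /d mulnCA eH natrM. Qed.
Let jd : (j <= d)%N. Proof. by rewrite leq_pmulr. Qed.
Let d0 : (0 < d)%N. Proof. exact: leq_trans jd. Qed.
Let u0 : (0 < u)%N. Proof. by rewrite expn_gt0. Qed.
Let u1 : (1 < u)%N. Proof. by rewrite -[1%N]/(2 ^ 0)%N ltn_exp2l. Qed.
Let lnu : ln u%:R = d%:R * ln 2 :> R. Proof. by rewrite natrX lnXn // mulr_natl. Qed.
Let lnpow n : ln (u ^ n)%:R = n%:R * ln u%:R :> R.
Proof. by rewrite natrX lnXn ?ltr0n // mulr_natl. Qed.
Let lnu_le : ln u%:R <= d%:R :> R.
Proof. by rewrite lnu -[X in _ <= X]mulr1; apply: ler_wpM2l => //; exact: ln2_le1. Qed.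
Let lnu_ge : d%:R / 2 <= ln u%:R :> R.
Proof. by rewrite lnu; apply: ler_wpM2l => //; exact: ln2_ge. Qed.
Let d10 : 10 <= d%:R :> R. Proof. by rewrite (ler_nat R 10) (leq_trans j10). Qed.
Let lnu5 : 5 <= ln u%:R :> R. Proof. by apply: le_trans lnu_ge; have := d10; lra. Qed.
Let lnu1 : 1 <= ln u%:R :> R. Proof. by apply: le_trans lnu5; rewrite ler1n. Qed.
Let uY n : (n <= T3)%N -> Y ^+ n <= u%:R.
Proof. by move=> H; rewrite -natY ler_nat leq_exp2l // leq_mul2l (leq_trans H eT3) orbT. Qed.

Let N0E : N0 = (u ^ (30 * m + 6))%N. Proof. by rewrite /N0 -expnM; congr (_ ^ _)%N; clear; lia. Qed.

Lemma choice_lnN0 (h' : R) : h' <= h%:R -> h' * ln N0%:R <= j%:R * Y.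
Proof.
move=> H; rewrite -dH N0E lnpow.
have X0 : 0 <= (30 * m + 6)%:R * ln u%:R :> R by rewrite mulr_ge0 // lnr_ge0.
apply: (le_trans (ler_wpM2r X0 H)); rewrite mulrA -(natrM R h); apply: ler_pM => //; first exact: lnr_ge0.
by rewrite ler_nat.
Qed.

Lemma choice_lnM (h' : R) : h' <= h%:R -> h' * (j%:R * Y) <= ln M%:R.
Proof.
move=> H; have X0 : 0 <= j%:R * Y by rewrite mulr_ge0.
apply: (le_trans (ler_wpM2r X0 H)); rewrite -dH lnpow.
apply: (@le_trans _ _ ((2 * h * 2 ^ hh)%:R * (d%:R / 2))).
  by rewrite !natrM le_eqVlt; apply/orP; left; apply/eqP; field.
by apply: ler_pM => //; rewrite ?divr_ge0 // ler_nat En1 -addnA leq_addr.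
Qed.

Let h0 : 0 < h%:R :> R. Proof. by rewrite ltr0n (leq_trans _ hb) // expn_gt0. Qed.

Let tail_power (x g : R) : 0 <= x <= (2 ^+ bb)^-1 -> 0 <= g <= Y -> (Y * x) ^+ j * (g * Y) <= tl.
Proof.
move=> /andP[x0 xb] /andP[g0 gY].
rewrite /tl exprMn -/B -[X in X <= _]mulrA -[X in _ <= X]mulrA; apply: ler_wpM2l; first exact: ltW.
rewrite [X in _ <= X]mulrC; apply: ler_pM; [exact: exprn_ge0|by rewrite mulr_ge0| |].
  have -> : y ^+ bb = ((2 ^+ bb)^-1) ^+ j by rewrite /y Ynat natrX !exprVn -!exprM mulnC.
  by apply: lerXn2r; rewrite ?nnegrE ?invr_ge0 ?exprn_ge0.
by rewrite expr2; apply: ler_wpM2r.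
Qed.

Lemma choice_low : \sum_(1 <= n < N0.+1) Lam R n * wt j (1 + ei R i) n <= tl.
Proof.
have N00 : (0 < N0)%N by rewrite !expn_gt0.
apply: le_trans (lower_tail h0 N00 (choice_lnN0 (lexx _))) _; apply: tail_power.
  by rewrite divr_ge0 ?expR_ge0 //=; exact: lower_ratio.
apply/andP; split; first by apply: mulr_ge0; rewrite ?expR_ge0.
exact: le_trans (@expR1_mul R 6 isT) Y1024.
Qed.

Lemma choice_up M' : \sum_(M <= n < M') Lam R n * wt j (1 + ei R i) n <= tl.
Proof.
have M00 : (0 < M)%N by rewrite expn_gt0 u0.
apply: le_trans (upper_tail M' M00 (choice_lnM (lexx _))) _; apply: tail_power.
  by rewrite mulr_ge0 ?expR_ge0 //=; exact: upper_ratio.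
apply/andP; split; first by apply: mulr_ge0; rewrite ?expR_ge0.
exact: le_trans (@expR1_mul R 12 isT) Y1024.
Qed.

Lemma choice_delta : 0 <= delta <= B * Y * y ^+ a.
Proof.
have E1 : 1024 ^+ i = Y :> R by rewrite pow1024 -exprM mulnC.
have t0 : 0 < 2 ^+ a :> R by exact: exprn_gt0.
rewrite /delta E1; apply/andP; split; first by rewrite exprn_ge0 // divr_ge0 // ltW.
rewrite expr_div_n exprSr -/B; apply: ler_wpM2l; first by rewrite mulr_ge0.
rewrite /y Ynat natrX exprVn -!exprM lef_pV2 ?posrE ?exprn_gt0 //.
by rewrite ler_weXn2l ?ler1n // mulnC leq_mul2l leqnSn orbT.
Qed.

Let kM : (k <= M)%N.
Proof.
apply: (@leq_trans (2 ^ j)); first by apply: leq_trans ki; rewrite leq_pmulr.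
apply: (@leq_trans u); first by rewrite leq_exp2l.
by rewrite -{1}(expn1 u) leq_exp2l // En1 addnS.
Qed.

Lemma choice_L : L <= Lk /\ Lk <= Y ^+ 2.
Proof.
have M0 : (0 < M)%N by rewrite expn_gt0 u0.
split; first by rewrite lerD2l; apply: ler_lnr; rewrite // leq_addr.
have H : ln (M + k)%:R <= n1.+1%:R * ln u%:R :> R.
  rewrite -lnpow; apply: ler_lnr; first by rewrite addn_gt0 M0.
  by rewrite expnS -/M; apply: (@leq_trans (2 * M)); [rewrite mul2n -addnn leq_add2l|rewrite leq_mul2r u1 orbT].
apply: (@le_trans _ _ (n1.+2 * d)%:R); last first.
  by rewrite Ynat -natrX ler_nat /d mulnA -mulnn leq_mul.
rewrite /Lk; apply: (@le_trans _ _ (1 + n1.+1%:R * d%:R)).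
  by rewrite lerD2l; apply: le_trans H _; apply: ler_wpM2l.
by rewrite mulSn natrD natrM lerD2r ler1n.
Qed.

Let Pi : R := @eprod R _ (@sq D W) (xpi k)%:R.

Lemma choice_Pi : 1 <= Pi <= Y ^+ F.
Proof.
have D1 : 1 <= ln D%:R :> R.
  by rewrite lnpow; apply: le_trans lnu1 _; apply: ler_peMl; rewrite ?lnr_ge0 ?ler1n.
apply/andP; split; first exact: eprod_ge1.
rewrite EF exprM; apply: eprod_le_expR => //; apply: le_trans (HC2 D1) _.
rewrite expr2; apply: (@le_trans _ _ (C2 * (1 + m%:R) * d%:R)).
  rewrite -mulrA; apply: ler_wpM2l; first exact: ltW.
  rewrite lnpow mulrDl mul1r; apply: lerD; last exact: ler_wpM2l.
  by rewrite ler1n.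
rewrite /d natrM mulrA; apply: ler_pM => //.
  by apply: mulr_ge0 => //; apply: mulr_ge0; rewrite ?addr_ge0 // ltW.
by rewrite Ynat ler_nat.
Qed.

Let PP := nonprime_mass R i N0 M.

Let L0 : 0 <= L. Proof. by rewrite /L addr_ge0 // lnr_ge0. Qed.
Let L2 : L <= Y ^+ 2. Proof. by case: choice_L => H1; exact: le_trans. Qed.

Let uinv n : (n <= T3)%N -> u%:R^-1 <= y ^+ n.
Proof. by move=> H; rewrite /y exprVn lef_pV2 ?posrE ?ltr0n //; exact: uY. Qed.

Let PP_L : PP <= B * Y ^+ 4 / S0%:R.
Proof.
apply: le_trans (@nonprime_mass_le R i u m n1 lnu1) _.
apply: ler_wpM2r; first by rewrite invr_ge0.
rewrite mulrC; apply: ler_wpM2l => //; rewrite (exprM Y 2 2).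
by apply: lerXn2r; rewrite ?nnegrE // ltW.
Qed.

Lemma choice_PP : 0 <= PP <= B * Y ^+ 4 * y ^+ T3.
Proof.
apply/andP; split; first by apply: sumr_ge0 => n _; apply: mulr_ge0; [exact: Lam_ge0|exact: (fw_ge0 _ _ (@scale_ge0 R i))].
apply: le_trans PP_L _; apply: ler_wpM2l; first by apply: mulr_ge0 => //; exact: ltW.
apply: le_trans (uinv (leqnn _)); rewrite lef_pV2 ?posrE ?ltr0n ?expn_gt0 ?u0 //.
by rewrite ler_nat -{1}(expn1 u) leq_exp2l // addnS.
Qed.

Lemma choice_RP : 0 <= R1%:R * PP <= B * Y ^+ 4 * y ^+ T3.
Proof.
have /andP[P0 _] := choice_PP; apply/andP; split; first exact: mulr_ge0.
apply: (@le_trans _ _ (R1%:R * (B * Y ^+ 4 / S0%:R))); first exact: ler_wpM2l.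
rewrite mulrCA; apply: ler_wpM2l; first by apply: mulr_ge0 => //; exact: ltW.
apply: le_trans (uinv (leqnn _)); rewrite ler_pdivrMr ?ltr0n ?expn_gt0 ?u0 //.
rewrite mulrC ler_pdivlMr ?ltr0n // -natrM ler_nat /R1 /D /S0 -expnM -expnSr leq_exp2l //.
clear -m0; lia.
Qed.

Lemma choice_G4 : 0 <= V%:R ^+ 2 * R1%:R ^+ 2 / N0%:R :> R /\
  V%:R ^+ 2 * R1%:R ^+ 2 / N0%:R <= y ^+ T3.
Proof.
split; first by rewrite divr_ge0 // mulr_ge0 // exprn_ge0.
apply: le_trans (uinv (leqnn _)); rewrite ler_pdivrMr ?ltr0n ?expn_gt0 ?u0 //.
rewrite [X in _ <= X]mulrC ler_pdivlMr ?ltr0n // -!natrX -!natrM ler_nat N0E power_count1 leq_exp2l //.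
by rewrite leq_add2l.
Qed.

Lemma choice_HX : Q0%:R^-1 + 4 * R1%:R ^+ 4 * W%:R / V%:R <= (2 * y ^+ A2) ^+ 2.
Proof.
have WY : W%:R <= Y by rewrite Ynat ler_nat (leq_trans Wi) // leq_exp2l // leq_pmull.
have H1 : 4 * R1%:R ^+ 4 * W%:R / V%:R <= y ^+ (2 * A2).
  apply: (@le_trans _ _ (u%:R^-1 * (4 * Y))).
    have -> : 4 * R1%:R ^+ 4 * W%:R / V%:R = R1%:R ^+ 4 / V%:R * (4 * W%:R) :> R by ring.
    apply: ler_pM; rewrite ?mulr_ge0 ?invr_ge0 ?exprn_ge0 //; last by apply: ler_wpM2l.
    rewrite ler_pdivrMr ?ltr0n ?expn_gt0 ?u0 // mulrC ler_pdivlMr ?ltr0n // -!natrX -!natrM ler_nat.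
    by rewrite power_count2 leq_exp2l // leq_add2l.
  apply: (@le_trans _ _ (y ^+ (2 * A2 + 2) * Y ^+ 2)).
    apply: ler_pM; rewrite ?invr_ge0 ?mulr_ge0 //; first exact: uinv.
    by rewrite expr2; apply: ler_wpM2r => //; apply: le_trans Y1024; rewrite ler_nat.
  by rewrite exprD -mulrA [y ^+ 2 * _]mulrC YyX mulr1.
rewrite exprMn -exprM mulnC natY -exprVn -/y.
apply: (@le_trans _ _ (y ^+ (2 * A2) + y ^+ (2 * A2))); first by rewrite lerD2l.
exact: double_le4 (ltW (yX _)).
Qed.

Lemma choice_Bd : (Lk * B * k%:R * k.+1%:R) ^+ 2 * (Pi ^+ 4 * Lk ^+ E.+1) / z%:R <= (B * y ^+ T) ^+ 2.
Proof.
have [LLk Lk2] := choice_L; have Lk0 := le_trans L0 LLk.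
have /andP[P1 PF] := choice_Pi; have P0 := le_trans ler01 P1.
have H1 : (Lk * B * k%:R * k.+1%:R) ^+ 2 <= B ^+ 2 * Y ^+ 6.
  rewrite (exprM Y 3 2) -exprMn; apply: lerXn2r; rewrite ?nnegrE ?mulr_ge0 // ?(ltW (YX 3)) //.
  rewrite -!mulrA mulrCA; apply: ler_wpM2l => //; rewrite -natrM exprSr; apply: ler_pM => //.
  by rewrite Ynat ler_nat.
have H2 : Pi ^+ 4 * Lk ^+ E.+1 <= Y ^+ (F * 4 + 2 * E.+1).
  rewrite exprD !exprM; apply: ler_pM; rewrite ?exprn_ge0 //.
    by apply: lerXn2r; rewrite ?nnegrE // ltW.
  by apply: lerXn2r; rewrite ?nnegrE // ltW.
rewrite /z natY ler_pdivrMr //; apply: (@le_trans _ _ (B ^+ 2 * Y ^+ 6 * Y ^+ (F * 4 + 2 * E.+1))).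
  by apply: ler_pM; rewrite ?sqr_ge0 // mulr_ge0 // exprn_ge0.
rewrite exprMn -[X in X <= _]mulrA -[X in _ <= X]mulrA; apply: ler_wpM2l; first exact: sqr_ge0.
rewrite -(exprD Y) -(exprM y); have -> : (2 * A' = T * 2 + (6 + (F * 4 + 2 * E.+1)))%N by rewrite EA'; clear; lia.
by rewrite (exprD Y (T * 2)) [X in _ <= X]mulrA [X in _ <= X * _]mulrC YyX mul1r.
Qed.

(** [ln z / ln D] equals [2 A' / (m e)], and [e >= T3] is at least [2 A' (c0 + 1)]. So the extra
    penalty on small primes adds at most 1, and [c0] could be chosen beforehand with 2 in place of
    the bracket. *)
Lemma choice_lz : 1 + Csel k m K * (2 * k%:R * K * (1 + (c0%:R + 1) * (ln z%:R / ln D%:R) ^+ 2)) <= c0%:R.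
Proof.
apply: le_trans Hc0; rewrite lerD2l; apply: ler_wpM2l.
  by rewrite mulr_ge0 ?expR_ge0.
apply: ler_wpM2l; first by rewrite !mulr_ge0 ?exprn_ge0 ?expR_ge0.
have l2 : 0 < ln 2 :> R by apply: lt_le_trans (ln2_ge R); rewrite invr_gt0.
have c1 : 0 < c0%:R + 1 :> R by rewrite natr1 ltr0n.
have -> : ln z%:R / ln D%:R = (2 * A')%:R / (m%:R * e%:R) :> R.
  have -> : ln z%:R = j%:R * (2 * A')%:R * ln 2 :> R by rewrite natrX lnXn // -(natrM R j) mulr_natl.
  rewrite lnpow lnu /d natrM; field.
  by rewrite !pnatr_eq0 -!lt0n m0 j00 e0 gt_eqF.
set l := _ / _; have l0 : 0 <= l by rewrite divr_ge0 // mulr_ge0.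
have cl : (c0%:R + 1) * l <= 1.
  rewrite mulrA ler_pdivrMr ?mulr_gt0 ?ltr0n // mul1r natr1 -!natrM ler_nat mulnC.
  by apply: leq_trans T3c _; apply: leq_trans eT3 _; rewrite leq_pmull.
have l1 : l <= 1 by apply: le_trans cl; rewrite -[X in X <= _]mul1r; apply: ler_wpM2r => //; rewrite lerDr.
have : (c0%:R + 1) * l ^+ 2 <= 1.
  by rewrite expr2 mulrA; apply: mulr_ile1 => //; rewrite mulr_ge0 // ltW.
by rewrite -(lerD2l 1).
Qed.

Lemma almost_prime_choice : exists p, [/\ prime p, p = b %[mod W] &
  forall t, (0 < t <= k)%N -> (forall r, prime r -> ~~ (r %| W)%N -> (r %| p + t)%N ->
      (B0 < r)%N /\ ~~ (r ^ 2 %| p + t)%N) /\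
    (size [seq r <- primes (p + t) | ~~ (r %| W)%N] <= c0 + n1.+1)%N].
Proof.
have A'1 : (0 < A')%N by rewrite EA' !addnS.
have B0z : (B0 <= z)%N by apply: leq_trans B0i _; rewrite leq_exp2l // leq_pmulr // muln_gt0.
have zu : (z <= u)%N.
  by rewrite -(ler_nat R) natY; apply: uY; apply: leq_trans T3c; rewrite leq_pmulr.
have [LLk Lk2] := choice_L; have Lk0 := le_trans L0 LLk.
have /andP[P1 PF] := choice_Pi; have P0 := le_trans ler01 P1.
have /andP[d00 _] := choice_delta.
have WY : W%:R <= Y by rewrite Ynat ler_nat (leq_trans Wi) // leq_exp2l // leq_pmull.
have G := @sieve_conclusion R k W b i u m n1 z c0 Q0 (2 ^ ((20 * A2 + 1) * i)) delta tl (2 * y ^+ A2)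
  k0 W1 cb HW lnu1 m0 mK.
have [||||||||||||p [pp pb Hp]] := G _ _ _ choice_low choice_up d00 Hchi _ _ _ choice_HX _ _ _ choice_lz
   (B / Y ^+ C1) (B * y ^+ T) _ _ choice_Bd.
- by rewrite En1; clear; lia.
- by rewrite -/N0 N0E; apply: leq_trans Wi _; rewrite -expnM leq_exp2l // mulnDr; apply: (@leq_trans (d * 6)); [apply: leq_trans (leq_pmulr _ _) => //; apply: leq_trans jd; rewrite leq_pmull|rewrite leq_addl].
- rewrite -/N0 N0E lnpow; apply: (@le_trans _ _ (6 * d%:R / 2)).
    by rewrite ler_pdivlMr // -(natrM R 2) -(natrM R 6) -(natrM R _ 2) ler_nat; case: (choice_arith A2 erefl j10 jd).
  by rewrite -mulrA; apply: ler_pM => //; rewrite ?divr_ge0 // ler_nat leq_addl.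
- by rewrite expn_gt0.
- by case: (choice_arith A2 erefl j10 jd) => _ ->; rewrite expnD leq_mul2l Wi orbT.
- by rewrite mulr_ge0 // ltW.
- have -> : ln z%:R = (j * (2 * A'))%:R * ln 2 :> R by rewrite natrX lnXn // mulr_natl.
  apply: (@le_trans _ _ (2 * 2^-1)); first by rewrite mulfV ?pnatr_eq0.
  apply: ler_pM; [by []|by rewrite invr_ge0| |exact: ln2_ge].
  by rewrite ler_nat; apply: leq_trans (leq_pmull _ j00); rewrite leq_pmulr.
- by apply: leq_trans zu _; rewrite -{1}(expn1 u) leq_exp2l.
- exact: kM.
- by apply: Hfull; [rewrite !expn_gt0|exact: choice_lnN0|exact: choice_lnM].
- by rewrite mulr_ge0 // ltW.
- have /andP[PP0 PPY] := choice_PP; have [G40 G4Y] := choice_G4; have tl0 : 0 <= tl by rewrite mulr_ge0 // ?mulr_ge0 // ltW.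
  have := @numeric_choice R Y y Y8 erefl F C1 T T2 A2 a bb T3 B Pi L W%:R delta tl
    (V%:R ^+ 2 * R1%:R ^+ 2 / N0%:R) PP (R1%:R * PP) c0%:R (B * y ^+ T) ET ET2 EA2 Ea Ebb T3a B00.
  rewrite P0 PF L0 (le_trans LLk Lk2) ler1n (ltnW W1) WY choice_delta tl0 lexx G40 G4Y choice_PP choice_RP.
  rewrite ler0n (mulr_ge0 B01 (ltW (yX T))) lexx natr1 -(natrM R 4) Ynat ler_nat ci -Ynat.
  move=> /(_ isT P1 isT isT isT isT isT isT isT isT isT isT).
  rewrite -/j -/S0 -/V -/N0 -/M -/L -/D -/R1 -/Pi -/PP -/Y -/B (natY (2 * A2)) -exprVn -/y.
  congr (_ * _ + _ < _); congr (Pi * (_ + _ + _)); last by rewrite mulrCA mulrA.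
  by congr (_ + _); ring.
exists p; split => // t /Hp[H1 H2]; split => // r pr rW rd; have [zr rr] := H1 r pr rW rd.
by split => //; exact: leq_ltn_trans zr.
Qed.

End Choice.

Lemma exists_nat_ge (R : realType) (x : R) : exists n : nat, x <= n%:R.
Proof. by exists (Num.truncn x).+1; apply: ltW; rewrite truncnS_gt. Qed.

(** [C] is fixed before [W], [b] and [B0]. These only force the scale to be large: [poly_lt_exp]
    makes [2 ^ i] exceed them, and [small_char_bound] supplies a good scale beyond that point. *)
Lemma almost_prime_shifts (R : realType) (k : nat) : (0 < k)%N -> exists C : nat, forall W b B0 : nat,
  (1 < W)%N -> coprime b W -> (forall p, prime p -> (p <= k.+1)%N -> (p %| W)%N) ->
  exists p, [/\ prime p, p = b %[mod W] &
  forall t, (0 < t <= k)%N -> (forall r, prime r -> ~~ (r %| W)%N -> (r %| p + t)%N ->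
      (B0 < r)%N /\ ~~ (r ^ 2 %| p + t)%N) /\
    (size [seq r <- primes (p + t) | ~~ (r %| W)%N] <= C)%N].
Proof.
move=> k0; pose K : R := 6 * expR 1 ^+ 2.
have [m' Hm'] := exists_nat_ge (8 * k%:R * K); pose m := m'.+1.
have mK : 8 * k%:R * K <= m%:R by apply: le_trans Hm' _; rewrite ler_nat.
have [c0 Hc0] := exists_nat_ge (1 + Csel k m K * (2 * k%:R * K * 2)).
have [C1 [h1 [h10 [i1 Hfull]]]] := full_mass_lower R.
have [C2 [C20 HC2]] := prime_recip_sum R.
pose E := (2 ^ (4 * k.+2 * k))%N; pose F := (2 * xpi k)%N; pose T := (C1 + 6)%N.
pose T2 := (T + 2 * F + 2)%N; pose A2 := (11 + F + T2)%N.
pose a := (4 * A2 + F + 2 + T2)%N; pose bb := (2 * A2 + F + 3 + T2)%N.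
pose A' := (T + 4 + 2 * F + E)%N.
pose T3 := (F + 4 + T2 + (2 * A2 + 2) + 2 * A' * c0.+1)%N.
have [h2 Hh2] := exists_nat_ge h1; pose h := (h2 + 2 ^ (bb + 4))%N.
have h1h : h1 <= h%:R by apply: le_trans Hh2 _; rewrite ler_nat leq_addr.
pose hh := (h * (30 * m + 6))%N; pose n1 := (2 * h * 2 ^ hh + 30 * m + 7)%N.
exists (c0 + n1.+1)%N => W b B0 W1 cb HW.
pose s : nat := (n1.+2 + W + k * k.+1 + 4 * c0.+1 + B0)%N.
have [i2 Hi2] := poly_lt_exp ((C2 * (1 + m%:R) + s%:R) * 10) 1.
have A0 : (0 < 20 * A2 + 1)%N by rewrite addn1.
(* The moduli covered reach [2 ^ ((20 A2 + 1) i) = Y ^ (2 A2) * 2 ^ i], which is at least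
   [Q0 * W]. *)
have [i [ii Hchi]] := @small_char_bound R (20 * A2 + 1) a A0 (i1 + i2 + hh + T3).+1.
have i0 : (0 < i)%N by apply: leq_trans ii.
have ij : (i <= 10 * i)%N by rewrite leq_pmull.
have ii' : (i1 + i2 + hh + T3 <= i)%N by apply: ltnW.
have Hi1 : (i1 <= i)%N by apply: leq_trans ii'; rewrite -!addnA leq_addr.
have {}Hi2 := Hi2 i (leq_trans _ ii').
have big (x : R) : 0 <= x -> x <= C2 * (1 + m%:R) + s%:R -> x * (10 * i)%:R <= 2 ^+ i.
  move=> x0 xs; apply: le_trans (ltW (Hi2 _)).
    rewrite expr1 natrM mulrA; apply: ler_pM => //; first by rewrite mulr_ge0.
      by apply: ler_wpM2r.
    by rewrite lerDr.
  by rewrite addnAC -addnA (addnC i1) -!addnA leq_addr.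
have c20 : 0 <= C2 * (1 + m%:R) by rewrite mulr_ge0 ?addr_ge0 // ltW.
have big_nat (x : nat) : (x <= s)%N -> (x * (10 * i) <= 2 ^ i)%N.
  move=> xs; rewrite -(ler_nat R) natrM natrX; apply: big => //.
  by apply: (@le_trans _ _ s%:R); rewrite ?ler_nat // lerDr.
have jj : (0 < 10 * i)%N by rewrite muln_gt0.
have big_i (x : nat) : (x <= s)%N -> (x <= 2 ^ i)%N.
  by move=> /big_nat; apply: leq_trans; rewrite leq_pmulr.
have ijx : (2 ^ i <= 2 ^ (10 * i))%N by rewrite leq_exp2l.
have big_j (x : nat) : (x <= s)%N -> (x <= 2 ^ (10 * i))%N.
  by move=> /big_i H; exact: leq_trans ijx.
have [sn sW sk sc sB] : [/\ (n1.+2 <= s)%N, (W <= s)%N, (k * k.+1 <= s)%N, (4 * c0.+1 <= s)%N & (B0 <= s)%N].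
  by rewrite /s; move: n1.+2 (k * k.+1)%N (4 * c0.+1)%N; clear => *; split; lia.
have [T3a T3b T3c] : [/\ (F + 4 + T2 <= T3)%N, (2 * A2 + 2 <= T3)%N & (2 * A' * c0.+1 <= T3)%N].
  by rewrite /T3; move: (F + 4 + T2)%N (2 * A2 + 2)%N (2 * A' * c0.+1)%N; clear => *; split; lia.
apply: (@almost_prime_choice R k W b B0 m c0 C1 i h C2 h1 F T T2 A2 a bb A' T3 hh n1) => //.
- by rewrite leq_addl.
- by move=> N0 M; exact: Hfull.
- by apply: leq_trans ij; apply: leq_trans ii'; rewrite -!addnA addnA leq_addl.
- exact: big_i.
- exact: big_j.
- exact: big_j.
- exact: big_j.
- by apply: leq_trans ijx; exact: big_nat.
- apply: (@le_trans _ _ (2 ^+ i)); first by apply: big; rewrite // lerDl.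
  by rewrite /Ysc ler_weXn2l // ler1n.
Qed.

Lemma prime_dvd_prod_seq (s : seq nat) r : prime r -> all prime s -> (r %| \prod_(p <- s) p)%N -> r \in s.
Proof.
move=> pr; elim: s => [|p s IH] /=; first by rewrite big_nil dvdn1 => _ /eqP rE; rewrite rE in pr.
move=> /andP[pp ps]; rewrite big_cons Euclid_dvdM // inE dvdn_prime2 // => /orP[->//|/(IH ps) ->].
by rewrite orbT.
Qed.

Lemma crossing (Q : pred nat) a n : ~~ Q a -> (a <= n)%N -> Q n ->
  exists m, [/\ (a <= m)%N, ~~ Q m & Q m.+1].
Proof.
move=> Qa; elim: n => [|n IH]; first by rewrite leqn0 => /eqP E; rewrite -E (negbTE Qa).
rewrite leq_eqVlt => /predU1P[E|]; first by rewrite -E (negbTE Qa).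
rewrite ltnS => an Qn; case Qm: (Q n); first exact: IH.
by exists n; rewrite an Qm.
Qed.

(** Modulo the square one has [n = t * (1 + t * x)], so the cofactor is prime to [t]. *)
Lemma mod_square_self (n t : nat) : (0 < t)%N -> n = t %[mod t ^ 2] ->
  (t %| n)%N /\ coprime (n %/ t) t.
Proof.
case: t => [//|[|t]] _; first by rewrite dvd1n divn1 coprimen1.
set u := t.+2 => H; have tu : (u < u ^ 2)%N by rewrite -{1}(expn1 u) ltn_exp2l.
have -> : n = ((n %/ u ^ 2 * u + 1) * u)%N.
  by rewrite {1}(divn_eq n (u ^ 2)) H modn_small // mulnDl mul1n -mulnA mulnn.
rewrite dvdn_mull // mulnK //; split => //.
by rewrite coprime_sym /coprime gcdnMDl gcdn1.
Qed.

(** * From prime factors to values of the function *)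

Section Multiplicative.
Variables (R : realType) (f : nat -> R).
Hypotheses (f0 : forall n, (0 < n)%N -> 0 < f n) (f1 : f 1%N = 1).
Hypothesis fM : forall m n, (0 < m)%N -> (0 < n)%N -> coprime m n -> f (m * n)%N = f m * f n.

Lemma mult_prod_primes (s : seq nat) : uniq s -> all prime s ->
  f (\prod_(p <- s) p)%N = \prod_(p <- s) f p.
Proof.
elim: s => [|p s IH] /=; first by rewrite !big_nil.
move=> /andP[ps us] /andP[pp ap].
have s0 : (0 < \prod_(p <- s) p)%N by rewrite big_seq prodn_cond_gt0 // => q /(allP ap)/prime_gt0.
rewrite !big_cons fM ?(prime_gt0 pp) ?IH //.
by rewrite prime_coprime //; apply: contra ps; exact: prime_dvd_prod_seq.
Qed.

Lemma mult_squarefree m : (0 < m)%N -> (forall r, prime r -> ~~ (r ^ 2 %| m)%N) ->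
  f m = \prod_(r <- primes m) f r.
Proof.
move=> m0 sf; rewrite -mult_prod_primes ?primes_uniq //; last by apply/allP => r; rewrite mem_primes => /andP[].
congr (f _); rewrite {1}(prod_prime_decomp m0) prime_decompE big_map /= big_seq [RHS]big_seq.
apply: eq_bigr => r; rewrite mem_primes => /and3P[pr _ rm].
have l1 : (0 < logn r m)%N by rewrite logn_gt0 mem_primes pr m0.
have : ~~ (2 <= logn r m)%N by rewrite -pfactor_dvdn //; exact: sf.
by case: (logn r m) l1 => [|[|]].
Qed.

(** All primes of [t] lie beyond [N], so [t] can be made prime to everything fixed before it. *)
Definition reachable (y : R) := forall eps N, 0 < eps -> exists t, [/\ (0 < t)%N,
  (forall r, prime r -> (r %| t)%N -> (N < r)%N) & `|f t - y| < eps].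

Lemma reach_select (sel : pred nat) N n : exists t, [/\ (0 < t)%N,
  (forall r, prime r -> (r %| t)%N -> (N <= r)%N) &
  f t = \prod_(N <= p < n | prime p && sel p) f p].
Proof.
pose s := [seq p <- index_iota N n | prime p && sel p].
have ap : all prime s by apply/allP => p; rewrite mem_filter => /andP[/andP[]].
exists (\prod_(p <- s) p)%N; split.
- by rewrite big_seq prodn_cond_gt0 // => p /(allP ap)/prime_gt0.
- move=> r pr /(prime_dvd_prod_seq pr ap); rewrite mem_filter mem_index_iota.
  by move=> /andP[_ /andP[]].
- by rewrite mult_prod_primes // ?big_filter // filter_uniq // iota_uniq.
Qed.

Hypothesis fP : forall eps, 0 < eps -> exists N, forall p, prime p -> (N <= p)%N -> `|f p - 1| < eps.

Lemma sum_tail_unbounded (P : pred nat) (a : nat -> R) N : (forall p, P p -> 0 <= a p) ->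
  (forall M, exists n, M < \sum_(0 <= p < n | P p) a p) ->
  forall M, exists2 n, (N <= n)%N & M < \sum_(N <= p < n | P p) a p.
Proof.
move=> a0 H M; have [n Hn] := H (M + \sum_(0 <= p < N | P p) a p).
exists (maxn N n); first exact: leq_maxl.
rewrite -(ltrD2r (\sum_(0 <= p < N | P p) a p)) addrC [X in _ < X]addrC -big_cat_nat ?leq_maxl //=.
rewrite addrC; apply: lt_le_trans Hn _; rewrite [X in _ <= X](@big_cat_nat _ _ _ n) ?leq_maxr //=.
by rewrite lerDl sumr_ge0.
Qed.

Lemma prod_ge_sum (s : seq nat) (P : pred nat) : (forall p, P p -> 1 <= f p) ->
  1 + \sum_(p <- s | P p) (f p - 1) <= \prod_(p <- s | P p) f p.
Proof.
move=> fp; elim: s => [|p s IH]; first by rewrite !big_nil addr0.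
rewrite !big_cons; case: ifP => // /fp p1.
have S0 : 0 <= \sum_(p <- s | P p) (f p - 1) by apply: sumr_ge0 => q /fp; rewrite subr_ge0.
move: IH S0; set S := \sum_(_ <- _ | _) _; set Q := \prod_(_ <- _ | _) _; clearbody S Q => IH S0.
have := ler_pM (le_trans ler01 p1) (addr_ge0 ler01 S0) (lexx (f p)) IH.
have : 0 <= (f p - 1) * S by rewrite mulr_ge0 // subr_ge0.
rewrite mulrBl mulrDr; lra.
Qed.

(** One more factor gives at most [f p + f p * (1 - f p) = 1 - (1 - f p) ^ 2]. *)
Lemma prod_mul_sum_le1 (s : seq nat) (P : pred nat) : (forall p, P p -> 0 <= f p <= 1) ->
  \prod_(p <- s | P p) f p * (1 + \sum_(p <- s | P p) (1 - f p)) <= 1.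
Proof.
move=> fp; elim: s => [|p s IH]; first by rewrite !big_nil addr0 mulr1.
rewrite !big_cons; case: ifP => // /fp/andP[p0 p1].
have S0 : 0 <= \sum_(p <- s | P p) (1 - f p) by apply: sumr_ge0 => q /fp/andP[_]; rewrite subr_ge0.
have Q0 : 0 <= \prod_(p <- s | P p) f p by apply: prodr_ge0 => q /fp/andP[].
move: IH S0 Q0; set S := \sum_(_ <- _ | _) _; set Q := \prod_(_ <- _ | _) _; clearbody S Q => IH S0 Q0.
have Q1 : Q <= 1 by apply: le_trans IH; rewrite ler_peMr // lerDl.
have A1 := ler_wpM2l p0 IH.
have p2 : 0 <= f p * (1 - f p) by rewrite mulr_ge0 // subr_ge0.
have A2 := ler_wpM2l p2 Q1; have A3 := sqr_ge0 (1 - f p).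
have -> : f p * Q * (1 + (1 - f p + S)) = f p * (Q * (1 + S)) + f p * (1 - f p) * Q by ring.
move: A1 A2 A3; rewrite !mulr1; clear; rewrite expr2; lra.
Qed.

(** The values above 1 at successive large primes are multiplied until [y] is passed; the last
    factor is so close to 1 that the overshoot is below [eps]. *)
Lemma reachable_ge1 y : (forall M, exists n, M < \sum_(0 <= p < n | prime p && (1 < f p)) (f p - 1)) ->
  1 <= y -> reachable y.
Proof.
move=> H y1 eps N e0; have y0 : 0 < y := lt_le_trans ltr01 y1.
have [N1 HN1] := fP (divr_gt0 e0 y0); pose N2 := maxn N.+1 N1.
pose Pn n := \prod_(N2 <= p < n | prime p && (1 < f p)) f p.
have P1 p : prime p && (1 < f p) -> 1 <= f p by move=> /andP[_ /ltW].
have [n Nn Hn] := @sum_tail_unbounded (fun p => prime p && (1 < f p)) (fun p => f p - 1) N2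
  (fun p Hp => eq_ind_r is_true (P1 p Hp) (subr_ge0 _ _)) H y.
have [m [Nm Qm Qm1]] : exists m, [/\ (N2 <= m)%N, ~~ (y < Pn m) & y < Pn m.+1].
  apply: (@crossing (fun m => y < Pn m) N2 n) => //; first by rewrite /Pn big_geq // -leNgt.
  by apply: lt_le_trans Hn _; apply: le_trans (prod_ge_sum _ P1); rewrite lerDr.
have [t [t0 tN tE]] := reach_select (fun p => 1 < f p) N2 m.+1.
exists t; split => //; first by move=> r pr /(tN r pr); apply: leq_trans; rewrite leq_maxl.
rewrite tE -/(Pn _); rewrite -leNgt in Qm.
move: Qm1; rewrite {1 2}/Pn big_mkcond big_nat_recr //= -big_mkcond -/(Pn m).
case: ifP => [/andP[pm fm]|_]; last by rewrite mulr1 ltNge Qm.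
move=> ym; have := HN1 m pm (leq_trans (leq_maxr _ _) Nm).
rewrite gtr0_norm ?subr_gt0 // gtr0_norm ?subr_gt0 // => fe.
have fme : 0 <= f m by apply: ltW; exact: lt_trans fm.
apply: (@le_lt_trans _ _ (y * (f m - 1))); last by rewrite mulrC -ltr_pdivlMr.
by rewrite mulrBr mulr1 lerD2r; apply: ler_wpM2r.
Qed.

(** The mirror image: [prod_mul_sum_le1] drives the product to 0, so it falls below [y > 0]. *)
Lemma reachable_le1 y : (forall M, exists n, M < \sum_(0 <= p < n | prime p && (f p < 1)) (1 - f p)) ->
  0 < y -> y <= 1 -> reachable y.
Proof.
move=> H y0 y1 eps N e0.
have [N1 HN1] := fP e0; pose N2 := maxn N.+1 N1.
pose Pn n := \prod_(N2 <= p < n | prime p && (f p < 1)) f p.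
have P1 p : prime p && (f p < 1) -> 0 <= f p <= 1.
  by move=> /andP[/prime_gt0/f0/ltW -> /ltW].
have P2 p : prime p && (f p < 1) -> 0 <= 1 - f p by move=> /P1/andP[_]; rewrite subr_ge0.
have [n Nn Hn] := @sum_tail_unbounded (fun p => prime p && (f p < 1)) (fun p => 1 - f p) N2 P2 H y^-1.
have Pn0 m : 0 <= Pn m by apply: prodr_ge0 => p /P1/andP[].
have [m [Nm Qm Qm1]] : exists m, [/\ (N2 <= m)%N, ~~ (Pn m < y) & Pn m.+1 < y].
  apply: (@crossing (fun m => Pn m < y) N2 n) => //; first by rewrite /Pn big_geq // -leNgt.
  have H1 := @prod_mul_sum_le1 (index_iota N2 n) _ P1; rewrite -/(Pn n) in H1.
  rewrite ltNge; apply/negP => yP; move: H1; rewrite leNgt => /negP[].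
  apply: (@lt_le_trans _ _ (y * (1 + y^-1))); first by rewrite mulrDr mulfV ?gt_eqF // mulr1 ltrDr.
  apply: ler_pM => //; first by rewrite ltW.
    by rewrite addr_ge0 // invr_ge0 ltW.
  by rewrite lerD2l ltW.
have [t [t0 tN tE]] := reach_select (fun p => f p < 1) N2 m.+1.
exists t; split => //; first by move=> r pr /(tN r pr); apply: leq_trans; rewrite leq_maxl.
rewrite tE -/(Pn _); rewrite -leNgt in Qm.
have Pm1 : Pn m <= 1 by apply: prodr_ile1 => p /P1.
move: Qm1; rewrite {1 2}/Pn big_mkcond big_nat_recr //= -big_mkcond -/(Pn m).
case: ifP => [/andP[pm fm]|_]; last by rewrite mulr1 ltNge Qm.
move=> ym; have := HN1 m pm (leq_trans (leq_maxr _ _) Nm).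
rewrite distrC gtr0_norm ?subr_gt0 // distrC gtr0_norm ?subr_gt0 // => fe.
have fm0 : 0 < f m by apply: f0; exact: prime_gt0.
by apply: le_lt_trans fe; nra.
Qed.

Lemma reachable_0 : (forall M, exists n, M < \sum_(0 <= p < n | prime p && (f p < 1)) (1 - f p)) -> reachable 0.
Proof.
move=> H eps N e0; pose y := Num.min 1 (eps / 2).
have y0 : 0 < y by rewrite lt_min ltr01 divr_gt0.
have y1 : y <= 1 by rewrite ge_min lexx.
have ye : y <= eps / 2 by rewrite ge_min lexx orbT.
have [t [t0 tN tE]] := reachable_le1 H y0 y1 (eps := eps / 2) N (divr_gt0 e0 (ltr0n _ 2)).
exists t; split => //; rewrite subr0.
have -> : f t = (f t - y) + y by ring.
apply: le_lt_trans (ler_normD _ _) _; rewrite (gtr0_norm y0) [eps]splitr; exact: ltr_leD.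
Qed.

(** [eta] depends only on the bound for the number of factors; this is where the sieve's bounded
    count of primes is used. *)
Lemma prod_near1 (C : nat) eta0 : 0 < eta0 -> exists2 eta : R, 0 < eta &
  forall s : seq nat, (size s <= C)%N -> (forall r, r \in s -> `|f r - 1| <= eta) ->
    `|\prod_(r <- s) f r - 1| <= eta0.
Proof.
elim: C eta0 => [|C IH] eta0 e0.
  exists 1 => // s; rewrite leqn0 size_eq0 => /eqP -> _; rewrite big_nil subrr normr0; exact: ltW.
have [|eta' h' IH'] := IH (Num.min 1 (eta0 / 2)); first by rewrite lt_min ltr01 divr_gt0.
exists (Num.min eta' (eta0 / 4)) => [|[|r s] sC Hs]; first by rewrite lt_min h' divr_gt0.
  by rewrite big_nil subrr normr0 ltW.
have /IH' {}IH' : (size s <= C)%N by [].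
have {}IH' : `|\prod_(r <- s) f r - 1| <= Num.min 1 (eta0 / 2).
  by apply: IH' => q qs; apply: le_trans (Hs q _) _; rewrite ?in_cons ?qs ?orbT // ge_min lexx.
have := Hs r (mem_head _ _); rewrite big_cons; move: IH'; rewrite !le_min => /andP[P1 P2] /andP[_ fr].
set P := \prod_(_ <- _) _ in P1 P2 *.
have PN : `|P| <= 2 by rewrite -[P](subrK 1); apply: le_trans (ler_normD _ _) _; rewrite normr1 -[2]/(1 + 1) lerD2r.
have -> : f r * P - 1 = (f r - 1) * P + (P - 1) by ring.
apply: le_trans (ler_normD _ _) _; rewrite normrM.
have := ler_pM (normr_ge0 _) (normr_ge0 _) fr PN; lra.
Qed.

End Multiplicative.

(** * Congruence conditions on the shifts, and density of the tuples *)

Lemma coprime_no_prime m n : (0 < m)%N -> (forall r, prime r -> (r %| m)%N -> ~~ (r %| n)%N) -> coprime m n.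
Proof.
move=> m0 H; rewrite /coprime eqn_leq gcdn_gt0 m0 andbT leqNgt; apply/negP => g1.
have pg := pdiv_prime g1; have dg := pdiv_dvd (gcdn m n).
have /negP[] := H _ pg (dvdn_trans dg (dvdn_gcdl _ _)).
exact: dvdn_trans dg (dvdn_gcdr _ _).
Qed.

Definition shift_base (k i : nat) : nat := if i == 1%N then Kconst k else i.-1.

Lemma Kconst_gt1 k : (2 <= k)%N -> (1 < Kconst k)%N.
Proof.
case: k => [//|k] k1; apply: (@leq_trans (k.+1 * (k.+1 + 1))); last by rewrite leq_pmulr // expn_gt0 fact_gt0.
by apply: leq_trans k1 _; rewrite leq_pmulr // addn1.
Qed.

(** [(k - 1)!] occurs twice in [Kconst k], so dividing by [i - 1] removes no prime. *)
Lemma shift_base_dvd k i : (2 <= k)%N -> (1 < i <= k)%N ->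
  (i.-1 %| Kconst k)%N /\
  forall r, prime r -> (r %| Kconst k)%N -> (r %| Kconst k %/ i.-1)%N.
Proof.
move=> k2 /andP[i1 ik]; have i0 : (0 < i.-1)%N by rewrite -ltnS prednK // ltnW.
have di : (i.-1 %| (k.-1)`!)%N by rewrite dvdn_fact // i0 -ltnS !prednK // ltnW.
have KE : Kconst k = (k * (k + 1) * (k.-1)`! * ((k.-1)`! %/ i.-1) * i.-1)%N.
  by rewrite -[RHS]mulnA divnK // /Kconst -mulnn mulnA.
split; first by rewrite KE dvdn_mull.
rewrite {2}KE mulnK // => r pr; rewrite /Kconst -mulnn !Euclid_dvdM // orbb.
by move=> ->.
Qed.

(** For [i >= 2] write [p + i = (p + 1) + (i - 1)]: since [K] divides [p + 1], the quotient by
    [i - 1] is 1 modulo [K / (i - 1)]. For [i = 1] the square in the modulus does the same work. *)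
Lemma shift_base_split (k p i : nat) : (2 <= k)%N -> (1 <= i <= k)%N ->
  p + 1 = Kconst k %[mod Kconst k ^ 2] ->
  [/\ (0 < shift_base k i)%N, (shift_base k i %| p + i)%N, (shift_base k i %| Kconst k)%N &
  forall r, prime r -> (r %| Kconst k)%N -> ~~ (r %| (p + i) %/ shift_base k i)%N].
Proof.
move=> k2 /andP[i1 ik]; rewrite /shift_base; set K := Kconst k => pK.
have K1 : (1 < K)%N by exact: Kconst_gt1.
have K0 := ltnW K1.
case: eqP => [->|/eqP i_neq].
  have [d c] := mod_square_self K0 pK; split => // r pr rK.
  by apply: contraL c => rn; apply/negP => c; have := coprime_dvdr rK (coprime_dvdl rn c); rewrite prime_coprime // dvdnn.
have i2 : (1 < i)%N by rewrite ltn_neqAle eq_sym i_neq.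
have [dK HK] := @shift_base_dvd k i k2 (introT andP (conj i2 ik)).
have e0 : (0 < i.-1)%N by rewrite -ltnS prednK // ltnW.
have pE : (p + i = (K %/ i.-1 * (1 + (p + 1) %/ K ^ 2 * K) + 1) * i.-1)%N.
  have -> : (p + i = p + 1 + i.-1)%N by rewrite -addnA add1n prednK.
  have KK : (K < K ^ 2)%N by rewrite -{1}(expn1 K) ltn_exp2l.
  rewrite {1}(divn_eq (p + 1) (K ^ 2)) pK modn_small // mulnDl mul1n; congr (_ + _)%N.
  by rewrite [RHS]mulnAC (divnK dK) -/K [RHS]mulnDr muln1 addnC -mulnn mulnA [(K * (_ * K))%N]mulnC.
rewrite pE dvdn_mull // mulnK //; split => // r pr /(HK _ pr) rK.
by rewrite dvdn_addr ?dvdn_mulr // dvdn1; apply/eqP => r1; rewrite r1 in pr.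
Qed.

Section Tuples.
Variables (R : realType) (f : nat -> R).
Hypotheses (f0 : forall n, (0 < n)%N -> 0 < f n) (f1 : f 1%N = 1).
Hypothesis fM : forall m n, (0 < m)%N -> (0 < n)%N -> coprime m n -> f (m * n)%N = f m * f n.
Hypothesis fP : forall eps, 0 < eps -> exists N, forall p, prime p -> (N <= p)%N -> `|f p - 1| < eps.

(** Induction on the number of shifts. The next [t] uses only primes beyond the current [W], so the
    Chinese remainder theorem extends [b]. The class stays prime to the modulus because a prime of
    [t] dividing [b] would divide the shift, which is at most [k]. *)
Lemma congruence_data (k K : nat) (y eps : nat -> R) : (1 < K)%N ->
  (forall i, (1 <= i <= k)%N -> reachable f (y i) /\ 0 < eps i) ->
  forall n, (n <= k)%N -> exists (t : nat -> nat) (W b : nat),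
  [/\ coprime b W, (0 < W)%N, (K ^ 2 %| W)%N, b + 1 = K %[mod K ^ 2] &
   (forall i, (1 <= i <= n)%N -> [/\ (0 < t i)%N,
      (forall r, prime r -> (r %| t i)%N -> (maxn k K < r)%N), `|f (t i) - y i| < eps i,
      (t i ^ 2 %| W)%N & b + i = t i %[mod t i ^ 2]]) /\
   (forall r, prime r -> (r %| W)%N -> (r %| K)%N \/ exists2 i, (1 <= i <= n)%N & (r %| t i)%N)].
Proof.
move=> K1 Hy; elim=> [_|n IH nk].
  exists (fun _ => 1%N), (K ^ 2)%N, K.-1; split => //.
  - rewrite coprimeXr //; rewrite -{2}(prednK (ltnW K1)); exact: coprimenS.
  - by rewrite expn_gt0 ltnW.
  - by rewrite addn1 prednK // ltnW.
  - split; first by case.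
    by move=> r pr; rewrite Euclid_dvdX // => /andP[rK _]; left.
have [t [W [b [cb W0 KW bK [Ht HW]]]]] := IH (ltnW nk).
have [re e0] := Hy n.+1 (introT andP (conj isT nk)).
have [s [s0 sP sy]] := re (eps n.+1) (maxn k W) e0.
have KleW : (K <= W)%N by apply: dvdn_leq => //; apply: dvdn_trans KW; rewrite -mulnn dvdn_mulr.
have cWs : coprime W (s ^ 2).
  rewrite coprimeXr // coprime_sym; apply: coprime_no_prime => // r pr /(sP r pr).
  rewrite gtn_max => /andP[_ Wr]; apply/negP => /(dvdn_leq W0); by rewrite leqNgt Wr.
(* A natural number congruent to [s - n.+1] modulo [s ^ 2]; the added multiple keeps the subtraction
   from truncating. *)
pose c := (s ^ 2 * n.+1 + s - n.+1)%N.
have cE : (c + n.+1 = s ^ 2 * n.+1 + s)%N.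
  rewrite subnK // -[X in (X <= _)%N]addn0 leq_add //; by rewrite leq_pmull // expn_gt0 s0.
pose b' := chinese W (s ^ 2) b c.
have bl : b' = b %[mod W] by exact: chinese_modl.
have br : b' = c %[mod s ^ 2] by exact: chinese_modr.
have bs : b' + n.+1 = s %[mod s ^ 2].
  by rewrite -modnDml br modnDml cE mulnC modnMDl.
have bWd d i : (d %| W)%N -> b' + i = b + i %[mod d].
  move=> dW; rewrite -[LHS]modnDml -[RHS]modnDml; congr ((_ + _) %% _)%N.
  by rewrite -(modn_dvdm b' dW) bl modn_dvdm.
exists (fun i => if i == n.+1 then s else t i), (W * s ^ 2)%N, b'; split.
- rewrite coprimeMr; apply/andP; split.
    by rewrite -coprime_modl bl coprime_modl.
  rewrite coprimeXr // coprime_sym; apply: coprime_no_prime => // r pr rs.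
  apply/negP => rb; have := sP r pr rs; rewrite gtn_max => /andP[kr _].
  have : (r %| b' + n.+1)%N.
    rewrite /dvdn -(modn_dvdm (b' + n.+1)%N (_ : (r %| s ^ 2)%N)) ?bs ?modn_dvdm -?/(dvdn _ _) //.
      by rewrite -mulnn dvdn_mulr.
    by rewrite -mulnn dvdn_mulr.
  rewrite dvdn_addr // => /dvdn_leq => /(_ isT) rn; by have := leq_ltn_trans (leq_trans rn nk) kr; rewrite ltnn.
- by rewrite muln_gt0 W0 expn_gt0 s0.
- exact: dvdn_mulr.
- by rewrite (bWd _ 1%N KW).
- split=> [i /andP[i1 iN]|r pr].
    case: eqP => [->|/eqP i_neq].
      split => //; last exact: dvdn_mull.
      by move=> r pr /(sP r pr); apply: leq_ltn_trans; rewrite geq_max leq_maxl leq_max KleW orbT.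
    have iN' : (1 <= i <= n)%N by rewrite i1 -ltnS ltn_neqAle i_neq.
    have [ti0 tp tf tW tb] := Ht i iN'; split => //; first exact: dvdn_mulr.
    by rewrite (bWd _ i tW).
  rewrite Euclid_dvdM // => /orP[/(HW r pr)[rK|[i /andP[i1 iN] ri]]|]; first by left.
    right; exists i; first by rewrite i1 ltnW.
    by rewrite ltn_eqF.
  rewrite Euclid_dvdX // => /andP[rs _]; right; exists n.+1; first by rewrite leqnn.
  by rewrite eqxx.
Qed.

(** [p + i = e * T * m] with pairwise coprime factors. A prime of [m] dividing [W] would divide [K]
    or [T]; [shift_base_split] excludes the first and the congruence modulo [T ^ 2] the second. So
    [m] has only the primes that the sieve controls. *)
Lemma shift_factor (k p i T C : nat) (Bd W : nat) (K := Kconst k) (e := shift_base k i) :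
  (2 <= k)%N -> (1 <= i <= k)%N -> p + 1 = K %[mod K ^ 2] -> (0 < T)%N ->
  p + i = T %[mod T ^ 2] -> (forall r, prime r -> (r %| T)%N -> (K < r)%N) ->
  (forall r, prime r -> (r %| W)%N -> (r %| p + i)%N -> (r %| K)%N || (r %| T)%N) ->
  (forall r, prime r -> ~~ (r %| W)%N -> (r %| p + i)%N -> (Bd < r)%N /\ ~~ (r ^ 2 %| p + i)%N) ->
  (size [seq r <- primes (p + i) | ~~ (r %| W)%N] <= C)%N ->
  exists s : seq nat, [/\ (size s <= C)%N, (forall r, r \in s -> prime r /\ (Bd < r)%N) &
    f (p + i)%N = f e * f T * \prod_(r <- s) f r].
Proof.
move=> k2 ik pK T0 pT Tp HW Hr HC.
have [e0 en eK He] := shift_base_split k2 ik pK; rewrite -/e in e0 en eK He.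
have [Tn cT] := mod_square_self T0 pT.
have K0 : (0 < K)%N by rewrite ltnW // Kconst_gt1.
set n := (p + i)%N in en He Tn cT HW Hr HC *.
have n0 : (0 < n)%N by case/andP: ik => i1 _; rewrite addn_gt0 i1 orbT.
have ceT : coprime e T.
  rewrite coprime_sym; apply: coprime_no_prime => // r pr /(Tp r pr) Kr; apply/negP => re.
  by have := dvdn_leq K0 (dvdn_trans re eK); rewrite leqNgt Kr.
have eTn : (e * T %| n)%N by rewrite Gauss_dvd // en.
pose m := (n %/ (e * T))%N; have nE : n = (e * T * m)%N by rewrite mulnC divnK.
have m0 : (0 < m)%N by move: n0; rewrite nE muln_gt0 => /andP[].
have neE : (n %/ e = T * m)%N by rewrite nE -mulnA mulKn.
have nTE : (n %/ T = e * m)%N by rewrite nE mulnAC mulnK.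
have mW r : prime r -> (r %| m)%N -> ~~ (r %| W)%N.
  move=> pr rm; apply/negP => rW.
  have rn : (r %| n)%N by rewrite nE dvdn_mull.
  have /orP[rK|rT] := HW r pr rW rn.
    by have := He r pr rK; rewrite neE dvdn_mull.
  have := coprime_dvdl _ (coprime_dvdr rT cT) => /(_ r); rewrite nTE dvdn_mull // => /(_ isT).
  by rewrite prime_coprime // dvdnn.
have ceTm : coprime (e * T) m.
  rewrite coprime_sym; apply: coprime_no_prime => // r pr rm; rewrite Euclid_dvdM //; apply/norP; split.
    by apply/negP => re; have := He r pr (dvdn_trans re eK); rewrite neE dvdn_mull.
  apply/negP => rT; have := coprime_dvdl _ (coprime_dvdr rT cT) => /(_ r).
  by rewrite nTE dvdn_mull // => /(_ isT); rewrite prime_coprime // dvdnn.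
have mn r : (r %| m)%N -> (r %| n)%N by move=> rm; rewrite nE dvdn_mull.
exists (primes m); split.
- apply: leq_trans HC; apply: uniq_leq_size; first exact: primes_uniq.
  move=> r; rewrite mem_primes mem_filter mem_primes => /and3P[pr _ rm].
  by rewrite mW // pr n0 mn.
- move=> r; rewrite mem_primes => /and3P[pr _ rm]; split => //.
  by case: (Hr r pr (mW r pr rm) (mn r rm)).
- rewrite nE fM ?muln_gt0 ?e0 // fM // (mult_squarefree f1 fM m0) // => r pr.
  apply/negP => r2; have rm : (r %| m)%N by apply: dvdn_trans r2; rewrite -mulnn dvdn_mulr.
  by have [_ /negP[]] := Hr r pr (mW r pr rm) (mn r rm); exact: mn.
Qed.

Theorem reachable_tuples (k : nat) (x : nat -> R) : (2 <= k)%N ->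
  (forall i, (1 <= i <= k)%N -> 0 <= x i /\ reachable f (x i / f (shift_base k i))) ->
  forall eps, 0 < eps -> exists p, prime p /\ forall i, (1 <= i <= k)%N -> `|f (p + i)%N - x i| < eps.
Proof.
move=> k2 Hx eps e0; have k0 : (0 < k)%N := ltnW k2.
set K := Kconst k; have K1 : (1 < K)%N by exact: Kconst_gt1.
have fe i : (1 <= i <= k)%N -> 0 < f (shift_base k i).
  move=> /andP[i1 ik]; apply: f0; rewrite /shift_base; case: eqP => [_|/eqP i_neq]; first exact: ltnW.
  by rewrite -ltnS prednK // ltn_neqAle eq_sym i_neq.
(* The order of choice: [C] from the sieve, then [eta] and [B0] from the behaviour of [f] at primes,
   then the [t i] with [W] and [b], and the prime [p] last. *)
have [C HC] := almost_prime_shifts R k0.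
(* A bound for all the products of [f] at the fixed part and at [t i], known before the [t i] are
   chosen. *)
pose Bd := \sum_(1 <= i < k.+1) x i + eps.
have xBd i : (1 <= i <= k)%N -> x i + eps / 2 <= Bd.
  move=> /andP[i1 ik]; apply: lerD; last by rewrite ler_pdivrMr // mulr_natr mulr2n lerDl ltW.
  rewrite (bigD1_seq i) ?mem_index_iota ?iota_uniq ?i1 //= lerDl big_seq_cond.
  by apply: sumr_ge0 => j /andP[]; rewrite mem_index_iota => jk _; case: (Hx j).
have Bd0 : 0 < Bd.
  by apply: lt_le_trans (xBd 1%N _); rewrite ?k0 // ltr_wpDl ?divr_gt0 //; case: (Hx 1%N); rewrite ?k0.
pose eta0 := eps / 2 / Bd.
have eta00 : 0 < eta0 by rewrite !divr_gt0.
have [eta h0 Heta] := prod_near1 f C eta00.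
have [B0 HB0] := fP h0.
have Hy i : (1 <= i <= k)%N -> reachable f (x i / f (shift_base k i)) /\ 0 < eps / 2 / f (shift_base k i).
  by move=> Hi; split; [case: (Hx i Hi)|rewrite !divr_gt0 // fe].
have [t [W [b [cb W0 KW bK [Ht HW]]]]] :=
  congruence_data (y := fun i => x i / f (shift_base k i)) (eps := fun i => eps / 2 / f (shift_base k i)) K1 Hy (leqnn k).
have W1 : (1 < W)%N by apply: leq_trans (dvdn_leq W0 KW); rewrite -[1%N]/(1 ^ 2)%N ltn_exp2r.
have kW r : prime r -> (r <= k.+1)%N -> (r %| W)%N.
  move=> pr rk; apply: dvdn_trans KW; rewrite -mulnn dvdn_mulr // /K /Kconst.
  have [rk1|kr] := leqP r k.-1.
    by rewrite dvdn_mull // -mulnn dvdn_mulr // dvdn_fact // prime_gt0.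
  rewrite dvdn_mulr // addn1; move: kr; rewrite prednK // leq_eqVlt => /predU1P[->|kr]; first by rewrite dvdn_mulr.
  have -> : r = k.+1 by apply/eqP; rewrite eqn_leq rk.
  by rewrite dvdn_mull.
have [p [pp pb Hp]] := HC W b B0 W1 cb kW.
have pd d i : (d %| W)%N -> p + i = b + i %[mod d].
  move=> dW; rewrite -[LHS]modnDml -[RHS]modnDml; congr ((_ + _) %% _)%N.
  by rewrite -(modn_dvdm p dW) pb modn_dvdm.
exists p; split => // i ik; have [Hr Hs] := Hp i ik.
have [t0 tp tf tW tb] := Ht i ik.
have [||||s [sC sP ->]] := @shift_factor k p i (t i) C B0 W k2 ik _ t0 _ _ _ Hr Hs.
- by rewrite (pd _ 1%N KW).
- by rewrite (pd _ i tW).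
- by move=> r pr /(tp r pr); apply: leq_ltn_trans; rewrite leq_maxr.
- move=> r pr rW rn; case: (HW r pr rW) => [->//|[j jk rj]].
  have [tj0 tjp _ tjW tjb] := Ht j jk.
  (* A prime [r > k] cannot divide both [p + i] and [p + j] unless [i = j], because
     [|i - j| < k]. *)
  have kr : (k < r)%N by apply: leq_ltn_trans (tjp r pr rj); rewrite leq_maxl.
  have rpj : (r %| p + j)%N.
    have pj : p + j = t j %[mod t j ^ 2] by rewrite (pd _ j tjW).
    by case: (mod_square_self tj0 pj) => d _; exact: dvdn_trans rj d.
  have [E|ij] := eqVneq i j; first by rewrite E rj orbT.
  exfalso; case/andP: ik jk => i1 ik /andP[j1 jk].
  wlog ltij : i j i1 ik j1 jk rn rpj ij {t0 tp tf tW tb Hr Hs rj tj0 tjp tjW tjb} / (i < j)%N.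
    by move=> H; case: (ltngtP i j) => [|/(H j i)|E]; [exact: H|apply; rewrite // eq_sym|rewrite E eqxx in ij].
  have : (r %| j - i)%N by rewrite -(subnDl p) dvdn_sub.
  move=> /dvdn_leq; rewrite subn_gt0 => /(_ ltij); rewrite leqNgt => /negP[].
  by apply: leq_ltn_trans kr; apply: leq_trans jk; rewrite leq_subr.
have fei := fe i ik; set E := f (shift_base k i) in fei tf *.
set P := \prod_(r <- s) f r.
have HP : `|P - 1| <= eta0.
  by apply: Heta => // r /sP[pr /ltnW Br]; apply: ltW; exact: HB0.
have A1 : `|E * f (t i) - x i| < eps / 2.
  have -> : E * f (t i) - x i = E * (f (t i) - x i / E) by rewrite mulrBr mulrCA mulfV ?gt_eqF // mulr1.
  by rewrite normrM gtr0_norm // mulrC -ltr_pdivlMr.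
have A2 : `|E * f (t i)| <= Bd.
  apply: le_trans (xBd i ik); rewrite -[E * _](subrK (x i)) addrC.
  have x0 : 0 <= x i by case: (Hx i ik).
  by apply: le_trans (ler_normD _ _) _; rewrite (ger0_norm x0) lerD2l ltW.
have -> : E * f (t i) * P - x i = E * f (t i) * (P - 1) + (E * f (t i) - x i) by ring.
apply: le_lt_trans (ler_normD _ _) _; rewrite [eps]splitr; apply: ler_ltD => //.
rewrite normrM; apply: le_trans (ler_pM _ _ A2 HP) _ => //.
by rewrite /eta0 mulrC divfK // gt_eqF.
Qed.

End Tuples.

(* MathComp exports another [multiplicative]. *)
Import Defs.
Local Open Scope ring_scope.

Lemma sum_f_R0E (a : nat -> R) N : sum_f_R0 a N = \sum_(0 <= n < N.+1) a n.
Proof. by elim: N => [|N IH] /=; rewrite ?big_nat1 // IH [RHS]big_nat_recr. Qed.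

Lemma diverges_sum (a b : nat -> R) (P : pred nat) : (forall n, a n = if P n then b n else 0) ->
  diverges a -> forall M : R, exists n, M < \sum_(0 <= p < n | P p) b p.
Proof.
move=> E H M; have [N /RltP HN] := H M; exists N.+1; move: HN; rewrite sum_f_R0E [X in _ -> _ < X]big_mkcond.
by rewrite (eq_bigr (fun p => if P p then b p else 0)).
Qed.

Lemma excess_termE (f : nat -> R) n :
  excess_term f n = if prime n && (1 < f n) then f n - 1 else 0.
Proof.
rewrite /excess_term; case: (prime n) => //=.
case: Rlt_dec => H /=; case: ifP => //; last by move=> /RltP.
by move=> /negP[]; apply/RltP.
Qed.

Lemma deficit_termE (f : nat -> R) n :
  deficit_term f n = if prime n && (f n < 1) then 1 - f n else 0.
Proof.
rewrite /deficit_term; case: (prime n) => //=.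
case: Rlt_dec => H /=; case: ifP => //; last by move=> /RltP.
by move=> /negP[]; apply/RltP.
Qed.

Lemma endpointE (f : nat -> R) k i : endpoint f k i = f (shift_base k i).
Proof. by rewrite /endpoint /shift_base; case: eqP. Qed.

Open Scope R_scope.

Theorem theorem1p3 (k : nat) (f : nat -> R) :
  (2 <= k)%N -> positive_fun f -> multiplicative f -> tends_to_one_on_primes f ->
  (diverges (excess_term f) ->
     dense_in f k (fun x => forall i : nat, (1 <= i <= k)%N -> endpoint f k i <= x i)) /\
  (diverges (deficit_term f) ->
     dense_in f k (fun x => forall i : nat, (1 <= i <= k)%N -> 0 <= x i <= endpoint f k i)).
Proof.
move=> k2 fpos [f1 fmul] flim.
have f0 n : (0 < n)%N -> (0 < f n)%R by move=> /fpos/RltP.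
have fP (eps : R) : (0 < eps)%R -> exists N, forall p, prime p -> (N <= p)%N -> (`|f p - 1| < eps)%R.
  by move=> /RltP/flim[N HN]; exists N => p pp Np; have /RltP := HN p pp Np; rewrite RabsE.
have fe i : (1 <= i <= k)%N -> (0 < f (shift_base k i))%R.
  by move=> ik; apply: f0; case: (shift_base_split (p := Kconst k - 1) k2 ik _) => //; rewrite subnK // ltnW // Kconst_gt1.
have dense (S : (nat -> R) -> Prop) : (forall x, S x -> forall i, (1 <= i <= k)%N ->
    (0 <= x i)%R /\ reachable f (x i / f (shift_base k i))%R) -> dense_in f k S.
  move=> HS x Sx eps /RltP e0.
  have [p [pp Hp]] := reachable_tuples f0 f1 fmul fP k2 (HS x Sx) e0.
  by exists p; split => // i /Hp H; apply/RltP; rewrite RabsE.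
split=> D; apply: dense => x Hx i ik; have := Hx i ik; rewrite endpointE; have fei := fe i ik.
- move=> /RleP xf; split; first exact: le_trans (ltW fei) xf.
  apply: reachable_ge1 => //; last by rewrite ler_pdivlMr // mul1r.
  exact: diverges_sum (excess_termE f) D.
- move=> [/RleP x0 /RleP xf]; split => //.
  have DD := diverges_sum (deficit_termE f) D.
  (* A product of positive values only tends to 0, so this target is treated apart. *)
  case: (eqVneq (x i) 0%R) => [->|xi]; first by rewrite mul0r; exact: reachable_0.
  apply: reachable_le1 => //; last by rewrite ler_pdivrMr // mul1r.
  by rewrite divr_gt0 // lt_neqAle eq_sym xi.
Qed.
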